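(* Let $0<\gamma<\infty$ and $T>0$. Let $(u_1,\omega_1,\psi_1)$ be a classical solution of the system $$\partial_t u_1 + u^r\partial_r u_1 + u^z\partial_z u_1 = 2u_1\partial_z\psi_1,\qquad \partial_t \omega_1 + u^r\partial_r \omega_1 + u^z\partial_z \omega_1 = \partial_z(u_1^2),$$ $$-\Big(\partial_r^2+\frac{3}{r}\partial_r+\partial_z^2\Big)\psi_1=\omega_1,\qquad u^r=-r\partial_z\psi_1,\quad u^z=2\psi_1+r\partial_r\psi_1,$$ in a space-time region $\mathcal{W}$, where $\mathcal{W}$ is either (i) $\mathcal{C}_{\delta,T}=\{(r,z,t): 1-\delta<r<1,\ -\delta<z<\delta,\ T-\delta<t<T\}$ for some $0<\delta\ll 1$, or (ii) $\mathcal{W}_{\delta(t)}=\{(r,z,t): 1-\delta(t)<r<1,\ -\delta(t)<z<\delta(t),\ T_0<t<T\}$ for some $T_0<T$ and some decreasing function $\delta:(T_0,T)\to(0,\infty)$ with $\lim_{t\to T^-}\delta(t)=0$ and $\limsup_{t\to T^-}(T-t)^{-\gamma}\delta(t)=\infty$. Suppose that on $\mathcal{W}$ the solution has the generalized self-similar form $$u_1=(T-t)^{-1+\frac{\gamma}{2}}\sum_{k=0}^\infty (T-t)^{k\gamma}U_k(R,Z),\quad \omega_1=(T-t)^{-1}\sum_{k=0}^\infty (T-t)^{k\gamma}\Omega_k(R,Z),\quad \psi_1=(T-t)^{-1+2\gamma}\sum_{k=0}^\infty (T-t)^{k\gamma}\Psi_k(R,Z),$$ with $R=(r-1)(T-t)^{-\gamma}$,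 $Z=z(T-t)^{-\gamma}$, where the profiles $U_k,\Omega_k,\Psi_k$ are independent of $t$ and defined on $\mathcal{D}=\{Y=(R,Z)\in\mathbb{R}^2: R\le 0\}$. Assume: (a) $U_k,\Omega_k,\Psi_k\in C^1_{loc}(\overline{\mathcal{D}})$ for all $k\ge 0$; (b) for all $k\ge0$, $|U_k(Y)|+|\Omega_k(Y)|=o(1)$ and $|\nabla\Psi_k(Y)|=o(|Y|)$ as $|Y|\to\infty$; (c) $\partial_Z\Psi_k(0,Z)=0$ for all $Z\in\mathbb{R}$ and all $k\ge0$; (d) for some even integer $p$, $\displaystyle\lim_{\rho\to\infty}\int_{\{Y\in\mathcal{D}:\rho<|Y|<2\rho\}}\big(U_k^p+\Omega_k^p\big)\,dY=0$ for all integers $0\le k\le 1/\gamma$. Then $u_1\equiv0$, $\omega_1\equiv 0$ and $\nabla\psi_1\equiv0$ on $\mathcal{W}$.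
   Context: This concerns axisymmetric solutions of the 3D incompressible Euler equations in the cylinder $\{0<r<1\}$ in cylindrical coordinates $(r,\theta,z)$, with velocity $u=u^re_r+u^\theta e_\theta+u^ze_z$ independent of $\theta$. Here $u_1=u^\theta/r$, $\omega_1=\omega^\theta/r$, $\psi_1=\psi^\theta/r$, where $\omega^\theta$ is the angular component of the vorticity $\mathrm{curl}\,u$ and $\psi^\theta$ is the angular component of the vector stream function $\psi$ (with $\mathrm{curl}\,\psi=u$, $\mathrm{div}\,\psi=0$). $T$ is a (possible) blow-up time. $\nabla=(\partial_R,\partial_Z)$ in the profile variables and $\nabla\psi_1$ denotes the spatial gradient in $(r,z)$. Condition (c) corresponds to the vanishing of the normal velocity $u^r=-r\partial_z\psi_1$ at the boundary $r=1$. *)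

(* Defs.v *)
From Stdlib Require Import Reals Lra ClassicalEpsilon.
Open Scope R_scope.

(* Case (i): C_{delta,T}, with 0 < delta < 1 (reading of "0 < delta << 1"). *)
Definition W_case1 (T : R) (W : R -> R -> R -> Prop) : Prop :=
  exists delta : R, 0 < delta < 1 /\
    forall r z t, W r z t <->
      (1 - delta < r < 1 /\ - delta < z < delta /\ T - delta < t < T).

(* Case (ii): W_{delta(t)}, intersected with the cylinder {r > 0}. *)
Definition W_case2 (gamma T : R) (W : R -> R -> R -> Prop) : Prop :=
  exists (T0 : R) (delta : R -> R),
    T0 < T /\
    (forall t, T0 < t < T -> 0 < delta t) /\
    (forall s t, T0 < s -> s <= t -> t < T -> delta t <= delta s) /\
    (forall eps, 0 < eps -> exists eta, 0 < eta /\
        forall t, T0 < t < T -> T - eta < t -> delta t < eps) /\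
    (forall (M eta : R), 0 < eta -> exists t, T0 < t < T /\ T - eta < t /\
        M < Rpower (T - t) (- gamma) * delta t) /\
    (forall r z t, W r z t <->
      (0 < r /\ 1 - delta t < r < 1 /\ - delta t < z < delta t /\ T0 < t < T)).

Definition cont3_on (W : R -> R -> R -> Prop) (f : R -> R -> R -> R) : Prop :=
  forall r z t, W r z t -> forall eps, 0 < eps -> exists eta, 0 < eta /\
    forall r' z' t', W r' z' t' ->
      Rabs (r' - r) < eta -> Rabs (z' - z) < eta -> Rabs (t' - t) < eta ->
      Rabs (f r' z' t' - f r z t) < eps.

(* (u1, w1, psi1) is a classical solution on W: u1, w1 are C^1 in (r,z,t),
   psi1 has continuous partials up to second order in (r,z) (those entering
   the system), and the equations hold pointwise on W. *)
Definition classical_solution (W : R -> R -> R -> Prop)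
    (u1 w1 psi1 : R -> R -> R -> R) : Prop :=
  exists (u1r u1z u1t w1r w1z w1t p1r p1z p1rr p1zz : R -> R -> R -> R),
    (forall r z t, W r z t ->
       derivable_pt_lim (fun x => u1 x z t) r (u1r r z t) /\
       derivable_pt_lim (fun y => u1 r y t) z (u1z r z t) /\
       derivable_pt_lim (fun s => u1 r z s) t (u1t r z t) /\
       derivable_pt_lim (fun x => w1 x z t) r (w1r r z t) /\
       derivable_pt_lim (fun y => w1 r y t) z (w1z r z t) /\
       derivable_pt_lim (fun s => w1 r z s) t (w1t r z t) /\
       derivable_pt_lim (fun x => psi1 x z t) r (p1r r z t) /\
       derivable_pt_lim (fun y => psi1 r y t) z (p1z r z t) /\
       derivable_pt_lim (fun x => p1r x z t) r (p1rr r z t) /\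
       derivable_pt_lim (fun y => p1z r y t) z (p1zz r z t)) /\
    cont3_on W u1 /\ cont3_on W u1r /\ cont3_on W u1z /\ cont3_on W u1t /\
    cont3_on W w1 /\ cont3_on W w1r /\ cont3_on W w1z /\ cont3_on W w1t /\
    cont3_on W psi1 /\ cont3_on W p1r /\ cont3_on W p1z /\
    cont3_on W p1rr /\ cont3_on W p1zz /\
    (forall r z t, W r z t ->
       let ur := - r * p1z r z t in
       let uz := 2 * psi1 r z t + r * p1r r z t in
       u1t r z t + ur * u1r r z t + uz * u1z r z t = 2 * u1 r z t * p1z r z t /\
       w1t r z t + ur * w1r r z t + uz * w1z r z t = 2 * u1 r z t * u1z r z t /\
       - (p1rr r z t + 3 / r * p1r r z t + p1zz r z t) = w1 r z t).

Definition self_similar (W : R -> R -> R -> Prop) (gamma T a : R)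
    (f : R -> R -> R -> R) (F : nat -> R -> R -> R) : Prop :=
  forall r z t, W r z t ->
    exists S : R,
      infinite_sum
        (fun k => Rpower (T - t) (INR k * gamma) *
                  F k ((r - 1) * Rpower (T - t) (- gamma))
                      (z * Rpower (T - t) (- gamma))) S /\
      f r z t = Rpower (T - t) a * S.

Definition cont_D (f : R -> R -> R) : Prop :=
  forall X Y, X <= 0 -> forall eps, 0 < eps -> exists eta, 0 < eta /\
    forall X' Y', X' <= 0 -> Rabs (X' - X) < eta -> Rabs (Y' - Y) < eta ->
      Rabs (f X' Y' - f X Y) < eps.

Definition C1_D_with (f fR fZ : R -> R -> R) : Prop :=
  (forall X Y, X <= 0 ->
     limit1_in (fun h => (f (X + h) Y - f X Y) / h)
               (fun h => h <> 0 /\ X + h <= 0) (fR X Y) 0 /\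
     derivable_pt_lim (fun y => f X y) Y (fZ X Y)) /\
  cont_D f /\ cont_D fR /\ cont_D fZ.

Definition C1_D (f : R -> R -> R) : Prop :=
  exists fR fZ, C1_D_with f fR fZ.

Definition normY (X Y : R) : R := sqrt (X ^ 2 + Y ^ 2).

Definition RInt_val (f : R -> R) (a b v : R) : Prop :=
  exists pr : Riemann_integrable f a b, RiemannInt pr = v.

Definition in_half_annulus (rho X Y : R) : Prop :=
  X <= 0 /\ rho < normY X Y < 2 * rho.

Definition half_annulus_integral (f : R -> R -> R) (rho v : R) : Prop :=
  exists g : R -> R,
    (forall X, - (2 * rho) <= X <= 0 ->
       RInt_val (fun Y =>
                  if excluded_middle_informative (in_half_annulus rho X Y)
                  then f X Y else 0) (- (2 * rho)) (2 * rho) (g X)) /\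
    RInt_val g (- (2 * rho)) 0 v.

(* Main.v *)
Require Import Defs.
From Stdlib Require Import Reals Lra Lia List ClassicalEpsilon FunctionalExtensionality.
From Coquelicot Require Import Coquelicot.
Open Scope R_scope.

(** In the variables [l = (T - t)^gamma], [X = (r - 1) / l], [Y = z / l] the three unknowns become power
    series in [l] whose coefficients are the profiles; they converge only pointwise, and only for those
    [(l, X, Y)] that come from [W].

    As [l] tends to [0] the transport equations yield, for the first profile [Q],
    [c Q + (g X - d_Y Psi) d_X Q + (g Y + d_X Psi) d_Y Q = 0], with [Psi] the first stream profile. Once [Q]
    is known to vanish, dividing by [l] gives the same equation for the next profile with [c] replaced by
    [c - g]. While [k g <= 1] the energy identity for [Q^p] and the annulus condition force [Q = 0]; for
    [k g > 1] the coefficient is negative and the maximum principle applies to a decaying [Q]. This is done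
    first for [u_1], then for [omega_1].

    The stream function then solves the homogeneous elliptic equation, and its first profile is harmonic
    in the half plane with constant boundary values and sublinear gradient. Comparison shows that
    differences in [Y] vanish, so the profile is affine in [X]; the next profile then has constant
    Laplacian, and its subquadratic growth kills the slope. Iterating, all profiles are constant.

    Two difficulties are circumvented rather than met with regularity theory. Passing to the limit without
    uniform convergence: the Baire category theorem gives boxes with uniform coefficient bounds, and
    Newton interpolation of solutions, whose finite differences decay like those of analytic functions,
    propagates the convergence elsewhere. Limits of derivatives: equations for the limit are tested at
    maxima of differences with smooth functions. *)

(** * Maximum tests *)

(** The scaling puts every lower-order effect behind a factor [l]: the stretching term, the part
    [2 psi_1] of [u^z] and the curvature term [(3 / r) d_r]. That is why the limiting operators are
    simple and one power of [l] can be stripped off at a time. [u_1] precedes [omega_1] because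
    [d_z (u_1^2)] is a source for the latter.

    The two limits need different kinds of convergence. All terms of the limiting transport equation
    are continuous, so it is enough to obtain it on a dense set of points, and the Baire boxes
    provide one. The profiles are only [C^1], so the Laplacian is tested in the viscosity sense, at
    maximum points that cannot be chosen; there uniform convergence near every point is required.
    This forces difference estimates of analytic type and a Hartogs-type argument, since convergence
    in [l] is merely pointwise.

    The coefficient [3 l / (1 + l X)] depends on [X] and on [l]. In five dimensions the operator
    becomes invariant under translation in [x] and independent of [l], which serves both the
    iterated differences of one slice and the comparison of slices with different [l]. *)

Definition box4 (a b p : R * (R * (R * R))) : Prop :=
  fst a <= fst p <= fst b /\ fst (snd a) <= fst (snd p) <= fst (snd b) /\
  fst (snd (snd a)) <= fst (snd (snd p)) <= fst (snd (snd b)) /\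
  snd (snd (snd a)) <= snd (snd (snd p)) <= snd (snd (snd b)).

(** Near each point the function stays below its value there plus one; compactness extracts finitely
    many tags from this gauge. Four coordinates are what the doubling argument in [(x, s, z, k)]
    needs, and problems with fewer variables freeze the remaining ones at [0]. *)
Lemma continuous_box4_bounded (f : R * (R * (R * R)) -> R) a b :
  (forall p, box4 a b p -> continuous f p) ->
  exists M, forall p, box4 a b p -> f p < M.
Proof.
  intros Hc.
  assert (Hd : forall p, exists d : posreal, box4 a b p ->
     forall q, Rabs (fst q - fst p) < d -> Rabs (fst (snd q) - fst (snd p)) < d ->
      Rabs (fst (snd (snd q)) - fst (snd (snd p))) < d ->
      Rabs (snd (snd (snd q)) - snd (snd (snd p))) < d -> f q < f p + 1).
  { intros p. destruct (classic (box4 a b p)) as [Hb|Hb].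
    - destruct (proj1 (filterlim_locally _ _) (Hc p Hb) (mkposreal 1 Rlt_0_1)) as [d Hd].
      exists d. intros _ q H1 H2 H3 H4.
      assert (Hq : ball (f p) 1 (f q)).
      { apply (Hd q). split; [exact H1|split;[exact H2|split;[exact H3|exact H4]]]. }
      apply Rabs_def2 in Hq. simpl in Hq. unfold minus, plus, opp in Hq; simpl in Hq. lra.
    - exists (mkposreal 1 Rlt_0_1). tauto. }
  set (delta := fun p => proj1_sig (constructive_indefinite_description _ (Hd p))).
  set (pk := fun t : Compactness.Tn 4 R =>
     (fst t, (fst (snd t), (fst (snd (snd t)), fst (snd (snd (snd t))))))).
  set (up := fun p : R * (R * (R * R)) =>
     ((fst p, (fst (snd p), (fst (snd (snd p)), (snd (snd (snd p)), tt)))) : Compactness.Tn 4 R)).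
  (* [compactness_list] yields its finite list only under a double negation, and for points encoded
     in [Tn 4 R]; [pk] and [up] translate between the encodings. *)
  destruct (NNPP _ (compactness_list 4 (up a) (up b) (fun t => delta (pk t)))) as [l Hl].
  assert (HM : exists M, forall t, In t l -> f (pk t) + 1 < M).
  { clear Hl. induction l as [|t l [M HM]].
    - exists 0. intros t [].
    - exists (Rmax M (f (pk t) + 2)). intros u [<-|Hu].
      + eapply Rlt_le_trans; [|apply Rmax_r]. lra.
      + eapply Rlt_le_trans; [apply HM, Hu|apply Rmax_l]. }
  destruct HM as [M HM]. exists M. intros p Hp.
  destruct (Hl (up p)) as [t [Ht [Hb Hcl]]].
  { destruct a as [a1 [a2 [a3 a4]]], b as [b1 [b2 [b3 b4]]], p as [p1 [p2 [p3 p4]]].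
    unfold box4 in Hp; simpl in *. tauto. }
  specialize (HM t Ht).
  apply Rlt_trans with (2 := HM).
  destruct t as [t1 [t2 [t3 [t4 []]]]]. simpl in Hcl, Hb.
  unfold delta in Hcl.
  destruct (constructive_indefinite_description _ _) as [d Hdp] in Hcl. simpl in Hcl.
  destruct a as [a1 [a2 [a3 a4]]], b as [b1 [b2 [b3 b4]]], p as [p1 [p2 [p3 p4]]].
  apply Hdp; simpl in *; try tauto.
  unfold box4; simpl; tauto.
Qed.

(** If the supremum [s] were not attained, [1 / (s - f)] would be continuous, hence below some [B],
    and [s - 1 / B] would be a smaller upper bound. *)
Lemma continuous_box4_max (f : R * (R * (R * R)) -> R) a b :
  (exists p, box4 a b p) ->
  (forall p, box4 a b p -> continuous f p) ->
  exists p, box4 a b p /\ forall q, box4 a b q -> f q <= f p.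
Proof.
  intros [p0 Hp0] Hc.
  destruct (continuous_box4_bounded f a b Hc) as [M HM].
  destruct (completeness (fun y => exists p, box4 a b p /\ y = f p)) as [s [Hs1 Hs2]].
  { exists M. intros y [p [Hp ->]]. apply Rlt_le, HM, Hp. }
  { exists (f p0), p0. auto. }
  destruct (classic (exists p, box4 a b p /\ f p = s)) as [[p [Hp Hps]]|Hn].
  { exists p. split; [exact Hp|]. intros q Hq. rewrite Hps. apply Hs1. eauto. }
  assert (Hlt : forall p, box4 a b p -> f p < s).
  { intros p Hp. destruct (Hs1 (f p)) as [H|H]; eauto. exfalso. eauto. }
  destruct (continuous_box4_bounded (fun p => / (s - f p)) a b) as [B HB].
  { intros p Hp. apply continuous_comp with (f := fun p => s - f p) (g := Rinv).
    - apply (continuous_minus (fun _ => s) f); [apply continuous_const|apply Hc, Hp].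
    - apply continuous_Rinv. specialize (Hlt p Hp). lra. }
  assert (HB0 : 0 < B).
  { apply Rlt_trans with (/ (s - f p0)); [|apply HB, Hp0].
    apply Rinv_0_lt_compat. specialize (Hlt p0 Hp0). lra. }
  assert (s <= s - / B).
  { apply Hs2. intros y [p [Hp ->]].
    specialize (HB p Hp). specialize (Hlt p Hp).
    assert (/ B < s - f p); [|lra].
    rewrite <- (Rinv_inv (s - f p)). apply Rinv_lt_contravar; [|exact HB].
    apply Rmult_lt_0_compat; [apply Rinv_0_lt_compat; lra|lra]. }
  assert (0 < / B) by (apply Rinv_0_lt_compat; lra). lra.
Qed.

Lemma local_max_derive0 (f : R -> R) x l e :
  0 < e -> is_derive f x l ->
  (forall y, Rabs (y - x) < e -> f y <= f x) -> l = 0.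
Proof.
  intros He Hd Hm. apply is_derive_Reals in Hd.
  apply Rle_antisym.
  - apply Rnot_lt_le. intros Hl. destruct (Hd (l / 2)) as [d Hd']; [lra|].
    set (h := Rmin (d / 2) (e / 2)).
    assert (0 < h <= d / 2 /\ h <= e / 2).
    { unfold h. pose proof (cond_pos d). split; [split; [apply Rmin_glb_lt; lra|apply Rmin_l]|apply Rmin_r]. }
    specialize (Hd' h ltac:(lra)). rewrite Rabs_pos_eq in Hd' by lra.
    pose proof (cond_pos d). specialize (Hd' ltac:(lra)). apply Rabs_def2 in Hd'.
    specialize (Hm (x + h)). replace (x + h - x) with h in Hm by ring. rewrite Rabs_pos_eq in Hm by lra.
    specialize (Hm ltac:(lra)).
    assert ((f (x + h) - f x) / h <= 0); [|lra].
    apply Rmult_le_0_r; [lra|]. apply Rlt_le, Rinv_0_lt_compat; lra.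
  - apply Rnot_lt_le. intros Hl. destruct (Hd (- l / 2)) as [d Hd']; [lra|].
    set (h := Rmin (d / 2) (e / 2)).
    assert (0 < h <= d / 2 /\ h <= e / 2).
    { unfold h. pose proof (cond_pos d). split; [split; [apply Rmin_glb_lt; lra|apply Rmin_l]|apply Rmin_r]. }
    specialize (Hd' (-h) ltac:(lra)). rewrite Rabs_Ropp, Rabs_pos_eq in Hd' by lra.
    pose proof (cond_pos d). specialize (Hd' ltac:(lra)). apply Rabs_def2 in Hd'.
    specialize (Hm (x + -h)). replace (x + -h - x) with (-h) in Hm by ring. rewrite Rabs_Ropp, Rabs_pos_eq in Hm by lra.
    specialize (Hm ltac:(lra)).
    assert (0 <= (f (x + -h) - f x) / -h); [|lra].
    replace ((f (x + - h) - f x) / - h) with ((f x - f (x + -h)) / h) by (field; lra).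
    apply Rmult_le_pos; [lra|]. apply Rlt_le, Rinv_0_lt_compat; lra.
Qed.

(** Needed on the axis [s = 0] of the lifted domain, where [s] can only be increased. *)
Lemma right_max_derive_le0 (f : R -> R) x l e :
  0 < e -> is_derive f x l ->
  (forall y, x <= y < x + e -> f y <= f x) -> l <= 0.
Proof.
  intros He Hd Hm. apply is_derive_Reals in Hd.
  apply Rnot_lt_le. intros Hl. destruct (Hd (l / 2)) as [d Hd']; [lra|].
  set (h := Rmin (d / 2) (e / 2)).
  assert (0 < h <= d / 2 /\ h <= e / 2).
  { unfold h. pose proof (cond_pos d). split; [split; [apply Rmin_glb_lt; lra|apply Rmin_l]|apply Rmin_r]. }
  specialize (Hd' h ltac:(lra)). rewrite Rabs_pos_eq in Hd' by lra.
  pose proof (cond_pos d). specialize (Hd' ltac:(lra)). apply Rabs_def2 in Hd'.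
  specialize (Hm (x + h) ltac:(lra)).
  assert ((f (x + h) - f x) / h <= 0); [|lra].
  apply Rmult_le_0_r; [lra|]. apply Rlt_le, Rinv_0_lt_compat; lra.
Qed.

(** No continuity of the second derivative enters: with [f' x = 0] and [l > 0], the derivative would
    be positive just to the right of [x], and the mean value theorem would give a value above the
    maximum. *)
Lemma local_max_derive2 (f f' : R -> R) x l e :
  0 < e -> (forall y, Rabs (y - x) < e -> is_derive f y (f' y)) ->
  is_derive f' x l ->
  (forall y, Rabs (y - x) < e -> f y <= f x) -> f' x = 0 /\ l <= 0.
Proof.
  intros He Hd Hd2 Hm.
  assert (H0 : f' x = 0).
  { apply (local_max_derive0 f x (f' x) e He); [apply Hd|exact Hm].
    rewrite Rminus_diag, Rabs_R0. exact He. }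
  split; [exact H0|].
  apply Rnot_lt_le. intros Hl.
  apply is_derive_Reals in Hd2. destruct (Hd2 (l / 2)) as [d Hd']; [lra|].
  set (h := Rmin (d / 2) (e / 2)).
  assert (Hh : 0 < h <= d / 2 /\ h <= e / 2).
  { unfold h. pose proof (cond_pos d). split; [split; [apply Rmin_glb_lt; lra|apply Rmin_l]|apply Rmin_r]. }
  destruct (MVT_cor2 f f' x (x + h)) as [c [Hc1 Hc2]]; [lra| |].
  { intros c Hc. apply is_derive_Reals, Hd. rewrite Rabs_pos_eq; lra. }
  pose proof (cond_pos d).
  specialize (Hd' (c - x) ltac:(lra)). rewrite Rabs_pos_eq in Hd' by lra.
  specialize (Hd' ltac:(lra)). apply Rabs_def2 in Hd'.
  replace (x + (c - x)) with c in Hd' by ring. rewrite H0 in Hd'.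
  assert (Hfc : 0 < f' c).
  { apply Rnot_le_lt. intros Hle.
    assert ((f' c - 0) / (c - x) <= 0); [|lra].
    apply Rmult_le_0_r; [lra|]. apply Rlt_le, Rinv_0_lt_compat; lra. }
  specialize (Hm (x + h)). replace (x + h - x) with h in Hm by ring.
  rewrite Rabs_pos_eq in Hm by lra. specialize (Hm ltac:(lra)).
  replace (x + h - x) with h in Hc1 by ring.
  assert (0 < f' c * h) by (apply Rmult_lt_0_compat; lra). lra.
Qed.

Lemma is_derive_comp_affine (f : R -> R) a c x l :
  is_derive f (a * x + c) l -> is_derive (fun y => f (a * y + c)) x (a * l).
Proof.
  intros H.
  apply (is_derive_comp (K := R_AbsRing) (V := R_NormedModule) f (fun y => a * y + c) x l a H).
  auto_derive; [tauto|ring].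
Qed.

Lemma is_derive_shift (f : R -> R) c x l :
  is_derive f (x + c) l -> is_derive (fun y => f (y + c)) x l.
Proof.
  intros H. replace l with (1 * l) by ring.
  apply (is_derive_ext (fun y => f (1 * y + c))); [intros t; f_equal; ring|].
  apply is_derive_comp_affine. replace (1 * x + c) with (x + c) by ring. exact H.
Qed.

Lemma is_derive_reflect (f : R -> R) c x l :
  is_derive f (c - x) l -> is_derive (fun y => f (c - y)) x (- l).
Proof.
  intros H. replace (- l) with (-1 * l) by ring.
  apply (is_derive_ext (fun y => f (-1 * y + c))); [intros t; f_equal; ring|].
  apply is_derive_comp_affine. replace (-1 * x + c) with (c - x) by ring. exact H.
Qed.

(** * Interior estimates for the Poisson equation *)

Definition unc3 (H : R -> R -> R -> R) (p : R * (R * R)) : R :=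
  H (fst p) (fst (snd p)) (snd (snd p)).

Lemma continuous_pair (U V W : UniformSpace) (f : U -> V) (g : U -> W) p :
  continuous f p -> continuous g p -> continuous (fun q => (f q, g q)) p.
Proof.
  intros Hf Hg. apply filterlim_locally. intros e.
  pose proof (proj1 (filterlim_locally _ _) Hf e) as H1.
  pose proof (proj1 (filterlim_locally _ _) Hg e) as H2.
  generalize (filter_and _ _ H1 H2). apply filter_imp. intros q [A B]. split; assumption.
Qed.

Lemma continuous_unc3 (U : UniformSpace) (H : R -> R -> R -> R) (g1 g2 g3 : U -> R) p :
  continuous (unc3 H) (g1 p, (g2 p, g3 p)) ->
  continuous g1 p -> continuous g2 p -> continuous g3 p ->
  continuous (fun q => H (g1 q) (g2 q) (g3 q)) p.
Proof.
  intros HH H1 H2 H3.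
  apply (continuous_comp (fun q => (g1 q, (g2 q, g3 q))) (unc3 H)).
  - apply continuous_pair; [exact H1|]. apply continuous_pair; assumption.
  - exact HH.
Qed.

(* With [s = |y|^2], [y] in R^3, the operator [Hxx + Hzz + 4 s Hss + 6 Hs] is the
   Laplacian in R^5 acting on functions of [(x, |y|^2, z)]. *)
Definition poisson5 (x0 z0 r S : R) (H : R -> R -> R -> R) (G : R) : Prop :=
  exists Hx Hxx Hs Hss Hz Hzz : R -> R -> R -> R,
  forall x s z, Rabs (x - x0) < r -> 0 <= s < S -> Rabs (z - z0) < r ->
    continuous (unc3 H) (x, (s, z)) /\
    is_derive (fun y => H y s z) x (Hx x s z) /\
    is_derive (fun y => Hx y s z) x (Hxx x s z) /\
    is_derive (fun y => H x y z) s (Hs x s z) /\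
    is_derive (fun y => Hs x y z) s (Hss x s z) /\
    is_derive (fun y => H x s y) z (Hz x s z) /\
    is_derive (fun y => Hz x s y) z (Hzz x s z) /\
    Rabs (Hxx x s z + Hzz x s z + 4 * s * Hss x s z + 6 * Hs x s z) <= G.

Ltac cont :=
  repeat match goal with
  | |- continuous (fun _ => _ + _) _ => apply @continuous_plus
  | |- continuous (fun _ => _ - _) _ => apply @continuous_minus
  | |- continuous (fun _ => _ * _) _ => apply @continuous_mult
  | |- continuous (fun _ => ?c) _ => apply continuous_const
  | |- continuous (fun p => fst p) _ => apply continuous_fst
  | |- continuous (fun p => snd p) _ => apply continuous_snd
  | |- continuous fst _ => apply continuous_fst
  | |- continuous snd _ => apply continuous_snd
  | |- continuous (fun p => fst (@?f p)) _ => apply (continuous_comp f fst)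
  | |- continuous (fun p => snd (@?f p)) _ => apply (continuous_comp f snd)
  end.

Lemma Rabs_bd a b : Rabs a <= b <-> - b <= a <= b.
Proof.
  split; intros H.
  - unfold Rabs in H. destruct (Rcase_abs a); lra.
  - apply Rabs_le; lra.
Qed.

Lemma Rabs_bd' a b : Rabs a < b <-> - b < a < b.
Proof.
  split; intros H; [apply Rabs_def2 in H; lra|apply Rabs_def1; lra].
Qed.

(* Maximum principle for [H (x + k) - H (x - k)] as a function of [(x, s, z, k)], with a quadratic barrier:
   it gives interior gradient estimates without any representation formula. *)
Lemma poisson5_doubling x0 z0 r S H G M d D c s0 z1 k :
  poisson5 x0 z0 r S H G -> 0 < M -> 0 <= G ->
  (forall x s z, Rabs (x - x0) < r -> 0 <= s < S -> Rabs (z - z0) < r -> Rabs (H x s z) <= M) ->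
  0 < d -> 0 < D -> S * d ^ 2 <= D ^ 2 ->
  Rabs (c - x0) + 2 * d < r -> Rabs (z1 - z0) + d < r -> 0 <= s0 -> s0 + D < S ->
  0 <= k <= d ->
  H (c + k) s0 z1 - H (c - k) s0 z1 <= (47 * M / d ^ 2 + 2 * G) * (2 * d * k).
Proof.
  intros [Hx [Hxx [Hs [Hss [Hz [Hzz HP]]]]]] HM HG HB Hd HD HSD Hc Hz1 Hs0 HsD Hk.
  (* The choices [al d^2 = be D^2 = 2 M] make the barrier reach the oscillation of [H] on the
     lateral faces. At a maximum the second derivatives of the difference in [x] and in [k] coincide
     and average to at most [al - A]; [z] contributes at most [2 al] and the [s]-terms at most
     [20 be S <= 20 al], while the equation bounds the sum below by [-2 G]. Since [47 M / d^2] is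
     [47/2 al > 23 al], this is impossible. *)
  set (A := 47 * M / d ^ 2 + 2 * G).
  assert (Hd2 : 0 < d ^ 2) by nra. assert (HD2 : 0 < D ^ 2) by nra.
  set (al := 2 * M / d ^ 2). set (be := 2 * M / D ^ 2).
  assert (Hal : al * d ^ 2 = 2 * M) by (unfold al; field; lra).
  assert (Hbe : be * D ^ 2 = 2 * M) by (unfold be; field; lra).
  assert (HAd : A * d ^ 2 = 47 * M + 2 * G * d ^ 2) by (unfold A; field; lra).
  assert (HA : 47 * M / d ^ 2 = 47/2 * al) by (unfold al; field; lra).
  assert (Hal0 : 0 < al) by (unfold al; apply Rdiv_lt_0_compat; lra).
  assert (Hbe0 : 0 < be) by (unfold be; apply Rdiv_lt_0_compat; lra).
  assert (HA0 : 0 < A) by (unfold A; lra).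
  assert (Hab : be * S <= al).
  { apply Rmult_le_reg_r with (d ^ 2); [lra|]. rewrite Hal, <- Hbe.
    rewrite Rmult_assoc. apply Rmult_le_compat_l; lra. }
  set (b := fun x s z k => al * ((x - c) * (x - c) + (z - z1) * (z - z1)) +
                be * ((s - s0) * (s - s0)) + A * (2 * d * k - k * k)).
  set (F := fun p : R * (R * (R * R)) =>
     H (fst p + snd (snd (snd p))) (fst (snd p)) (fst (snd (snd p))) -
     H (fst p - snd (snd (snd p))) (fst (snd p)) (fst (snd (snd p))) -
     b (fst p) (fst (snd p)) (fst (snd (snd p))) (snd (snd (snd p)))).
  apply Rabs_bd' in Hc || (assert (Hc' : Rabs (c - x0) < r - 2 * d) by lra; apply Rabs_bd' in Hc').
  assert (Hz1' : Rabs (z1 - z0) < r - d) by lra. apply Rabs_bd' in Hz1'.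
  set (smin := Rmax 0 (s0 - D)).
  assert (Hsm : 0 <= smin /\ s0 - D <= smin /\ smin <= s0 /\ (smin = 0 \/ smin = s0 - D)).
  { unfold smin, Rmax. destruct Rle_dec; lra. }
  assert (Hdom : forall x s z k, c - d <= x <= c + d -> smin <= s <= s0 + D ->
      z1 - d <= z <= z1 + d -> 0 <= k <= d ->
      (Rabs (x + k - x0) < r /\ Rabs (x - k - x0) < r) /\ 0 <= s < S /\ Rabs (z - z0) < r).
  { intros. rewrite !Rabs_bd'. lra. }
  destruct (continuous_box4_max F (c - d, (smin, (z1 - d, 0))) (c + d, (s0 + D, (z1 + d, d))))
    as [[x [s [z m]]] [Hin Hmax]].
  { exists (c, (s0, (z1, k))). unfold box4; simpl. lra. }
  { intros [x [s [z m]]] Hin. unfold box4 in Hin; simpl in Hin.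
    destruct (Hdom x s z m) as [[D1 D2] [D3 D4]]; try tauto.
    unfold F. apply @continuous_minus; [apply @continuous_minus|].
    - apply continuous_unc3; simpl; [apply HP; tauto| | |]; cont.
    - apply continuous_unc3; simpl; [apply HP; tauto| | |]; cont.
    - unfold b. cont. }
  unfold box4 in Hin; simpl in Hin.
  assert (Hgoal : F (x, (s, (z, m))) <= 0).
  2:{ assert (F (c, (s0, (z1, k))) <= 0).
      { eapply Rle_trans; [apply Hmax|exact Hgoal]. unfold box4; simpl; lra. }
      unfold F, b in H0; simpl in H0. assert (0 <= A * (k * k)) by (apply Rmult_le_pos; [lra|apply Rle_0_sqr]). lra. }
  (* At a positive maximum the barrier is below [2 M], which keeps the point off the lateral faces
     and off [k = d]; on [k = 0] the difference vanishes. Only the face [s = 0] may still be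
     touched. *)
  apply Rnot_lt_le. intros Hpos.
  destruct (Hdom x s z m) as [[D1 D2] [D3 D4]]; try tauto.
  assert (HM2 : H (x + m) s z - H (x - m) s z <= 2 * M).
  { pose proof (HB _ _ _ D1 D3 D4) as B1. pose proof (HB _ _ _ D2 D3 D4) as B2.
    apply Rabs_bd in B1. apply Rabs_bd in B2. lra. }
  assert (Hb1 : b x s z m < 2 * M) by (unfold F in Hpos; simpl in Hpos; lra).
  unfold b in Hb1.
  assert (P1 := Rle_0_sqr (x - c)). assert (P2 := Rle_0_sqr (z - z1)).
  assert (P3 := Rle_0_sqr (s - s0)). unfold Rsqr in P1, P2, P3.
  assert (P4 : 0 <= m * (2 * d - m)) by (apply Rmult_le_pos; lra).
  assert (Q1 := Rmult_le_pos _ _ (Rlt_le _ _ Hal0) P1).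
  assert (Q2 := Rmult_le_pos _ _ (Rlt_le _ _ Hal0) P2).
  assert (Q3 := Rmult_le_pos _ _ (Rlt_le _ _ Hbe0) P3).
  assert (Q4 := Rmult_le_pos _ _ (Rlt_le _ _ HA0) P4).
  replace (A * (m * (2 * d - m))) with (A * (2 * d * m - m * m)) in Q4 by ring.
  assert (Hxi : c - d < x < c + d).
  { assert ((x - c) * (x - c) < d ^ 2); [|clear - H0 Hd HD; nra]. apply Rnot_le_lt. intros N.
    assert (al * d ^ 2 <= al * ((x - c) * (x - c))) by (apply Rmult_le_compat_l; lra). lra. }
  assert (Hzi : z1 - d < z < z1 + d).
  { assert ((z - z1) * (z - z1) < d ^ 2); [|clear - H0 Hd HD; nra]. apply Rnot_le_lt. intros N.
    assert (al * d ^ 2 <= al * ((z - z1) * (z - z1))) by (apply Rmult_le_compat_l; lra). lra. }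
  assert (Hsi : s0 - D < s < s0 + D).
  { assert ((s - s0) * (s - s0) < D ^ 2); [|clear - H0 Hd HD; nra]. apply Rnot_le_lt. intros N.
    assert (be * D ^ 2 <= be * ((s - s0) * (s - s0))) by (apply Rmult_le_compat_l; lra). lra. }
  assert (Hmi : 0 < m < d).
  { split.
    - destruct (Rle_lt_or_eq_dec 0 m) as [h|<-]; [lra|exact h|].
      unfold F in Hpos; simpl in Hpos. rewrite Rplus_0_r, Rminus_0_r in Hpos.
      unfold b in Hpos. lra.
    - destruct (Rle_lt_or_eq_dec m d) as [h|E]; [lra|exact h|]. rewrite E in *.
      assert (E2 : 2 * d * d - d * d = d ^ 2) by ring. rewrite E2 in Hb1. assert (0 <= G * d ^ 2) by (apply Rmult_le_pos; lra). lra. }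
  assert (HsP : 0 < s \/ (s = 0 /\ smin = 0)).
  { destruct Hsm as [E1 [E2 [E3 [E4|E4]]]]; lra. }
  set (e := Rmin (Rmin (Rmin (x - (c - d)) (c + d - x)) (Rmin (z - (z1 - d)) (z1 + d - z)))
             (Rmin m (d - m))).
  assert (He : 0 < e /\ e <= x - (c - d) /\ e <= c + d - x /\ e <= z - (z1 - d) /\
               e <= z1 + d - z /\ e <= m /\ e <= d - m).
  { unfold e, Rmin. repeat destruct Rle_dec; lra. }
  destruct He as [He [E1 [E2 [E3 [E4 [E5 E6]]]]]].
  assert (T1 : Hxx (x + m) s z - Hxx (x - m) s z - 2 * al <= 0).
  { apply (local_max_derive2 (fun y => F (y, (s, (z, m))))
      (fun y => Hx (y + m) s z - Hx (y - m) s z - 2 * al * (y - c)) x _ e He).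
    - intros y Hy. apply Rabs_bd' in Hy.
      destruct (Hdom y s z m) as [[D1' D2'] [D3' D4']]; try lra.
      unfold F, b; simpl.
      destruct (HP _ _ _ D1' D3' D4') as [_ [K1 _]]. destruct (HP _ _ _ D2' D3' D4') as [_ [K2 _]].
      apply (is_derive_minus (V := R_NormedModule)); [apply (is_derive_minus (V := R_NormedModule))|].
      + apply (is_derive_shift (fun y => H y s z)); exact K1.
      + apply (is_derive_shift (fun y => H y s z) (- m)); exact K2.
      + auto_derive; [tauto|ring].
    - destruct (HP _ _ _ D1 D3 D4) as [_ [_ [K1 _]]]. destruct (HP _ _ _ D2 D3 D4) as [_ [_ [K2 _]]].
      apply (is_derive_minus (V := R_NormedModule)); [apply (is_derive_minus (V := R_NormedModule))|].
      + apply (is_derive_shift (fun y => Hx y s z)); exact K1.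
      + apply (is_derive_shift (fun y => Hx y s z) (- m)); exact K2.
      + auto_derive; [tauto|ring].
    - intros y Hy. apply Rabs_bd' in Hy. apply Hmax. unfold box4; simpl; lra. }
  assert (T2 : Hxx (x + m) s z - Hxx (x - m) s z + 2 * A <= 0).
  { apply (local_max_derive2 (fun y => F (x, (s, (z, y))))
      (fun y => Hx (x + y) s z + Hx (x - y) s z - A * (2 * d - 2 * y)) m _ e He).
    - intros y Hy. apply Rabs_bd' in Hy.
      destruct (Hdom x s z y) as [[D1' D2'] [D3' D4']]; try lra.
      unfold F, b; simpl.
      destruct (HP _ _ _ D1' D3' D4') as [_ [K1 _]]. destruct (HP _ _ _ D2' D3' D4') as [_ [K2 _]].
      replace (Hx (x + y) s z + Hx (x - y) s z - A * (2 * d - 2 * y)) with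
       (Hx (x + y) s z - - Hx (x - y) s z - A * (2 * d - 2 * y)) by ring.
      apply (is_derive_minus (V := R_NormedModule)); [apply (is_derive_minus (V := R_NormedModule))|].
      + apply (is_derive_ext (fun y => H (y + x) s z)); [intros t; f_equal; ring|].
        apply (is_derive_shift (fun y => H y s z)). rewrite Rplus_comm. exact K1.
      + apply (is_derive_reflect (fun y => H y s z)); exact K2.
      + auto_derive; [tauto|ring].
    - destruct (HP _ _ _ D1 D3 D4) as [_ [_ [K1 _]]]. destruct (HP _ _ _ D2 D3 D4) as [_ [_ [K2 _]]].
      replace (Hxx (x + m) s z - Hxx (x - m) s z + 2 * A) with
       (Hxx (x + m) s z + - Hxx (x - m) s z - - (2 * A)) by ring.
      apply (is_derive_minus (V := R_NormedModule)); [apply (is_derive_plus (V := R_NormedModule))|].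
      + apply (is_derive_ext (fun y => Hx (y + x) s z)); [intros t; f_equal; ring|].
        apply (is_derive_shift (fun y => Hx y s z)). rewrite Rplus_comm. exact K1.
      + apply (is_derive_reflect (fun y => Hx y s z)); exact K2.
      + auto_derive; [tauto|ring].
    - intros y Hy. apply Rabs_bd' in Hy. apply Hmax. unfold box4; simpl; lra. }
  assert (T3 : Hzz (x + m) s z - Hzz (x - m) s z - 2 * al <= 0).
  { apply (local_max_derive2 (fun y => F (x, (s, (y, m))))
      (fun y => Hz (x + m) s y - Hz (x - m) s y - 2 * al * (y - z1)) z _ e He).
    - intros y Hy. apply Rabs_bd' in Hy.
      destruct (Hdom x s y m) as [[D1' D2'] [D3' D4']]; try lra.
      unfold F, b; simpl.
      destruct (HP _ _ _ D1' D3' D4') as [_ [_ [_ [_ [_ [K1 _]]]]]].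
      destruct (HP _ _ _ D2' D3' D4') as [_ [_ [_ [_ [_ [K2 _]]]]]].
      apply (is_derive_minus (V := R_NormedModule)); [apply (is_derive_minus (V := R_NormedModule) _ _ _ _ _ K1 K2)|].
      auto_derive; [tauto|ring].
    - destruct (HP _ _ _ D1 D3 D4) as [_ [_ [_ [_ [_ [_ [K1 _]]]]]]].
      destruct (HP _ _ _ D2 D3 D4) as [_ [_ [_ [_ [_ [_ [K2 _]]]]]]].
      apply (is_derive_minus (V := R_NormedModule)); [apply (is_derive_minus (V := R_NormedModule) _ _ _ _ _ K1 K2)|].
      auto_derive; [tauto|ring].
    - intros y Hy. apply Rabs_bd' in Hy. apply Hmax. unfold box4; simpl; lra. }
  set (ws := Hs (x + m) s z - Hs (x - m) s z).
  set (wss := Hss (x + m) s z - Hss (x - m) s z).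
  assert (Kd : forall y, smin <= y <= s0 + D -> is_derive (fun y => F (x, (y, (z, m)))) y
      (Hs (x + m) y z - Hs (x - m) y z - 2 * be * (y - s0))).
  { intros y Hy. destruct (Hdom x y z m) as [[D1' D2'] [D3' D4']]; try lra.
    unfold F, b; simpl.
    destruct (HP _ _ _ D1' D3' D4') as [_ [_ [_ [K1 _]]]].
    destruct (HP _ _ _ D2' D3' D4') as [_ [_ [_ [K2 _]]]].
    apply (is_derive_minus (V := R_NormedModule)); [apply (is_derive_minus (V := R_NormedModule) _ _ _ _ _ K1 K2)|].
    auto_derive; [tauto|ring]. }
  assert (T4 : 4 * s * wss + 6 * ws <= 20 * be * S).
  { assert (HbS : be * s <= be * S) by (apply Rmult_le_compat_l; lra).
    destruct HsP as [HsP|[HsP Hsm0]].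
    - assert (Hsi' : smin < s).
      { destruct Hsm as [U1 [U2 [U3 [U4|U4]]]]; lra. }
      set (e2 := Rmin (s - smin) (s0 + D - s)).
      assert (He2 : 0 < e2 /\ e2 <= s - smin /\ e2 <= s0 + D - s).
      { unfold e2, Rmin. destruct Rle_dec; lra. }
      destruct (local_max_derive2 (fun y => F (x, (y, (z, m))))
        (fun y => Hs (x + m) y z - Hs (x - m) y z - 2 * be * (y - s0)) s (wss - 2 * be) e2) as [V1 V2].
      + tauto.
      + intros y Hy. apply Rabs_bd' in Hy. apply Kd. lra.
      + destruct (HP _ _ _ D1 D3 D4) as [_ [_ [_ [_ [K1 _]]]]].
        destruct (HP _ _ _ D2 D3 D4) as [_ [_ [_ [_ [K2 _]]]]].
        apply (is_derive_minus (V := R_NormedModule)); [apply (is_derive_minus (V := R_NormedModule) _ _ _ _ _ K1 K2)|].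
        auto_derive; [tauto|ring].
      + intros y Hy. apply Rabs_bd' in Hy. apply Hmax. unfold box4; simpl; lra.
      + fold ws in V1. assert (s * wss <= s * (2 * be)) by (apply Rmult_le_compat_l; lra).
        assert (0 <= be * s0) by (apply Rmult_le_pos; lra). lra.
    - assert (V : Hs (x + m) s z - Hs (x - m) s z - 2 * be * (s - s0) <= 0).
      { apply (right_max_derive_le0 (fun y => F (x, (y, (z, m)))) s _ (s0 + D - s)); [lra|apply Kd; lra|].
        intros y Hy. apply Hmax. unfold box4; simpl; lra. }
      fold ws in V. rewrite HsP in V |- *. assert (0 <= be * s0) by (apply Rmult_le_pos; lra).
      assert (0 <= be * S) by (apply Rmult_le_pos; lra). lra. }
  destruct (HP _ _ _ D1 D3 D4) as [_ [_ [_ [_ [_ [_ [_ N1]]]]]]].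
  destruct (HP _ _ _ D2 D3 D4) as [_ [_ [_ [_ [_ [_ [_ N2]]]]]]].
  apply Rabs_bd in N1. apply Rabs_bd in N2. fold al in HA.
  unfold A in T2. rewrite HA in T2. unfold ws, wss in T4. lra.
Qed.

Ltac ands := repeat match goal with |- _ /\ _ => split end.

Lemma poisson5_swap x0 z0 r S H G :
  poisson5 x0 z0 r S H G -> poisson5 z0 x0 r S (fun x s z => H z s x) G.
Proof.
  intros [Hx [Hxx [Hs [Hss [Hz [Hzz HP]]]]]].
  exists (fun x s z => Hz z s x), (fun x s z => Hzz z s x), (fun x s z => Hs z s x),
    (fun x s z => Hss z s x), (fun x s z => Hx z s x), (fun x s z => Hxx z s x).
  intros x s z A B C. destruct (HP z s x C B A) as [K0 [K1 [K2 [K3 [K4 [K5 [K6 K7]]]]]]].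
  ands; try assumption.
  - unfold unc3. apply (continuous_unc3 _ H (fun p => snd (snd p)) (fun p => fst (snd p)) fst);
      [exact K0| | |]; cont.
  - cbv beta. rewrite (Rplus_comm (Hzz z s x)). exact K7.
Qed.

Lemma poisson5_opp x0 z0 r S H G :
  poisson5 x0 z0 r S H G -> poisson5 x0 z0 r S (fun x s z => - H x s z) G.
Proof.
  intros [Hx [Hxx [Hs [Hss [Hz [Hzz HP]]]]]].
  exists (fun x s z => - Hx x s z), (fun x s z => - Hxx x s z), (fun x s z => - Hs x s z),
    (fun x s z => - Hss x s z), (fun x s z => - Hz x s z), (fun x s z => - Hzz x s z).
  intros x s z A B C. destruct (HP x s z A B C) as [K0 [K1 [K2 [K3 [K4 [K5 [K6 K7]]]]]]].
  ands; try (apply @is_derive_opp; assumption).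
  - unfold unc3. apply (continuous_opp (unc3 H)). exact K0.
  - replace (- Hxx x s z + - Hzz x s z + 4 * s * - Hss x s z + 6 * - Hs x s z) with
      (- (Hxx x s z + Hzz x s z + 4 * s * Hss x s z + 6 * Hs x s z)) by ring.
    rewrite Rabs_Ropp. exact K7.
Qed.

Lemma poisson5_minus x0 z0 r S H K G G' :
  poisson5 x0 z0 r S H G -> poisson5 x0 z0 r S K G' ->
  poisson5 x0 z0 r S (fun x s z => H x s z - K x s z) (G + G').
Proof.
  intros [Hx [Hxx [Hs [Hss [Hz [Hzz HP]]]]]] [Kx [Kxx [Ks [Kss [Kz [Kzz KP]]]]]].
  exists (fun x s z => Hx x s z - Kx x s z), (fun x s z => Hxx x s z - Kxx x s z),
    (fun x s z => Hs x s z - Ks x s z), (fun x s z => Hss x s z - Kss x s z),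
    (fun x s z => Hz x s z - Kz x s z), (fun x s z => Hzz x s z - Kzz x s z).
  intros x s z A B C. destruct (HP x s z A B C) as [K0 [K1 [K2 [K3 [K4 [K5 [K6 K7]]]]]]].
  destruct (KP x s z A B C) as [L0 [L1 [L2 [L3 [L4 [L5 [L6 L7]]]]]]].
  ands; try (apply (is_derive_minus (V := R_NormedModule)); assumption).
  - unfold unc3. apply (continuous_minus (unc3 H) (unc3 K)); assumption.
  - replace (Hxx x s z - Kxx x s z + (Hzz x s z - Kzz x s z) + 4 * s * (Hss x s z - Kss x s z) +
      6 * (Hs x s z - Ks x s z)) with
     ((Hxx x s z + Hzz x s z + 4 * s * Hss x s z + 6 * Hs x s z) -
      (Kxx x s z + Kzz x s z + 4 * s * Kss x s z + 6 * Ks x s z)) by ring.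
    eapply Rle_trans; [apply Rabs_triang|]. rewrite Rabs_Ropp. lra.
Qed.

Lemma poisson5_shift x0 z0 r r' S S' H G h :
  poisson5 x0 z0 r S H G -> r' + Rabs h <= r -> S' <= S ->
  poisson5 x0 z0 r' S' (fun x s z => H (x + h) s z) G.
Proof.
  intros [Hx [Hxx [Hs [Hss [Hz [Hzz HP]]]]]] Hr HS.
  exists (fun x s z => Hx (x + h) s z), (fun x s z => Hxx (x + h) s z), (fun x s z => Hs (x + h) s z),
    (fun x s z => Hss (x + h) s z), (fun x s z => Hz (x + h) s z), (fun x s z => Hzz (x + h) s z).
  intros x s z A B C. pose proof (Rabs_pos h).
  destruct (HP (x + h) s z) as [K0 [K1 [K2 [K3 [K4 [K5 [K6 K7]]]]]]]; try lra.
  { replace (x + h - x0) with (x - x0 + h) by ring. eapply Rle_lt_trans; [apply Rabs_triang|]. lra. }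
  ands; try assumption.
  - unfold unc3. apply (continuous_unc3 _ H (fun p => fst p + h) (fun p => fst (snd p)) (fun p => snd (snd p)));
      [exact K0| | |]; cont.
  - apply (is_derive_shift (fun y => H y s z)). exact K1.
  - apply (is_derive_shift (fun y => Hx y s z)). exact K2.
Qed.

Lemma poisson5_mono x0 z0 r r' S S' H G :
  poisson5 x0 z0 r S H G -> r' <= r -> S' <= S -> poisson5 x0 z0 r' S' H G.
Proof.
  intros [Hx [Hxx [Hs [Hss [Hz [Hzz HP]]]]]] Hr HS.
  exists Hx, Hxx, Hs, Hss, Hz, Hzz. intros x s z A B C. apply HP; lra.
Qed.

(** The increment from [x] to [x + h] is a symmetric difference about [x + h / 2], so the doubling
    estimate for [H] and for [- H] bounds it from both sides. *)
Lemma poisson5_lipschitz x0 z0 r S H G M d D x s z h :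
  poisson5 x0 z0 r S H G -> 0 <= M -> 0 <= G ->
  (forall x s z, Rabs (x - x0) < r -> 0 <= s < S -> Rabs (z - z0) < r -> Rabs (H x s z) <= M) ->
  0 < d -> 0 < D -> S * d ^ 2 <= D ^ 2 ->
  Rabs (x - x0) + 3 * d <= r -> Rabs (z - z0) + d < r -> 0 <= s -> s + D < S ->
  Rabs h <= d ->
  Rabs (H (x + h) s z - H x s z) <= (47 * M / d + 2 * G * d) * Rabs h.
Proof.
  intros HP HM HG HB Hd HD HSD Hx Hz Hs HsD Hh.
  apply le_epsilon. intros e He.
  (* The doubling estimate wants a positive bound while [M] may vanish; the increment costs
     [e |h| / d <= e] in the result. *)
  set (M' := M + e / 47).
  set (c := x + h / 2). set (k := Rabs h / 2).
  pose proof (Rabs_pos h).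
  assert (Hc : Rabs (c - x0) + 2 * d < r).
  { assert (Rabs (c - x0) <= Rabs (x - x0) + Rabs h / 2).
    { unfold c. replace (x + h / 2 - x0) with (x - x0 + h / 2) by field.
      eapply Rle_trans; [apply Rabs_triang|]. apply Rplus_le_compat_l.
      unfold Rdiv. rewrite Rabs_mult, (Rabs_pos_eq (/2)); lra. }
    lra. }
  assert (HE : (47 * M' / d ^ 2 + 2 * G) * (2 * d * k) <= (47 * M / d + 2 * G * d) * Rabs h + e).
  { unfold k, M'. replace ((47 * (M + e / 47) / d ^ 2 + 2 * G) * (2 * d * (Rabs h / 2))) with
     ((47 * M / d + 2 * G * d) * Rabs h + e * (Rabs h / d)) by (field; lra).
    apply Rplus_le_compat_l. rewrite <- (Rmult_1_r e) at 2. apply Rmult_le_compat_l; [lra|].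
    apply Rmult_le_reg_r with d; [lra|]. unfold Rdiv. rewrite Rmult_assoc, Rinv_l; lra. }
  assert (A1 := poisson5_doubling x0 z0 r S H G M' d D c s z k HP).
  assert (A2 := poisson5_doubling x0 z0 r S _ G M' d D c s z k (poisson5_opp _ _ _ _ _ _ HP)).
  simpl in A2.
  assert (B1 : H (c + k) s z - H (c - k) s z <= (47 * M' / d ^ 2 + 2 * G) * (2 * d * k)).
  { apply A1; unfold M', k; try lra. intros. eapply Rle_trans; [apply HB; assumption|lra]. }
  assert (B2 : - H (c + k) s z - - H (c - k) s z <= (47 * M' / d ^ 2 + 2 * G) * (2 * d * k)).
  { apply A2; unfold M', k; try lra. intros. rewrite Rabs_Ropp.
    eapply Rle_trans; [apply HB; assumption|lra]. }
  assert (E : (c + k = x + h /\ c - k = x) \/ (c + k = x /\ c - k = x + h)).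
  { unfold c, k, Rabs. destruct (Rcase_abs h); [right|left]; split; field. }
  destruct E as [[E1 E2]|[E1 E2]]; rewrite E1, E2 in B1, B2; apply Rabs_bd; lra.
Qed.

Definition diff1 (h : R) (H : R -> R -> R -> R) : R -> R -> R -> R :=
  fun x s z => H (x + h) s z - H x s z.

(** Differences in [x] commute with the operator, so the Lipschitz bound with [G = 0] applies to
    each of them in turn. Every application gains the factor [47 |h| / d] and costs [3 d] of radius
    and [D] of the range of [s]. *)
Lemma poisson5_iter_diff x0 z0 r S H M d D h j :
  poisson5 x0 z0 r S H 0 -> 0 <= M ->
  (forall x s z, Rabs (x - x0) < r -> 0 <= s < S -> Rabs (z - z0) < r -> Rabs (H x s z) <= M) ->
  0 < d -> 0 < D -> S * d ^ 2 <= D ^ 2 -> Rabs h <= d -> 0 <= S ->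
  let r' := r - INR j * (3 * d) in let S' := S - INR j * D in
  poisson5 x0 z0 r' S' (Nat.iter j (diff1 h) H) 0 /\
  forall x s z, Rabs (x - x0) < r' -> 0 <= s < S' -> Rabs (z - z0) < r' ->
    Rabs (Nat.iter j (diff1 h) H x s z) <= (47 * Rabs h / d) ^ j * M.
Proof.
  intros HP HM HB Hd HD HSD Hh HS. pose proof (Rabs_pos h) as Hh0.
  assert (Hq : 0 <= 47 * Rabs h / d) by (apply Rdiv_le_0_compat; lra).
  induction j as [|j [IH1 IH2]].
  - simpl. split.
    + apply (poisson5_mono _ _ r _ S); [exact HP|lra|lra].
    + intros. rewrite Rmult_1_l. apply HB; lra.
  - rewrite S_INR. intros r' S'. pose proof (pos_INR j) as Hj. split.
    + simpl. unfold diff1 at 1. replace 0 with (0 + 0) by ring. apply poisson5_minus.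
      * apply (poisson5_shift _ _ (r - INR j * (3 * d)) _ (S - INR j * D)); [exact IH1| |];
          unfold r', S'; lra.
      * apply (poisson5_mono _ _ (r - INR j * (3 * d)) _ (S - INR j * D)); [exact IH1| |];
          unfold r', S'; lra.
    + intros x s z A B C. simpl Nat.iter. unfold diff1 at 1.
      replace ((47 * Rabs h / d) ^ Datatypes.S j * M) with
        ((47 * ((47 * Rabs h / d) ^ j * M) / d + 2 * 0 * d) * Rabs h) by (simpl; field; lra).
      unfold r' in A, C. unfold S' in B.
      apply (poisson5_lipschitz x0 z0 (r - INR j * (3 * d)) (S - INR j * D) _ 0 _ d D);
        try lra; try assumption.
      * apply Rmult_le_pos; [apply pow_le; exact Hq|exact HM].
      * assert (INR j * D * d ^ 2 >= 0); [|nra].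
        apply Rle_ge, Rmult_le_pos; [apply Rmult_le_pos; lra|nra].
Qed.

(** The counterpart of the Cauchy estimates for analytic functions. The step [d = r / (6 n)] spends
    half of the radius on [n] differences, and [282 = 6 * 47]. *)
Lemma poisson5_diff_bound x0 z0 r H M h n x z :
  poisson5 x0 z0 r (r ^ 2) H 0 -> 0 <= M -> 0 < r ->
  (forall x s z, Rabs (x - x0) < r -> 0 <= s < r ^ 2 -> Rabs (z - z0) < r -> Rabs (H x s z) <= M) ->
  (0 < n)%nat -> INR n * Rabs h <= r / 6 ->
  Rabs (x - x0) < r / 2 -> Rabs (z - z0) < r / 2 ->
  Rabs (Nat.iter n (diff1 h) H x 0 z) <= (282 * (INR n * Rabs h) / r) ^ n * M.
Proof.
  intros HP HM Hr HB Hn Hh Hx Hz.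
  assert (Hn0 : 0 < INR n) by (apply lt_0_INR; exact Hn).
  set (d := r / (6 * INR n)).
  assert (Hd : 0 < d) by (apply Rdiv_lt_0_compat; lra).
  assert (Hnd : INR n * d = r / 6) by (unfold d; field; lra).
  destruct (poisson5_iter_diff x0 z0 r (r ^ 2) H M d (r * d) h n) as [_ HH]; try assumption.
  - nra.
  - right; ring.
  - apply Rmult_le_reg_l with (INR n); [lra|]. lra.
  - nra.
  - replace (282 * (INR n * Rabs h) / r) with (47 * Rabs h / d) by (unfold d; field; lra).
    apply HH; try lra. split; [lra|].
    replace (INR n * (r * d)) with (r * (INR n * d)) by ring. rewrite Hnd. nra.
Qed.

(** * Newton interpolation and extrapolation of power series *)

Definition dseq (phi : nat -> R) : nat -> R := fun i => phi (S i) - phi i.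

(* Newton's forward interpolation through the nodes [0 .. n-1], evaluated at [N]. *)
Fixpoint newton (n : nat) : nat -> (nat -> R) -> R :=
  match n with
  | O => fun _ _ => 0
  | S n' => fix aux (N : nat) (phi : nat -> R) : R :=
      match N with
      | O => phi O
      | S N' => aux N' phi + newton n' N' (dseq phi)
      end
  end.

Lemma newton_S n N phi :
  newton (S n) (S N) phi = newton (S n) N phi + newton n N (dseq phi).
Proof. reflexivity. Qed.

(** The remainder is a sum of [n]-th differences with total weight [binom(N, n)], and
    [binom(N, n) t^n <= (1 + t)^N]. Carrying the free parameter [t] through Pascal's recurrence
    avoids binomial coefficients; it is chosen when [N] is known. *)
Lemma newton_error n : forall N phi D t, 0 <= D -> 0 < t ->
  (forall i, (i + n <= N)%nat -> Rabs (Nat.iter n dseq phi i) <= D) ->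
  Rabs (phi N - newton n N phi) * t ^ n <= D * (1 + t) ^ N.
Proof.
  induction n as [|n IHn]; intros N phi D t HD Ht Hb.
  - simpl. rewrite Rminus_0_r, Rmult_1_r. eapply Rle_trans; [apply (Hb N); lia|].
    rewrite <- (Rmult_1_r D) at 1. apply Rmult_le_compat_l; [exact HD|]. apply pow_R1_Rle; lra.
  - induction N as [|N IHN].
    + simpl newton. rewrite Rminus_diag, Rabs_R0, Rmult_0_l.
      apply Rmult_le_pos; [exact HD|apply pow_le; lra].
    + replace (phi (S N) - newton (S n) (S N) phi) with
        ((phi N - newton (S n) N phi) + (dseq phi N - newton n N (dseq phi)))
        by (rewrite newton_S; unfold dseq; ring).
      assert (A := IHN ltac:(intros i Hi; apply Hb; lia)).
      assert (B : Rabs (dseq phi N - newton n N (dseq phi)) * t ^ n <= D * (1 + t) ^ N).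
      { apply IHn; try assumption. intros i Hi. rewrite <- Nat.iter_succ_r. apply Hb. lia. }
      eapply Rle_trans.
      { apply Rmult_le_compat_r; [apply pow_le; lra|apply Rabs_triang]. }
      rewrite Rmult_plus_distr_r.
      replace (D * (1 + t) ^ S N) with (D * (1 + t) ^ N + t * (D * (1 + t) ^ N)) by (simpl; ring).
      apply Rplus_le_compat; [exact A|].
      replace (t ^ S n) with (t ^ n * t) by (simpl; ring). rewrite <- Rmult_assoc, Rmult_comm.
      apply Rmult_le_compat_l; [lra|exact B].
Qed.

(** A crude Lebesgue constant: taking differences doubles the bound on the nodes, and the recurrence
    in [N] adds this to the previous value, whence [3 = 1 + 2]. *)
Lemma newton_bound n : forall N phi m, 0 <= m ->
  (forall i, (i < n)%nat -> Rabs (phi i) <= m) -> Rabs (newton n N phi) <= 3 ^ N * m.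
Proof.
  induction n as [|n IHn]; intros N phi m Hm Hb.
  - simpl. rewrite Rabs_R0. apply Rmult_le_pos; [apply pow_le; lra|exact Hm].
  - induction N as [|N IHN].
    + simpl. rewrite Rmult_1_l. apply Hb; lia.
    + rewrite newton_S. eapply Rle_trans; [apply Rabs_triang|].
      replace (3 ^ S N * m) with (3 ^ N * m + 3 ^ N * (2 * m)) by (simpl; ring).
      apply Rplus_le_compat; [exact IHN|]. apply IHn; [lra|].
      intros i Hi. unfold dseq. eapply Rle_trans; [apply Rabs_triang|]. rewrite Rabs_Ropp.
      pose proof (Hb i ltac:(lia)). pose proof (Hb (S i) ltac:(lia)). lra.
Qed.

Lemma newton_minus n : forall N phi psi,
  newton n N phi - newton n N psi = newton n N (fun i => phi i - psi i).
Proof.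
  induction n as [|n IHn]; intros N phi psi; [simpl; ring|].
  induction N as [|N IHN]; [reflexivity|].
  rewrite !newton_S, <- IHN.
  replace (dseq (fun i => phi i - psi i)) with (fun i => dseq phi i - dseq psi i)
    by (apply functional_extensionality; intros i; unfold dseq; ring).
  rewrite <- IHn. ring.
Qed.

Lemma is_pseries_newton n : forall N (a : nat -> nat -> R) l s,
  (forall i, (i < n)%nat -> is_pseries (a i) l (s i)) ->
  is_pseries (fun k => newton n N (fun i => a i k)) l (newton n N s).
Proof.
  induction n as [|n IHn]; intros N a l s Hs.
  - simpl. apply (is_series_ext (fun _ => 0)).
    { intros k. unfold scal; simpl. unfold mult; simpl. symmetry. apply Rmult_0_r. }
    change (is_lim_seq (sum_n (fun _ => 0)) 0).
    apply is_lim_seq_ext with (fun _ => 0); [|apply is_lim_seq_const].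
    intros k. symmetry. rewrite sum_n_const. ring.
  - induction N as [|N IHN].
    + simpl. apply Hs. lia.
    + rewrite newton_S. apply (is_pseries_plus (fun k => newton (S n) N (fun i => a i k))
        (fun k => newton n N (dseq (fun i => a i k)))); [exact IHN|].
      apply (IHn N (fun i k => a (S i) k - a i k)). intros i Hi.
      apply (is_pseries_minus (a (S i)) (a i)); apply Hs; lia.
Qed.

Definition fdiff (h : R) (f : R -> R) : R -> R := fun y => f (y + h) - f y.

Lemma iter_dseq h f y0 n : forall i,
  Nat.iter n dseq (fun i => f (y0 + INR i * h)) i = Nat.iter n (fdiff h) f (y0 + INR i * h).
Proof.
  induction n as [|n IH]; intros i; [reflexivity|].
  simpl Nat.iter. unfold dseq at 1, fdiff at 1. rewrite !IH. f_equal. f_equal. rewrite S_INR. ring.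
Qed.

Lemma iter_diff1 h H s z n : forall x,
  Nat.iter n (diff1 h) H x s z = Nat.iter n (fdiff h) (fun x => H x s z) x.
Proof.
  induction n as [|n IH]; intros x; [reflexivity|].
  simpl. unfold diff1 at 1, fdiff at 1. rewrite !IH. reflexivity.
Qed.

Fixpoint horner (m : nat) (c : nat -> R) (y : R) : R :=
  match m with O => 0 | S m => c O + y * horner m (fun k => c (S k)) y end.

(** Discrete form of the rule that the derivative of order [n + 1] of [y g] is [y] times that of [g]
    plus [n + 1] times the derivative of order [n]. It shows by induction that [m]-th differences
    annihilate polynomials of degree below [m]. *)
Lemma iter_fdiff_leibniz h g n : forall y,
  Nat.iter (S n) (fdiff h) (fun y => y * g y) y =
  y * Nat.iter (S n) (fdiff h) g y + INR (S n) * h * Nat.iter n (fdiff h) g (y + h).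
Proof.
  induction n as [|n IH]; intros y.
  - simpl. unfold fdiff. ring.
  - change (Nat.iter (S (S n)) (fdiff h) (fun y => y * g y) y) with
      (fdiff h (Nat.iter (S n) (fdiff h) (fun y => y * g y)) y).
    unfold fdiff at 1. rewrite !IH.
    change (Nat.iter (S (S n)) (fdiff h) g y) with (fdiff h (Nat.iter (S n) (fdiff h) g) y).
    unfold fdiff at 5. rewrite (S_INR (S n)).
    change (Nat.iter (S n) (fdiff h) g (y + h)) with
      (Nat.iter n (fdiff h) g (y + h + h) - Nat.iter n (fdiff h) g (y + h)).
    ring.
Qed.

Lemma iter_fdiff_horner h m : forall c y, Nat.iter m (fdiff h) (horner m c) y = 0.
Proof.
  induction m as [|m IH]; intros c y; [reflexivity|].
  assert (E : Nat.iter (S m) (fdiff h) (horner (S m) c) =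
    Nat.iter (S m) (fdiff h) (fun y => y * horner m (fun k => c (S k)) y)).
  { rewrite !Nat.iter_succ_r. f_equal. apply functional_extensionality. intros u.
    unfold fdiff. simpl. ring. }
  rewrite E, iter_fdiff_leibniz, IH. simpl. unfold fdiff at 1. rewrite !IH. ring.
Qed.

(** The polynomial is its own Newton interpolant. The nodes start at [2 l1] with step
    [(y - 2 l1) / (2 m)]: the first [m] of them have moved at most halfway towards [y] and so remain
    in [[l1, 2 l1]], while node [2 m] is [y] itself. The factor is [3^(2 m) = 9^m]. *)
Lemma horner_extrapolate m c l1 e y :
  0 < l1 -> 0 <= y <= 2 * l1 ->
  (forall x, l1 <= x <= 2 * l1 -> Rabs (horner m c x) <= e) ->
  Rabs (horner m c y) <= 9 ^ m * e.
Proof.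
  intros Hl Hy Hb.
  assert (He : 0 <= e) by (eapply Rle_trans; [apply Rabs_pos|apply (Hb l1); lra]).
  assert (H9 : 1 <= 9 ^ m) by (apply pow_R1_Rle; lra).
  destruct (Rle_dec l1 y) as [Hl'|Hl'].
  { eapply Rle_trans; [apply Hb; lra|]. nra. }
  destruct m as [|m'].
  { simpl. rewrite Rabs_R0. lra. }
  set (m := S m') in *.
  assert (Hm : 0 < INR m) by (apply lt_0_INR; unfold m; lia).
  set (h := (y - 2 * l1) / (2 * INR m)).
  assert (Hh : INR m * h = y / 2 - l1) by (unfold h; field; lra).
  assert (HN : 2 * l1 + INR (2 * m) * h = y) by (rewrite mult_INR; simpl (INR 2); lra).
  set (phi := fun i => horner m c (2 * l1 + INR i * h)).
  assert (E := newton_error m (2 * m) phi 0 1 (Rle_refl _) Rlt_0_1).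
  rewrite pow1, Rmult_1_r, Rmult_0_l in E.
  assert (E' : phi (2 * m)%nat = newton m (2 * m) phi).
  { apply Rminus_diag_uniq. apply Rabs_eq_0. apply Rle_antisym; [|apply Rabs_pos]. apply E.
    intros i _. unfold phi. rewrite iter_dseq, iter_fdiff_horner, Rabs_R0. lra. }
  unfold phi at 1 in E'. rewrite HN in E'. rewrite E'.
  replace (9 ^ m) with (3 ^ (2 * m)).
  2:{ rewrite pow_mult. f_equal. ring. }
  apply newton_bound; [exact He|].
  intros i Hi. apply Hb. apply lt_INR in Hi. pose proof (pos_INR i).
  assert (Hh0 : h <= 0) by (apply Rnot_lt_le; intros K; nra).
  nra.
Qed.

Definition coef_bound (a : nat -> R) (l0 C : R) : Prop := forall k, Rabs (a k) * l0 ^ k <= C.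

Lemma coef_bound_term a l0 C y k : 0 < l0 -> coef_bound a l0 C -> Rabs y <= l0 / 2 ->
  Rabs (a k * y ^ k) <= C * (1 / 2) ^ k.
Proof.
  intros Hl Ha Hy. rewrite Rabs_mult, <- RPow_abs.
  eapply Rle_trans; [apply Rmult_le_compat_l; [apply Rabs_pos|apply pow_incr; split; [apply Rabs_pos|exact Hy]]|].
  replace (l0 / 2) with (l0 * (1 / 2)) by field. rewrite Rpow_mult_distr, <- Rmult_assoc.
  apply Rmult_le_compat_r; [apply pow_le; lra|]. apply Ha.
Qed.

Lemma is_series_half C : is_series (fun k => C * (1 / 2) ^ k) (2 * C).
Proof.
  replace (2 * C) with (C * / (1 - 1 / 2)) by field.
  apply (is_series_scal (V := R_NormedModule) C). apply is_series_geom. rewrite Rabs_pos_eq; lra.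
Qed.

Lemma coef_bound_ex a l0 C y : 0 < l0 -> coef_bound a l0 C -> Rabs y <= l0 / 2 ->
  ex_pseries a y.
Proof.
  intros Hl Ha Hy. apply ex_pseries_R.
  apply (ex_series_le (V := R_CompleteNormedModule) _ (fun k => C * (1 / 2) ^ k)).
  - intros k. apply (coef_bound_term a l0); assumption.
  - eexists. apply is_series_half.
Qed.

Lemma coef_bound_PSeries a l0 C y : 0 < l0 -> coef_bound a l0 C -> Rabs y <= l0 / 2 ->
  Rabs (PSeries a y) <= 2 * C.
Proof.
  intros Hl Ha Hy. unfold PSeries.
  assert (E : forall k, 0 <= Rabs (a k * y ^ k) <= C * (1 / 2) ^ k).
  { intros k. split; [apply Rabs_pos|]. apply (coef_bound_term a l0); assumption. }
  eapply Rle_trans.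
  - apply Series_Rabs. apply (ex_series_le (V := R_CompleteNormedModule) _ (fun k => C * (1 / 2) ^ k)).
    + intros k. unfold norm; simpl. unfold abs; simpl. rewrite Rabs_Rabsolu. apply E.
    + eexists. apply is_series_half.
  - rewrite <- (is_series_unique _ _ (is_series_half C)). apply Series_le; [exact E|].
    eexists. apply is_series_half.
Qed.

Lemma coef_bound_shift a l0 C : 0 < l0 -> coef_bound a l0 C ->
  coef_bound (fun k => a (S k)) l0 (C / l0).
Proof.
  intros Hl Ha k. apply Rmult_le_reg_r with l0; [exact Hl|].
  unfold Rdiv. rewrite (Rmult_assoc C), Rinv_l, Rmult_1_r by lra.
  replace (Rabs (a (S k)) * l0 ^ k * l0) with (Rabs (a (S k)) * l0 ^ S k) by (simpl; ring). apply Ha.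
Qed.

Lemma coef_bound_minus a b l0 C C' : 0 < l0 -> coef_bound a l0 C -> coef_bound b l0 C' ->
  coef_bound (fun k => a k - b k) l0 (C + C').
Proof.
  intros Hl Ha Hb k. specialize (Ha k). specialize (Hb k).
  eapply Rle_trans; [apply Rmult_le_compat_r; [apply pow_le; lra|apply Rabs_triang]|].
  rewrite Rabs_Ropp. lra.
Qed.

Lemma PSeries_horner m : forall a l0 C y, 0 < l0 -> coef_bound a l0 C -> 0 <= y <= l0 / 2 ->
  Rabs (PSeries a y - horner m a y) <= 2 * C * (y / l0) ^ m.
Proof.
  induction m as [|m IH]; intros a l0 C y Hl Ha Hy.
  - simpl. rewrite Rminus_0_r, Rmult_1_r. apply (coef_bound_PSeries a l0); try assumption.
    rewrite Rabs_pos_eq; lra.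
  - rewrite PSeries_decr_1.
    2:{ apply (coef_bound_ex a l0 C); try assumption. rewrite Rabs_pos_eq; lra. }
    simpl horner. replace (a 0%nat + y * PSeries (PS_decr_1 a) y - (a 0%nat + y * horner m (fun k => a (S k)) y))
      with (y * (PSeries (fun k => a (S k)) y - horner m (fun k => a (S k)) y))
      by (unfold PS_decr_1; ring).
    rewrite Rabs_mult, (Rabs_pos_eq y) by lra.
    replace (2 * C * (y / l0) ^ S m) with (y * (2 * (C / l0) * (y / l0) ^ m)) by (simpl; field; lra).
    apply Rmult_le_compat_l; [lra|]. apply IH; [exact Hl|apply coef_bound_shift; assumption|exact Hy].
Qed.

(** The series is truncated at degree [m] and the polynomial extrapolated. The truncation error
    [2 C (2 l1 / l0)^m] enters twice, on the window and at [y]; both times it is covered by the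
    factor [9^m >= 1]. *)
Lemma PSeries_extrapolate m a l0 C l1 e y :
  0 < l1 -> 4 * l1 <= l0 -> coef_bound a l0 C -> 0 <= C -> 0 <= y <= 2 * l1 ->
  (forall x, l1 <= x <= 2 * l1 -> Rabs (PSeries a x) <= e) ->
  Rabs (PSeries a y) <= 9 ^ m * (e + 4 * C * (2 * l1 / l0) ^ m).
Proof.
  intros Hl Hl0 Ha HC Hy Hb.
  assert (T : forall x, 0 <= x <= 2 * l1 ->
     Rabs (PSeries a x - horner m a x) <= 2 * C * (2 * l1 / l0) ^ m).
  { intros x Hx. eapply Rle_trans; [apply (PSeries_horner m a l0 C); lra || assumption|].
    apply Rmult_le_compat_l; [lra|]. apply pow_incr. split; [apply Rdiv_le_0_compat; lra|].
    apply Rmult_le_compat_r; [apply Rlt_le, Rinv_0_lt_compat; lra|lra]. }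
  assert (Hq : 0 <= 2 * C * (2 * l1 / l0) ^ m).
  { apply Rmult_le_pos; [lra|]. apply pow_le, Rdiv_le_0_compat; lra. }
  assert (P := horner_extrapolate m a l1 (e + 2 * C * (2 * l1 / l0) ^ m) y Hl Hy).
  assert (P' : Rabs (horner m a y) <= 9 ^ m * (e + 2 * C * (2 * l1 / l0) ^ m)).
  { apply P. intros x Hx. specialize (T x ltac:(lra)). specialize (Hb x Hx).
    replace (horner m a x) with (PSeries a x - (PSeries a x - horner m a x)) by ring.
    eapply Rle_trans; [apply Rabs_triang|]. rewrite Rabs_Ropp. lra. }
  specialize (T y Hy).
  replace (PSeries a y) with ((PSeries a y - horner m a y) + horner m a y) by ring.
  eapply Rle_trans; [apply Rabs_triang|].
  assert (1 <= 9 ^ m) by (apply pow_R1_Rle; lra). nra.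
Qed.

(** * Baire category *)

Lemma nested_intervals_point (c r : nat -> R) :
  (forall n, 0 < r n) ->
  (forall n x, Rabs (x - c (S n)) <= r (S n) -> Rabs (x - c n) <= r n) ->
  exists x, forall n, Rabs (x - c n) <= r n.
Proof.
  intros Hr Hn.
  assert (Hk : forall k n x, Rabs (x - c (k + n)%nat) <= r (k + n)%nat -> Rabs (x - c n) <= r n).
  { induction k as [|k IH]; intros n x H; [exact H|]. apply IH. apply Hn. exact H. }
  assert (Hc : forall n m, c n - r n <= c m + r m).
  { intros n m.
    assert (A : Rabs (c (n + m)%nat - c m) <= r m).
    { apply (Hk n). rewrite Rminus_diag, Rabs_R0. apply Rlt_le, Hr. }
    assert (B : Rabs (c (n + m)%nat - c n) <= r n).
    { rewrite Nat.add_comm. apply (Hk m). rewrite Rminus_diag, Rabs_R0. apply Rlt_le, Hr. }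
    apply Rabs_bd in A. apply Rabs_bd in B. lra. }
  destruct (completeness (fun y => exists n, y = c n - r n)) as [s [Hs1 Hs2]].
  - exists (c O + r O). intros y [n ->]. apply Hc.
  - exists (c O - r O), O. reflexivity.
  - exists s. intros n. apply Rabs_bd. split.
    + assert (c n - r n <= s) by (apply Hs1; exists n; reflexivity). lra.
    + assert (s <= c n + r n); [|lra]. apply Hs2. intros y [m ->]. apply Hc.
Qed.

(** If no box carried a uniform bound, every box would contain, for each [n], a smaller one on which
    some [|F k|] exceeds [n] throughout, by continuity of that [F k]. At a common point of the
    nested boxes the sequence would be unbounded. *)
Lemma baire_uniform_bound (F : nat -> R -> R -> R) x0 z0 r :
  0 < r ->
  (forall k x z, Rabs (x - x0) < r -> Rabs (z - z0) < r -> continuity_2d_pt (F k) x z) ->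
  (forall x z, Rabs (x - x0) < r -> Rabs (z - z0) < r -> exists C, forall k, Rabs (F k x z) <= C) ->
  exists x1 z1 r1 N, 0 < r1 /\ forall x z, Rabs (x - x1) <= r1 -> Rabs (z - z1) <= r1 ->
    Rabs (x - x0) < r /\ Rabs (z - z0) < r /\ forall k, Rabs (F k x z) <= N.
Proof.
  intros Hr Hc Hb. apply NNPP. intros Hno.
  set (inside := fun q : R * R * R => 0 < snd q /\
     forall x z, Rabs (x - fst (fst q)) <= snd q -> Rabs (z - snd (fst q)) <= snd q ->
       Rabs (x - x0) < r /\ Rabs (z - z0) < r).
  assert (Hstep : forall n q, inside q -> exists q', inside q' /\
     (forall x, Rabs (x - fst (fst q')) <= snd q' -> Rabs (x - fst (fst q)) <= snd q) /\
     (forall z, Rabs (z - snd (fst q')) <= snd q' -> Rabs (z - snd (fst q)) <= snd q) /\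
     exists k, forall x z, Rabs (x - fst (fst q')) <= snd q' -> Rabs (z - snd (fst q')) <= snd q' ->
        INR n < Rabs (F k x z)).
  { intros n [[x1 z1] r1] [Hr1 Hin]; simpl in *.
    assert (exists x z k, Rabs (x - x1) <= r1 / 2 /\ Rabs (z - z1) <= r1 / 2 /\ INR n < Rabs (F k x z)).
    { apply NNPP. intros Hn. apply Hno. exists x1, z1, (r1 / 2), (INR n). split; [lra|].
      intros x z Hx Hz. destruct (Hin x z) as [A B]; try lra. split; [exact A|]. split; [exact B|].
      intros k. apply Rnot_lt_le. intros K. apply Hn. eauto 10. }
    destruct H as [x [z [k [Hx [Hz HF]]]]].
    destruct (Hin x z) as [A B]; try lra.
    destruct (Hc k x z A B (mkposreal (Rabs (F k x z) - INR n) ltac:(lra))) as [e He].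
    simpl in He. pose proof (cond_pos e).
    set (r2 := Rmin (e / 2) (r1 / 2)).
    assert (Hr2 : 0 < r2 /\ r2 <= e / 2 /\ r2 <= r1 / 2).
    { unfold r2. split; [apply Rmin_glb_lt; lra|]. split; [apply Rmin_l|apply Rmin_r]. }
    assert (S1 : forall u, Rabs (u - x) <= r2 -> Rabs (u - x1) <= r1).
    { intros u Hu. apply Rabs_bd in Hu. apply Rabs_bd in Hx. apply Rabs_bd. lra. }
    assert (S2 : forall u, Rabs (u - z) <= r2 -> Rabs (u - z1) <= r1).
    { intros u Hu. apply Rabs_bd in Hu. apply Rabs_bd in Hz. apply Rabs_bd. lra. }
    exists (x, z, r2). unfold inside. simpl. split; [split; [lra|]|split; [exact S1|split; [exact S2|]]].
    - intros u v Hu Hv. apply Hin; [apply S1, Hu|apply S2, Hv].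
    - exists k. intros u v Hu Hv. specialize (He u v ltac:(lra) ltac:(lra)).
      apply Rabs_bd' in He.
      assert (T : Rabs (F k x z) - Rabs (F k u v) <= Rabs (F k u v - F k x z)).
      { rewrite Rabs_minus_sym. apply Rabs_triang_inv. }
      assert (Rabs (F k u v - F k x z) < Rabs (F k x z) - INR n) by (apply Rabs_bd'; lra). lra. }
  assert (H0 : inside (x0, z0, r / 2)).
  { split; simpl; [lra|]. intros. lra. }
  set (st := fix st n : {q | inside q} := match n with
     | O => exist _ _ H0
     | S n => let q := st n in let d := constructive_indefinite_description _ (Hstep n (proj1_sig q) (proj2_sig q)) in
        exist _ (proj1_sig d) (proj1 (proj2_sig d)) end).
  assert (Hst : forall n,
     (forall x, Rabs (x - fst (fst (proj1_sig (st (S n))))) <= snd (proj1_sig (st (S n))) ->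
        Rabs (x - fst (fst (proj1_sig (st n)))) <= snd (proj1_sig (st n))) /\
     (forall z, Rabs (z - snd (fst (proj1_sig (st (S n))))) <= snd (proj1_sig (st (S n))) ->
        Rabs (z - snd (fst (proj1_sig (st n)))) <= snd (proj1_sig (st n))) /\
     exists k, forall x z, Rabs (x - fst (fst (proj1_sig (st (S n))))) <= snd (proj1_sig (st (S n))) ->
        Rabs (z - snd (fst (proj1_sig (st (S n))))) <= snd (proj1_sig (st (S n))) ->
        INR n < Rabs (F k x z)).
  { intros n. simpl. destruct (constructive_indefinite_description _ _) as [q' Hq']. simpl. tauto. }
  destruct (nested_intervals_point (fun n => fst (fst (proj1_sig (st n)))) (fun n => snd (proj1_sig (st n))))
    as [x Hx].
  { intros n. apply (proj1 (proj2_sig (st n))). }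
  { intros n. apply Hst. }
  destruct (nested_intervals_point (fun n => snd (fst (proj1_sig (st n)))) (fun n => snd (proj1_sig (st n))))
    as [z Hz].
  { intros n. apply (proj1 (proj2_sig (st n))). }
  { intros n. apply Hst. }
  destruct (proj2 (proj2_sig (st O)) x z (Hx O) (Hz O)) as [A B].
  destruct (Hb x z A B) as [C HC].
  destruct (INR_unbounded C) as [n Hn].
  destruct (proj2 (proj2 (Hst n))) as [k Hk].
  specialize (Hk x z (Hx (S n)) (Hz (S n))). specialize (HC k). lra.
Qed.

(** * Interpolation with scaled nodes and the Hartogs-type step *)

Lemma newton_ext n N phi psi : (forall i, (i < n)%nat -> phi i = psi i) ->
  newton n N phi = newton n N psi.
Proof.
  intros H. apply Rminus_diag_uniq. rewrite newton_minus. apply Rabs_eq_0.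
  apply Rle_antisym; [|apply Rabs_pos]. rewrite <- (Rmult_0_r (3 ^ N)). apply newton_bound; [lra|].
  intros i Hi. rewrite H by exact Hi. rewrite Rminus_diag, Rabs_R0. lra.
Qed.

Lemma pow_one_plus_inv_le3 B : (0 < B)%nat -> (1 + / INR B) ^ B <= 3.
Proof.
  intros HB. assert (0 < INR B) by (apply lt_0_INR; exact HB).
  assert (0 < / INR B) by (apply Rinv_0_lt_compat; lra).
  apply Rle_trans with (exp (/ INR B) ^ B).
  - apply pow_incr. split; [lra|]. apply Rlt_le, exp_ineq1. lra.
  - rewrite <- Rpower_pow by apply exp_pos. unfold Rpower. rewrite ln_exp, Rinv_r by lra. apply exp_le_3.
Qed.

(** The general error bound with [N = B n] and [t = 1 / B]: the factor [t^(-n) = B^n] cancels the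
    one in [(q / B)^n], and [(1 + 1 / B)^(B n) <= 3^n]. The result does not depend on [B], although
    the nodes fill only a fraction [1 / B] of the range. *)
Lemma newton_error_scaled n B phi q M : (0 < B)%nat -> 0 <= q -> 0 <= M ->
  (forall i, (i + n <= B * n)%nat -> Rabs (Nat.iter n dseq phi i) <= (q / INR B) ^ n * M) ->
  Rabs (phi (B * n)%nat - newton n (B * n) phi) <= (3 * q) ^ n * M.
Proof.
  intros HB Hq HM Hb. assert (HB0 : 0 < INR B) by (apply lt_0_INR; exact HB).
  assert (HBi : 0 < / INR B) by (apply Rinv_0_lt_compat; lra).
  assert (HqB : 0 <= q / INR B) by (apply Rdiv_le_0_compat; lra).
  assert (E := newton_error n (B * n) phi _ (/ INR B)
    (Rmult_le_pos _ _ (pow_le _ n HqB) HM) HBi Hb).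
  apply Rmult_le_reg_r with ((/ INR B) ^ n); [apply pow_lt; exact HBi|].
  eapply Rle_trans; [exact E|].
  rewrite pow_mult. replace ((3 * q) ^ n * M * (/ INR B) ^ n) with ((q / INR B) ^ n * M * 3 ^ n)
    by (unfold Rdiv; rewrite !Rpow_mult_distr; ring).
  apply Rmult_le_compat_l; [apply Rmult_le_pos; [apply pow_le; exact HqB|exact HM]|].
  apply pow_incr. split; [apply pow_le; lra|]. apply pow_one_plus_inv_le3; exact HB.
Qed.

Lemma quarter_pow_small C e : 0 < e -> exists m, C * (1 / 4) ^ m <= e.
Proof.
  intros He.
  destruct (Rle_dec C 0) as [HC|HC].
  { exists O. simpl. lra. }
  destruct (pow_lt_1_zero (1 / 4)) with (y := e / C) as [m Hm].
  { rewrite Rabs_pos_eq; lra. } { apply Rdiv_lt_0_compat; lra. }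
  exists m. specialize (Hm m (Nat.le_refl _)). rewrite Rabs_pos_eq in Hm by (apply pow_le; lra).
  apply Rmult_le_reg_r with (/ C); [apply Rinv_0_lt_compat; lra|].
  rewrite Rmult_comm, <- Rmult_assoc, Rinv_l, Rmult_1_l by lra. apply Rlt_le. exact Hm.
Qed.

(* Hartogs-type step: approximants [a m] of exponential size, exponentially close to [g] on one
   window, control [g] uniformly near [0]; the constant [Cs] does not enter the conclusion. *)
Lemma PSeries_window_approx (g : nat -> R) (a : nat -> nat -> R) l0 l1 K N M Cs :
  0 < l1 -> 4 * l1 <= l0 -> 1 <= K -> 0 <= N -> 0 <= M -> 0 <= Cs ->
  2 * l1 / l0 <= / (36 * K) ->
  coef_bound g l0 Cs -> (forall m, coef_bound (a m) l0 (N * K ^ m)) ->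
  (forall m x, (2 <= m)%nat -> l1 <= x <= 2 * l1 ->
     Rabs (PSeries g x - PSeries (a m) x) <= 2 * M * (1 / 72) ^ m) ->
  forall m y, (2 <= m)%nat -> 0 <= y <= 2 * l1 ->
    Rabs (PSeries g y - g O) <= 4 * (4 * M + 8 * N * K) * (1 / 4) ^ m + 2 * (N * K ^ m) * (y / l0).
Proof.
  intros Hl1 Hl0 HK HN HM HCs Hth Hg Ha Hw m y Hm Hy.
  assert (Hl0p : 0 < l0) by lra.
  assert (HKm : forall j, 1 <= K ^ j) by (intros j; apply pow_R1_Rle; exact HK).
  assert (Hth0 : 0 <= 2 * l1 / l0) by (apply Rdiv_le_0_compat; lra).
  assert (Hthm : forall j, 9 ^ j * (2 * l1 / l0) ^ j * K ^ j <= (1 / 4) ^ j).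
  { intros j. rewrite <- !Rpow_mult_distr. apply pow_incr. split.
    - apply Rmult_le_pos; [|lra]. lra.
    - apply Rle_trans with (9 * / (36 * K) * K); [|right; field; lra].
      apply Rmult_le_compat_r; [lra|]. apply Rmult_le_compat_l; [lra|exact Hth]. }
  assert (H72 : forall j, 9 ^ j * (1 / 72) ^ j <= (1 / 4) ^ j).
  { intros j. rewrite <- Rpow_mult_distr. apply pow_incr. lra. }
  assert (Hq : forall j, 0 < (1 / 4) ^ j) by (intros j; apply pow_lt; lra).
  assert (H9 : forall j, 0 <= 9 ^ j * (2 * l1 / l0) ^ j).
  { intros j. rewrite <- Rpow_mult_distr. apply pow_le. lra. }
  assert (Habs : forall u, 0 <= u <= 2 * l1 -> Rabs u <= l0 / 2).
  { intros u Hu. rewrite Rabs_pos_eq; lra. }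
  assert (Hsub : forall (b c : nat -> R) C1 C2 u, coef_bound b l0 C1 -> coef_bound c l0 C2 ->
     0 <= u <= 2 * l1 -> PSeries (fun k => b k - c k) u = PSeries b u - PSeries c u).
  { intros b c C1 C2 u Hb Hc Hu. apply (PSeries_minus b c);
      [apply (coef_bound_ex b l0 C1)|apply (coef_bound_ex c l0 C2)]; auto; lra. }
  set (C' := 4 * M + 8 * N * K).
  assert (HC' : 0 <= C').
  { unfold C'. apply Rplus_le_le_0_compat; [lra|]. apply Rmult_le_pos; lra. }
  (* Consecutive approximants are close on the window, since both are close to [g] there, and their
     difference has coefficients of size [N K^(j + 1)]. Extrapolation loses [9^j], which [(1/72)^j]
     and the smallness of [2 l1 / l0] against [K] both outweigh, leaving [(1/4)^j]. *)
  assert (A2 : forall j u, (2 <= j)%nat -> 0 <= u <= 2 * l1 ->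
     Rabs (PSeries (a (S j)) u - PSeries (a j) u) <= C' * (1 / 4) ^ j).
  { intros j u Hj Hu.
    rewrite <- (Hsub _ _ _ _ u (Ha (S j)) (Ha j) Hu).
    eapply Rle_trans.
    { apply (PSeries_extrapolate j _ l0 (2 * (N * K ^ S j)) l1 (4 * M * (1 / 72) ^ j)); try lra.
      - intros k. eapply Rle_trans; [apply (coef_bound_minus _ _ _ _ _ Hl0p (Ha (S j)) (Ha j))|].
        assert (N * K ^ j <= N * K ^ S j); [|lra]. apply Rmult_le_compat_l; [exact HN|].
        simpl. specialize (HKm j). nra.
      - specialize (HKm (S j)). assert (0 <= N * K ^ S j) by (apply Rmult_le_pos; lra). lra.
      - intros x Hx. rewrite (Hsub _ _ _ _ x (Ha (S j)) (Ha j)) by lra.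
        pose proof (Hw j x Hj Hx) as W1. pose proof (Hw (S j) x ltac:(lia) Hx) as W2.
        apply Rabs_bd in W1. apply Rabs_bd in W2.
        assert (2 * M * (1 / 72) ^ S j <= 2 * M * (1 / 72) ^ j).
        { apply Rmult_le_compat_l; [lra|]. simpl.
          assert (0 < (1 / 72) ^ j) by (apply pow_lt; lra). lra. }
        apply Rabs_bd. lra. }
    unfold C'. specialize (H72 j). specialize (Hthm j).
    replace (9 ^ j * (4 * M * (1 / 72) ^ j + 4 * (2 * (N * K ^ S j)) * (2 * l1 / l0) ^ j)) with
      (4 * M * (9 ^ j * (1 / 72) ^ j) + 8 * N * K * (9 ^ j * (2 * l1 / l0) ^ j * K ^ j))
      by (simpl; ring).
    rewrite Rmult_plus_distr_r. apply Rplus_le_compat; apply Rmult_le_compat_l; try lra.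
    apply Rmult_le_pos; lra. }
  set (C'' := 2 * M + 4 * (Cs + N)).
  assert (A3 : forall j u, (2 <= j)%nat -> 0 <= u <= 2 * l1 ->
     Rabs (PSeries g u - PSeries (a j) u) <= C'' * (1 / 4) ^ j).
  { intros j u Hj Hu. rewrite <- (Hsub _ _ _ _ u Hg (Ha j) Hu).
    eapply Rle_trans.
    { apply (PSeries_extrapolate j _ l0 (Cs + N * K ^ j) l1 (2 * M * (1 / 72) ^ j)); try lra.
      - apply coef_bound_minus; [lra|exact Hg|apply Ha].
      - specialize (HKm j). assert (0 <= N * K ^ j) by (apply Rmult_le_pos; lra). lra.
      - intros x Hx. rewrite (Hsub _ _ _ _ x Hg (Ha j)) by lra. apply Hw; assumption. }
    unfold C''. specialize (H72 j). specialize (Hthm j). specialize (H9 j). specialize (HKm j).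
    assert (9 ^ j * (2 * l1 / l0) ^ j <= (1 / 4) ^ j).
    { eapply Rle_trans; [|exact Hthm]. rewrite <- (Rmult_1_r (9 ^ j * _)) at 1.
      apply Rmult_le_compat_l; [exact H9|exact HKm]. }
    replace (9 ^ j * (2 * M * (1 / 72) ^ j + 4 * (Cs + N * K ^ j) * (2 * l1 / l0) ^ j)) with
      (2 * M * (9 ^ j * (1 / 72) ^ j) + 4 * Cs * (9 ^ j * (2 * l1 / l0) ^ j) +
       4 * N * (9 ^ j * (2 * l1 / l0) ^ j * K ^ j)) by ring.
    replace ((2 * M + 4 * (Cs + N)) * (1 / 4) ^ j) with
      (2 * M * (1 / 4) ^ j + 4 * Cs * (1 / 4) ^ j + 4 * N * (1 / 4) ^ j) by ring.
    repeat apply Rplus_le_compat; apply Rmult_le_compat_l; lra. }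
  assert (A4 : forall i u, 0 <= u <= 2 * l1 ->
     Rabs (PSeries g u - PSeries (a m) u) <= 2 * C' * ((1 / 4) ^ m - (1 / 4) ^ (m + i)) + C'' * (1 / 4) ^ (m + i)).
  { intros i u Hu. 
    assert (B : Rabs (PSeries (a (m + i)%nat) u - PSeries (a m) u) <= 2 * C' * ((1 / 4) ^ m - (1 / 4) ^ (m + i))).
    { induction i as [|i IH].
      - rewrite Nat.add_0_r, !Rminus_diag, Rabs_R0, Rmult_0_r. lra.
      - rewrite Nat.add_succ_r.
        pose proof (A2 (m + i)%nat u ltac:(lia) Hu) as B2. apply Rabs_bd in IH. apply Rabs_bd in B2.
        assert (2 * C' * ((1 / 4) ^ m - (1 / 4) ^ S (m + i)) =
           2 * C' * ((1 / 4) ^ m - (1 / 4) ^ (m + i)) + C' * (1 / 4) ^ (m + i) + C' * (1 / 4) ^ (m + i) / 2).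
        { simpl. field. }
        assert (0 <= C' * (1 / 4) ^ (m + i)) by (apply Rmult_le_pos; [exact HC'|apply Rlt_le, Hq]).
        apply Rabs_bd. lra. }
    pose proof (A3 (m + i)%nat u ltac:(lia) Hu) as B2. apply Rabs_bd in B. apply Rabs_bd in B2.
    apply Rabs_bd. lra. }
  (* The constant [Cs] sits in [C''] alone, which multiplies [(1/4)^(m + i)]; letting [i] grow
     removes it, and only the telescoping sum of the steps [A2] remains. *)
  assert (A5 : forall u, 0 <= u <= 2 * l1 ->
     Rabs (PSeries g u - PSeries (a m) u) <= 2 * C' * (1 / 4) ^ m).
  { intros u Hu. apply le_epsilon. intros e He.
    destruct (quarter_pow_small C'' e He) as [i Hi].
    eapply Rle_trans; [apply (A4 i u Hu)|].
    assert (0 <= 2 * C' * (1 / 4) ^ (m + i)) by (apply Rmult_le_pos; [lra|apply Rlt_le, Hq]).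
    assert (C'' * (1 / 4) ^ (m + i) <= C'' * (1 / 4) ^ i).
    { apply Rmult_le_compat_l; [unfold C''; lra|]. rewrite pow_add. apply Rle_trans with (1 * (1 / 4) ^ i); [|rewrite Rmult_1_l; apply Rle_refl].
      apply Rmult_le_compat_r; [apply Rlt_le, Hq|]. apply Rle_trans with (1 ^ m); [apply pow_incr; lra|rewrite pow1; apply Rle_refl]. }
    lra. }
  assert (Z0 : forall b : nat -> R, PSeries b 0 = b O) by (intros b; apply PSeries_0).
  pose proof (A5 y Hy) as D1. pose proof (A5 0 ltac:(lra)) as D2. rewrite !Z0 in D2.
  pose proof (PSeries_horner 1 (a m) l0 _ y Hl0p (Ha m) ltac:(lra)) as D3. simpl in D3.
  rewrite Rmult_0_r, Rplus_0_r, Rmult_1_r in D3.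
  apply Rabs_bd in D1. apply Rabs_bd in D2. apply Rabs_bd in D3. apply Rabs_bd.
  fold C'. lra.
Qed.

(** * Lifting to five dimensions *)

(* A solution of [f_rr + (3 / r) f_r + f_zz = - w] is a function of [(r, z)], [r = |q|], [q] in R^4. Taking
   [q = (1 + l x, l y)] with [y] in R^3 and [s = |y|^2] makes its rescaling a solution of the same equation
   in R^5 for every [l], so that solutions with different [l] can be subtracted. *)
Definition lift_radius (l x s : R) : R := sqrt ((1 + l * x) ^ 2 + l ^ 2 * s).

Definition lift_coord (l x s : R) : R := (lift_radius l x s - 1) / l.

Lemma lift_arg_pos l x s : 0 < 1 + l * x -> 0 <= s -> 0 < (1 + l * x) ^ 2 + l ^ 2 * s.
Proof.
  intros H1 H2. apply Rplus_lt_le_0_compat; [apply pow_lt; exact H1|].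
  apply Rmult_le_pos; [apply pow2_ge_0|exact H2].
Qed.

Lemma lift_radius_pos l x s : 0 < 1 + l * x -> 0 <= s -> 0 < lift_radius l x s.
Proof. intros H1 H2. apply sqrt_lt_R0, lift_arg_pos; assumption. Qed.

Lemma lift_radius_sqr l x s : 0 <= s -> lift_radius l x s ^ 2 = (1 + l * x) ^ 2 + l ^ 2 * s.
Proof. intros Hs. apply pow2_sqrt. apply Rplus_le_le_0_compat; [apply pow2_ge_0|].
  apply Rmult_le_pos; [apply pow2_ge_0|exact Hs].
Qed.

Lemma lift_coord_0 l x : 0 < l -> 0 < 1 + l * x -> lift_coord l x 0 = x.
Proof.
  intros Hl Hx. unfold lift_coord, lift_radius. rewrite Rmult_0_r, Rplus_0_r, sqrt_pow2 by lra.
  field. lra.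
Qed.

Lemma lift_coord_bounds l x s : 0 < l -> 1 / 2 <= 1 + l * x -> 0 <= s ->
  x <= lift_coord l x s <= x + l * s.
Proof.
  intros Hl Hx Hs.
  assert (Hq := lift_radius_pos l x s ltac:(lra) Hs). assert (Hq2 := lift_radius_sqr l x s Hs).
  set (q := lift_radius l x s) in *.
  assert (E : lift_coord l x s = x + (q - (1 + l * x)) / l) by (unfold lift_coord; fold q; field; lra).
  rewrite E.
  assert (A : 0 <= q - (1 + l * x)) by nra.
  assert (B : q - (1 + l * x) <= l * (l * s)) by nra.
  split.
  - assert (0 <= (q - (1 + l * x)) / l) by (apply Rdiv_le_0_compat; lra). lra.
  - apply Rplus_le_compat_l. apply Rmult_le_reg_l with l; [lra|].
    replace (l * ((q - (1 + l * x)) / l)) with (q - (1 + l * x)) by (field; lra). exact B.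
Qed.

Lemma is_derive_lift_x l x s : 0 < l -> 0 < 1 + l * x -> 0 <= s ->
  is_derive (fun y => lift_coord l y s) x ((1 + l * x) / lift_radius l x s).
Proof.
  intros Hl Hx Hs. assert (Hq := lift_radius_pos l x s Hx Hs).
  assert (Ha := lift_arg_pos l x s Hx Hs). unfold lift_coord, lift_radius in *. auto_derive.
  - exact Ha.
  - simpl in *.  rewrite ?Rmult_1_r in *. set (q := sqrt _) in *. field. lra.
Qed.

Lemma is_derive_lift_s l x s : 0 < l -> 0 < 1 + l * x -> 0 <= s ->
  is_derive (fun y => lift_coord l x y) s (l / (2 * lift_radius l x s)).
Proof.
  intros Hl Hx Hs. assert (Hq := lift_radius_pos l x s Hx Hs).
  assert (Ha := lift_arg_pos l x s Hx Hs). unfold lift_coord, lift_radius in *. auto_derive.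
  - exact Ha.
  - simpl in *. field. split; lra.
Qed.

Lemma is_derive_lift_xx l x s : 0 < l -> 0 < 1 + l * x -> 0 <= s ->
  is_derive (fun y => (1 + l * y) / lift_radius l y s) x
    (l / lift_radius l x s - l * (1 + l * x) ^ 2 / lift_radius l x s ^ 3).
Proof.
  intros Hl Hx Hs. assert (Hq := lift_radius_pos l x s Hx Hs).
  assert (Ha := lift_arg_pos l x s Hx Hs). unfold lift_radius in *. auto_derive.
  - simpl in *. split; [exact Ha|]. split; [|tauto]. lra.
  - simpl in *. rewrite ?Rmult_1_r in *. set (q := sqrt _) in *. field. lra.
Qed.

Lemma is_derive_lift_ss l x s : 0 < l -> 0 < 1 + l * x -> 0 <= s ->
  is_derive (fun y => l / (2 * lift_radius l x y)) s (- (l ^ 3 / (4 * lift_radius l x s ^ 3))).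
Proof.
  intros Hl Hx Hs. assert (Hq := lift_radius_pos l x s Hx Hs).
  assert (Ha := lift_arg_pos l x s Hx Hs). unfold lift_radius in *. auto_derive.
  - simpl in *. split; [exact Ha|]. split; [|tauto]. lra.
  - simpl in *. rewrite ?Rmult_1_r in *. set (q := sqrt _) in *. field. lra.
Qed.

Lemma continuous_lift l x s : 0 < l -> 0 < 1 + l * x -> 0 <= s ->
  continuous (fun p : R * (R * R) => lift_coord l (fst p) (fst (snd p))) (x, (s, 0)).
Proof.
  intros Hl Hx Hs. unfold lift_coord, lift_radius.
  apply (continuous_mult (fun p : R * (R * R) => sqrt ((1 + l * fst p) ^ 2 + l ^ 2 * fst (snd p)) - 1)
    (fun _ => / l)); [|apply continuous_const].
  apply (continuous_minus (fun p : R * (R * R) => sqrt ((1 + l * fst p) ^ 2 + l ^ 2 * fst (snd p))) (fun _ => 1));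
    [|apply continuous_const].
  apply (continuous_comp (fun p : R * (R * R) => (1 + l * fst p) ^ 2 + l ^ 2 * fst (snd p)) sqrt).
  - apply (continuous_ext (fun p : R * (R * R) => (1 + l * fst p) * (1 + l * fst p) + l ^ 2 * fst (snd p))).
    + intros p. simpl. ring.
    + cont.
  - apply continuous_sqrt.
Qed.

(* The equation [- (d_r^2 + (3 / r) d_r + d_z^2) f = w] in the variables [r = 1 + l R], [z = l Z]. *)
Definition slice_at (l : R) (f fR fRR fZ fZZ w : R -> R -> R) (R0 Z0 : R) : Prop :=
  0 < l /\ 0 < 1 + l * R0 /\
  continuous (fun p : R * R => f (fst p) (snd p)) (R0, Z0) /\
  is_derive (fun y => f y Z0) R0 (fR R0 Z0) /\
  is_derive (fun y => fR y Z0) R0 (fRR R0 Z0) /\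
  is_derive (fun y => f R0 y) Z0 (fZ R0 Z0) /\
  is_derive (fun y => fZ R0 y) Z0 (fZZ R0 Z0) /\
  fRR R0 Z0 + fZZ R0 Z0 + 3 * l / (1 + l * R0) * fR R0 Z0 = - w R0 Z0.

(** With [l^2 s = q^2 - (1 + l x)^2], the coefficients of [fRR] add up to one, because the radius
    has unit gradient, and those of [fR] to [3 l / q], the radial Laplacian in four dimensions. *)
Lemma lift_derivatives l f fR fRR fZ fZZ w x s z :
  slice_at l f fR fRR fZ fZZ w (lift_coord l x s) z -> 0 < 1 + l * x -> 0 <= s ->
  let q := lift_radius l x s in let y := lift_coord l x s in
  continuous (unc3 (fun x s z => f (lift_coord l x s) z)) (x, (s, z)) /\
  is_derive (fun x => f (lift_coord l x s) z) x (fR y z * ((1 + l * x) / q)) /\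
  is_derive (fun x => fR (lift_coord l x s) z * ((1 + l * x) / lift_radius l x s)) x
    (fRR y z * ((1 + l * x) / q) ^ 2 + fR y z * (l / q - l * (1 + l * x) ^ 2 / q ^ 3)) /\
  is_derive (fun s => f (lift_coord l x s) z) s (fR y z * (l / (2 * q))) /\
  is_derive (fun s => fR (lift_coord l x s) z * (l / (2 * lift_radius l x s))) s
    (fRR y z * (l / (2 * q)) ^ 2 - fR y z * (l ^ 3 / (4 * q ^ 3))) /\
  is_derive (fun z => f (lift_coord l x s) z) z (fZ y z) /\
  is_derive (fun z => fZ (lift_coord l x s) z) z (fZZ y z) /\
  (fRR y z * ((1 + l * x) / q) ^ 2 + fR y z * (l / q - l * (1 + l * x) ^ 2 / q ^ 3)) + fZZ y z +
   4 * s * (fRR y z * (l / (2 * q)) ^ 2 - fR y z * (l ^ 3 / (4 * q ^ 3))) + 6 * (fR y z * (l / (2 * q)))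
   = - w y z.
Proof.
  intros [Hl [H1 [Hc [HR [HRR [HZ [HZZ He]]]]]]] Hx Hs q y. fold y in H1, Hc, HR, HRR, HZ, HZZ, He.
  assert (Hq := lift_radius_pos l x s Hx Hs). fold q in Hq.
  assert (Hq2 := lift_radius_sqr l x s Hs). fold q in Hq2.
  assert (Hy : 1 + l * y = q) by (unfold y, lift_coord; fold q; field; lra).
  assert (Dx := is_derive_lift_x l x s Hl Hx Hs). assert (Dxx := is_derive_lift_xx l x s Hl Hx Hs).
  assert (Ds := is_derive_lift_s l x s Hl Hx Hs). assert (Dss := is_derive_lift_ss l x s Hl Hx Hs).
  fold q in Dx, Dxx, Ds, Dss.
  ands.
  - unfold unc3.
    apply (continuous_comp (fun p : R * (R * R) => (lift_coord l (fst p) (fst (snd p)), snd (snd p)))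
      (fun p : R * R => f (fst p) (snd p))).
    + apply continuous_pair; [|cont].
      apply (continuous_comp (fun p : R * (R * R) => (fst p, (fst (snd p), 0)))
        (fun p : R * (R * R) => lift_coord l (fst p) (fst (snd p)))).
      * apply continuous_pair; [cont|]. apply continuous_pair; cont.
      * apply continuous_lift; assumption.
    + exact Hc.
  - replace (fR y z * ((1 + l * x) / q)) with (scal ((1 + l * x) / q) (fR y z))
      by (unfold scal; simpl; unfold mult; simpl; ring).
    exact (is_derive_comp (K := R_AbsRing) (V := R_NormedModule) (fun u => f u z) (fun u => lift_coord l u s) x _ _ HR Dx).
  - replace (fRR y z * ((1 + l * x) / q) ^ 2 + fR y z * (l / q - l * (1 + l * x) ^ 2 / q ^ 3)) with
      (plus (mult (scal ((1 + l * x) / q) (fRR y z)) ((1 + l * x) / q))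
        (mult (fR y z) (l / q - l * (1 + l * x) ^ 2 / q ^ 3)))
      by (unfold scal, plus, mult; simpl; unfold mult; simpl; ring).
    exact (is_derive_mult (K := R_AbsRing) (fun u => fR (lift_coord l u s) z)
      (fun u => (1 + l * u) / lift_radius l u s) x _ _ (is_derive_comp (K := R_AbsRing) (V := R_NormedModule) (fun u => fR u z) (fun u => lift_coord l u s) x _ _ HRR Dx) Dxx Rmult_comm).
  - replace (fR y z * (l / (2 * q))) with (scal (l / (2 * q)) (fR y z))
      by (unfold scal; simpl; unfold mult; simpl; ring).
    exact (is_derive_comp (K := R_AbsRing) (V := R_NormedModule) (fun u => f u z) (fun u => lift_coord l x u) s _ _ HR Ds).
  - replace (fRR y z * (l / (2 * q)) ^ 2 - fR y z * (l ^ 3 / (4 * q ^ 3))) with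
      (plus (mult (scal (l / (2 * q)) (fRR y z)) (l / (2 * q)))
        (mult (fR y z) (- (l ^ 3 / (4 * q ^ 3)))))
      by (unfold scal, plus, mult; simpl; unfold mult; simpl; ring).
    exact (is_derive_mult (K := R_AbsRing) (fun u => fR (lift_coord l x u) z)
      (fun u => l / (2 * lift_radius l x u)) s _ _ (is_derive_comp (K := R_AbsRing) (V := R_NormedModule) (fun u => fR u z) (fun u => lift_coord l x u) s _ _ HRR Ds) Dss Rmult_comm).
  - exact HZ.
  - exact HZZ.
  - rewrite Hy in He. rewrite <- He.
    assert (E : l ^ 2 * s = q ^ 2 - (1 + l * x) ^ 2) by lra.
    assert (E3 : 4 * s * (fRR y z * (l / (2 * q)) ^ 2 - fR y z * (l ^ 3 / (4 * q ^ 3))) =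
      (l ^ 2 * s) * (fRR y z / q ^ 2 - fR y z * l / q ^ 3)) by (field; lra).
    rewrite E3, E. field. lra.
Qed.

(** Two different values of [l] are allowed because the lifted operator no longer contains [l].
    Taking the second function to be zero lifts a single slice. *)
Lemma poisson5_lift l f fR fRR fZ fZZ w l' f' fR' fRR' fZ' fZZ' w' x0 z0 r S G :
  (forall x s z, Rabs (x - x0) < r -> 0 <= s < S -> Rabs (z - z0) < r ->
     0 < 1 + l * x /\ 0 < 1 + l' * x /\
     slice_at l f fR fRR fZ fZZ w (lift_coord l x s) z /\
     slice_at l' f' fR' fRR' fZ' fZZ' w' (lift_coord l' x s) z /\
     Rabs (w (lift_coord l x s) z - w' (lift_coord l' x s) z) <= G) ->
  poisson5 x0 z0 r S (fun x s z => f (lift_coord l x s) z - f' (lift_coord l' x s) z) G.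
Proof.
  intros H.
  set (Hx := fun x s z => fR (lift_coord l x s) z * ((1 + l * x) / lift_radius l x s) -
    fR' (lift_coord l' x s) z * ((1 + l' * x) / lift_radius l' x s)).
  set (Hs := fun x s z => fR (lift_coord l x s) z * (l / (2 * lift_radius l x s)) -
    fR' (lift_coord l' x s) z * (l' / (2 * lift_radius l' x s))).
  set (xx := fun l (fR fRR : R -> R -> R) x s z => let q := lift_radius l x s in let y := lift_coord l x s in
     fRR y z * ((1 + l * x) / q) ^ 2 + fR y z * (l / q - l * (1 + l * x) ^ 2 / q ^ 3)).
  set (ss := fun l (fR fRR : R -> R -> R) x s z => let q := lift_radius l x s in let y := lift_coord l x s in
     fRR y z * (l / (2 * q)) ^ 2 - fR y z * (l ^ 3 / (4 * q ^ 3))).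
  exists Hx, (fun x s z => xx l fR fRR x s z - xx l' fR' fRR' x s z), Hs,
    (fun x s z => ss l fR fRR x s z - ss l' fR' fRR' x s z),
    (fun x s z => fZ (lift_coord l x s) z - fZ' (lift_coord l' x s) z),
    (fun x s z => fZZ (lift_coord l x s) z - fZZ' (lift_coord l' x s) z).
  intros x s z A B C. destruct (H x s z A B C) as [P1 [P1' [P2 [P2' P3]]]].
  destruct (lift_derivatives _ _ _ _ _ _ _ _ _ _ P2 P1 (proj1 B)) as [K0 [K1 [K2 [K3 [K4 [K5 [K6 K7]]]]]]].
  destruct (lift_derivatives _ _ _ _ _ _ _ _ _ _ P2' P1' (proj1 B)) as [L0 [L1 [L2 [L3 [L4 [L5 [L6 L7]]]]]]].
  ands; try (apply (is_derive_minus (V := R_NormedModule)); assumption).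
  - apply (continuous_minus (unc3 (fun x s z => f (lift_coord l x s) z))
      (unc3 (fun x s z => f' (lift_coord l' x s) z))); assumption.
  - match goal with |- Rabs ?e <= _ => replace e with
      (- (w (lift_coord l x s) z - w' (lift_coord l' x s) z)) end.
    + rewrite Rabs_Ropp. exact P3.
    + rewrite <- (Ropp_involutive (w (lift_coord l x s) z)), <- (Ropp_involutive (w' (lift_coord l' x s) z)).
      rewrite <- K7, <- L7. unfold xx, ss, Hs. ring.
Qed.

(** The nodes occupy only the first [1 / B] of the segment from [X0] to [X0 + dl], yet the value at
    its end is recovered with an error geometric in [|dl| / r] and independent of [B]. Thus
    information on a tiny box reaches points at a fixed distance. The constant is
    [846 = 3 * 282]. *)
Lemma poisson5_newton x0 z0 r H M n B X0 Z dl :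
  poisson5 x0 z0 r (r ^ 2) H 0 -> 0 <= M -> 0 < r ->
  (forall x s z, Rabs (x - x0) < r -> 0 <= s < r ^ 2 -> Rabs (z - z0) < r -> Rabs (H x s z) <= M) ->
  (0 < n)%nat -> (0 < B)%nat -> Rabs dl <= r / 6 ->
  Rabs (X0 - x0) < r / 4 -> Rabs (Z - z0) < r / 2 ->
  Rabs (H (X0 + dl) 0 Z -
    newton n (B * n) (fun i => H (X0 + INR i * (dl / (INR B * INR n))) 0 Z)) <=
  (846 * Rabs dl / r) ^ n * M.
Proof.
  intros HP HM Hr HB Hn HBn Hdl HX HZ.
  assert (Hn0 : 0 < INR n) by (apply lt_0_INR; exact Hn).
  assert (HB0 : 0 < INR B) by (apply lt_0_INR; exact HBn).
  assert (HB1 : 1 <= INR B) by (apply (le_INR 1); lia).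
  pose proof (Rabs_pos dl) as Hdl0.
  set (h := dl / (INR B * INR n)).
  assert (Hh : INR n * Rabs h = Rabs dl / INR B).
  { unfold h, Rdiv. rewrite Rabs_mult, Rabs_inv, (Rabs_pos_eq (INR B * INR n)); [field; lra|].
    apply Rmult_le_pos; lra. }
  set (phi := fun i => H (X0 + INR i * h) 0 Z).
  assert (E : phi (B * n)%nat = H (X0 + dl) 0 Z).
  { unfold phi, h. rewrite mult_INR. f_equal. field. lra. }
  rewrite <- E. replace (846 * Rabs dl / r) with (3 * (282 * Rabs dl / r)) by (field; lra).
  apply newton_error_scaled; try assumption.
  { apply Rdiv_le_0_compat; lra. }
  intros i Hi. unfold phi. rewrite (iter_dseq h (fun x => H x 0 Z)), <- iter_diff1.
  replace (282 * Rabs dl / r / INR B) with (282 * (INR n * Rabs h) / r) by (rewrite Hh; field; lra).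
  apply (poisson5_diff_bound x0 z0); try assumption.
  - rewrite Hh. apply Rle_trans with (Rabs dl); [|exact Hdl].
    apply Rmult_le_reg_r with (INR B); [lra|]. unfold Rdiv. rewrite Rmult_assoc, Rinv_l by lra. nra.
  - assert (Hi' : INR i <= INR B * INR n) by (rewrite <- mult_INR; apply le_INR; lia).
    assert (Rabs (INR i * h) <= Rabs dl).
    { rewrite Rabs_mult, (Rabs_pos_eq (INR i)) by apply pos_INR.
      apply Rle_trans with (INR B * INR n * Rabs h).
      - apply Rmult_le_compat_r; [apply Rabs_pos|exact Hi'].
      - rewrite Rmult_assoc, Hh. right. field. lra. }
    replace (X0 + INR i * h - x0) with (X0 - x0 + INR i * h) by ring.
    eapply Rle_lt_trans; [apply Rabs_triang|]. lra.
Qed.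

(** Lets a linear term be added to a solution before interpolation, to remove its source, and be
    taken off again afterwards. *)
Lemma newton_affine n N a b : (2 <= n)%nat -> newton n N (fun i => a + b * INR i) = a + b * INR N.
Proof.
  intros Hn.
  assert (E := newton_error n N (fun i => a + b * INR i) 0 1 (Rle_refl _) Rlt_0_1).
  rewrite pow1, Rmult_1_r, Rmult_0_l in E.
  symmetry. apply Rminus_diag_uniq, Rabs_eq_0, Rle_antisym; [|apply Rabs_pos]. apply E.
  intros i _. destruct n as [|[|n]]; try lia.
  rewrite !Nat.iter_succ_r.
  replace (dseq (dseq (fun i => a + b * INR i))) with (fun _ : nat => 0).
  - assert (Z : forall k, Nat.iter k dseq (fun _ => 0) = (fun _ => 0)).
    { induction k as [|k IH]; [reflexivity|]. simpl. rewrite IH. unfold dseq.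
      apply functional_extensionality. intros; ring. }
    rewrite Z, Rabs_R0. lra.
  - apply functional_extensionality. intros j. unfold dseq. rewrite !S_INR. ring.
Qed.

(** * Elliptic families *)

(* In case (ii) the limsup condition provides arbitrarily large rectangles only for parameters in
   windows [[l1, 2 l1]] accumulating at [0]. *)
Definition windows (V : R -> R -> R -> Prop) : Prop :=
  forall M eps, 0 < eps -> exists l1, 0 < l1 < eps /\
    forall l X Y, l1 <= l <= 2 * l1 -> - M <= X < 0 -> Rabs Y <= M -> V l X Y.

(* The source [be / (1 + l X)] appears when a linear first coefficient is subtracted. *)
Definition elliptic_family (V : R -> R -> R -> Prop) (be : R)
  (f : R -> R -> R -> R) (F : nat -> R -> R -> R) : Prop :=
  exists fR fRR fZ fZZ : R -> R -> R -> R, forall l X Y, V l X Y ->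
    continuous (unc3 f) (l, (X, Y)) /\
    slice_at l (f l) (fR l) (fRR l) (fZ l) (fZZ l) (fun X _ => be / (1 + l * X)) X Y /\
    is_pseries (fun k => F k X Y) l (f l X Y).

Lemma is_pseries_coef_bound a l s : 0 < l -> is_pseries a l s -> exists C, 0 <= C /\ coef_bound a l C.
Proof.
  intros Hl Hs.
  assert (E : ex_series (fun k => a k * l ^ k)).
  { apply ex_pseries_R. exists s. exact Hs. }
  apply ex_series_lim_0 in E.
  destruct (filterlim_bounded (fun k => a k * l ^ k)) as [M HM].
  { exists 0. exact E. }
  exists (Rmax 0 M). split; [apply Rmax_l|].
  intros k. specialize (HM k). unfold norm in HM; simpl in HM. unfold abs in HM; simpl in HM.
  rewrite Rabs_mult, (Rabs_pos_eq (l ^ k)) in HM by (apply pow_le; lra).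
  eapply Rle_trans; [exact HM|apply Rmax_r].
Qed.

Lemma windows_coef_bound V (f : R -> R -> R -> R) F M :
  windows V -> (forall l X Y, V l X Y -> is_pseries (fun k => F k X Y) l (f l X Y)) ->
  exists l0, 0 < l0 /\ forall X Y, - M <= X < 0 -> Rabs Y <= M ->
    exists C, 0 <= C /\ coef_bound (fun k => F k X Y) l0 C.
Proof.
  intros HV Hs. destruct (HV M 1 Rlt_0_1) as [l [Hl H]].
  exists l. split; [lra|]. intros X Y HX HY.
  apply (is_pseries_coef_bound _ _ (f l X Y)); [lra|]. apply Hs, H; lra || assumption.
Qed.

(** On [s = 0] the lift is the identity, so the estimates for the lifted function restrict to [f];
    the direction [Z] follows by exchanging the roles of [x] and [z]. The hypotheses cover
    [|X - x0| < 2 r] because lifting moves the first coordinate by up to [l s <= r]. *)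
Lemma slice_newton l f fR fRR fZ fZZ x0 z0 r M n B X0 Z0 dl :
  0 < l -> 0 < r -> 0 <= M -> l * r <= 1 ->
  (forall X Z, Rabs (X - x0) < 2 * r -> Rabs (Z - z0) < r -> 1 / 2 <= 1 + l * X /\
     slice_at l f fR fRR fZ fZZ (fun _ _ => 0) X Z /\ Rabs (f X Z) <= M) ->
  (0 < n)%nat -> (0 < B)%nat -> Rabs dl <= r / 6 ->
  Rabs (X0 - x0) < r / 4 -> Rabs (Z0 - z0) < r / 4 ->
  Rabs (f (X0 + dl) Z0 - newton n (B * n) (fun i => f (X0 + INR i * (dl / (INR B * INR n))) Z0)) <=
    (846 * Rabs dl / r) ^ n * M /\
  Rabs (f X0 (Z0 + dl) - newton n (B * n) (fun i => f X0 (Z0 + INR i * (dl / (INR B * INR n))))) <=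
    (846 * Rabs dl / r) ^ n * M.
Proof.
  intros Hl Hr HM Hlr H Hn HB Hdl HX HZ.
  set (zero := fun _ _ : R => 0).
  assert (Hz : forall X Z, 0 < 1 + l * X -> slice_at l zero zero zero zero zero zero X Z).
  { intros X Z Hp. unfold zero. split; [exact Hl|]. split; [exact Hp|].
    ands; try apply (is_derive_const (V := R_NormedModule)); [apply continuous_const|ring]. }
  set (Hf := fun x s z => f (lift_coord l x s) z - zero (lift_coord l x s) z).
  assert (Hlift : forall x s, Rabs (x - x0) < r -> 0 <= s < r ^ 2 ->
     0 < 1 + l * x /\ Rabs (lift_coord l x s - x0) < 2 * r).
  { intros x s Hx Hs. destruct (H x z0) as [A _]; [lra|rewrite Rminus_diag, Rabs_R0; lra|].
    destruct (lift_coord_bounds l x s Hl A (proj1 Hs)) as [B1 B2]. split; [lra|].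
    assert (l * s <= r) by nra.
    apply Rabs_bd' in Hx. apply Rabs_bd'. lra. }
  assert (HP : poisson5 x0 z0 r (r ^ 2) Hf 0).
  { apply (poisson5_lift l f fR fRR fZ fZZ zero l zero zero zero zero zero zero).
    intros x s z A B' C. destruct (Hlift x s A B') as [D1 D2].
    destruct (H _ z D2 C) as [E1 [E2 E3]].
    split; [exact D1|]. split; [exact D1|]. split; [exact E2|]. split; [apply Hz; lra|].
    unfold zero. rewrite Rminus_diag, Rabs_R0. lra. }
  assert (Hbd : forall x s z, Rabs (x - x0) < r -> 0 <= s < r ^ 2 -> Rabs (z - z0) < r ->
     Rabs (Hf x s z) <= M).
  { intros x s z A B' C. destruct (Hlift x s A B') as [D1 D2].
    unfold Hf, zero. rewrite Rminus_0_r. apply H; assumption. }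
  assert (H0 : forall x z, Rabs (x - x0) < r -> Hf x 0 z = f x z).
  { intros x z Hx. unfold Hf, zero. rewrite Rminus_0_r, lift_coord_0; [reflexivity|exact Hl|].
    destruct (Hlift x 0 Hx); [nra|assumption]. }
  assert (Hdl0 := Rabs_pos dl).
  assert (HB0 : 0 < INR B) by (apply lt_0_INR; exact HB).
  assert (HB1 : 1 <= INR B) by (apply (le_INR 1); lia).
  assert (Hn0 : 0 < INR n) by (apply lt_0_INR; exact Hn).
  split.
  - assert (P := poisson5_newton x0 z0 r Hf M n B X0 Z0 dl HP HM Hr Hbd Hn HB Hdl HX ltac:(lra)).
    rewrite H0 in P.
    2:{ replace (X0 + dl - x0) with (X0 - x0 + dl) by ring. eapply Rle_lt_trans; [apply Rabs_triang|]. lra. }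
    erewrite newton_ext; [exact P|]. intros i Hi. symmetry. apply H0.
    assert (Hi' : INR i <= INR n) by (apply le_INR; lia). pose proof (pos_INR i).
    assert (Rabs (INR i * (dl / (INR B * INR n))) <= Rabs dl).
    { unfold Rdiv. rewrite !Rabs_mult, Rabs_inv, (Rabs_pos_eq (INR i)), (Rabs_pos_eq (INR B * INR n)) by nra.
      rewrite <- Rmult_assoc, (Rmult_comm (INR i)), Rmult_assoc.
      rewrite <- (Rmult_1_r (Rabs dl)) at 2. apply Rmult_le_compat_l; [exact Hdl0|].
      apply Rmult_le_reg_r with (INR B * INR n); [nra|]. rewrite Rmult_assoc, Rinv_l by nra. nra. }
    replace (X0 + INR i * (dl / (INR B * INR n)) - x0) with (X0 - x0 + INR i * (dl / (INR B * INR n))) by ring.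
    eapply Rle_lt_trans; [apply Rabs_triang|]. lra.
  - assert (P := poisson5_newton z0 x0 r _ M n B Z0 X0 dl (poisson5_swap _ _ _ _ _ _ HP) HM Hr
      (fun x s z A B C => Hbd z s x C B A) Hn HB Hdl HZ ltac:(lra)). cbv beta in P.
    rewrite H0 in P by lra.
    erewrite newton_ext; [exact P|]. intros i Hi. symmetry. apply H0. lra.
Qed.

Lemma newton_node_bound i n B d : (i < n)%nat -> (0 < B)%nat ->
  Rabs (INR i * (d / (INR B * INR n))) <= Rabs d / INR B.
Proof.
  intros Hi HB. assert (HB0 : 0 < INR B) by (apply lt_0_INR; exact HB).
  assert (Hn0 : 0 < INR n) by (apply lt_0_INR; lia).
  assert (Hi' : INR i <= INR n) by (apply le_INR; lia). pose proof (pos_INR i).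
  unfold Rdiv. rewrite !Rabs_mult, Rabs_inv, (Rabs_pos_eq (INR i)), (Rabs_pos_eq (INR B * INR n)) by nra.
  replace (INR i * (Rabs d * / (INR B * INR n))) with ((Rabs d * / INR B) * (INR i / INR n)) by (field; lra).
  rewrite <- (Rmult_1_r (Rabs d * / INR B)) at 2. apply Rmult_le_compat_l.
  - apply Rmult_le_pos; [apply Rabs_pos|apply Rlt_le, Rinv_0_lt_compat; lra].
  - apply Rmult_le_reg_r with (INR n); [lra|]. unfold Rdiv. rewrite Rmult_assoc, Rinv_l; lra.
Qed.

(** A linear function of slope [be / (3 l)] meets the first-order coefficient [3 l / (1 + l X)] and
    produces [be / (1 + l X)], which cancels the source. *)
Lemma slice_at_add_linear l f fR fRR fZ fZZ be X Y :
  slice_at l f fR fRR fZ fZZ (fun X _ => be / (1 + l * X)) X Y ->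
  slice_at l (fun X Y => f X Y + be / (3 * l) * X) (fun X Y => fR X Y + be / (3 * l)) fRR fZ fZZ
    (fun _ _ => 0) X Y.
Proof.
  intros [Hl [H1 [Hc [HR [HRR [HZ [HZZ He]]]]]]].
  split; [exact Hl|]. split; [exact H1|]. ands.
  - apply (continuous_plus (fun p : R * R => f (fst p) (snd p))); [exact Hc|]. cont.
  - apply (is_derive_plus (V := R_NormedModule) _ (fun X => be / (3 * l) * X)); [exact HR|].
    auto_derive; [tauto|ring].
  - replace (fRR X Y) with (fRR X Y + 0) by ring.
    apply (is_derive_plus (V := R_NormedModule) _ (fun _ => be / (3 * l))); [exact HRR|].
    apply (is_derive_const (V := R_NormedModule)).
  - replace (fZ X Y) with (fZ X Y + 0) by ring.
    apply (is_derive_plus (V := R_NormedModule) (fun y => f X y) (fun _ => be / (3 * l) * X)); [exact HZ|].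
    apply (is_derive_const (V := R_NormedModule)).
  - exact HZZ.
  - replace (fRR X Y + fZZ X Y + 3 * l / (1 + l * X) * (fR X Y + be / (3 * l))) with
      ((fRR X Y + fZZ X Y + 3 * l / (1 + l * X) * fR X Y) + be / (1 + l * X)) by (field; lra).
    rewrite He. ring.
Qed.

Lemma elliptic_family_bound V be f F l1 x0 z0 r :
  elliptic_family V be f F -> 0 < l1 ->
  (forall l X Y, l1 <= l <= 2 * l1 -> Rabs (X - x0) <= 2 * r -> Rabs (Y - z0) <= r -> V l X Y) ->
  exists M, 0 <= M /\ forall l X Y, l1 <= l <= 2 * l1 -> Rabs (X - x0) <= 2 * r -> Rabs (Y - z0) <= r ->
    Rabs (f l X Y + be / (3 * l) * X) <= M.
Proof.
  intros [fR [fRR [fZ [fZZ HE]]]] Hl HV.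
  set (phi := fun p : R * (R * (R * R)) =>
    f (fst p) (fst (snd p)) (fst (snd (snd p))) + be / (3 * fst p) * fst (snd p)).
  set (a := (l1, (x0 - 2 * r, (z0 - r, 0)))). set (b := (2 * l1, (x0 + 2 * r, (z0 + r, 0)))).
  assert (Hc : forall p, box4 a b p -> continuous phi p).
  { intros [l [X [Y u]]] Hp. unfold box4 in Hp; simpl in Hp. unfold phi.
    apply (continuous_plus (V := R_NormedModule) (fun p : R * (R * (R * R)) =>
       f (fst p) (fst (snd p)) (fst (snd (snd p))))).
    - apply continuous_unc3; simpl; [|cont|cont|cont].
      apply HE, HV; [lra| |]; apply Rabs_bd; lra.
    - apply (continuous_mult (fun p : R * (R * (R * R)) => be / (3 * fst p))); [|cont].
      unfold Rdiv. apply (continuous_mult (fun _ => be)); [apply continuous_const|].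
      apply (continuous_comp (fun p : R * (R * (R * R)) => 3 * fst p) Rinv); [cont|].
      apply continuous_Rinv. simpl. lra. }
  destruct (continuous_box4_bounded phi a b Hc) as [M1 HM1].
  destruct (continuous_box4_bounded (fun p => - phi p) a b) as [M2 HM2].
  { intros p Hp. apply (continuous_opp phi), Hc, Hp. }
  exists (Rmax 0 (Rmax M1 M2)). split; [apply Rmax_l|].
  intros l X Y Hl' HX HY. apply Rabs_bd in HX. apply Rabs_bd in HY.
  assert (Hp : box4 a b (l, (X, (Y, 0)))) by (unfold box4; simpl; lra).
  specialize (HM1 _ Hp). specialize (HM2 _ Hp). unfold phi in HM1, HM2. simpl in HM1, HM2.
  pose proof (Rmax_r 0 (Rmax M1 M2)). pose proof (Rmax_l M1 M2). pose proof (Rmax_r M1 M2).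
  apply Rabs_bd. lra.
Qed.

(** Uniform coefficient bounds are available only on some small box near [(xs, zs)]. Values at other
    points are approximated by Newton interpolation from nodes in that box: the approximants have
    coefficients of size [N K^m], and on one window of [l] they are geometrically close to [f] by
    the difference estimates. The Hartogs-type step turns this into closeness to [F O] for small
    [l], with constants independent of the point. *)
Lemma elliptic_uniform V be f F : windows V -> elliptic_family V be f F ->
  (forall k X Y, X < 0 -> continuity_2d_pt (F k) X Y) ->
  forall xs zs, xs < 0 -> exists rho, 0 < rho < - xs /\ forall eps, 0 < eps -> exists kap, 0 < kap /\
    forall l X Y, 0 < l < kap -> Rabs (X - xs) <= rho -> Rabs (Y - zs) <= rho -> V l X Y ->
      Rabs (f l X Y - F O X Y) <= eps.
Proof.
  intros HV HE HF xs zs Hxs.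
  set (r := - xs / 4). assert (Hr : 0 < r) by (unfold r; lra).
  assert (Exs : xs = - 4 * r) by (unfold r; field).
  pose proof (Rabs_pos zs) as Hzs0.
  set (M0 := 7 * r + Rabs zs).
  assert (Hser : forall l X Y, V l X Y -> is_pseries (fun k => F k X Y) l (f l X Y)).
  { destruct HE as [fR [fRR [fZ [fZZ HE]]]]. intros l X Y H. apply HE, H. }
  destruct (windows_coef_bound V f F M0 HV Hser) as [l0 [Hl0 Hcoef]].
  assert (Hbox : forall X Y, Rabs (X - xs) <= 2 * r -> Rabs (Y - zs) <= r -> - M0 <= X < 0 /\ Rabs Y <= M0).
  { intros X Y HX HY. apply Rabs_bd in HX. split; [unfold M0; lra|].
    replace Y with ((Y - zs) + zs) by ring. eapply Rle_trans; [apply Rabs_triang|]. unfold M0. lra. }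
  (* Displacements are at most [2 rho], and [846 * 2 * 72 < 200000] makes the interpolation factor
     [846 |dl| / r] at most [1 / 72]. *)
  set (rho := r / 200000). assert (Hrho : 0 < rho) by (unfold rho; lra).
  assert (Hrr : rho = r / 200000) by reflexivity.
  destruct (baire_uniform_bound (fun k X Y => F k X Y * l0 ^ k) xs zs rho) as [X0 [Z0 [r1 [N [Hr1 HN]]]]].
  { exact Hrho. }
  { intros k X Y HX HY. apply Rabs_bd' in HX. apply continuity_2d_pt_mult; [apply HF; lra|].
    apply continuity_2d_pt_const. }
  { intros X Y HX HY. destruct (Hbox X Y) as [B1 B2]; try lra.
    destruct (Hcoef X Y B1 B2) as [C [_ HC]]. exists C. intros k. rewrite Rabs_mult.
    rewrite (Rabs_pos_eq (l0 ^ k)) by (apply pow_le; lra). apply HC. }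
  assert (HX0 : Rabs (X0 - xs) < rho /\ Rabs (Z0 - zs) < rho).
  { destruct (HN X0 Z0) as [A [B _]]; try (rewrite Rminus_diag, Rabs_R0; lra). auto. }
  assert (HN0 : 0 <= N).
  { destruct (HN X0 Z0) as [_ [_ H]]; try (rewrite Rminus_diag, Rabs_R0; lra).
    eapply Rle_trans; [apply Rabs_pos|apply (H O)]. }
  (* With this [B] the nodes, which fill the fraction [1 / B] of a segment of length at most
     [2 rho], stay within distance [r1] of the centre of the good box. *)
  destruct (INR_unbounded (2 * rho / r1 + 1)) as [B HB].
  assert (Hrr1 : 0 <= 2 * rho / r1) by (apply Rdiv_le_0_compat; lra).
  assert (HB0 : (0 < B)%nat) by (apply INR_lt; simpl; lra).
  assert (HBr : 2 * rho / INR B <= r1).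
  { apply Rmult_le_reg_r with (INR B); [lra|]. unfold Rdiv at 1. rewrite Rmult_assoc, Rinv_l, Rmult_1_r by lra.
    apply Rmult_le_reg_l with (/ r1); [apply Rinv_0_lt_compat; lra|].
    replace (/ r1 * (2 * rho)) with (2 * rho / r1) by (unfold Rdiv; ring).
    replace (/ r1 * (r1 * INR B)) with (INR B) by (field; lra). lra. }
  (* Interpolation in [Z] magnifies errors by [3^(B m)]. With [ka m] nodes in [X] the inner error is
     [(1/72)^((B + 1) m)], which absorbs this factor. [K] is the resulting growth rate of the
     coefficients. *)
  set (ka := S B).
  set (K := 3 ^ B * 3 ^ (B * ka)).
  assert (HK : 1 <= K).
  { unfold K. rewrite <- (Rmult_1_l 1). apply Rmult_le_compat; try lra; apply pow_R1_Rle; lra. }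
  (* The window is chosen after [K]: extrapolating from [[l1, 2 l1]] to [0] must beat [9^m K^m] by
     [(2 l1 / l0)^m]. The bound [M] on the solution in this window comes later still and may be
     arbitrarily large. *)
  assert (He2 : 0 < Rmin (l0 / (72 * K)) (/ (24 * r))).
  { apply Rmin_glb_lt; [apply Rdiv_lt_0_compat; lra|apply Rinv_0_lt_compat; lra]. }
  destruct (HV M0 _ He2) as [l1 [Hl1 HW]].
  assert (Hl1a : l1 < l0 / (72 * K)) by (eapply Rlt_le_trans; [apply Hl1|apply Rmin_l]).
  assert (Hl1b : l1 < / (24 * r)) by (eapply Rlt_le_trans; [apply Hl1|apply Rmin_r]).
  assert (Hl1r : 24 * (l1 * r) <= 1).
  { apply Rmult_lt_compat_r with (r := 24 * r) in Hl1b; [|lra]. rewrite Rinv_l in Hl1b; lra. }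
  assert (Hl1K : 72 * (l1 * K) <= l0).
  { apply Rmult_lt_compat_r with (r := 72 * K) in Hl1a; [|lra]. unfold Rdiv in Hl1a.
    rewrite Rmult_assoc, Rinv_l in Hl1a; lra. }
  assert (Hl1l0 : 4 * l1 <= l0).
  { apply Rle_trans with (72 * (l1 * K)); [|exact Hl1K]. nra. }
  assert (Hth : 2 * l1 / l0 <= / (36 * K)).
  { apply Rmult_le_reg_r with (l0 * (36 * K)); [nra|].
    replace (2 * l1 / l0 * (l0 * (36 * K))) with (72 * (l1 * K)) by (field; lra).
    replace (/ (36 * K) * (l0 * (36 * K))) with l0 by (field; lra). exact Hl1K. }
  destruct (elliptic_family_bound V be f F l1 xs zs r HE ltac:(lra)) as [M [HM0 HM]].
  { intros l X Y Hl HX HY. destruct (Hbox X Y HX HY). apply HW; assumption. }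
  assert (Hint : forall l n X Z dl, l1 <= l <= 2 * l1 -> (2 <= n)%nat ->
     Rabs (X - xs) <= rho -> Rabs (Z - zs) <= rho -> Rabs dl <= 2 * rho ->
     Rabs (f l (X + dl) Z - newton n (B * n) (fun i => f l (X + INR i * (dl / (INR B * INR n))) Z)) <=
       (1 / 72) ^ n * M /\
     Rabs (f l X (Z + dl) - newton n (B * n) (fun i => f l X (Z + INR i * (dl / (INR B * INR n))))) <=
       (1 / 72) ^ n * M).
  { intros l n X Z dl Hl Hn HX HZ Hdl.
    destruct HE as [fR [fRR [fZ [fZZ HE]]]].
    assert (Hlr : 12 * (l * r) <= 1) by nra.
    assert (Hpw : (846 * Rabs dl / r) ^ n * M <= (1 / 72) ^ n * M).
    { apply Rmult_le_compat_r; [exact HM0|]. apply pow_incr. pose proof (Rabs_pos dl). split.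
      - apply Rdiv_le_0_compat; lra.
      - apply Rmult_le_reg_r with r; [lra|]. unfold Rdiv at 1. rewrite Rmult_assoc, Rinv_l by lra. lra. }
    destruct (slice_newton l (fun X Y => f l X Y + be / (3 * l) * X) (fun X Y => fR l X Y + be / (3 * l))
       (fRR l) (fZ l) (fZZ l) xs zs r M n B X Z dl) as [E1 E2]; try lia; try lra.
    - intros X' Z' HX' HZ'. destruct (Hbox X' Z' (Rlt_le _ _ HX') (Rlt_le _ _ HZ')) as [C1 C2].
      split; [|split].
      + apply Rabs_bd' in HX'. nra.
      + apply slice_at_add_linear. apply HE, HW; lra.
      + apply HM; lra.
    - assert (Hn0 : 0 < INR n) by (apply lt_0_INR; lia).
      split.
      + eapply Rle_trans; [|exact Hpw]. eapply Rle_trans; [|exact E1]. right. f_equal.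
        transitivity (f l (X + dl) Z - (newton n (B * n)
           (fun i => f l (X + INR i * (dl / (INR B * INR n))) Z +
                     be / (3 * l) * (X + INR i * (dl / (INR B * INR n)))) -
           newton n (B * n) (fun i => be / (3 * l) * X + be / (3 * l) * (dl / (INR B * INR n)) * INR i))).
        * rewrite newton_minus. f_equal. f_equal. f_equal. apply functional_extensionality. intros i. ring.
        * rewrite newton_affine by exact Hn. rewrite mult_INR. 
          replace (be / (3 * l) * (dl / (INR B * INR n)) * (INR B * INR n)) with (be / (3 * l) * dl) by (field; lra).
          ring.
      + eapply Rle_trans; [|exact Hpw]. eapply Rle_trans; [|exact E2]. right. f_equal.
        transitivity (f l X (Z + dl) - (newton n (B * n)
           (fun i => f l X (Z + INR i * (dl / (INR B * INR n))) + be / (3 * l) * X) -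
           newton n (B * n) (fun i => be / (3 * l) * X + 0 * INR i))).
        * rewrite newton_minus. f_equal. f_equal. f_equal. apply functional_extensionality. intros i. ring.
        * rewrite newton_affine by exact Hn. ring. }
  exists rho. split; [lra|].
  assert (Hmain : forall X Z, Rabs (X - xs) <= rho -> Rabs (Z - zs) <= rho ->
    forall m y, (2 <= m)%nat -> 0 <= y <= 2 * l1 ->
    Rabs (PSeries (fun k => F k X Z) y - F O X Z) <=
      4 * (4 * M + 8 * N * K) * (1 / 4) ^ m + 2 * (N * K ^ m) * (y / l0)).
  { intros X Z HX HZ m y Hm Hy.
    destruct (Hbox X Z) as [C1 C2]; try lra. destruct (Hcoef X Z C1 C2) as [Cs [HCs0 HCs]].
    set (dX := X - X0). set (dZ := Z - Z0).
    assert (HdX : Rabs dX <= 2 * rho).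
    { destruct HX0 as [U _]. apply Rabs_bd' in U. apply Rabs_bd in HX. apply Rabs_bd. unfold dX. lra. }
    assert (HdZ : Rabs dZ <= 2 * rho).
    { destruct HX0 as [_ U]. apply Rabs_bd' in U. apply Rabs_bd in HZ. apply Rabs_bd. unfold dZ. lra. }
    set (Xn := fun m i => X0 + INR i * (dX / (INR B * INR (ka * m)))).
    set (Zn := fun m j => Z0 + INR j * (dZ / (INR B * INR m))).
    assert (HXn : forall m i, (i < ka * m)%nat -> Rabs (Xn m i - X0) <= r1).
    { intros m' i Hi. unfold Xn. replace (X0 + INR i * (dX / (INR B * INR (ka * m'))) - X0) with
        (INR i * (dX / (INR B * INR (ka * m')))) by ring.
      eapply Rle_trans; [apply newton_node_bound; assumption|]. eapply Rle_trans; [|exact HBr].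
      apply Rmult_le_compat_r; [apply Rlt_le, Rinv_0_lt_compat; lra|exact HdX]. }
    assert (HZn : forall m j, (j < m)%nat -> Rabs (Zn m j - Z0) <= r1).
    { intros m' i Hi. unfold Zn. replace (Z0 + INR i * (dZ / (INR B * INR m')) - Z0) with
        (INR i * (dZ / (INR B * INR m'))) by ring.
      eapply Rle_trans; [apply newton_node_bound; assumption|]. eapply Rle_trans; [|exact HBr].
      apply Rmult_le_compat_r; [apply Rlt_le, Rinv_0_lt_compat; lra|exact HdZ]. }
    (* Tensor product interpolation. Being a finite linear combination of node values, it applies
       alike to a coefficient [F k] and to the sum [f l], and commutes with the series. *)
    set (T := fun (G : R -> R -> R) m => newton m (B * m) (fun j =>
       newton (ka * m) (B * (ka * m)) (fun i => G (Xn m i) (Zn m j)))).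
    apply (PSeries_window_approx (fun k => F k X Z) (fun m k => T (F k) m) l0 l1 K N M Cs); try lra; try assumption.
    - intros m' k. unfold T.
      assert (Hp : 0 < l0 ^ k) by (apply pow_lt; exact Hl0).
      apply Rle_trans with (3 ^ (B * m') * (3 ^ (B * (ka * m')) * (N / l0 ^ k)) * l0 ^ k).
      + apply Rmult_le_compat_r; [lra|]. apply newton_bound.
        * apply Rmult_le_pos; [apply pow_le; lra|apply Rdiv_le_0_compat; lra].
        * intros j Hj. apply newton_bound; [apply Rdiv_le_0_compat; lra|]. intros i Hi.
          destruct (HN (Xn m' i) (Zn m' j) (HXn m' i Hi) (HZn m' j Hj)) as [_ [_ Hk]].
          specialize (Hk k). rewrite Rabs_mult, (Rabs_pos_eq (l0 ^ k)) in Hk by lra.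
          apply Rmult_le_reg_r with (l0 ^ k); [exact Hp|].
          unfold Rdiv. rewrite Rmult_assoc, Rinv_l by lra. lra.
      + right. unfold K. rewrite Rpow_mult_distr, <- !pow_mult, <- Nat.mul_assoc. field. lra.
    - intros m' l Hm' Hl.
      assert (HVb : forall X Y, Rabs (X - xs) <= rho -> Rabs (Y - zs) <= rho -> V l X Y).
      { intros X' Y' H1 H2. destruct (Hbox X' Y'); try lra. apply HW; assumption. }
      assert (Eg : PSeries (fun k => F k X Z) l = f l X Z).
      { apply is_pseries_unique. apply Hser, HVb; assumption. }
      assert (Ea : PSeries (fun k => T (F k) m') l = T (f l) m').
      { apply is_pseries_unique. unfold T.
        apply (is_pseries_newton m' (B * m') (fun j k => newton (ka * m') (B * (ka * m'))
          (fun i => F k (Xn m' i) (Zn m' j))) l). intros j Hj.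
        apply (is_pseries_newton (ka * m') (B * (ka * m')) (fun i k => F k (Xn m' i) (Zn m' j)) l). intros i Hi.
        apply Hser, HVb; apply Rlt_le, (HN (Xn m' i) (Zn m' j) (HXn m' i Hi) (HZn m' j Hj)). }
      rewrite Eg, Ea.
      destruct (Hint l m' X Z0 dZ Hl Hm' HX (Rlt_le _ _ (proj2 HX0)) HdZ) as [_ I1].
      replace (Z0 + dZ) with Z in I1 by (unfold dZ; ring).
      assert (I2 : Rabs (newton m' (B * m') (fun j => f l X (Zn m' j)) - T (f l) m') <=
          3 ^ (B * m') * ((1 / 72) ^ (ka * m') * M)).
      { unfold T. rewrite newton_minus. apply newton_bound.
        - apply Rmult_le_pos; [apply pow_le; lra|exact HM0].
        - intros j Hj.
          destruct (Hint l (ka * m')%nat X0 (Zn m' j) dX Hl) as [I2 _]; try assumption.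
          + unfold ka. nia.
          + lra.
          + apply Rlt_le. eapply (HN X0 (Zn m' j)); [rewrite Rminus_diag, Rabs_R0; lra|apply HZn; exact Hj].
          + replace (X0 + dX) with X in I2 by (unfold dX; ring). exact I2. }
      assert (I3 : 3 ^ (B * m') * ((1 / 72) ^ (ka * m') * M) <= (1 / 72) ^ m' * M).
      { rewrite <- Rmult_assoc. apply Rmult_le_compat_r; [exact HM0|].
        unfold ka. replace (S B * m')%nat with (B * m' + m')%nat by lia. rewrite pow_add, <- Rmult_assoc.
        rewrite <- Rpow_mult_distr. rewrite <- (Rmult_1_l ((1 / 72) ^ m')) at 2.
        apply Rmult_le_compat_r; [apply pow_le; lra|]. replace (3 * (1 / 72)) with (/ 24) by field.
        rewrite pow_inv. rewrite <- Rinv_1. apply Rinv_le_contravar; [lra|]. apply pow_R1_Rle; lra. }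
      change (fun i => f l X (Z0 + INR i * (dZ / (INR B * INR m')))) with (fun j => f l X (Zn m' j)) in I1.
      set (q := newton m' (B * m') (fun j => f l X (Zn m' j))) in *.
      apply Rabs_bd in I1. apply Rabs_bd in I2. apply Rabs_bd. lra. }
  (* First [m] makes the geometric term small, then [kap] makes [l] small against the factor [K^m]
     of the linear term. *)
  intros eps Heps.
  set (C' := 4 * (4 * M + 8 * N * K)).
  assert (HC' : 0 <= C').
  { unfold C'. assert (0 <= 8 * N * K) by (apply Rmult_le_pos; lra). lra. }
  destruct (quarter_pow_small C' (eps / 2) ltac:(lra)) as [m0 Hm0].
  set (m := (m0 + 2)%nat).
  assert (Hm1 : C' * (1 / 4) ^ m <= eps / 2).
  { eapply Rle_trans; [|exact Hm0]. apply Rmult_le_compat_l; [exact HC'|].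
    unfold m. rewrite pow_add. assert (0 < (1 / 4) ^ m0) by (apply pow_lt; lra). simpl. lra. }
  set (Q := 2 * (N * K ^ m)).
  assert (HQ : 0 <= Q).
  { unfold Q. apply Rmult_le_pos; [lra|]. apply Rmult_le_pos; [exact HN0|apply pow_le; lra]. }
  exists (Rmin (2 * l1) (eps / 2 * l0 / (Q + 1))). split.
  { apply Rmin_glb_lt; [lra|]. apply Rdiv_lt_0_compat; nra. }
  intros l X Y Hl HX HY HVl.
  rewrite <- (is_pseries_unique _ _ _ (Hser _ _ _ HVl)).
  pose proof (Rmin_l (2 * l1) (eps / 2 * l0 / (Q + 1))). pose proof (Rmin_r (2 * l1) (eps / 2 * l0 / (Q + 1))).
  eapply Rle_trans; [apply (Hmain X Y HX HY m l); [unfold m; lia|lra]|].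
  fold C' Q.
  assert (Q * (l / l0) <= eps / 2); [|lra].
  apply Rmult_le_reg_r with l0; [exact Hl0|].
  replace (Q * (l / l0) * l0) with (Q * l) by (field; lra).
  assert (L : l <= eps / 2 * l0 / (Q + 1)) by lra.
  apply Rmult_le_compat_r with (r := Q + 1) in L; [|lra].
  replace (eps / 2 * l0 / (Q + 1) * (Q + 1)) with (eps / 2 * l0) in L by (field; lra). nra.
Qed.

(** * Limits and rigidity of elliptic families *)

Lemma continuous_rect_max (g : R -> R -> R) a b c d : a <= b -> c <= d ->
  (forall X Y, a <= X <= b -> c <= Y <= d -> continuous (fun p : R * R => g (fst p) (snd p)) (X, Y)) ->
  exists X Y, a <= X <= b /\ c <= Y <= d /\
    forall X' Y', a <= X' <= b -> c <= Y' <= d -> g X' Y' <= g X Y.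
Proof.
  intros Hab Hcd Hc.
  destruct (continuous_box4_max (fun p : R * (R * (R * R)) => g (fst p) (fst (snd p)))
    (a, (c, (0, 0))) (b, (d, (0, 0)))) as [[X [Y [u v]]] [Hin Hmax]].
  - exists (a, (c, (0, 0))). unfold box4; simpl; lra.
  - intros [X [Y [u v]]] Hp. unfold box4 in Hp; simpl in Hp.
    apply (continuous_comp (fun p : R * (R * (R * R)) => (fst p, fst (snd p))) (fun p : R * R => g (fst p) (snd p))).
    + apply continuous_pair; cont.
    + apply Hc; simpl; tauto.
  - unfold box4 in Hin; simpl in Hin. exists X, Y. split; [tauto|]. split; [tauto|].
    intros X' Y' HX HY. apply (Hmax (X', (Y', (0, 0)))). unfold box4; simpl; lra.
Qed.

Definition quad (a0 a1 a2 b1 b2 X Y : R) : R := a0 + a1 * X + a2 * Y + b1 * X ^ 2 + b2 * Y ^ 2.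

Lemma continuous_quad a0 a1 a2 b1 b2 p :
  continuous (fun p : R * R => quad a0 a1 a2 b1 b2 (fst p) (snd p)) p.
Proof.
  unfold quad.
  apply (continuous_ext (fun p : R * R => a0 + a1 * fst p + a2 * snd p + b1 * (fst p * fst p) + b2 * (snd p * snd p))).
  - intros q. simpl. ring.
  - cont.
Qed.

Lemma Rabs_lt_of_sqr a e : 0 < e -> a ^ 2 < e ^ 2 -> Rabs a < e.
Proof.
  intros He H. apply Rnot_le_lt. intros K. rewrite <- (pow2_abs a) in H.
  assert (e ^ 2 <= Rabs a ^ 2) by (apply pow_incr; lra). lra.
Qed.

(* Viscosity form of [Laplacian (F 0) = - be], which needs no derivatives of [F 0]. *)
Lemma elliptic_family_viscosity V be f F : windows V -> elliptic_family V be f F ->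
  (forall k X Y, X < 0 -> continuity_2d_pt (F k) X Y) ->
  forall a0 a1 a2 b1 b2 xs zs e, xs < 0 -> 0 < e ->
  (forall X Y, Rabs (X - xs) <= e -> Rabs (Y - zs) <= e ->
     F O X Y - quad a0 a1 a2 b1 b2 X Y <= F O xs zs - quad a0 a1 a2 b1 b2 xs zs) ->
  0 <= 2 * b1 + 2 * b2 + be.
Proof.
  intros HV HE HF a0 a1 a2 b1 b2 xs zs e Hxs He Hmax.
  apply Rnot_lt_le. intros Hneg.
  set (eta := - (2 * b1 + 2 * b2 + be)). assert (Heta : 0 < eta) by (unfold eta; lra).
  set (nu := eta / 8). assert (Hnu : 0 < nu) by (unfold nu; lra).
  destruct (elliptic_uniform V be f F HV HE HF xs zs Hxs) as [rho [Hrho Hun]].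
  set (e' := Rmin e (rho / 2)).
  assert (He' : 0 < e' /\ e' <= e /\ e' <= rho / 2).
  { unfold e'. split; [apply Rmin_glb_lt; lra|]. split; [apply Rmin_l|apply Rmin_r]. }
  assert (Hen : 0 < nu * e' ^ 2) by (apply Rmult_lt_0_compat; [exact Hnu|apply pow_lt; lra]).
  destruct (Hun (nu * e' ^ 2 / 4) ltac:(lra)) as [kap [Hkap Hcl]].
  set (Xm := - xs + e').
  (* [C] collects the first-order term and the effect of [1 + l X] differing from one; [4 l C < eta]
     makes both negligible against the defect [eta] of the test function. *)
  set (C := 2 * Rabs be * Xm + 6 * (Rabs a1 + 2 * Rabs b1 * Xm + 2 * nu * e') + 2 * Xm).
  assert (Hab := Rabs_pos be). assert (Ha1 := Rabs_pos a1). assert (Hb1 := Rabs_pos b1).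
  assert (HXm : 0 < Xm) by (unfold Xm; lra).
  assert (HC1 : 0 <= 2 * Rabs be * Xm) by (apply Rmult_le_pos; lra).
  assert (HC2 : 0 <= 2 * Rabs b1 * Xm) by (apply Rmult_le_pos; lra).
  assert (HC3 : 0 <= 2 * nu * e') by (apply Rmult_le_pos; lra).
  assert (HC : 0 < C) by (unfold C; lra).
  set (M := Xm + Rabs zs + e').
  destruct (HV M (Rmin kap (Rmin (eta / (4 * C)) (/ (4 * Xm))))) as [l [Hl HW]].
  { repeat apply Rmin_glb_lt; [exact Hkap|apply Rdiv_lt_0_compat; lra|apply Rinv_0_lt_compat; lra]. }
  assert (L1 : l < kap) by (eapply Rlt_le_trans; [apply Hl|apply Rmin_l]).
  assert (L2 : l < eta / (4 * C)).
  { eapply Rlt_le_trans; [apply Hl|]. eapply Rle_trans; [apply Rmin_r|apply Rmin_l]. }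
  assert (L3 : l < / (4 * Xm)).
  { eapply Rlt_le_trans; [apply Hl|]. eapply Rle_trans; [apply Rmin_r|apply Rmin_r]. }
  apply Rmult_lt_compat_r with (r := 4 * C) in L2; [|lra].
  replace (eta / (4 * C) * (4 * C)) with eta in L2 by (field; lra).
  apply Rmult_lt_compat_r with (r := 4 * Xm) in L3; [|lra]. rewrite Rinv_l in L3 by lra.
  assert (HVb : forall X Y, Rabs (X - xs) <= e' -> Rabs (Y - zs) <= e' -> V l X Y).
  { intros X Y HX HY. apply Rabs_bd in HX. apply HW; [lra| |].
    - pose proof (Rabs_pos zs). unfold M, Xm. lra.
    - replace Y with ((Y - zs) + zs) by ring. eapply Rle_trans; [apply Rabs_triang|]. unfold M. lra. }
  (* The additional [nu |(X, Y) - (xs, zs)|^2] makes the maximum strict, so a maximum of [f l - phi]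
     over the box is interior once [f l] is within [nu e'^2 / 4] of [F O]. It uses up
     [4 nu = eta / 2] of the defect. *)
  set (phi := quad (a0 + nu * (xs ^ 2 + zs ^ 2)) (a1 - 2 * nu * xs) (a2 - 2 * nu * zs) (b1 + nu) (b2 + nu)).
  assert (Hphi : forall X Y, phi X Y = quad a0 a1 a2 b1 b2 X Y + nu * ((X - xs) ^ 2 + (Y - zs) ^ 2)).
  { intros X Y. unfold phi, quad. ring. }
  destruct HE as [fR [fRR [fZ [fZZ HE]]]].
  destruct (continuous_rect_max (fun X Y => f l X Y - phi X Y) (xs - e') (xs + e') (zs - e') (zs + e'))
    as [X [Y [HX [HY HXY]]]]; try lra.
  { intros X Y HX HY. apply (continuous_minus (V := R_NormedModule) (fun p : R * R => f l (fst p) (snd p))).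
    - apply HE, HVb; apply Rabs_bd; lra.
    - apply continuous_quad. }
  assert (Hbd : forall X Y, xs - e' <= X <= xs + e' -> zs - e' <= Y <= zs + e' ->
    Rabs (f l X Y - F O X Y) <= nu * e' ^ 2 / 4).
  { intros X' Y' HX' HY'. apply Hcl; [lra| | |apply HVb]; apply Rabs_bd; lra. }
  assert (Hin : Rabs (X - xs) < e' /\ Rabs (Y - zs) < e').
  { pose proof (HXY xs zs ltac:(lra) ltac:(lra)) as HM. rewrite !Hphi in HM.
    pose proof (Hbd X Y HX HY) as B1. pose proof (Hbd xs zs ltac:(lra) ltac:(lra)) as B2.
    apply Rabs_bd in B1. apply Rabs_bd in B2.
    assert (HX' : Rabs (X - xs) <= e') by (apply Rabs_bd; lra).
    assert (HY' : Rabs (Y - zs) <= e') by (apply Rabs_bd; lra).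
    pose proof (Hmax X Y ltac:(lra) ltac:(lra)) as HM2.
    assert (HS : nu * ((X - xs) ^ 2 + (Y - zs) ^ 2) <= nu * e' ^ 2 / 2).
    { replace (nu * ((xs - xs) ^ 2 + (zs - zs) ^ 2)) with 0 in HM by ring. lra. }
    assert (HS2 : (X - xs) ^ 2 + (Y - zs) ^ 2 < e' ^ 2).
    { apply Rmult_lt_reg_l with nu; [exact Hnu|]. lra. }
    pose proof (pow2_ge_0 (X - xs)). pose proof (pow2_ge_0 (Y - zs)).
    split; apply Rabs_lt_of_sqr; lra. }
  destruct Hin as [HiX HiY]. apply Rabs_bd' in HiX. apply Rabs_bd' in HiY.
  destruct (HE l X Y) as [_ [[Hl0 [Hp [_ [_ [DXX [_ [DYY Heq]]]]]]] _]].
  { apply HVb; apply Rabs_bd; lra. }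
  set (d := Rmin (Rmin (X - (xs - e')) (xs + e' - X)) (Rmin (Y - (zs - e')) (zs + e' - Y))).
  assert (Hd : 0 < d /\ d <= X - (xs - e') /\ d <= xs + e' - X /\ d <= Y - (zs - e') /\ d <= zs + e' - Y).
  { unfold d, Rmin. repeat destruct Rle_dec; lra. }
  destruct (local_max_derive2 (fun y => f l y Y - phi y Y)
    (fun y => fR l y Y - (a1 - 2 * nu * xs + 2 * (b1 + nu) * y)) X (fRR l X Y - 2 * (b1 + nu)) d) as [T1 T2].
  { tauto. }
  { intros y Hy. apply Rabs_bd' in Hy.
    apply (is_derive_minus (V := R_NormedModule) (fun y => f l y Y)).
    - apply HE, HVb; apply Rabs_bd; lra.
    - unfold phi, quad. auto_derive; [tauto|ring]. }
  { apply (is_derive_minus (V := R_NormedModule) (fun y => fR l y Y)); [exact DXX|].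
    auto_derive; [tauto|ring]. }
  { intros y Hy. apply Rabs_bd' in Hy. apply HXY; lra. }
  destruct (local_max_derive2 (fun y => f l X y - phi X y)
    (fun y => fZ l X y - (a2 - 2 * nu * zs + 2 * (b2 + nu) * y)) Y (fZZ l X Y - 2 * (b2 + nu)) d) as [_ T4].
  { tauto. }
  { intros y Hy. apply Rabs_bd' in Hy.
    apply (is_derive_minus (V := R_NormedModule) (fun y => f l X y)).
    - apply HE, HVb; apply Rabs_bd; lra.
    - unfold phi, quad. auto_derive; [tauto|ring]. }
  { apply (is_derive_minus (V := R_NormedModule) (fun y => fZ l X y)); [exact DYY|].
    auto_derive; [tauto|ring]. }
  { intros y Hy. apply Rabs_bd' in Hy. apply HXY; lra. }
  cbv beta in T1.
  set (px := a1 - 2 * nu * xs + 2 * (b1 + nu) * X) in *.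
  assert (Hpx : Rabs px <= Rabs a1 + 2 * Rabs b1 * Xm + 2 * nu * e').
  { replace px with (a1 + 2 * (b1 * X) + 2 * nu * (X - xs)) by (unfold px; ring).
    assert (HX1 : Rabs X <= Xm) by (apply Rabs_bd; unfold Xm; lra).
    assert (Rabs (b1 * X) <= Rabs b1 * Xm) by (rewrite Rabs_mult; apply Rmult_le_compat_l; assumption).
    assert (Rabs (2 * nu * (X - xs)) <= 2 * nu * e').
    { rewrite Rabs_mult, (Rabs_pos_eq (2 * nu)) by lra. apply Rmult_le_compat_l; [lra|apply Rabs_bd; lra]. }
    eapply Rle_trans; [apply Rabs_triang|]. apply Rplus_le_compat; [|assumption].
    eapply Rle_trans; [apply Rabs_triang|]. rewrite Rabs_mult, (Rabs_pos_eq 2) by lra. lra. }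
  assert (HfR : fR l X Y = px) by lra. rewrite HfR in Heq.
  (* at the maximum the equation reads [- 3 l px - be >= - (be + eta / 2) (1 + l X)] *)
  assert (Hlow : 1 / 2 <= 1 + l * X).
  { assert (- (l * Xm) <= l * X); [|lra].
    rewrite <- Ropp_mult_distr_r_reverse. apply Rmult_le_compat_l; [lra|unfold Xm; lra]. }
  assert (Hs : - (be / (1 + l * X)) - 3 * l / (1 + l * X) * px <= - be - eta / 2).
  { assert (4 * nu = eta / 2) by (unfold nu; field). unfold eta in *. lra. }
  apply Rmult_le_compat_r with (r := 1 + l * X) in Hs; [|lra].
  replace ((- (be / (1 + l * X)) - 3 * l / (1 + l * X) * px) * (1 + l * X)) with (- be - 3 * (l * px)) in Hs
    by (field; lra).
  assert (K1 : Rabs (l * px) <= l * (Rabs a1 + 2 * Rabs b1 * Xm + 2 * nu * e')).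
  { rewrite Rabs_mult, (Rabs_pos_eq l) by lra. apply Rmult_le_compat_l; lra. }
  assert (K2 : Rabs (be * (l * X)) <= l * (Rabs be * Xm)).
  { rewrite !Rabs_mult, (Rabs_pos_eq l) by lra.
    assert (HX1 : Rabs X <= Xm) by (apply Rabs_bd; unfold Xm; lra).
    replace (l * (Rabs be * Xm)) with (Rabs be * (l * Xm)) by ring.
    apply Rmult_le_compat_l; [exact Hab|]. apply Rmult_le_compat_l; lra. }
  apply Rabs_bd in K1. apply Rabs_bd in K2.
  assert (K3 : eta / 4 <= eta / 2 * (1 + l * X)) by nra.
  assert (K4 : l * C = 2 * (l * (Rabs be * Xm)) + 6 * (l * (Rabs a1 + 2 * Rabs b1 * Xm + 2 * nu * e')) + 2 * (l * Xm))
    by (unfold C; ring).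
  assert (0 < l * Xm) by (apply Rmult_lt_0_compat; lra).
  assert (0 <= l * (Rabs a1 + 2 * Rabs b1 * Xm + 2 * nu * e')) by (apply Rmult_le_pos; lra).
  assert (0 <= l * (Rabs be * Xm)) by (apply Rmult_le_pos; [lra|apply Rmult_le_pos; lra]).
  set (A1 := l * (Rabs be * Xm)) in *. 
  set (A2 := l * (Rabs a1 + 2 * Rabs b1 * Xm + 2 * nu * e')) in *.
  assert (J1 : eta / 4 <= 3 * (l * px) - be * (l * X)).
  { replace ((- be - eta / 2) * (1 + l * X)) with (- be - be * (l * X) - eta / 2 * (1 + l * X)) in Hs by ring. lra. }
  assert (J2 : l * (4 * C) = 4 * (l * C)) by ring.
  lra.
Qed.

(** The equation is invariant under translation in [Y] and its source depends on [X] alone, so the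
    source cancels in the difference. *)
Lemma elliptic_family_Zdiff V be f F h : elliptic_family V be f F ->
  elliptic_family (fun l X Y => V l X Y /\ V l X (Y + h)) 0
    (fun l X Y => f l X (Y + h) - f l X Y) (fun k X Y => F k X (Y + h) - F k X Y).
Proof.
  intros [fR [fRR [fZ [fZZ HE]]]].
  exists (fun l X Y => fR l X (Y + h) - fR l X Y), (fun l X Y => fRR l X (Y + h) - fRR l X Y),
    (fun l X Y => fZ l X (Y + h) - fZ l X Y), (fun l X Y => fZZ l X (Y + h) - fZZ l X Y).
  intros l X Y [HV1 HV2].
  destruct (HE l X Y HV1) as [C1 [[L1 [P1 [D0 [D1 [D2 [D3 [D4 E1]]]]]]] S1]].
  destruct (HE l X (Y + h) HV2) as [C2 [[L2 [Q1 [G0 [G1 [G2 [G3 [G4 E2]]]]]]] S2]].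
  ands.
  - apply (continuous_minus (fun p => f (fst p) (fst (snd p)) (snd (snd p) + h)) (unc3 f)); [|exact C1].
    apply continuous_unc3; [exact C2| | |]; cont.
  - split; [exact L1|]. split; [exact P1|]. ands.
    + apply (continuous_minus (V := R_NormedModule) (fun p : R * R => f l (fst p) (snd p + h)) (fun p => f l (fst p) (snd p)));
        [|exact D0].
      apply (continuous_comp (fun p : R * R => (fst p, snd p + h)) (fun p : R * R => f l (fst p) (snd p)));
        [|exact G0].
      apply continuous_pair; cont.
    + apply (is_derive_minus (V := R_NormedModule)); assumption.
    + apply (is_derive_minus (V := R_NormedModule)); assumption.
    + apply (is_derive_minus (V := R_NormedModule)); [|assumption].
      apply (is_derive_shift (fun y => f l X y)); assumption.
    + apply (is_derive_minus (V := R_NormedModule)); [|assumption].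
      apply (is_derive_shift (fun y => fZ l X y)); assumption.
    + replace (fRR l X (Y + h) - fRR l X Y + (fZZ l X (Y + h) - fZZ l X Y) +
        3 * l / (1 + l * X) * (fR l X (Y + h) - fR l X Y)) with
       ((fRR l X (Y + h) + fZZ l X (Y + h) + 3 * l / (1 + l * X) * fR l X (Y + h)) -
        (fRR l X Y + fZZ l X Y + 3 * l / (1 + l * X) * fR l X Y)) by ring.
      rewrite E1, E2. field. lra.
  - apply (is_pseries_minus (fun k => F k X (Y + h)) (fun k => F k X Y)); assumption.
Qed.

Lemma elliptic_family_opp V be f F : elliptic_family V be f F ->
  elliptic_family V (- be) (fun l X Y => - f l X Y) (fun k X Y => - F k X Y).
Proof.
  intros [fR [fRR [fZ [fZZ HE]]]].
  exists (fun l X Y => - fR l X Y), (fun l X Y => - fRR l X Y),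
    (fun l X Y => - fZ l X Y), (fun l X Y => - fZZ l X Y).
  intros l X Y HV1.
  destruct (HE l X Y HV1) as [C1 [[L1 [P1 [D0 [D1 [D2 [D3 [D4 E1]]]]]]] S1]].
  ands.
  - apply (continuous_opp (unc3 f)); exact C1.
  - split; [exact L1|]. split; [exact P1|]. ands; try (apply @is_derive_opp; assumption).
    + apply (continuous_opp (V := R_NormedModule) (fun p : R * R => f l (fst p) (snd p))); exact D0.
    + replace (- fRR l X Y + - fZZ l X Y + 3 * l / (1 + l * X) * - fR l X Y) with
       (- (fRR l X Y + fZZ l X Y + 3 * l / (1 + l * X) * fR l X Y)) by ring.
      rewrite E1. field. lra.
  - apply (is_pseries_opp (fun k => F k X Y)); assumption.
Qed.

Lemma is_pseries_tail a l s : 0 < l -> is_pseries a l s -> is_pseries (fun k => a (S k)) l ((s - a O) / l).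
Proof.
  intros Hl Hs.
  assert (E := is_pseries_decr_1 (K := R_AbsRing) (V := R_NormedModule) a l (/ l) s).
  replace ((s - a O) / l) with (scal (/ l) (plus s (opp (a O)))).
  - apply E; [|exact Hs]. unfold mult, one; simpl. apply Rinv_l. lra.
  - unfold scal, plus, opp; simpl. unfold mult; simpl. field. lra.
Qed.

(** Through [3 l / (1 + l X)] the removed slope [b] leaves the term [3 l b / (1 + l X)]. It is of
    order [l], so after division by [l] it becomes the source of the next stage: the slope of one
    profile is seen in the Laplacian of the following one. *)
Lemma elliptic_family_next V f F c b : elliptic_family V 0 f F ->
  (forall l X Y, V l X Y -> F O X Y = c + b * X) ->
  elliptic_family V (3 * b) (fun l X Y => (f l X Y - (c + b * X)) / l) (fun k X Y => F (S k) X Y).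
Proof.
  intros [fR [fRR [fZ [fZZ HE]]]] H0.
  exists (fun l X Y => (fR l X Y - b) / l), (fun l X Y => fRR l X Y / l),
    (fun l X Y => fZ l X Y / l), (fun l X Y => fZZ l X Y / l).
  intros l X Y HV1.
  destruct (HE l X Y HV1) as [C1 [[L1 [P1 [D0 [D1 [D2 [D3 [D4 E1]]]]]]] S1]].
  assert (Sc : forall (g : R -> R) x d, is_derive g x d -> is_derive (fun y => g y / l) x (d / l)).
  { intros g x d H. apply (is_derive_ext (fun y => / l * g y)); [intros; unfold Rdiv; apply Rmult_comm|].
    replace (d / l) with (/ l * d) by (unfold Rdiv; apply Rmult_comm). apply is_derive_scal. exact H. }
  ands.
  - unfold unc3. unfold Rdiv.
    apply (continuous_mult (K := R_AbsRing) (fun p : R * (R * R) =>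
      f (fst p) (fst (snd p)) (snd (snd p)) - (c + b * fst (snd p))) (fun p => / fst p)).
    + apply (continuous_minus (V := R_NormedModule) (unc3 f)); [exact C1|]. cont.
    + apply (continuous_comp fst Rinv); [cont|]. apply continuous_Rinv. simpl. lra.
  - split; [exact L1|]. split; [exact P1|]. ands.
    + unfold Rdiv.
      apply (continuous_mult (K := R_AbsRing) (fun p : R * R => f l (fst p) (snd p) - (c + b * fst p)) (fun _ => / l));
        [|apply continuous_const].
      apply (continuous_minus (V := R_NormedModule) (fun p : R * R => f l (fst p) (snd p))); [exact D0|]. cont.
    + apply Sc. apply (is_derive_minus (V := R_NormedModule) (fun y => f l y Y)); [exact D1|].
      auto_derive; [tauto|ring].
    + apply Sc. replace (fRR l X Y) with (fRR l X Y - 0) by ring.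
      apply (is_derive_minus (V := R_NormedModule) (fun y => fR l y Y)); [exact D2|].
      apply (is_derive_const (V := R_NormedModule)).
    + apply Sc. replace (fZ l X Y) with (fZ l X Y - 0) by ring.
      apply (is_derive_minus (V := R_NormedModule) (fun y => f l X y)); [exact D3|].
      apply (is_derive_const (V := R_NormedModule)).
    + apply Sc. exact D4.
    + replace (fRR l X Y / l + fZZ l X Y / l + 3 * l / (1 + l * X) * ((fR l X Y - b) / l)) with
        ((fRR l X Y + fZZ l X Y + 3 * l / (1 + l * X) * fR l X Y) / l - 3 * b / (1 + l * X)) by (field; lra).
      rewrite E1. field. lra.
  - rewrite <- (H0 l X Y HV1). apply (is_pseries_tail (fun k => F k X Y)); assumption.
Qed.

(** Replacing [X] by [Rmin X 0] extends a function from the closed half plane to a continuous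
    function on the plane, so that compactness arguments work up to the boundary. *)
Lemma cont_D_clamp F x y : cont_D F -> continuity_2d_pt (fun X Y => F (Rmin X 0) Y) x y.
Proof.
  intros HF e. destruct (HF (Rmin x 0) y (Rmin_r _ _) e (cond_pos e)) as [d [Hd H]].
  exists (mkposreal d Hd). intros u v Hu Hv. simpl in Hu, Hv.
  apply H; [apply Rmin_r| |exact Hv].
  eapply Rle_lt_trans; [|exact Hu].
  unfold Rmin. repeat destruct Rle_dec; unfold Rabs; repeat destruct Rcase_abs; lra.
Qed.

Lemma continuity_2d_continuous f x y : continuity_2d_pt f x y <->
  continuous (fun p : R * R => f (fst p) (snd p)) (x, y).
Proof. apply continuity_2d_pt_filterlim. Qed.

Lemma cont_D_interior F x y : cont_D F -> x < 0 -> continuity_2d_pt F x y.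
Proof.
  intros HF Hx. apply (continuity_2d_pt_ext_loc (fun X Y => F (Rmin X 0) Y)).
  - exists (mkposreal (- x) ltac:(lra)). intros u v Hu _. simpl in Hu. apply Rabs_bd' in Hu.
    rewrite Rmin_left; [reflexivity|lra].
  - apply cont_D_clamp; exact HF.
Qed.

Lemma continuous_Zshift (g : R -> R -> R) h x y :
  continuous (fun p : R * R => g (fst p) (snd p)) (x, y + h) ->
  continuous (fun p : R * R => g (fst p) (snd p + h)) (x, y).
Proof.
  intros H. apply (continuous_comp (fun p : R * R => (fst p, snd p + h)) (fun p : R * R => g (fst p) (snd p)));
    [|exact H]. apply continuous_pair; cont.
Qed.

(** Comparison on a half rectangle of size [rho]: the difference in [Y] satisfies the viscosity form
    of subharmonicity, vanishes on [X = 0] and is at most [2 eps rho] elsewhere. The resulting bound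
    at the fixed point [(x1, z1)] is proportional to [eps], uniformly in [rho]. *)
Lemma elliptic_family_Zindep_le V be f F : windows V -> elliptic_family V be f F ->
  (forall k, cont_D (F k)) ->
  (forall Y, F O 0 Y = F O 0 0) ->
  (forall h eps, 0 < eps -> exists C, forall X Y, X <= 0 ->
     Rabs (F O X (Y + h) - F O X Y) <= eps * (Rabs X + Rabs Y) + C) ->
  forall h X Y, X < 0 -> F O X (Y + h) <= F O X Y.
Proof.
  intros HV HE HF H0 Hg h x1 z1 Hx1.
  assert (HE' := elliptic_family_Zdiff V be f F h HE).
  assert (HV' : windows (fun l X Y => V l X Y /\ V l X (Y + h))).
  { intros M eps Heps. destruct (HV (M + Rabs h) eps Heps) as [l1 [Hl1 HW]].
    exists l1. split; [exact Hl1|]. intros l X Y Hl HX HY. pose proof (Rabs_pos h).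
    split; apply HW; try lra. eapply Rle_trans; [apply Rabs_triang|]. lra. }
  assert (HF' : forall k X Y, X < 0 -> continuity_2d_pt (fun X Y => F k X (Y + h) - F k X Y) X Y).
  { intros k X Y HX. apply continuity_2d_pt_minus; [|apply cont_D_interior; [apply HF|exact HX]].
    apply continuity_2d_continuous, continuous_Zshift, continuity_2d_continuous.
    apply cont_D_interior; [apply HF|exact HX]. }
  set (g := fun X Y => F O X (Y + h) - F O X Y).
  cut (g x1 z1 <= 0); [unfold g; lra|].
  set (K := 2 * (4 * x1 ^ 2 + 9 * - x1) + 1).
  assert (HK : 0 < K) by (unfold K; pose proof (pow2_ge_0 x1); lra).
  apply le_epsilon. intros e He. rewrite Rplus_0_l.
  set (eps := e / K). assert (Heps : 0 < eps) by (apply Rdiv_lt_0_compat; lra).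
  destruct (Hg h (eps / 2) ltac:(lra)) as [C HC].
  set (rho := 1 + 2 * Rabs z1 + Rabs C / eps - 2 * x1).
  assert (HCe : 0 <= Rabs C / eps) by (apply Rdiv_le_0_compat; [apply Rabs_pos|lra]).
  pose proof (Rabs_pos z1) as Hz1.
  assert (Hrho : 1 <= rho /\ - rho / 2 < x1) by (unfold rho; lra).
  assert (Hgb : forall X Y, - rho / 2 <= X <= 0 -> z1 - rho / 2 <= Y <= z1 + rho / 2 -> g X Y <= 2 * eps * rho).
  { intros X Y HX HY. specialize (HC X Y ltac:(lra)). fold (g X Y) in HC. apply Rabs_bd in HC.
    assert (Rabs X <= rho / 2) by (apply Rabs_bd; lra).
    assert (Rabs Y <= Rabs z1 + rho / 2).
    { replace Y with (z1 + (Y - z1)) by ring. eapply Rle_trans; [apply Rabs_triang|].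
      apply Rplus_le_compat_l, Rabs_bd; lra. }
    assert (C <= eps * rho).
    { apply Rle_trans with (Rabs C); [apply Rle_abs|].
      apply Rle_trans with (eps * (Rabs C / eps)); [right; field; lra|].
      apply Rmult_le_compat_l; [lra|unfold rho; lra]. }
    assert (eps / 2 * (Rabs X + Rabs Y) <= eps / 2 * (2 * rho)).
    { apply Rmult_le_compat_l; [lra|unfold rho in *; lra]. }
    lra. }
  set (s := 2 * eps / rho). assert (Hs : 0 < s) by (apply Rdiv_lt_0_compat; lra).
  assert (Hsr : s * rho ^ 2 = 2 * eps * rho) by (unfold s; field; lra).
  (* Its Laplacian is [-2 s < 0]. It is nonnegative on [X = 0] and at least [s rho^2 = 2 eps rho] on
     the three other sides: on [|Y - z1| = rho / 2] by the first square, on [X = - rho / 2] by the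
     other two terms. *)
  set (b := quad (4 * s * z1 ^ 2) (- 9 * s * rho) (- 8 * s * z1) (-5 * s) (4 * s)).
  assert (Hb : forall X Y, b X Y = s * (4 * (Y - z1) ^ 2 + 4 * X ^ 2 + 9 * (- X * (rho + X)))).
  { intros X Y. unfold b, quad. ring. }
  destruct (continuous_rect_max (fun X Y => (F O (Rmin X 0) (Y + h) - F O (Rmin X 0) Y) - b X Y)
    (- rho / 2) 0 (z1 - rho / 2) (z1 + rho / 2)) as [X [Y [HX [HY Hmax]]]]; try lra.
  { intros X Y HX HY. apply (continuous_minus (V := R_NormedModule) (fun p : R * R => F O (Rmin (fst p) 0) (snd p + h) - F O (Rmin (fst p) 0) (snd p))).
    - apply (continuous_minus (V := R_NormedModule) (fun p : R * R => F O (Rmin (fst p) 0) (snd p + h))).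
      + apply (continuous_Zshift (fun X Y => F O (Rmin X 0) Y)).
        apply (proj1 (continuity_2d_continuous (fun X Y => F O (Rmin X 0) Y) X (Y + h))), cont_D_clamp, HF.
      + apply (proj1 (continuity_2d_continuous (fun X Y => F O (Rmin X 0) Y) X Y)), cont_D_clamp, HF.
    - apply continuous_quad. }
  assert (Hmax' : forall X' Y', - rho / 2 <= X' <= 0 -> z1 - rho / 2 <= Y' <= z1 + rho / 2 ->
     g X' Y' - b X' Y' <= g X Y - b X Y).
  { intros X' Y' HX' HY'. specialize (Hmax X' Y' HX' HY'). rewrite !Rmin_left in Hmax by lra. exact Hmax. }
  assert (Hle : g X Y - b X Y <= 0).
  { apply Rnot_lt_le. intros Hpos.
    assert (HX0 : X < 0).
    { destruct (Rle_lt_or_eq_dec X 0) as [A|A]; [lra|exact A|]. exfalso.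
      rewrite A, Hb in Hpos. unfold g in Hpos. rewrite (H0 (Y + h)), (H0 Y) in Hpos.
      assert (0 <= s * (4 * (Y - z1) ^ 2)) by (apply Rmult_le_pos; [lra|pose proof (pow2_ge_0 (Y - z1)); lra]). nra. }
    pose proof (Hgb X Y HX HY) as Hgb'. rewrite Hb in Hpos.
    assert (P1 : 0 <= - X * (rho + X)) by (apply Rmult_le_pos; lra).
    pose proof (pow2_ge_0 X) as P2. pose proof (pow2_ge_0 (Y - z1)) as P3.
    assert (Hlt : 4 * (Y - z1) ^ 2 + 4 * X ^ 2 + 9 * (- X * (rho + X)) < rho ^ 2).
    { apply Rmult_lt_reg_l with s; [exact Hs|]. lra. }
    assert (HXl : - rho / 2 < X).
    { destruct (Rle_lt_or_eq_dec (- rho / 2) X) as [A|A]; [lra|exact A|]. exfalso. rewrite <- A in Hlt. nra. }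
    assert (HYl : Rabs (Y - z1) < rho / 2) by (apply Rabs_lt_of_sqr; [lra|nra]).
    apply Rabs_bd' in HYl.
    set (d := Rmin (Rmin (- X) (X + rho / 2)) (Rmin (Y - (z1 - rho / 2)) (z1 + rho / 2 - Y))).
    assert (Hd : 0 < d /\ d <= - X /\ d <= X + rho / 2 /\ d <= Y - (z1 - rho / 2) /\ d <= z1 + rho / 2 - Y).
    { unfold d, Rmin. repeat destruct Rle_dec; lra. }
    assert (Hv := elliptic_family_viscosity _ _ _ _ HV' HE' HF' (4 * s * z1 ^ 2) (- 9 * s * rho) (- 8 * s * z1) (-5 * s) (4 * s)
      X Y d HX0 (proj1 Hd)).
    apply (Rlt_irrefl 0). apply Rle_lt_trans with (2 * (-5 * s) + 2 * (4 * s) + 0); [|lra].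
    apply Hv. intros X' Y' HX' HY'. apply Rabs_bd in HX'. apply Rabs_bd in HY'.
    apply Hmax'; lra. }
  eapply Rle_trans with (b x1 z1).
  { pose proof (Hmax' x1 z1 ltac:(lra) ltac:(lra)). lra. }
  rewrite Hb. replace ((z1 - z1) ^ 2) with 0 by ring.
  apply Rle_trans with (eps * (2 * (4 * x1 ^ 2 + 9 * - x1))).
  - replace (eps * (2 * (4 * x1 ^ 2 + 9 * - x1))) with (s * (rho * (4 * x1 ^ 2 + 9 * - x1))) by (unfold s; field; lra).
    apply Rmult_le_compat_l; [lra|]. pose proof (pow2_ge_0 x1). nra.
  - apply Rle_trans with (eps * K); [|unfold eps; right; field; lra].
    apply Rmult_le_compat_l; [lra|unfold K; lra].
Qed.

Lemma elliptic_family_Zindep V be f F : windows V -> elliptic_family V be f F ->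
  (forall k, cont_D (F k)) ->
  (forall Y, F O 0 Y = F O 0 0) ->
  (forall h eps, 0 < eps -> exists C, forall X Y, X <= 0 ->
     Rabs (F O X (Y + h) - F O X Y) <= eps * (Rabs X + Rabs Y) + C) ->
  forall X Y, X < 0 -> F O X Y = F O X 0.
Proof.
  intros HV HE HF H0 Hg X Y HX.
  assert (P := elliptic_family_Zindep_le V be f F HV HE HF H0 Hg).
  pose proof (P Y X 0 HX) as A. pose proof (P (- Y) X Y HX) as B.
  rewrite Rplus_0_l in A. replace (Y + - Y) with 0 in B by ring. lra.
Qed.

(** In one variable the viscosity inequality for [F O] is convexity of [q]: a point above its chord
    would allow a test function whose second derivative is too negative. *)
Lemma elliptic_family_chord V be f F : windows V -> elliptic_family V be f F ->
  (forall k, cont_D (F k)) ->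
  (forall X Y, X < 0 -> F O X Y = F O X 0) ->
  let q := fun X => F O X 0 + be / 2 * X ^ 2 in
  forall a c d, a < c -> c < d -> d < 0 -> q c * (d - a) <= q a * (d - c) + q d * (c - a).
Proof.
  intros HV HE HF HZ q a c d Hac Hcd Hd. apply Rnot_lt_le. intros Hlt.
  set (m := (q d - q a) / (d - a)).
  set (de := q c - (q a + m * (c - a))).
  assert (Hde : 0 < de).
  { apply Rmult_lt_reg_r with (d - a); [lra|]. unfold de, m.
    replace ((q c - (q a + (q d - q a) / (d - a) * (c - a))) * (d - a)) with
      (q c * (d - a) - (q a * (d - c) + q d * (c - a))) by (field; lra). lra. }
  assert (Hprod : 0 < (c - a) * (d - c)) by (apply Rmult_lt_0_compat; lra).
  (* The parabola [ep (X - a) (d - X)] takes away exactly half of the excess [de] at [c]. A positive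
     excess remains, while the ends have none, so the maximum is interior. *)
  set (ep := de / (2 * ((c - a) * (d - c)))).
  assert (Hep : 0 < ep) by (apply Rdiv_lt_0_compat; lra).
  set (phi := quad (q a - m * a - ep * a * d) (m + ep * (a + d)) 0 (- be / 2 - ep) 0).
  assert (Hphi : forall X Y, X < 0 -> F O X Y - phi X Y = q X - (q a + m * (X - a)) - ep * ((X - a) * (d - X))).
  { intros X Y HX. rewrite HZ by exact HX. unfold phi, quad, q. field. }
  destruct (continuous_rect_max (fun X Y => F O X Y - phi X Y) a d 0 0) as [X [Y [HX [HY Hmax]]]]; try lra.
  { intros X Y HX HY. apply (continuous_minus (V := R_NormedModule) (fun p : R * R => F O (fst p) (snd p))).
    - apply continuity_2d_continuous, cont_D_interior; [apply HF|lra].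
    - apply continuous_quad. }
  pose proof (Hmax c 0 ltac:(lra) ltac:(lra)) as Hc. rewrite !Hphi in Hc by lra.
  assert (Ec : q c - (q a + m * (c - a)) - ep * ((c - a) * (d - c)) = de / 2).
  { unfold ep. fold de. field. lra. }
  rewrite Ec in Hc.
  assert (Ha : a <> X).
  { intros <-. replace (q a - (q a + m * (a - a)) - ep * ((a - a) * (d - a))) with 0 in Hc by ring. lra. }
  assert (Hd' : d <> X).
  { intros <-. replace (q d - (q a + m * (d - a)) - ep * ((d - a) * (d - d))) with 0 in Hc
      by (unfold m; field; lra). lra. }
  set (e := Rmin (X - a) (d - X)).
  assert (He : 0 < e /\ e <= X - a /\ e <= d - X).
  { unfold e, Rmin. destruct Rle_dec; lra. }
  assert (Hv := elliptic_family_viscosity V be f F HV HE (fun k X Y HX => cont_D_interior _ _ _ (HF k) HX)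
    (q a - m * a - ep * a * d) (m + ep * (a + d)) 0 (- be / 2 - ep) 0 X Y e ltac:(lra) (proj1 He)).
  assert (0 <= 2 * (- be / 2 - ep) + 2 * 0 + be); [|lra].
  apply Hv. intros X' Y' HX' _. apply Rabs_bd in HX'. fold phi.
  pose proof (Hmax X' 0 ltac:(lra) ltac:(lra)) as HM. rewrite !Hphi in HM |- * by lra. exact HM.
Qed.

(** The chord inequality for the family and for its negative makes [q] affine; its coefficients are
    read off at [-1] and [-2], which keeps clear of the boundary. *)
Lemma elliptic_family_parabola V be f F : windows V -> elliptic_family V be f F ->
  (forall k, cont_D (F k)) ->
  (forall X Y, X < 0 -> F O X Y = F O X 0) ->
  exists c b, forall X Y, X < 0 -> F O X Y = c + b * X - be / 2 * X ^ 2.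
Proof.
  intros HV HE HF HZ.
  assert (Hup := elliptic_family_chord V be f F HV HE HF HZ). cbv zeta in Hup.
  assert (Hlo := elliptic_family_chord V (- be) _ _ HV (elliptic_family_opp V be f F HE)).
  cbv beta zeta in Hlo.
  set (q := fun X => F O X 0 + be / 2 * X ^ 2).
  assert (Heq : forall a c d, a < c -> c < d -> d < 0 -> q c * (d - a) = q a * (d - c) + q d * (c - a)).
  { intros a c d H1 H2 H3. apply Rle_antisym; [apply Hup; assumption|].
    assert (P := Hlo). lapply P; [clear P; intros P|].
    2:{ intros k X Y HX e He. destruct (HF k X Y HX e He) as [eta [Heta H]]. exists eta. split; [exact Heta|].
        intros X' Y' A B C. replace (- F k X' Y' - - F k X Y) with (- (F k X' Y' - F k X Y)) by ring.
        rewrite Rabs_Ropp. apply H; assumption. }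
    lapply P; [clear P; intros P|].
    2:{ intros X Y HX. rewrite HZ by exact HX. reflexivity. }
    specialize (P a c d H1 H2 H3).
    replace (- F O c 0 + - be / 2 * c ^ 2) with (- q c) in P by (unfold q; field).
    replace (- F O a 0 + - be / 2 * a ^ 2) with (- q a) in P by (unfold q; field).
    replace (- F O d 0 + - be / 2 * d ^ 2) with (- q d) in P by (unfold q; field). lra. }
  exists (q (-1) + (q (-1) - q (-2))), (q (-1) - q (-2)).
  intros X Y HX. rewrite HZ by exact HX.
  assert (E : q X = q (-1) + (q (-1) - q (-2)) + (q (-1) - q (-2)) * X).
  { destruct (Rtotal_order X (-2)) as [A|[->|A]].
    - pose proof (Heq X (-2) (-1) A ltac:(lra) ltac:(lra)). lra.
    - ring.
    - destruct (Rtotal_order X (-1)) as [B|[->|B]].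
      + pose proof (Heq (-2) X (-1) A B ltac:(lra)). lra.
      + ring.
      + pose proof (Heq (-2) (-1) X ltac:(lra) B HX). lra. }
  unfold q at 1 in E. lra.
Qed.

Lemma elliptic_family_const0 V f F : windows V -> elliptic_family V 0 f F ->
  (forall l X Y, V l X Y -> X < 0) ->
  (forall k, cont_D (F k)) ->
  (forall k Y, F k 0 Y = F k 0 0) ->
  (forall k h eps, 0 < eps -> exists C, forall X Y, X <= 0 ->
     Rabs (F k X (Y + h) - F k X Y) <= eps * (Rabs X + Rabs Y) + C) ->
  (forall k eps, 0 < eps -> exists C, forall X, X <= 0 -> Rabs (F k X 0) <= eps * X ^ 2 + C) ->
  exists c, forall X Y, X < 0 -> F O X Y = c.
Proof.
  intros HV HE HVX HF H0 Hg Hq.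
  assert (HZ := elliptic_family_Zindep V 0 f F HV HE HF (H0 O) (Hg O)).
  destruct (elliptic_family_parabola V 0 f F HV HE HF HZ) as [c [b Hcb]].
  assert (HE1 := elliptic_family_next V f F c b HE).
  lapply HE1; [clear HE1; intros HE1|].
  2:{ intros l X Y HVl. rewrite Hcb by (eapply HVX; exact HVl). field. }
  assert (HZ1 := elliptic_family_Zindep V (3 * b) _ _ HV HE1 (fun k => HF (S k)) (H0 1%nat) (Hg 1%nat)).
  destruct (elliptic_family_parabola V (3 * b) _ _ HV HE1 (fun k => HF (S k)) HZ1) as [c1 [b1 Hcb1]].
  assert (Hb : b = 0).
  { apply NNPP. intros Hb. assert (Hab : 0 < Rabs b) by (apply Rabs_pos_lt; exact Hb).
    destruct (Hq 1%nat (Rabs b / 2) ltac:(lra)) as [C HC].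
    (* At [X = - t] the quadratic term [3/2 |b| t^2] faces the allowed growth [|b| / 2 t^2 + C],
       leaving [|b| t^2 <= |c1| + |b1| t + |C|]. This [t >= 1] has
       [|b| t = |b| + |b1| + |c1| + |C|], a contradiction. *)
    set (t := 1 + (Rabs b1 + Rabs c1 + Rabs C) / Rabs b).
    pose proof (Rabs_pos b1). pose proof (Rabs_pos c1). pose proof (Rabs_pos C).
    assert (Ht : 1 <= t).
    { unfold t. assert (0 <= (Rabs b1 + Rabs c1 + Rabs C) / Rabs b) by (apply Rdiv_le_0_compat; lra). lra. }
    assert (Hbt : Rabs b * t = Rabs b + Rabs b1 + Rabs c1 + Rabs C) by (unfold t; field; lra).
    specialize (HC (- t) ltac:(lra)). rewrite (Hcb1 (- t) 0) in HC by lra.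
    assert (L : 3 / 2 * Rabs b * t ^ 2 <= Rabs c1 + Rabs b1 * t + (Rabs b / 2 * t ^ 2 + C)).
    { replace (3 / 2 * Rabs b * t ^ 2) with (Rabs (3 * b / 2 * (- t) ^ 2)).
      2:{ rewrite Rabs_mult. replace ((- t) ^ 2) with (t ^ 2) by ring.
          rewrite (Rabs_pos_eq (t ^ 2)) by apply pow2_ge_0.
          unfold Rdiv. rewrite !Rabs_mult, (Rabs_pos_eq 3), (Rabs_pos_eq (/ 2)) by lra. field. }
      replace (3 * b / 2 * (- t) ^ 2) with (c1 + b1 * (- t) - (c1 + b1 * - t - 3 * b / 2 * (- t) ^ 2)) by ring.
      replace ((- t) ^ 2) with (t ^ 2) in HC |- * by ring.
      eapply Rle_trans; [apply Rabs_triang|]. rewrite Rabs_Ropp. apply Rplus_le_compat; [|exact HC].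
      eapply Rle_trans; [apply Rabs_triang|]. rewrite Rabs_mult, Rabs_Ropp, (Rabs_pos_eq t) by lra. lra. }
    assert (HCa := Rle_abs C).
    assert (L2 : Rabs b * t ^ 2 <= Rabs c1 + Rabs b1 * t + Rabs C) by lra.
    replace (Rabs b * t ^ 2) with (Rabs b * t * t) in L2 by ring. rewrite Hbt in L2. nra. }
  exists c. intros X Y HX. rewrite Hcb by exact HX. rewrite Hb. field.
Qed.

Lemma elliptic_family_const k : forall V f F, windows V -> elliptic_family V 0 f F ->
  (forall l X Y, V l X Y -> X < 0) ->
  (forall k, cont_D (F k)) ->
  (forall k Y, F k 0 Y = F k 0 0) ->
  (forall k h eps, 0 < eps -> exists C, forall X Y, X <= 0 ->
     Rabs (F k X (Y + h) - F k X Y) <= eps * (Rabs X + Rabs Y) + C) ->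
  (forall k eps, 0 < eps -> exists C, forall X, X <= 0 -> Rabs (F k X 0) <= eps * X ^ 2 + C) ->
  exists c, forall X Y, X < 0 -> F k X Y = c.
Proof.
  induction k as [|k IH]; intros V f F HV HE HVX HF H0 Hg Hq.
  - apply (elliptic_family_const0 V f F); assumption.
  - destruct (elliptic_family_const0 V f F) as [c Hc]; try assumption.
    assert (HE1 := elliptic_family_next V f F c 0 HE).
    lapply HE1; [clear HE1; intros HE1|].
    2:{ intros l X Y HVl. rewrite Hc by (eapply HVX; exact HVl). ring. }
    rewrite Rmult_0_r in HE1.
    apply (IH V _ (fun k => F (S k)) HV HE1 HVX); intros k'; [apply HF|apply H0|apply Hg|apply Hq].
Qed.

(** * Growth of profiles *)

Lemma cont_D_bounded F a c d : cont_D F -> a <= 0 -> c <= d ->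
  exists M, 0 <= M /\ forall X Y, a <= X <= 0 -> c <= Y <= d -> Rabs (F X Y) <= M.
Proof.
  intros HF Ha Hcd.
  assert (Hc : forall p, continuous (fun p : R * R => F (Rmin (fst p) 0) (snd p)) p).
  { intros [x y]. apply (proj1 (continuity_2d_continuous (fun X Y => F (Rmin X 0) Y) x y)), cont_D_clamp, HF. }
  destruct (continuous_rect_max (fun X Y => F (Rmin X 0) Y) a 0 c d Ha Hcd) as [X1 [Y1 [_ [_ H1]]]].
  { intros X Y _ _. apply Hc. }
  destruct (continuous_rect_max (fun X Y => - F (Rmin X 0) Y) a 0 c d Ha Hcd) as [X2 [Y2 [_ [_ H2]]]].
  { intros X Y _ _. apply (continuous_opp (V := R_NormedModule) (fun p : R * R => F (Rmin (fst p) 0) (snd p))), Hc. }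
  set (M1 := F (Rmin X1 0) Y1) in *. set (M2 := - F (Rmin X2 0) Y2) in *.
  exists (Rmax 0 (Rmax M1 M2)). split; [apply Rmax_l|].
  intros X Y HX HY. specialize (H1 X Y HX HY). specialize (H2 X Y HX HY).
  rewrite Rmin_left in H1, H2 by lra.
  pose proof (Rmax_r 0 (Rmax M1 M2)). pose proof (Rmax_l M1 M2). pose proof (Rmax_r M1 M2).
  apply Rabs_bd. lra.
Qed.

Lemma normY_le X Y : normY X Y <= Rabs X + Rabs Y.
Proof.
  pose proof (Rabs_pos X). pose proof (Rabs_pos Y). unfold normY.
  rewrite <- (sqrt_pow2 (Rabs X + Rabs Y)) by lra. apply sqrt_le_1_alt.
  rewrite <- (pow2_abs X), <- (pow2_abs Y). nra.
Qed.

Lemma normY_ge X Y : Rabs X <= normY X Y /\ Rabs Y <= normY X Y.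
Proof.
  unfold normY. split; [rewrite <- (sqrt_pow2 (Rabs X)) by apply Rabs_pos|
    rewrite <- (sqrt_pow2 (Rabs Y)) by apply Rabs_pos]; apply sqrt_le_1_alt; rewrite pow2_abs;
    pose proof (pow2_ge_0 X); pose proof (pow2_ge_0 Y); lra.
Qed.

Lemma sublinear_bound G : cont_D G ->
  (forall eps, 0 < eps -> exists M, forall X Y, X <= 0 -> M < normY X Y -> Rabs (G X Y) <= eps * normY X Y) ->
  forall eps, 0 < eps -> exists C, 0 <= C /\ forall X Y, X <= 0 -> Rabs (G X Y) <= eps * (Rabs X + Rabs Y) + C.
Proof.
  intros HG Hd eps Heps. destruct (Hd eps Heps) as [M HM].
  pose proof (Rabs_pos M). pose proof (Rle_abs M).
  destruct (cont_D_bounded G (- Rabs M) (- Rabs M) (Rabs M) HG ltac:(lra) ltac:(lra)) as [C [HC HCb]].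
  exists C. split; [exact HC|]. intros X Y HX.
  pose proof (Rabs_pos X). pose proof (Rabs_pos Y).
  assert (HeX : 0 <= eps * (Rabs X + Rabs Y)) by (apply Rmult_le_pos; lra).
  destruct (Rlt_le_dec M (normY X Y)) as [A|A].
  - eapply Rle_trans; [apply HM; assumption|].
    assert (eps * normY X Y <= eps * (Rabs X + Rabs Y)) by (apply Rmult_le_compat_l; [lra|apply normY_le]). lra.
  - destruct (normY_ge X Y) as [B1 B2].
    assert (Rabs (G X Y) <= C); [|lra].
    apply HCb; [|apply Rabs_bd; lra].
    assert (B3 : Rabs X <= Rabs M) by lra. apply Rabs_bd in B3. lra.
Qed.

Lemma C1_D_derive_X f fR fZ X Y : C1_D_with f fR fZ -> X < 0 -> is_derive (fun x => f x Y) X (fR X Y).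
Proof.
  intros [H _] HX. apply is_derive_Reals. intros e He.
  destruct (proj1 (H X Y (Rlt_le _ _ HX)) e He) as [d [Hd HL]].
  assert (Hm : 0 < Rmin d (- X)) by (apply Rmin_glb_lt; lra).
  exists (mkposreal _ Hm). intros h Hh0 Hh. simpl in Hh.
  pose proof (Rmin_l d (- X)). pose proof (Rmin_r d (- X)).
  assert (Hh' := Hh). apply Rabs_bd' in Hh'.
  specialize (HL h). simpl in HL. unfold Rdist in HL. apply HL.
  split; [split; [exact Hh0|lra]|]. rewrite Rminus_0_r. lra.
Qed.

Lemma C1_D_derive_Z f fR fZ X Y : C1_D_with f fR fZ -> X <= 0 -> is_derive (fun y => f X y) Y (fZ X Y).
Proof. intros [H _] HX. apply is_derive_Reals. apply H. exact HX. Qed.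

(** The mean value theorem turns the sublinear gradient into sublinear growth of increments in [Y]
    and subquadratic growth along [Y = 0]; in the latter the cross term [C |X|] is absorbed by
    completing a square, whence [C^2 / (2 eps)]. *)
Lemma sublinear_gradient_growth P PR PZ : C1_D_with P PR PZ ->
  (forall eps, 0 < eps -> exists M, forall X Y, X <= 0 ->
      M < normY X Y -> normY (PR X Y) (PZ X Y) <= eps * normY X Y) ->
  (forall h eps, 0 < eps -> exists C, forall X Y, X <= 0 ->
     Rabs (P X (Y + h) - P X Y) <= eps * (Rabs X + Rabs Y) + C) /\
  (forall eps, 0 < eps -> exists C, forall X, X <= 0 -> Rabs (P X 0) <= eps * X ^ 2 + C).
Proof.
  intros HP Hb. destruct (HP) as [_ [HcP [HcR HcZ]]].
  assert (HR : forall eps, 0 < eps -> exists C, 0 <= C /\ forall X Y, X <= 0 -> Rabs (PR X Y) <= eps * (Rabs X + Rabs Y) + C).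
  { apply sublinear_bound; [exact HcR|]. intros eps Heps. destruct (Hb eps Heps) as [M HM]. exists M.
    intros X Y HX HN. eapply Rle_trans; [apply (normY_ge _ (PZ X Y))|]. apply HM; assumption. }
  assert (HZ : forall eps, 0 < eps -> exists C, 0 <= C /\ forall X Y, X <= 0 -> Rabs (PZ X Y) <= eps * (Rabs X + Rabs Y) + C).
  { apply sublinear_bound; [exact HcZ|]. intros eps Heps. destruct (Hb eps Heps) as [M HM]. exists M.
    intros X Y HX HN. eapply Rle_trans; [apply (normY_ge (PR X Y))|]. apply HM; assumption. }
  split.
  - intros h eps Heps. set (H := Rabs h + 1). pose proof (Rabs_pos h).
    destruct (HZ (eps / H)) as [C [HC HCb]]. { apply Rdiv_lt_0_compat; unfold H; lra. }
    exists (H * (eps / H * H + C)). intros X Y HX.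
    destruct (MVT_gen (fun y => P X y) Y (Y + h) (fun y => PZ X y)) as [xi [Hxi E]].
    + intros x _. apply (C1_D_derive_Z P PR PZ); assumption.
    + intros x _. apply derivable_continuous_pt. exists (PZ X x). apply is_derive_Reals.
      apply (C1_D_derive_Z P PR PZ); assumption.
    + rewrite E. replace (Y + h - Y) with h by ring. rewrite Rabs_mult.
      assert (Hxi' : Rabs xi <= Rabs Y + H).
      { replace xi with (Y + (xi - Y)) by ring. eapply Rle_trans; [apply Rabs_triang|].
        apply Rplus_le_compat_l. unfold H. revert Hxi. unfold Rmin, Rmax, Rabs.
        repeat destruct Rle_dec; repeat destruct Rcase_abs; lra. }
      specialize (HCb X xi HX). pose proof (Rabs_pos X). pose proof (Rabs_pos Y).
      assert (HH : 0 < H) by (unfold H; lra).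
      assert (HeH : 0 < eps / H) by (apply Rdiv_lt_0_compat; lra).
      assert (Rabs (PZ X xi) <= eps / H * (Rabs X + Rabs Y + H) + C).
      { eapply Rle_trans; [exact HCb|]. apply Rplus_le_compat_r, Rmult_le_compat_l; lra. }
      apply Rle_trans with ((eps / H * (Rabs X + Rabs Y + H) + C) * H).
      * apply Rmult_le_compat; try apply Rabs_pos; [assumption|unfold H; lra].
      * right. field. lra.
  - intros eps Heps. destruct (HR (eps / 2) ltac:(lra)) as [C [HC HCb]].
    exists (C ^ 2 / (2 * eps) + Rabs (P 0 0)). intros X HX.
    destruct (Rle_lt_or_eq_dec X 0 HX) as [HX0| ->].
    2:{ replace (eps * 0 ^ 2) with 0 by ring.
        assert (0 <= C ^ 2 / (2 * eps)) by (apply Rdiv_le_0_compat; [apply pow2_ge_0|lra]). lra. }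
    assert (Hlim : forall x, X <= x < 0 -> Rabs (P x 0 - P X 0) <= (eps / 2 * - X + C) * - X).
    { intros x Hx.
      destruct (MVT_gen (fun y => P y 0) X x (fun y => PR y 0)) as [xi [Hxi E]].
      - intros y Hy. apply (C1_D_derive_X P PR PZ); [exact HP|]. rewrite Rmax_right in Hy by lra. lra.
      - intros y Hy. rewrite Rmax_right in Hy by lra. apply derivable_continuous_pt. exists (PR y 0).
        apply is_derive_Reals. apply (C1_D_derive_X P PR PZ); [exact HP|lra].
      - rewrite E, Rabs_mult. rewrite Rmin_left, Rmax_right in Hxi by lra.
        apply Rmult_le_compat; try apply Rabs_pos.
        + eapply Rle_trans; [apply HCb; lra|]. apply Rplus_le_compat_r, Rmult_le_compat_l; [lra|].
          rewrite Rabs_R0, Rplus_0_r. rewrite Rabs_left1; lra.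
        + rewrite Rabs_pos_eq; lra. }
    (* The derivative in [X] is two-sided only for [X < 0], so the mean value bound reaches the
       boundary point by continuity. *)
    assert (Hl : Rabs (P 0 0 - P X 0) <= (eps / 2 * - X + C) * - X).
    { apply le_epsilon. intros e He. destruct (HcP 0 0 (Rle_refl 0) e He) as [eta [Heta Hc]].
      set (x := Rmax X (- eta / 2)).
      assert (Hx : X <= x < 0 /\ - eta < x).
      { unfold x. split; [split; [apply Rmax_l|apply Rmax_lub_lt; lra]|].
        eapply Rlt_le_trans; [|apply Rmax_r]. lra. }
      specialize (Hlim x (proj1 Hx)). specialize (Hc x 0 ltac:(lra)).
      rewrite !Rminus_0_r, Rabs_R0 in Hc. specialize (Hc ltac:(apply Rabs_bd'; lra) Heta).
      apply Rabs_bd in Hlim. apply Rabs_bd' in Hc. apply Rabs_bd. lra. }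
    replace (P X 0) with (P 0 0 - (P 0 0 - P X 0)) by ring.
    eapply Rle_trans; [apply Rabs_triang|]. rewrite Rabs_Ropp.
    assert ((eps / 2 * - X + C) * - X <= eps * X ^ 2 + C ^ 2 / (2 * eps)); [|lra].
    assert (0 <= (eps * X + C) ^ 2 / (2 * eps)) by (apply Rdiv_le_0_compat; [apply pow2_ge_0|lra]).
    replace ((eps * X + C) ^ 2 / (2 * eps)) with
      (eps / 2 * X ^ 2 + C * X + C ^ 2 / (2 * eps)) in H by (field; lra). nra.
Qed.

Lemma coef_bound_PSeries_0 a l0 N l : 0 < l0 -> coef_bound a l0 N -> 0 <= l <= l0 / 2 ->
  Rabs (PSeries a l - a O) <= 2 * N * (l / l0).
Proof.
  intros Hl0 Ha Hl. pose proof (PSeries_horner 1 a l0 N l Hl0 Ha Hl) as H. simpl in H.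
  rewrite Rmult_0_r, Rplus_0_r, Rmult_1_r in H. exact H.
Qed.

(** Passing from radius [l0] to [l0 / 2] absorbs the factor [k + 1] of the differentiated terms, as
    [(k + 1) 2^(-k) <= 2]. *)
Lemma coef_bound_derive a l0 N l : 0 < l0 -> coef_bound a l0 N -> Rabs l <= l0 / 4 ->
  exists d, is_derive (PSeries a) l d /\ Rabs d <= 4 * N / l0.
Proof.
  intros Hl0 Ha Hl.
  exists (PSeries (PS_derive a) l). split.
  - apply is_derive_PSeries.
    destruct (CV_radius_bounded a) as [H _].
    eapply Rbar_lt_le_trans; [|apply (H l0)].
    + simpl. lra.
    + exists N. intros k. rewrite Rabs_mult, (Rabs_pos_eq (l0 ^ k)) by (apply pow_le; lra). apply Ha.
  - replace (4 * N / l0) with (2 * (2 * N / l0)) by (field; lra).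
    apply (coef_bound_PSeries _ (l0 / 2)); [lra| |lra].
    intros k. unfold PS_derive.
    rewrite Rabs_mult, (Rabs_pos_eq (INR (S k))) by apply pos_INR.
    pose proof (coef_bound_shift a l0 N Hl0 Ha k) as Hk.
    unfold Rdiv. rewrite Rpow_mult_distr.
    assert (H2 : INR (S k) * (/ 2) ^ k <= 2).
    { clear. induction k as [|k IH]; [simpl; lra|].
      rewrite S_INR. replace ((/ 2) ^ S k) with (/ 2 * (/ 2) ^ k) by reflexivity.
      assert ((/ 2) ^ k <= 1).
      { rewrite pow_inv. rewrite <- Rinv_1. apply Rinv_le_contravar; [lra|apply pow_R1_Rle; lra]. }
      nra. }
    assert (0 <= INR (S k) * (/ 2) ^ k) by (apply Rmult_le_pos; [apply pos_INR|apply pow_le; lra]).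
    assert (0 <= Rabs (a (S k)) * l0 ^ k) by (apply Rmult_le_pos; [apply Rabs_pos|apply pow_le; lra]).
    replace (INR (S k) * Rabs (a (S k)) * (l0 ^ k * (/ 2) ^ k)) with
      ((INR (S k) * (/ 2) ^ k) * (Rabs (a (S k)) * l0 ^ k)) by ring.
    replace (2 * N * / l0) with (2 * (N / l0)) by (unfold Rdiv; ring).
    apply Rmult_le_compat; assumption.
Qed.

(** * Limits of transport equations *)

Definition stream_family (V : R -> R -> R -> Prop) (psi psiR psiZ w : R -> R -> R -> R)
  (Psi Om : nat -> R -> R -> R) : Prop :=
  exists psiRR psiZZ : R -> R -> R -> R, forall l X Y, V l X Y ->
    slice_at l (psi l) (psiR l) (psiRR l) (psiZ l) (psiZZ l) (w l) X Y /\
    is_pseries (fun k => Psi k X Y) l (psi l X Y) /\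
    is_pseries (fun k => Om k X Y) l (w l X Y).

Lemma C1_D_lipschitz_X f fR fZ x1 y1 r L : C1_D_with f fR fZ -> 0 < r -> x1 + r < 0 ->
  (forall X Y, Rabs (X - x1) <= r -> Rabs (Y - y1) <= r -> Rabs (fR X Y) <= L) ->
  forall a b Y, Rabs (a - x1) <= r -> Rabs (b - x1) <= r -> Rabs (Y - y1) <= r ->
    Rabs (f b Y - f a Y) <= L * Rabs (b - a).
Proof.
  intros Hf Hr Hx HL a b Y Ha Hb HY. apply Rabs_bd in Ha. apply Rabs_bd in Hb.
  assert (HM : forall u, Rmin a b <= u <= Rmax a b -> x1 - r <= u <= x1 + r).
  { intros u. unfold Rmin, Rmax. destruct Rle_dec; lra. }
  destruct (MVT_gen (fun y => f y Y) a b (fun y => fR y Y)) as [xi [Hxi E]].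
  - intros y Hy. apply (C1_D_derive_X f fR fZ); [exact Hf|]. specialize (HM y ltac:(lra)). lra.
  - intros y Hy. apply derivable_continuous_pt. exists (fR y Y). apply is_derive_Reals.
    apply (C1_D_derive_X f fR fZ); [exact Hf|]. specialize (HM y Hy). lra.
  - rewrite E, Rabs_mult. apply Rmult_le_compat_r; [apply Rabs_pos|].
    apply HL; [|exact HY]. apply Rabs_bd. specialize (HM xi Hxi). lra.
Qed.

Lemma derive_dist_le (f g : R -> R) x a b C d : 0 < d -> is_derive f x a -> is_derive g x b ->
  (forall h, Rabs h <= d -> Rabs ((f (x + h) - g (x + h)) - (f x - g x)) <= C * Rabs h) ->
  Rabs (a - b) <= C.
Proof.
  intros Hd Hf Hg H. apply le_epsilon. intros e He.
  assert (Hfg : is_derive (fun y => f y - g y) x (a - b)) by (apply (is_derive_minus (V := R_NormedModule)); assumption).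
  apply is_derive_Reals in Hfg. destruct (Hfg e He) as [del Hdel].
  set (h := Rmin d (del / 2)). pose proof (cond_pos del).
  assert (Hh : 0 < h /\ h <= d /\ h <= del / 2).
  { unfold h. split; [apply Rmin_glb_lt; lra|]. split; [apply Rmin_l|apply Rmin_r]. }
  specialize (Hdel h ltac:(lra)). rewrite Rabs_pos_eq in Hdel by lra. specialize (Hdel ltac:(lra)).
  specialize (H h). rewrite Rabs_pos_eq in H by lra. specialize (H ltac:(lra)).
  set (D := f (x + h) - g (x + h) - (f x - g x)) in *.
  assert (HD : Rabs (D / h) <= C).
  { unfold Rdiv. rewrite Rabs_mult, Rabs_inv, (Rabs_pos_eq h) by lra.
    apply Rmult_le_reg_r with h; [lra|]. rewrite Rmult_assoc, Rinv_l by lra. lra. }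
  apply Rabs_bd' in Hdel. apply Rabs_bd in HD. apply Rabs_bd. lra.
Qed.

(** [Psi O] is only [C^1], so [psi l - Psi O] cannot be put into the elliptic equation. Instead
    [psi l] is compared with [psi m], where the Lipschitz estimate in five dimensions applies, and
    [m] goes to [0] along the windows. Only increments pass to the limit; the derivatives are then
    compared through them. *)
Lemma stream_gradient V psi psiR psiZ w Psi Om PR PZ OR OZ x1 y1 r l0 N :
  windows V -> stream_family V psi psiR psiZ w Psi Om ->
  C1_D_with (Psi O) PR PZ -> C1_D_with (Om O) OR OZ ->
  0 < r -> x1 + r < 0 -> 0 < l0 -> 0 <= N ->
  (forall X Y, Rabs (X - x1) <= r -> Rabs (Y - y1) <= r ->
     coef_bound (fun k => Psi k X Y) l0 N /\ coef_bound (fun k => Om k X Y) l0 N) ->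
  exists C kap, 0 < kap /\ forall l, 0 < l < kap ->
    (forall X Y, Rabs (X - x1) <= r -> Rabs (Y - y1) <= r -> V l X Y) ->
    forall X Y, Rabs (X - x1) < r / 4 -> Rabs (Y - y1) < r / 4 ->
      Rabs (psiR l X Y - PR X Y) <= C * l /\ Rabs (psiZ l X Y - PZ X Y) <= C * l.
Proof.
  intros HV [psiRR [psiZZ HS]] HP HO Hr Hxr Hl0 HN Hcb.
  destruct (cont_D_bounded PR (x1 - r) (y1 - r) (y1 + r)) as [L1 [HL1 HL1b]]; [apply HP|lra|lra|].
  destruct (cont_D_bounded OR (x1 - r) (y1 - r) (y1 + r)) as [L2 [HL2 HL2b]]; [apply HO|lra|lra|].
  set (d := Rmin (r / 24) (1 / 2)).
  assert (Hd : 0 < d /\ d <= r / 24 /\ d <= 1 / 2).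
  { unfold d. split; [apply Rmin_glb_lt; lra|]. split; [apply Rmin_l|apply Rmin_r]. }
  (* [2 N / l0] is the rate at which [psi] and [w] approach their first profiles. [L1] and [L2] are
     Lipschitz constants of these profiles, needed because the lifts with parameters [l] and [m]
     evaluate them at points up to [l + m] apart. *)
  set (E := 2 * N / l0 + L1 + L2).
  assert (HNl : 0 <= 2 * N / l0) by (apply Rdiv_le_0_compat; lra).
  set (C := 47 * E / d + 2 * E * d).
  assert (HE0 : 0 <= E) by (unfold E; lra).
  assert (HC : 0 <= C).
  { unfold C. apply Rplus_le_le_0_compat; [apply Rdiv_le_0_compat; lra|apply Rmult_le_pos; lra]. }
  set (kap := Rmin (Rmin (l0 / 2) (r / 2)) (/ (4 * (- x1 + r)))).
  assert (Hk : 0 < kap /\ kap <= l0 / 2 /\ kap <= r / 2 /\ kap <= / (4 * (- x1 + r))).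
  { assert (0 < / (4 * (- x1 + r))) by (apply Rinv_0_lt_compat; lra).
    unfold kap, Rmin. repeat destruct Rle_dec; lra. }
  exists C, kap. split; [apply Hk|].
  assert (Hone : forall l, 0 < l < kap -> forall X, Rabs (X - x1) <= r -> 1 / 2 <= 1 + l * X).
  { intros l Hl X HX. apply Rabs_bd in HX.
    assert (l * (4 * (- x1 + r)) <= 1).
    { apply Rmult_le_reg_r with (/ (4 * (- x1 + r))); [apply Rinv_0_lt_compat; lra|].
      rewrite Rmult_assoc, Rinv_r by lra. lra. }
    nra. }
  intros l Hl HVl.
  (* [psi l - psi m] has Lipschitz constant [O(l + m)]; [psi m] tends to [Psi O] as [m] tends to [0]. *)
  assert (Hcmp : forall m, 0 < m < kap -> 
    (forall X Y, Rabs (X - x1) <= r -> Rabs (Y - y1) <= r -> V m X Y) ->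
    forall X Y h, Rabs (X - x1) < r / 4 -> Rabs (Y - y1) < r / 4 -> Rabs h <= d ->
    Rabs ((psi l (X + h) Y - psi m (X + h) Y) - (psi l X Y - psi m X Y)) <= C * (l + m) * Rabs h /\
    Rabs ((psi l X (Y + h) - psi m X (Y + h)) - (psi l X Y - psi m X Y)) <= C * (l + m) * Rabs h).
  { intros m Hm HVm.
    assert (Happ : forall j X Y, 0 < j < kap -> V j X Y -> Rabs (X - x1) <= r -> Rabs (Y - y1) <= r ->
       Rabs (psi j X Y - Psi O X Y) <= 2 * N / l0 * j /\ Rabs (w j X Y - Om O X Y) <= 2 * N / l0 * j).
    { intros j X Y Hj HVj HX HY. destruct (HS j X Y HVj) as [_ [S1 S2]].
      destruct (Hcb X Y HX HY) as [B1 B2].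
      rewrite <- (is_pseries_unique _ _ _ S1), <- (is_pseries_unique _ _ _ S2).
      replace (2 * N / l0 * j) with (2 * N * (j / l0)) by (field; lra).
      split; [apply (coef_bound_PSeries_0 (fun k => Psi k X Y))|apply (coef_bound_PSeries_0 (fun k => Om k X Y))];
        try assumption; lra. }
    assert (Hlc : forall j x s, 0 < j < kap -> Rabs (x - x1) < r / 2 -> 0 <= s < 1 ->
       Rabs (lift_coord j x s - x1) <= r /\ x <= lift_coord j x s <= x + j).
    { intros j x s Hj Hx Hs.
      destruct (lift_coord_bounds j x s) as [A1 A2]; [lra|apply Hone; [exact Hj|lra]|lra|].
      assert (j * s <= j) by nra. apply Rabs_bd' in Hx. split; [apply Rabs_bd; lra|lra]. }
    set (H := fun x s z => psi l (lift_coord l x s) z - psi m (lift_coord m x s) z).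
    assert (Hdiff : forall x s z, Rabs (x - x1) < r / 2 -> 0 <= s < 1 -> Rabs (z - y1) < r / 2 ->
       Rabs (H x s z) <= E * (l + m) /\
       Rabs (w l (lift_coord l x s) z - w m (lift_coord m x s) z) <= E * (l + m)).
    { intros x s z Hx Hs Hz.
      destruct (Hlc l x s Hl Hx Hs) as [A1 A2]. destruct (Hlc m x s Hm Hx Hs) as [A3 A4].
      destruct (Happ l (lift_coord l x s) z) as [B1 B2]; try lra; [apply HVl; lra|].
      destruct (Happ m (lift_coord m x s) z) as [B3 B4]; try lra; [apply HVm; lra|].
      assert (D1 : Rabs (lift_coord l x s - lift_coord m x s) <= l + m) by (apply Rabs_bd; lra).
      assert (D2 : Rabs (Psi O (lift_coord l x s) z - Psi O (lift_coord m x s) z) <= L1 * (l + m)).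
      { eapply Rle_trans; [apply (C1_D_lipschitz_X _ PR PZ x1 y1 r L1)|]; try assumption; try lra.
        - intros X Y HX HY. apply Rabs_bd in HX. apply Rabs_bd in HY. apply HL1b; lra.
        - apply Rmult_le_compat_l; assumption. }
      assert (D3 : Rabs (Om O (lift_coord l x s) z - Om O (lift_coord m x s) z) <= L2 * (l + m)).
      { eapply Rle_trans; [apply (C1_D_lipschitz_X _ OR OZ x1 y1 r L2)|]; try assumption; try lra.
        - intros X Y HX HY. apply Rabs_bd in HX. apply Rabs_bd in HY. apply HL2b; lra.
        - apply Rmult_le_compat_l; assumption. }
      assert (EE : E * (l + m) = 2 * N / l0 * l + 2 * N / l0 * m + L1 * (l + m) + L2 * (l + m)) by (unfold E; ring).
      assert (0 <= L1 * (l + m)) by (apply Rmult_le_pos; lra).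
      assert (0 <= L2 * (l + m)) by (apply Rmult_le_pos; lra).
      apply Rabs_bd in B1. apply Rabs_bd in B2. apply Rabs_bd in B3. apply Rabs_bd in B4.
      apply Rabs_bd in D2. apply Rabs_bd in D3. unfold H. split; apply Rabs_bd; lra. }
    assert (HPH : poisson5 x1 y1 (r / 2) 1 H (E * (l + m))).
    { apply (poisson5_lift l (psi l) (psiR l) (psiRR l) (psiZ l) (psiZZ l) (w l)
        m (psi m) (psiR m) (psiRR m) (psiZ m) (psiZZ m) (w m)).
      intros x s z Hx Hs Hz.
      destruct (Hlc l x s Hl Hx Hs) as [A1 A2]. destruct (Hlc m x s Hm Hx Hs) as [A3 A4].
      split; [pose proof (Hone l Hl x); lra|]. split; [pose proof (Hone m Hm x); lra|].
      split; [apply HS, HVl; lra|]. split; [apply HS, HVm; lra|]. apply Hdiff; assumption. }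
    assert (HE2 : 0 <= E * (l + m)) by (apply Rmult_le_pos; lra).
    assert (HH0 : forall X Y, Rabs (X - x1) <= r -> H X 0 Y = psi l X Y - psi m X Y).
    { intros X Y HX. unfold H. rewrite !lift_coord_0; [reflexivity|lra| |lra|];
        [pose proof (Hone m Hm X HX); lra|pose proof (Hone l Hl X HX); lra]. }
    assert (HCe : forall h, (47 * (E * (l + m)) / d + 2 * (E * (l + m)) * d) * Rabs h = C * (l + m) * Rabs h).
    { intros h. unfold C. field. lra. }
    intros X Y h HX HY Hh. split.
    - rewrite <- HCe, <- !HH0; try lra.
      + apply (poisson5_lipschitz x1 y1 (r / 2) 1 H (E * (l + m)) (E * (l + m)) d d); try lra; try assumption.
        intros. apply Hdiff; assumption.
      + replace (X + h - x1) with (X - x1 + h) by ring. eapply Rle_trans; [apply Rabs_triang|]. lra.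
    - rewrite <- HCe, <- !HH0; try lra.
      apply (poisson5_lipschitz y1 x1 (r / 2) 1 (fun x s z => H z s x) (E * (l + m)) (E * (l + m)) d d); try lra.
      + apply poisson5_swap. exact HPH.
      + intros. apply Hdiff; assumption. }
  assert (Hlim : forall X Y h, Rabs (X - x1) < r / 4 -> Rabs (Y - y1) < r / 4 -> Rabs h <= d ->
    Rabs ((psi l (X + h) Y - Psi O (X + h) Y) - (psi l X Y - Psi O X Y)) <= C * l * Rabs h /\
    Rabs ((psi l X (Y + h) - Psi O X (Y + h)) - (psi l X Y - Psi O X Y)) <= C * l * Rabs h).
  { intros X Y h HX HY Hh.
    assert (Hm : forall e, 0 < e -> exists m, 0 < m < kap /\
      (forall X Y, Rabs (X - x1) <= r -> Rabs (Y - y1) <= r -> V m X Y) /\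
      (4 * N / l0 + C * Rabs h) * m <= e).
    { intros e He. set (B := 4 * N / l0 + C * Rabs h + 1).
      assert (HB : 1 <= B).
      { assert (0 <= 4 * N / l0) by (apply Rdiv_le_0_compat; lra).
        assert (0 <= C * Rabs h) by (apply Rmult_le_pos; [exact HC|apply Rabs_pos]). unfold B; lra. }
      destruct (HV (- x1 + r + Rabs y1) (Rmin kap (e / B))) as [m [Hm HW]].
      { apply Rmin_glb_lt; [lra|apply Rdiv_lt_0_compat; lra]. }
      assert (m < kap) by (eapply Rlt_le_trans; [apply Hm|apply Rmin_l]).
      assert (Hme : m < e / B) by (eapply Rlt_le_trans; [apply Hm|apply Rmin_r]).
      exists m. split; [lra|]. split.
      - intros X' Y' HX' HY'. apply Rabs_bd in HX'. pose proof (Rabs_pos y1). apply HW; try lra.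
        replace Y' with ((Y' - y1) + y1) by ring. eapply Rle_trans; [apply Rabs_triang|]. lra.
      - apply Rle_trans with (B * m); [apply Rmult_le_compat_r; [lra|unfold B; lra]|].
        apply Rmult_le_reg_l with (/ B); [apply Rinv_0_lt_compat; lra|].
        rewrite <- Rmult_assoc, Rinv_l by lra. unfold Rdiv in Hme. lra. }
    assert (Happ : forall m X Y, 0 < m < kap -> V m X Y -> Rabs (X - x1) <= r -> Rabs (Y - y1) <= r ->
       Rabs (psi m X Y - Psi O X Y) <= 2 * N / l0 * m).
    { intros j X' Y' Hj HVj HX' HY'. destruct (HS j X' Y' HVj) as [_ [S1 S2]].
      destruct (Hcb X' Y' HX' HY') as [B1 B2].
      rewrite <- (is_pseries_unique _ _ _ S1).
      replace (2 * N / l0 * j) with (2 * N * (j / l0)) by (field; lra).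
      apply (coef_bound_PSeries_0 (fun k => Psi k X' Y')); try assumption; lra. }
    assert (HXh : Rabs (X + h - x1) <= r).
    { replace (X + h - x1) with (X - x1 + h) by ring. eapply Rle_trans; [apply Rabs_triang|]. lra. }
    assert (HYh : Rabs (Y + h - y1) <= r).
    { replace (Y + h - y1) with (Y - y1 + h) by ring. eapply Rle_trans; [apply Rabs_triang|]. lra. }
    split; apply le_epsilon; intros e He; destruct (Hm e He) as [m [Hm1 [Hm2 Hm3]]];
      destruct (Hcmp m Hm1 Hm2 X Y h HX HY Hh) as [K1 K2];
      pose proof (Happ m X Y Hm1 (Hm2 X Y ltac:(lra) ltac:(lra)) ltac:(lra) ltac:(lra)) as A1;
      assert (Hexp : (4 * N / l0 + C * Rabs h) * m = 2 * (2 * N / l0 * m) + C * m * Rabs h) by (field; lra);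
      assert (Hexp2 : C * (l + m) * Rabs h = C * l * Rabs h + C * m * Rabs h) by ring.
    - pose proof (Happ m (X + h) Y Hm1 (Hm2 _ Y HXh ltac:(lra)) HXh ltac:(lra)) as A2.
      apply Rabs_bd in A1. apply Rabs_bd in A2. apply Rabs_bd in K1. apply Rabs_bd. lra.
    - pose proof (Happ m X (Y + h) Hm1 (Hm2 X _ ltac:(lra) HYh) ltac:(lra) HYh) as A2.
      apply Rabs_bd in A1. apply Rabs_bd in A2. apply Rabs_bd in K2. apply Rabs_bd. lra. }
  intros X Y HX HY.
  assert (HXn : X < 0) by (apply Rabs_bd' in HX; lra).
  destruct (HS l X Y (HVl X Y ltac:(lra) ltac:(lra))) as [[_ [_ [_ [D1 [_ [D2 _]]]]]] _].
  split.
  - apply (derive_dist_le (fun x => psi l x Y) (fun x => Psi O x Y) X _ _ _ d (proj1 Hd) D1).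
    + apply (C1_D_derive_X _ PR PZ); assumption.
    + intros h Hh. apply Hlim; assumption.
  - apply (derive_dist_le (fun y => psi l X y) (fun y => Psi O X y) Y _ _ _ d (proj1 Hd) D2).
    + apply (C1_D_derive_Z _ PR PZ); [assumption|lra].
    + intros h Hh. apply Hlim; assumption.
Qed.

(* The rescaled transport equation; [s] stands for [l dq/dl], and [ka] is the factor of the stretching term. *)
Definition transport_op (g c ka l X Y q qx qz s ps psx psz : R) : R :=
  c * q + g * (X * qx + Y * qz) - g * s + (- (1 + l * X) * psz) * qx +
  (2 * l * ps + (1 + l * X) * psx) * qz - ka * l * q * psz.

Definition transport_family (V : R -> R -> R -> Prop) (g c ka : R) (psi psiR psiZ q : R -> R -> R -> R)
  (Q : nat -> R -> R -> R) : Prop :=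
  exists qR qZ ql : R -> R -> R -> R, forall l X Y, V l X Y ->
    continuous (fun p : R * R => q l (fst p) (snd p)) (X, Y) /\
    is_derive (fun x => q l x Y) X (qR l X Y) /\
    is_derive (fun y => q l X y) Y (qZ l X Y) /\
    is_derive (fun m => q m X Y) l (ql l X Y) /\
    transport_op g c ka l X Y (q l X Y) (qR l X Y) (qZ l X Y) (l * ql l X Y)
      (psi l X Y) (psiR l X Y) (psiZ l X Y) = 0 /\
    is_pseries (fun k => Q k X Y) l (q l X Y).

Lemma countable_choice_seq (A : Type) (P : nat -> A -> Prop) :
  (forall n, exists v, P n v) -> exists f, forall n, P n (f n).
Proof.
  intros H. exists (fun n => proj1_sig (constructive_indefinite_description _ (H n))).
  intros n. exact (proj2_sig (constructive_indefinite_description _ (H n))).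
Qed.

(** The operator is a polynomial in its ten arguments, hence continuous. They are packed into one
    sequence so that a single choice produces all approximations. *)
Lemma transport_op_closed g c ka l X Y q qx qz s ps psx psz :
  (forall de, 0 < de -> exists l' X' Y' q' qx' qz' s' ps' psx' psz',
     Rabs (l' - l) <= de /\ Rabs (X' - X) <= de /\ Rabs (Y' - Y) <= de /\ Rabs (q' - q) <= de /\
     Rabs (qx' - qx) <= de /\ Rabs (qz' - qz) <= de /\ Rabs (s' - s) <= de /\ Rabs (ps' - ps) <= de /\
     Rabs (psx' - psx) <= de /\ Rabs (psz' - psz) <= de /\
     transport_op g c ka l' X' Y' q' qx' qz' s' ps' psx' psz' = 0) ->
  transport_op g c ka l X Y q qx qz s ps psx psz = 0.
Proof.
  intros H.
  assert (H' : forall n : nat, exists v : nat -> R,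
    (Rabs (v 0%nat - l) <= / INR (S n) /\ Rabs (v 1%nat - X) <= / INR (S n) /\ Rabs (v 2%nat - Y) <= / INR (S n) /\
     Rabs (v 3%nat - q) <= / INR (S n) /\ Rabs (v 4%nat - qx) <= / INR (S n) /\ Rabs (v 5%nat - qz) <= / INR (S n) /\
     Rabs (v 6%nat - s) <= / INR (S n) /\ Rabs (v 7%nat - ps) <= / INR (S n) /\ Rabs (v 8%nat - psx) <= / INR (S n) /\
     Rabs (v 9%nat - psz) <= / INR (S n)) /\
    transport_op g c ka (v 0%nat) (v 1%nat) (v 2%nat) (v 3%nat) (v 4%nat) (v 5%nat) (v 6%nat) (v 7%nat)
      (v 8%nat) (v 9%nat) = 0).
  { intros n. destruct (H (/ INR (S n))) as [l' [X' [Y' [q' [qx' [qz' [s' [ps' [psx' [psz' HH]]]]]]]]]].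
    { apply Rinv_0_lt_compat, lt_0_INR. lia. }
    exists (fun i => List.nth i (l' :: X' :: Y' :: q' :: qx' :: qz' :: s' :: ps' :: psx' :: psz' :: nil) 0).
    simpl. tauto. }
  destruct (countable_choice_seq _ _ H') as [v Hv]. cbv beta in Hv.
  assert (Hlim : forall i a, (forall n, Rabs (v n i - a) <= / INR (S n)) -> is_lim_seq (fun n => v n i) a).
  { intros i a Ha. apply is_lim_seq_spec. intros e.
    assert (Hi : is_lim_seq (fun n => / INR (S n)) 0).
    { apply (is_lim_seq_incr_1 (fun n => / INR n)). apply is_lim_seq_spec. intros e'.
      destruct (INR_unbounded (/ e')) as [n0 Hn0]. exists n0. intros n Hn. rewrite Rminus_0_r.
      assert (0 < / e') by (apply Rinv_0_lt_compat, cond_pos).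
      assert (INR n0 <= INR n) by (apply le_INR; exact Hn).
      rewrite Rabs_pos_eq by (apply Rlt_le, Rinv_0_lt_compat; lra).
      rewrite <- (Rinv_inv e'). apply Rinv_lt_contravar; [apply Rmult_lt_0_compat; lra|lra]. }
    apply is_lim_seq_spec in Hi. destruct (Hi e) as [n0 Hn0]. exists n0. intros n Hn.
    eapply Rle_lt_trans; [apply Ha|]. specialize (Hn0 n Hn). rewrite Rminus_0_r in Hn0.
    eapply Rle_lt_trans; [apply Rle_abs|exact Hn0]. }
  assert (L : is_lim_seq (fun n => transport_op g c ka (v n 0%nat) (v n 1%nat) (v n 2%nat) (v n 3%nat) (v n 4%nat)
     (v n 5%nat) (v n 6%nat) (v n 7%nat) (v n 8%nat) (v n 9%nat))
     (transport_op g c ka l X Y q qx qz s ps psx psz)).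
  { unfold transport_op.
    repeat match goal with
    | |- is_lim_seq (fun n => _ + _) _ => apply is_lim_seq_plus'
    | |- is_lim_seq (fun n => _ - _) _ => apply is_lim_seq_minus'
    | |- is_lim_seq (fun n => _ * _) _ => apply is_lim_seq_mult'
    | |- is_lim_seq (fun n => - _) (Finite (- ?a)) => apply (is_lim_seq_opp _ (Finite a))
    | |- is_lim_seq (fun _ => ?c) _ => apply is_lim_seq_const
    end; apply Hlim; intros n; apply Hv. }
  apply (is_lim_seq_ext _ (fun _ => 0)) in L.
  - apply is_lim_seq_unique in L. rewrite Lim_seq_const in L. injection L. auto.
  - intros n. apply Hv.
Qed.

(** At the centre of a Baire box [q l] tends to [Q O] uniformly nearby, but its derivatives need not
    converge there. At a maximum of [q l - Q O] minus a quadratic penalty, however, the gradients of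
    [q l] and [Q O] differ only by that of the penalty. The equation at such points, which approach
    the centre, gives the limit equation at the centre. *)
Lemma transport_limit_dense V g c ka psi psiR psiZ w Psi Om q Q PR PZ OR OZ QR QZ :
  windows V -> (forall l X Y, V l X Y -> locally l (fun m => V m X Y)) ->
  stream_family V psi psiR psiZ w Psi Om -> transport_family V g c ka psi psiR psiZ q Q ->
  (forall k, cont_D (Psi k)) -> (forall k, cont_D (Om k)) -> (forall k, cont_D (Q k)) ->
  C1_D_with (Psi O) PR PZ -> C1_D_with (Om O) OR OZ -> C1_D_with (Q O) QR QZ ->
  forall xs ys r, 0 < r -> xs + r < 0 -> exists X Y, Rabs (X - xs) < r /\ Rabs (Y - ys) < r /\ X < 0 /\
    transport_op g c ka 0 X Y (Q O X Y) (QR X Y) (QZ X Y) 0 (Psi O X Y) (PR X Y) (PZ X Y) = 0.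
Proof.
  intros HV HVo HS HT HcP HcO HcQ HP HO HQ xs ys r0 Hr0 Hxs.
  assert (HSs : forall l X Y, V l X Y -> is_pseries (fun k => Psi k X Y) l (psi l X Y) /\
      is_pseries (fun k => Om k X Y) l (w l X Y)).
  { destruct HS as [a [b HS']]. intros l X Y H. apply (HS' l X Y H). }
  assert (HT' := HT). destruct HT' as [qR [qZ [ql HTT]]].
  set (M0 := - xs + r0 + Rabs ys).
  destruct (HV M0 1 Rlt_0_1) as [l0 [Hl0 HW0]].
  assert (Hbox : forall X Y, Rabs (X - xs) < r0 -> Rabs (Y - ys) < r0 -> - M0 <= X < 0 /\ Rabs Y <= M0).
  { intros X Y HX HY. apply Rabs_bd' in HX. pose proof (Rabs_pos ys). split; [unfold M0; lra|].
    replace Y with ((Y - ys) + ys) by ring. eapply Rle_trans; [apply Rabs_triang|]. unfold M0. lra. }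
  destruct (baire_uniform_bound (fun k X Y => (Rabs (Psi k X Y) + Rabs (Om k X Y) + Rabs (Q k X Y)) * l0 ^ k) xs ys r0)
    as [x1 [y1 [r [N [Hr HN]]]]].
  { exact Hr0. }
  { intros k X Y HX HY. apply Rabs_bd' in HX.
    assert (HA : forall F, cont_D F -> continuity_2d_pt (fun X Y => Rabs (F X Y)) X Y).
    { intros F HF. apply (continuity_1d_2d_pt_comp Rabs F).
      - apply continuity_pt_filterlim, continuous_Rabs.
      - apply cont_D_interior; [exact HF|lra]. }
    apply continuity_2d_pt_mult; [|apply continuity_2d_pt_const].
    apply continuity_2d_pt_plus; [apply continuity_2d_pt_plus|]; apply HA; auto. }
  { intros X Y HX HY. destruct (Hbox X Y HX HY) as [B1 B2].
    assert (HVl : V l0 X Y) by (apply HW0; lra || assumption).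
    destruct (HSs _ _ _ HVl) as [S1 S2]. destruct (HTT _ _ _ HVl) as [_ [_ [_ [_ [_ S3]]]]].
    destruct (is_pseries_coef_bound _ l0 _ (proj1 Hl0) S1) as [C1 [_ H1]].
    destruct (is_pseries_coef_bound _ l0 _ (proj1 Hl0) S2) as [C2 [_ H2]].
    destruct (is_pseries_coef_bound _ l0 _ (proj1 Hl0) S3) as [C3 [_ H3]].
    exists (C1 + C2 + C3). intros k. specialize (H1 k). specialize (H2 k). specialize (H3 k).
    pose proof (Rabs_pos (Psi k X Y)). pose proof (Rabs_pos (Om k X Y)). pose proof (Rabs_pos (Q k X Y)).
    rewrite Rabs_pos_eq; [lra|]. apply Rmult_le_pos; [lra|apply pow_le; lra]. }
  assert (Hc1 : Rabs (x1 - x1) <= r /\ Rabs (y1 - y1) <= r) by (rewrite !Rminus_diag, Rabs_R0; lra).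
  assert (Hcen : Rabs (x1 - xs) < r0 /\ Rabs (y1 - ys) < r0) by (split; apply (HN x1 y1); apply Hc1).
  assert (Hxr : x1 + r < 0).
  { destruct (HN (x1 + r) y1) as [A _]; [|apply Hc1|].
    - replace (x1 + r - x1) with r by ring. rewrite Rabs_pos_eq; lra.
    - apply Rabs_bd' in A. lra. }
  assert (HN0 : 0 <= N).
  { destruct (HN x1 y1) as [_ [_ A]]; try apply Hc1. eapply Rle_trans; [apply Rabs_pos|apply (A O)]. }
  assert (Hcb : forall X Y, Rabs (X - x1) <= r -> Rabs (Y - y1) <= r ->
     coef_bound (fun k => Psi k X Y) l0 N /\ coef_bound (fun k => Om k X Y) l0 N /\ coef_bound (fun k => Q k X Y) l0 N).
  { intros X Y HX HY. destruct (HN X Y HX HY) as [_ [_ A]].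
    assert (Hk : forall k, (Rabs (Psi k X Y) + Rabs (Om k X Y) + Rabs (Q k X Y)) * l0 ^ k <= N).
    { intros k. specialize (A k). eapply Rle_trans; [apply Rle_abs|exact A]. }
    assert (Hp : forall k, 0 <= l0 ^ k) by (intros k; apply pow_le; lra).
    split; [|split]; intros k; specialize (Hk k); specialize (Hp k);
      pose proof (Rmult_le_pos _ _ (Rabs_pos (Psi k X Y)) Hp);
      pose proof (Rmult_le_pos _ _ (Rabs_pos (Om k X Y)) Hp);
      pose proof (Rmult_le_pos _ _ (Rabs_pos (Q k X Y)) Hp); lra. }
  destruct (stream_gradient V psi psiR psiZ w Psi Om PR PZ OR OZ x1 y1 r l0 N HV HS HP HO Hr Hxr (proj1 Hl0) HN0)
    as [C [kap [Hkap Hgrad]]].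
  { intros X Y HX HY. destruct (Hcb X Y HX HY) as [A [B _]]. auto. }
  exists x1, y1. split; [apply Hcen|]. split; [apply Hcen|]. split; [lra|].
  apply transport_op_closed. intros de Hde.
  assert (HcR : continuity_2d_pt QR x1 y1) by (apply cont_D_interior; [apply HQ|lra]).
  assert (HcZ : continuity_2d_pt QZ x1 y1) by (apply cont_D_interior; [apply HQ|lra]).
  assert (HcQ0 : continuity_2d_pt (Q O) x1 y1) by (apply cont_D_interior; [apply HQ|lra]).
  assert (HcP0 : continuity_2d_pt (Psi O) x1 y1) by (apply cont_D_interior; [apply HP|lra]).
  assert (HcPR : continuity_2d_pt PR x1 y1) by (apply cont_D_interior; [apply HP|lra]).
  assert (HcPZ : continuity_2d_pt PZ x1 y1) by (apply cont_D_interior; [apply HP|lra]).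
  assert (Hd2 : 0 < de / 2) by lra.
  destruct (HcR (mkposreal _ Hd2)) as [e1 He1]. destruct (HcZ (mkposreal _ Hd2)) as [e2 He2].
  destruct (HcQ0 (mkposreal _ Hd2)) as [e3 He3]. destruct (HcP0 (mkposreal _ Hd2)) as [e4 He4].
  destruct (HcPR (mkposreal _ Hd2)) as [e5 He5]. destruct (HcPZ (mkposreal _ Hd2)) as [e6 He6].
  simpl in He1, He2, He3, He4, He5, He6.
  pose proof (cond_pos e1). pose proof (cond_pos e2). pose proof (cond_pos e3).
  pose proof (cond_pos e4). pose proof (cond_pos e5). pose proof (cond_pos e6).
  assert (He : exists e, 0 < e /\ e <= e1 /\ e <= e2 /\ e <= e3 /\ e <= e4 /\ e <= e5 /\ e <= e6 /\ e <= r / 8 /\ e <= de / 4).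
  { exists (Rmin (Rmin (Rmin e1 e2) (Rmin e3 e4)) (Rmin (Rmin e5 e6) (Rmin (r / 8) (de / 4)))).
    unfold Rmin. repeat destruct Rle_dec; lra. }
  destruct He as [e [He0 [Hee1 [Hee2 [Hee3 [Hee4 [Hee5 [Hee6 [Her Hede]]]]]]]]].
  set (A := 2 * N / l0). assert (HA : 0 <= A) by (apply Rdiv_le_0_compat; lra).
  pose proof (Rabs_pos C) as HC0. pose proof (Rle_abs C) as HC1.
  assert (Hl : exists l, 0 < l /\ l <= l0 / 4 /\ l < kap /\ A * l < e ^ 2 / 4 /\ A * l <= de / 2 /\
     Rabs C * l <= de / 2 /\ 2 * A * l <= de /\ l <= de /\
     forall X Y, Rabs (X - x1) <= r -> Rabs (Y - y1) <= r -> V l X Y).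
  { set (B := 4 * A + Rabs C + 1). assert (HB : 1 <= B) by (unfold B; lra).
    set (mu := Rmin (e ^ 2 / 4) (de / 2)).
    assert (Hmu : 0 < mu /\ mu <= e ^ 2 / 4 /\ mu <= de / 2).
    { unfold mu. split; [apply Rmin_glb_lt; [|lra]; assert (0 < e ^ 2) by (apply pow_lt; lra); lra|].
      split; [apply Rmin_l|apply Rmin_r]. }
    destruct (HV (- x1 + r + Rabs y1) (Rmin (Rmin (l0 / 4) kap) (mu / B))) as [l [Hl HW]].
    { apply Rmin_glb_lt; [apply Rmin_glb_lt; lra|apply Rdiv_lt_0_compat; lra]. }
    assert (l < l0 / 4 /\ l < kap /\ l < mu / B).
    { revert Hl. unfold Rmin at 1 2. repeat destruct Rle_dec; lra. }
    assert (HBl : B * l < mu).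
    { apply Rmult_lt_reg_l with (/ B); [apply Rinv_0_lt_compat; lra|].
      rewrite <- Rmult_assoc, Rinv_l by lra. unfold Rdiv in *. lra. }
    assert (HAl : 0 <= A * l) by (apply Rmult_le_pos; lra).
    assert (HCl : 0 <= Rabs C * l) by (apply Rmult_le_pos; lra).
    replace (B * l) with (4 * (A * l) + Rabs C * l + l) in HBl by (unfold B; ring).
    exists l. repeat (split; [lra|]).
    intros X' Y' HX' HY'. apply Rabs_bd in HX'. pose proof (Rabs_pos y1). apply HW; try lra.
    replace Y' with ((Y' - y1) + y1) by ring. eapply Rle_trans; [apply Rabs_triang|]. lra. }
  destruct Hl as [l [Hl [Hll0 [Hlk [HlA [HlA2 [HlC [HlA3 [Hlde HVl]]]]]]]]].
  assert (Happ : forall X Y, Rabs (X - x1) <= r -> Rabs (Y - y1) <= r ->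
     Rabs (q l X Y - Q O X Y) <= A * l /\ Rabs (psi l X Y - Psi O X Y) <= A * l).
  { intros X Y HX HY. assert (HVl' := HVl X Y HX HY).
    destruct (HTT _ _ _ HVl') as [_ [_ [_ [_ [_ S1]]]]]. destruct (HSs _ _ _ HVl') as [S2 _].
    destruct (Hcb X Y HX HY) as [B1 [_ B2]].
    rewrite <- (is_pseries_unique _ _ _ S1), <- (is_pseries_unique _ _ _ S2).
    replace (A * l) with (2 * N * (l / l0)) by (unfold A; field; lra).
    split; [apply (coef_bound_PSeries_0 (fun k => Q k X Y))|apply (coef_bound_PSeries_0 (fun k => Psi k X Y))];
      try assumption; lra. }
  (* Because [|q l - Q O| <= A l < e^2 / 4] on the box, the penalty forces the maximum strictly
     inside it. *)
  destruct (continuous_rect_max (fun X Y => q l X Y - Q O X Y - ((X - x1) ^ 2 + (Y - y1) ^ 2))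
    (x1 - e) (x1 + e) (y1 - e) (y1 + e)) as [X [Y [HX [HY Hmax]]]]; try lra.
  { intros X Y HX HY.
    assert (HX' : Rabs (X - x1) <= r) by (apply Rabs_bd; lra).
    assert (HY' : Rabs (Y - y1) <= r) by (apply Rabs_bd; lra).
    apply (continuous_minus (V := R_NormedModule) (fun p : R * R => q l (fst p) (snd p) - Q O (fst p) (snd p))).
    - apply (continuous_minus (V := R_NormedModule) (fun p : R * R => q l (fst p) (snd p))).
      + apply (HTT _ _ _ (HVl X Y HX' HY')).
      + apply continuity_2d_continuous, cont_D_interior; [apply HQ|lra].
    - apply (continuous_ext (fun p : R * R => (fst p - x1) * (fst p - x1) + (snd p - y1) * (snd p - y1))).
      + intros p. simpl. ring.
      + cont. }
  assert (HX' : Rabs (X - x1) <= r) by (apply Rabs_bd; lra).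
  assert (HY' : Rabs (Y - y1) <= r) by (apply Rabs_bd; lra).
  assert (Hin : Rabs (X - x1) < e /\ Rabs (Y - y1) < e).
  { pose proof (Hmax x1 y1 ltac:(lra) ltac:(lra)) as HM.
    replace ((x1 - x1) ^ 2 + (y1 - y1) ^ 2) with 0 in HM by ring.
    destruct (Happ X Y HX' HY') as [B1 _]. destruct (Happ x1 y1 (proj1 Hc1) (proj2 Hc1)) as [B2 _].
    apply Rabs_bd in B1. apply Rabs_bd in B2.
    pose proof (pow2_ge_0 (X - x1)). pose proof (pow2_ge_0 (Y - y1)). pose proof (pow_lt e 2 He0).
    split; apply Rabs_lt_of_sqr; lra. }
  destruct Hin as [HiX HiY].
  destruct (HTT _ _ _ (HVl X Y HX' HY')) as [_ [DR [DZ [Dl [Heq _]]]]].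
  assert (HiX' := HiX). assert (HiY' := HiY). apply Rabs_bd' in HiX'. apply Rabs_bd' in HiY'.
  set (d := Rmin (Rmin (X - (x1 - e)) (x1 + e - X)) (Rmin (Y - (y1 - e)) (y1 + e - Y))).
  assert (Hd : 0 < d /\ d <= X - (x1 - e) /\ d <= x1 + e - X /\ d <= Y - (y1 - e) /\ d <= y1 + e - Y).
  { unfold d, Rmin. repeat destruct Rle_dec; lra. }
  assert (TR : qR l X Y - QR X Y - 2 * (X - x1) = 0).
  { apply (local_max_derive0 (fun x => q l x Y - Q O x Y - ((x - x1) ^ 2 + (Y - y1) ^ 2)) X _ d (proj1 Hd)).
    - apply (is_derive_minus (V := R_NormedModule) (fun x => q l x Y - Q O x Y)).
      + apply (is_derive_minus (V := R_NormedModule) (fun x => q l x Y)); [exact DR|].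
        apply (C1_D_derive_X _ QR QZ); [exact HQ|lra].
      + auto_derive; [tauto|ring].
    - intros y Hy. apply Rabs_bd' in Hy. apply Hmax; lra. }
  assert (TZ : qZ l X Y - QZ X Y - 2 * (Y - y1) = 0).
  { apply (local_max_derive0 (fun y => q l X y - Q O X y - ((X - x1) ^ 2 + (y - y1) ^ 2)) Y _ d (proj1 Hd)).
    - apply (is_derive_minus (V := R_NormedModule) (fun x => q l X x - Q O X x)).
      + apply (is_derive_minus (V := R_NormedModule) (fun x => q l X x)); [exact DZ|].
        apply (C1_D_derive_Z _ QR QZ); [exact HQ|lra].
      + auto_derive; [tauto|ring].
    - intros y Hy. apply Rabs_bd' in Hy. apply Hmax; lra. }
  (* For nearby parameters the point still belongs to the domain, so [q] is locally the sum of its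
     series in [l] and [ql] is the derivative of that sum. Hence [l ql] tends to [0]. *)
  assert (Hql : Rabs (ql l X Y) <= 2 * A).
  { destruct (Hcb X Y HX' HY') as [_ [_ B2]].
    destruct (coef_bound_derive _ l0 N l (proj1 Hl0) B2) as [dd [D1 D2]].
    { rewrite Rabs_pos_eq; lra. }
    assert (E : ql l X Y = dd).
    { rewrite <- (is_derive_unique _ _ _ Dl). apply is_derive_unique.
      apply (is_derive_ext_loc (PSeries (fun k => Q k X Y))); [|exact D1].
      generalize (HVo _ _ _ (HVl X Y HX' HY')). apply filter_imp. intros m Hm.
      apply is_pseries_unique. apply (HTT m X Y Hm). }
    rewrite E. replace (2 * A) with (4 * N / l0) by (unfold A; field; lra). exact D2. }
  destruct (Hgrad l ltac:(lra) HVl X Y ltac:(lra) ltac:(lra)) as [G1 G2].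
  assert (HCl : C * l <= de / 2).
  { eapply Rle_trans; [|exact HlC]. apply Rmult_le_compat_r; lra. }
  destruct (Happ X Y HX' HY') as [Q1 Q2].
  specialize (He1 X Y ltac:(lra) ltac:(lra)). specialize (He2 X Y ltac:(lra) ltac:(lra)).
  specialize (He3 X Y ltac:(lra) ltac:(lra)). specialize (He4 X Y ltac:(lra) ltac:(lra)).
  specialize (He5 X Y ltac:(lra) ltac:(lra)). specialize (He6 X Y ltac:(lra) ltac:(lra)).
  apply Rabs_bd' in He1. apply Rabs_bd' in He2. apply Rabs_bd' in He3. apply Rabs_bd' in He4.
  apply Rabs_bd' in He5. apply Rabs_bd' in He6.
  apply Rabs_bd in G1. apply Rabs_bd in G2. apply Rabs_bd in Q1. apply Rabs_bd in Q2.
  exists l, X, Y, (q l X Y), (qR l X Y), (qZ l X Y), (l * ql l X Y), (psi l X Y), (psiR l X Y), (psiZ l X Y).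
  rewrite Rminus_0_r, (Rabs_pos_eq l) by lra.
  split; [lra|]. split; [lra|]. split; [lra|].
  split; [apply Rabs_bd; lra|]. split; [apply Rabs_bd; lra|]. split; [apply Rabs_bd; lra|].
  split.
  { rewrite Rminus_0_r, Rabs_mult, (Rabs_pos_eq l) by lra.
    apply Rle_trans with (l * (2 * A)); [apply Rmult_le_compat_l; lra|]. lra. }
  split; [apply Rabs_bd; lra|]. split; [apply Rabs_bd; lra|]. split; [apply Rabs_bd; lra|].
  exact Heq.
Qed.

Lemma transport_limit V g c ka psi psiR psiZ w Psi Om q Q PR PZ OR OZ QR QZ :
  windows V -> (forall l X Y, V l X Y -> locally l (fun m => V m X Y)) ->
  stream_family V psi psiR psiZ w Psi Om -> transport_family V g c ka psi psiR psiZ q Q ->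
  (forall k, cont_D (Psi k)) -> (forall k, cont_D (Om k)) -> (forall k, cont_D (Q k)) ->
  C1_D_with (Psi O) PR PZ -> C1_D_with (Om O) OR OZ -> C1_D_with (Q O) QR QZ ->
  forall X Y, X <= 0 ->
    c * Q O X Y + (g * X - PZ X Y) * QR X Y + (g * Y + PR X Y) * QZ X Y = 0.
Proof.
  intros HV HVo HS HT HcP HcO HcQ HP HO HQ X Y HX.
  set (E := fun X Y => c * Q O X Y + (g * X - PZ X Y) * QR X Y + (g * Y + PR X Y) * QZ X Y).
  change (E X Y = 0). apply NNPP. intros HE.
  assert (Hc : continuity_2d_pt (fun X Y => c * Q O (Rmin X 0) Y + (g * Rmin X 0 - PZ (Rmin X 0) Y) * QR (Rmin X 0) Y +
     (g * Y + PR (Rmin X 0) Y) * QZ (Rmin X 0) Y) X Y).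
  { assert (Hmin : continuity_2d_pt (fun X _ => Rmin X 0) X Y).
    { apply (cont_D_clamp (fun X _ => X)). intros a b _ e He. exists e. split; [exact He|]. auto. }
    assert (HY : continuity_2d_pt (fun _ Y => Y) X Y).
    { intros e. exists e. auto. }
    repeat match goal with
    | |- continuity_2d_pt (fun _ _ => _ + _) _ _ => apply continuity_2d_pt_plus
    | |- continuity_2d_pt (fun _ _ => _ - _) _ _ => apply continuity_2d_pt_minus
    | |- continuity_2d_pt (fun _ _ => _ * _) _ _ => apply continuity_2d_pt_mult
    | |- continuity_2d_pt (fun _ _ => ?c) _ _ => apply continuity_2d_pt_const
    end; try exact Hmin; try exact HY;
    [apply (cont_D_clamp (Q O))|apply (cont_D_clamp PZ)|apply (cont_D_clamp QR)|
     apply (cont_D_clamp PR)|apply (cont_D_clamp QZ)]; first [apply HQ|apply HP]. }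
  assert (Ha : 0 < Rabs (E X Y)) by (apply Rabs_pos_lt; exact HE).
  destruct (Hc (mkposreal _ Ha)) as [d Hd]. simpl in Hd. pose proof (cond_pos d).
  (* The shift by [d / 2] and the radius [d / 4] place the search box in the open half plane, even
     when [X = 0], and within [d] of [(X, Y)]. *)
  destruct (transport_limit_dense V g c ka psi psiR psiZ w Psi Om q Q PR PZ OR OZ QR QZ HV HVo HS HT HcP HcO HcQ
    HP HO HQ (X - d / 2) Y (d / 4)) as [X' [Y' [H1 [H2 [H3 H4]]]]]; try lra.
  apply Rabs_bd' in H1. apply Rabs_bd' in H2.
  specialize (Hd X' Y' ltac:(apply Rabs_bd'; lra) ltac:(apply Rabs_bd'; lra)).
  rewrite !Rmin_left in Hd by lra. fold (E X' Y') (E X Y) in Hd.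
  assert (E X' Y' = 0).
  { rewrite <- H4. unfold E, transport_op. ring. }
  rewrite H0, Rminus_0_l, Rabs_Ropp in Hd. lra.
Qed.

(** * Energy identity *)

Ltac toR := match goal with |- ?a = ?b => change (@eq R a b) end.

Lemma RInt_plus_R (f g : R -> R) a b : ex_RInt f a b -> ex_RInt g a b ->
  RInt (fun y => f y + g y) a b = RInt f a b + RInt g a b.
Proof. exact (RInt_plus (V := R_CompleteNormedModule) f g a b). Qed.

Lemma RInt_minus_R (f g : R -> R) a b : ex_RInt f a b -> ex_RInt g a b ->
  RInt (fun y => f y - g y) a b = RInt f a b - RInt g a b.
Proof. exact (RInt_minus (V := R_CompleteNormedModule) f g a b). Qed.

Lemma RInt_scal_R (f : R -> R) k a b : ex_RInt f a b ->
  RInt (fun y => k * f y) a b = k * RInt f a b.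
Proof. exact (RInt_scal (V := R_CompleteNormedModule) f a b k). Qed.

(** Derivatives in [X] are two-sided only for [X < 0]. Integrals therefore end at some [b < 0], and
    the flux through [X = b] is estimated separately. *)
Definition cneg (f : R -> R -> R) : Prop := forall X Y, X < 0 -> continuity_2d_pt f X Y.

Definition dint (f : R -> R -> R) (a b c d : R) : R := RInt (fun X => RInt (fun Y => f X Y) c d) a b.

Lemma continuity_2d_slice f X Y : continuity_2d_pt f X Y -> continuous (fun y => f X y) Y.
Proof.
  intros H. apply filterlim_locally. intros e. destruct (H e) as [d Hd]. exists d. intros y Hy.
  apply Hd; [rewrite Rminus_diag, Rabs_R0; apply cond_pos|exact Hy].
Qed.

Lemma cneg_ex_RInt f X c d : cneg f -> X < 0 -> ex_RInt (fun Y => f X Y) c d.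
Proof.
  intros Hf HX. apply (ex_RInt_continuous (V := R_CompleteNormedModule)). intros Y _.
  apply continuity_2d_slice, Hf, HX.
Qed.

Lemma cneg_continuous_RInt f X c d : cneg f -> X < 0 -> c <= d -> continuous (fun X => RInt (fun Y => f X Y) c d) X.
Proof.
  intros Hf HX Hcd. apply filterlim_locally. intros e.
  set (e' := e / (2 * (d - c + 1))). pose proof (cond_pos e).
  assert (He' : 0 < e') by (apply Rdiv_lt_0_compat; lra).
  destruct (uniform_continuity_2d f (2 * X) (X / 2) c d) with (eps := mkposreal _ He') as [de Hde].
  { intros x y Hx Hy. apply Hf. lra. }
  simpl in Hde. pose proof (cond_pos de).
  assert (Hm : 0 < Rmin de (- X / 2)) by (apply Rmin_glb_lt; lra).
  exists (mkposreal _ Hm). intros X' HX'. change (Rabs (X' - X) < Rmin de (- X / 2)) in HX'.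
  pose proof (Rmin_l de (- X / 2)). pose proof (Rmin_r de (- X / 2)). assert (HX2 := HX'). apply Rabs_bd' in HX2.
  change (Rabs (RInt (fun Y => f X' Y) c d - RInt (fun Y => f X Y) c d) < e).
  assert (E1 := cneg_ex_RInt f X' c d Hf ltac:(lra)). assert (E2 := cneg_ex_RInt f X c d Hf HX).
  rewrite <- (RInt_minus_R (fun Y => f X' Y) (fun Y => f X Y) c d E1 E2).
  eapply Rle_lt_trans.
  - apply (abs_RInt_le_const _ c d e' Hcd).
    + apply (ex_RInt_minus (V := R_NormedModule)); assumption.
    + intros t Ht. change (Rabs (f X' t - f X t) <= e'). apply Rlt_le, Hde; try lra.
      rewrite Rminus_diag, Rabs_R0. lra.
  - unfold e'. apply Rmult_lt_reg_r with (2 * (d - c + 1)); [lra|].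
    replace ((d - c) * (e / (2 * (d - c + 1))) * (2 * (d - c + 1))) with ((d - c) * e) by (field; lra). nra.
Qed.

Lemma cneg_ex_dint f a b c d : cneg f -> a <= b -> b < 0 -> c <= d ->
  ex_RInt (fun X => RInt (fun Y => f X Y) c d) a b.
Proof.
  intros Hf Hab Hb Hcd. apply (ex_RInt_continuous (V := R_CompleteNormedModule)). intros X HX.
  rewrite Rmin_left, Rmax_right in HX by lra. apply cneg_continuous_RInt; [exact Hf|lra|exact Hcd].
Qed.

Lemma cneg_plus f g : cneg f -> cneg g -> cneg (fun X Y => f X Y + g X Y).
Proof. intros Hf Hg X Y HX. apply continuity_2d_pt_plus; auto. Qed.

Lemma cneg_minus f g : cneg f -> cneg g -> cneg (fun X Y => f X Y - g X Y).
Proof. intros Hf Hg X Y HX. apply continuity_2d_pt_minus; auto. Qed.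

Lemma cneg_mult f g : cneg f -> cneg g -> cneg (fun X Y => f X Y * g X Y).
Proof. intros Hf Hg X Y HX. apply continuity_2d_pt_mult; auto. Qed.

Lemma cneg_const k : cneg (fun _ _ => k).
Proof. intros X Y HX. apply continuity_2d_pt_const. Qed.

Ltac cnegs := repeat match goal with
  | |- cneg (fun _ _ => _ + _) => apply cneg_plus
  | |- cneg (fun _ _ => _ - _) => apply cneg_minus
  | |- cneg (fun _ _ => _ * _) => apply cneg_mult
  | |- cneg (fun _ _ => ?c) => apply cneg_const
  | _ => assumption
  end.

Lemma cneg_X : cneg (fun X _ => X).
Proof. intros X Y HX e. exists e. auto. Qed.

Lemma cneg_Y : cneg (fun _ Y => Y).
Proof. intros X Y HX e. exists e. auto. Qed.

Lemma cneg_Zshift f h : cneg f -> cneg (fun X Y => f X (Y + h)).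
Proof.
  intros Hf X Y HX. apply continuity_2d_continuous, continuous_Zshift, continuity_2d_continuous. apply Hf, HX.
Qed.

Lemma dint_plus f g a b c d : cneg f -> cneg g -> a <= b -> b < 0 -> c <= d ->
  dint (fun X Y => f X Y + g X Y) a b c d = dint f a b c d + dint g a b c d.
Proof.
  intros Hf Hg Hab Hb Hcd. unfold dint.
  rewrite <- RInt_plus_R by (apply cneg_ex_dint; assumption).
  apply RInt_ext. intros X HX. rewrite Rmin_left, Rmax_right in HX by lra.
  apply (RInt_plus_R (fun Y => f X Y) (fun Y => g X Y)); apply cneg_ex_RInt; auto; lra.
Qed.

Lemma dint_scal f k a b c d : cneg f -> a <= b -> b < 0 -> c <= d ->
  dint (fun X Y => k * f X Y) a b c d = k * dint f a b c d.
Proof.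
  intros Hf Hab Hb Hcd. unfold dint.
  rewrite <- RInt_scal_R by (apply cneg_ex_dint; assumption).
  apply RInt_ext. intros X HX. rewrite Rmin_left, Rmax_right in HX by lra.
  apply (RInt_scal_R (fun Y => f X Y)); apply cneg_ex_RInt; auto; lra.
Qed.

Lemma dint_ext f g a b c d : a <= b -> b < 0 -> c <= d ->
  (forall X Y, a <= X <= b -> c <= Y <= d -> f X Y = g X Y) -> dint f a b c d = dint g a b c d.
Proof.
  intros Hab Hb Hcd H. unfold dint. apply RInt_ext. intros X HX. rewrite Rmin_left, Rmax_right in HX by lra.
  apply RInt_ext. intros Y HY. rewrite Rmin_left, Rmax_right in HY by lra. apply H; lra.
Qed.

Lemma dint_bound f a b c d M : cneg f -> a <= b -> b < 0 -> c <= d ->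
  (forall X Y, a <= X <= b -> c <= Y <= d -> Rabs (f X Y) <= M) ->
  Rabs (dint f a b c d) <= (b - a) * ((d - c) * M).
Proof.
  intros Hf Hab Hb Hcd H. unfold dint. apply abs_RInt_le_const; [exact Hab|apply cneg_ex_dint; assumption|].
  intros X HX. apply abs_RInt_le_const; [exact Hcd|apply cneg_ex_RInt; [exact Hf|lra]|].
  intros Y HY. apply H; assumption.
Qed.

Lemma cneg_bounded f a b c d : cneg f -> a <= b -> b < 0 -> c <= d ->
  exists M, 0 <= M /\ forall X Y, a <= X <= b -> c <= Y <= d -> Rabs (f X Y) <= M.
Proof.
  intros Hf Hab Hb Hcd.
  destruct (continuous_rect_max (fun X Y => Rabs (f X Y)) a b c d Hab Hcd) as [X [Y [HX [HY H]]]].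
  { intros X Y HX HY. apply (continuous_comp (fun p : R * R => f (fst p) (snd p)) Rabs).
    - apply continuity_2d_continuous, Hf. lra.
    - apply continuous_Rabs. }
  exists (Rabs (f X Y)). split; [apply Rabs_pos|exact H].
Qed.

Lemma dint_derive_X A AX a b c d : a <= b -> b < 0 -> c <= d -> cneg A -> cneg AX ->
  (forall X Y, X < 0 -> is_derive (fun x => A x Y) X (AX X Y)) ->
  (forall Y, c <= Y <= d -> A a Y = 0) ->
  dint AX a b c d = RInt (fun Y => A b Y) c d.
Proof.
  intros Hab Hb Hcd HA HAX HD H0. unfold dint.
  assert (Hder : forall X, X < 0 -> is_derive (fun X => RInt (fun Y => A X Y) c d) X (RInt (fun Y => AX X Y) c d)).
  { intros X HX.
    assert (Hloc : locally X (fun x => x < 0)).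
    { exists (mkposreal (- X) ltac:(lra)). intros x Hx. change (Rabs (x - X) < - X) in Hx. apply Rabs_bd' in Hx. lra. }
    assert (HDX : forall x t, x < 0 -> Derive (fun u => A u t) x = AX x t).
    { intros x t Hx. apply is_derive_unique, HD, Hx. }
    rewrite (RInt_ext (fun Y => AX X Y) (fun t => Derive (fun u => A u t) X)).
    2:{ intros t _. symmetry. apply HDX, HX. }
    apply is_derive_RInt_param.
    - revert Hloc. apply filter_imp. intros x Hx t _. exists (AX x t). apply HD, Hx.
    - intros t _. apply (continuity_2d_pt_ext_loc AX); [|apply HAX, HX].
      exists (mkposreal (- X) ltac:(lra)). intros u v Hu _. simpl in Hu. apply Rabs_bd' in Hu.
      symmetry. apply HDX. lra.
    - revert Hloc. apply filter_imp. intros x Hx. apply cneg_ex_RInt; assumption. }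
  assert (E : is_RInt (fun X => RInt (fun Y => AX X Y) c d) a b
    (RInt (fun Y => A b Y) c d - RInt (fun Y => A a Y) c d)).
  { apply (is_RInt_derive (V := R_CompleteNormedModule) (fun X => RInt (fun Y => A X Y) c d)).
    - intros X HX. rewrite Rmin_left, Rmax_right in HX by lra. apply Hder. lra.
    - intros X HX. rewrite Rmin_left, Rmax_right in HX by lra. apply cneg_continuous_RInt; [exact HAX|lra|exact Hcd]. }
  apply is_RInt_unique in E. rewrite E, (RInt_ext (fun Y => A a Y) (fun _ => 0)).
  - rewrite RInt_const. change (RInt (fun Y => A b Y) c d - (d - c) * 0 = RInt (fun Y => A b Y) c d). ring.
  - intros Y HY. rewrite Rmin_left, Rmax_right in HY by lra. apply H0. lra.
Qed.

Lemma dint_derive_Y B BY a b c d : a <= b -> b < 0 -> c <= d -> cneg BY ->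
  (forall X Y, X < 0 -> is_derive (fun y => B X y) Y (BY X Y)) ->
  (forall X, B X c = 0 /\ B X d = 0) ->
  dint BY a b c d = 0.
Proof.
  intros Hab Hb Hcd HBY HD H0. unfold dint.
  rewrite (RInt_ext _ (fun _ => 0)).
  - rewrite RInt_const. apply Rmult_0_r.
  - intros X HX. rewrite Rmin_left, Rmax_right in HX by lra.
    assert (E : is_RInt (fun Y => BY X Y) c d (B X d - B X c)).
    { apply (is_RInt_derive (V := R_CompleteNormedModule) (fun Y => B X Y)).
      - intros Y _. apply HD. lra.
      - intros Y _. apply continuity_2d_slice, HBY. lra. }
    apply (is_RInt_unique (V := R_CompleteNormedModule)) in E. rewrite E. destruct (H0 X) as [-> ->]. apply Rminus_diag.
Qed.

Lemma uniform_quotient_Z f fZ a b c d e : a <= b -> b < 0 -> c <= d -> cneg fZ -> 0 < e ->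
  (forall X Y, X < 0 -> is_derive (fun y => f X y) Y (fZ X Y)) ->
  exists de, 0 < de <= 1 /\ forall h X Y, h <> 0 -> Rabs h < de -> a <= X <= b -> c <= Y <= d ->
    Rabs ((f X (Y + h) - f X Y) / h - fZ X Y) <= e.
Proof.
  intros Hab Hb Hcd HfZ He HD.
  destruct (uniform_continuity_2d fZ a b (c - 1) (d + 1)) with (eps := mkposreal _ He) as [de Hde].
  { intros X Y HX HY. apply HfZ. lra. }
  simpl in Hde. pose proof (cond_pos de).
  exists (Rmin de 1). split; [split; [apply Rmin_glb_lt; lra|apply Rmin_r]|].
  pose proof (Rmin_l de 1). pose proof (Rmin_r de 1).
  intros h X Y Hh0 Hh HX HY. 
  destruct (MVT_gen (fun y => f X y) Y (Y + h) (fun y => fZ X y)) as [xi [Hxi E]].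
  - intros y _. apply HD. lra.
  - intros y _. apply derivable_continuous_pt. exists (fZ X y). apply is_derive_Reals, HD. lra.
  - rewrite E. replace (fZ X xi * (Y + h - Y) / h) with (fZ X xi) by (field; exact Hh0).
    assert (Hx : Rabs (xi - Y) <= Rabs h).
    { revert Hxi. unfold Rmin, Rmax, Rabs. repeat destruct Rle_dec; repeat destruct Rcase_abs; lra. }
    apply Rlt_le, Hde; try lra.
    + apply Rabs_bd in Hx. lra.
    + rewrite Rminus_diag, Rabs_R0. lra.
Qed.

(** Integration by parts for difference quotients is a translation of the variable by [h]. As [f]
    vanishes within distance one of both ends and [h <= 1], the translated interval gives the same
    integral. *)
Lemma RInt_by_parts_shift (f g : R -> R) c d h : c <= d -> 0 < h <= 1 ->
  (forall y, continuous f y) -> (forall y, continuous g y) ->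
  (forall y, y <= c + 1 -> f y = 0) -> (forall y, d - 1 <= y -> f y = 0) ->
  RInt (fun y => f y * ((g (y + h) - g y) / h)) c d = - RInt (fun y => g y * ((f (y + - h) - f y) / - h)) c d.
Proof.
  intros Hcd Hh Hf Hg Hfc Hfd.
  assert (Hsh : forall (k : R -> R) u y, (forall y, continuous k y) -> continuous (fun y => k (y + u)) y).
  { intros k u y Hk. apply (continuous_comp (fun y => y + u) k); [|apply Hk].
    apply (continuous_plus (V := R_NormedModule)); [apply continuous_id|apply continuous_const]. }
  set (k := fun y => f (y + - h) * g y).
  assert (Hk : forall y, continuous k y).
  { intros y. apply (continuous_mult (K := R_AbsRing)); [apply Hsh, Hf|apply Hg]. }
  assert (Hek : forall u v, ex_RInt k u v) by (intros; apply (ex_RInt_continuous (V := R_CompleteNormedModule)); intros; apply Hk).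
  set (m := fun y => f y * g y).
  assert (Hm : forall y, continuous m y) by (intros y; apply (continuous_mult (K := R_AbsRing)); [apply Hf|apply Hg]).
  assert (Hem : forall u v, ex_RInt m u v) by (intros; apply (ex_RInt_continuous (V := R_CompleteNormedModule)); intros; apply Hm).
  set (n := fun y => f y * g (y + h)).
  assert (Hn : forall y, continuous n y).
  { intros y. apply (continuous_mult (K := R_AbsRing)); [apply Hf|apply Hsh, Hg]. }
  assert (Hen : forall u v, ex_RInt n u v) by (intros; apply (ex_RInt_continuous (V := R_CompleteNormedModule)); intros; apply Hn).
  assert (Enk : RInt n c d = RInt k c d).
  { assert (E1 : RInt n c d = RInt k (c + h) (d + h)).
    { assert (E0 := RInt_comp_lin (V := R_CompleteNormedModule) k 1 h c d (Hek _ _)).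
      rewrite (Rmult_1_l c), (Rmult_1_l d) in E0. rewrite <- E0. apply RInt_ext.
      intros y _. unfold scal; simpl. unfold mult; simpl. unfold n, k. rewrite !Rmult_1_l.
      replace (y + h + - h) with y by ring. reflexivity. }
    rewrite E1.
    assert (Z1 : RInt k c (c + h) = 0).
    { rewrite (RInt_ext k (fun _ => 0)); [rewrite RInt_const; apply Rmult_0_r|].
      intros y Hy. rewrite Rmin_left, Rmax_right in Hy by lra. unfold k. rewrite Hfc by lra. apply Rmult_0_l. }
    assert (Z2 : RInt k d (d + h) = 0).
    { rewrite (RInt_ext k (fun _ => 0)); [rewrite RInt_const; apply Rmult_0_r|].
      intros y Hy. rewrite Rmin_left, Rmax_right in Hy by lra. unfold k. rewrite Hfd by lra. apply Rmult_0_l. }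
    assert (C1 : RInt k c (c + h) + RInt k (c + h) (d + h) = RInt k c (d + h))
      by (apply (RInt_Chasles (V := R_CompleteNormedModule) k); apply Hek).
    assert (C2 : RInt k c d + RInt k d (d + h) = RInt k c (d + h))
      by (apply (RInt_Chasles (V := R_CompleteNormedModule) k); apply Hek).
    lra. }
  rewrite (RInt_ext _ (fun y => / h * (n y - m y))).
  2:{ intros y _. unfold n, m. toR. field. lra. }
  rewrite (RInt_ext (fun y => g y * ((f (y + - h) - f y) / - h)) (fun y => / h * (m y - k y))).
  2:{ intros y _. unfold k, m. toR. field. lra. }
  rewrite !RInt_scal_R by (apply (ex_RInt_minus (V := R_NormedModule)); auto).
  rewrite !RInt_minus_R by auto. rewrite Enk. toR. ring.
Qed.

(* Integration by parts for the bracket of two functions that are only [C^1]: the derivative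
   falling on [P] in the [Z] direction is replaced by a difference quotient. *)
Lemma dint_bracket P PR PZ phi phiR phiZ a b c d : a <= b -> b < 0 -> c <= d ->
  cneg P -> cneg PR -> cneg PZ -> cneg phi -> cneg phiR -> cneg phiZ ->
  (forall X Y, X < 0 -> is_derive (fun x => P x Y) X (PR X Y)) ->
  (forall X Y, X < 0 -> is_derive (fun y => P X y) Y (PZ X Y)) ->
  (forall X Y, X < 0 -> is_derive (fun x => phi x Y) X (phiR X Y)) ->
  (forall X Y, X < 0 -> is_derive (fun y => phi X y) Y (phiZ X Y)) ->
  (forall Y, phi a Y = 0) -> (forall X Y, Y <= c + 1 -> phi X Y = 0) -> (forall X Y, d - 1 <= Y -> phi X Y = 0) ->
  dint (fun X Y => PZ X Y * phiR X Y - PR X Y * phiZ X Y) a b c d = RInt (fun Y => phi b Y * PZ b Y) c d.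
Proof.
  intros Hab Hb Hcd HP HPR HPZ Hphi HphiR HphiZ DPR DPZ DphiR DphiZ Ha Hc Hd.
  destruct (cneg_bounded phiR a b c d HphiR Hab Hb Hcd) as [B1 [HB1 HB1b]].
  destruct (cneg_bounded PR a b c d HPR Hab Hb Hcd) as [B2 [HB2 HB2b]].
  destruct (cneg_bounded phi a b c d Hphi Hab Hb Hcd) as [B3 [HB3 HB3b]].
  apply Rminus_diag_uniq, Rabs_eq_0, Rle_antisym; [|apply Rabs_pos].
  apply le_epsilon. intros e He. rewrite Rplus_0_l.
  set (K := (b - a) * ((d - c) * (B1 + B2)) + (d - c) * B3 + 1).
  assert (HK1 : 0 <= (b - a) * ((d - c) * (B1 + B2))) by (repeat apply Rmult_le_pos; lra).
  assert (HK2 : 0 <= (d - c) * B3) by (apply Rmult_le_pos; lra).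
  assert (HK : 0 < K) by (unfold K; lra).
  set (e' := e / K). assert (He' : 0 < e') by (apply Rdiv_lt_0_compat; lra).
  destruct (uniform_quotient_Z P PZ a b c d e' Hab Hb Hcd HPZ He' DPZ) as [d1 [Hd1 HQ1]].
  destruct (uniform_quotient_Z phi phiZ a b c d e' Hab Hb Hcd HphiZ He' DphiZ) as [d2 [Hd2 HQ2]].
  set (h := Rmin d1 d2 / 2).
  assert (Hh : 0 < h < d1 /\ h < d2).
  { unfold h, Rmin. destruct Rle_dec; lra. }
  set (DP := fun X Y => (P X (Y + h) - P X Y) / h).
  set (DPR' := fun X Y => (PR X (Y + h) - PR X Y) / h).
  set (Dphi := fun X Y => (phi X (Y + - h) - phi X Y) / - h).
  assert (CDP : cneg DP).
  { unfold DP, Rdiv. apply cneg_mult; [|apply cneg_const]. apply cneg_minus; [|exact HP]. apply cneg_Zshift, HP. }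
  assert (CDPR : cneg DPR').
  { unfold DPR', Rdiv. apply cneg_mult; [|apply cneg_const]. apply cneg_minus; [|exact HPR]. apply cneg_Zshift, HPR. }
  assert (CDphi : cneg Dphi).
  { unfold Dphi, Rdiv. apply cneg_mult; [|apply cneg_const]. apply cneg_minus; [|exact Hphi]. apply cneg_Zshift, Hphi. }
  (* With the quotient [DP] in place of [PZ], the product [phi DP] can be differentiated in [X]
     using [PR] alone. [I2] then moves the quotient from [PR] to [phi], and both quotients converge
     uniformly. *)
  assert (I1 : dint (fun X Y => phiR X Y * DP X Y + phi X Y * DPR' X Y) a b c d = RInt (fun Y => phi b Y * DP b Y) c d).
  { apply (dint_derive_X (fun X Y => phi X Y * DP X Y)); try assumption.
    - apply cneg_mult; assumption.
    - apply cneg_plus; apply cneg_mult; assumption.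
    - intros X Y HX.
      apply (is_derive_mult (K := R_AbsRing) (fun x => phi x Y) (fun x => DP x Y)); [apply DphiR, HX| |exact Rmult_comm].
      unfold DP, DPR'. apply (is_derive_ext (fun x => / h * (P x (Y + h) - P x Y))); [intros; apply Rmult_comm|].
      replace ((PR X (Y + h) - PR X Y) / h) with (/ h * (PR X (Y + h) - PR X Y)) by apply Rmult_comm.
      apply is_derive_scal. apply (is_derive_minus (V := R_NormedModule)); apply DPR, HX.
    - intros Y _. rewrite Ha. ring. }
  assert (I2 : dint (fun X Y => phi X Y * DPR' X Y) a b c d = - dint (fun X Y => PR X Y * Dphi X Y) a b c d).
  { replace (- dint (fun X Y => PR X Y * Dphi X Y) a b c d) with (-1 * dint (fun X Y => PR X Y * Dphi X Y) a b c d) by ring.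
    unfold dint. rewrite <- RInt_scal_R.
    2:{ apply (cneg_ex_dint (fun X Y => PR X Y * Dphi X Y)); try assumption. apply cneg_mult; assumption. }
    apply RInt_ext. intros X HX. rewrite Rmin_left, Rmax_right in HX by lra.
    unfold DPR', Dphi. rewrite (RInt_by_parts_shift (fun Y => phi X Y) (fun Y => PR X Y) c d h); try lra.
    - intros y. apply continuity_2d_slice, Hphi. lra.
    - intros y. apply continuity_2d_slice, HPR. lra.
    - intros y Hy. apply Hc, Hy.
    - intros y Hy. apply Hd, Hy. }
  rewrite dint_plus, I2 in I1 by cnegs.
  assert (J1 : Rabs (dint (fun X Y => (PZ X Y * phiR X Y - PR X Y * phiZ X Y) + -1 * (phiR X Y * DP X Y + -1 * (PR X Y * Dphi X Y))) a b c d)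
     <= (b - a) * ((d - c) * ((B1 + B2) * e'))).
  { apply dint_bound; try assumption.
    - cnegs.
    - intros X Y HX HY.
      replace (PZ X Y * phiR X Y - PR X Y * phiZ X Y + -1 * (phiR X Y * DP X Y + -1 * (PR X Y * Dphi X Y))) with
        (- (phiR X Y * (DP X Y - PZ X Y)) + PR X Y * (Dphi X Y - phiZ X Y)) by ring.
      eapply Rle_trans; [apply Rabs_triang|]. rewrite Rabs_Ropp, !Rabs_mult, Rmult_plus_distr_r.
      apply Rplus_le_compat; apply Rmult_le_compat; try apply Rabs_pos; auto.
      + apply HQ1; try assumption; [lra|rewrite Rabs_pos_eq; lra].
      + apply HQ2; try assumption; [lra|rewrite Rabs_Ropp, Rabs_pos_eq; lra]. }
  rewrite dint_plus, dint_scal, dint_plus, dint_scal in J1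
    by cnegs.
  assert (J2 : Rabs (RInt (fun Y => phi b Y * DP b Y) c d - RInt (fun Y => phi b Y * PZ b Y) c d) <= (d - c) * (B3 * e')).
  { assert (X1 : ex_RInt (fun Y => phi b Y * DP b Y) c d)
      by (apply (cneg_ex_RInt (fun X Y => phi X Y * DP X Y)); [apply cneg_mult; assumption|lra]).
    assert (X2 : ex_RInt (fun Y => phi b Y * PZ b Y) c d)
      by (apply (cneg_ex_RInt (fun X Y => phi X Y * PZ X Y)); [apply cneg_mult; assumption|lra]).
    rewrite <- (RInt_minus_R _ _ c d X1 X2).
    apply abs_RInt_le_const; [exact Hcd|apply (ex_RInt_minus (V := R_NormedModule)); assumption|].
    intros Y HY.
    replace (phi b Y * DP b Y - phi b Y * PZ b Y) with (phi b Y * (DP b Y - PZ b Y)) by ring.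
    rewrite Rabs_mult. apply Rmult_le_compat; try apply Rabs_pos.
    - apply HB3b; lra.
    - apply HQ1; try lra. rewrite Rabs_pos_eq; lra. }
  replace e with (K * e') by (unfold e'; field; lra).
  assert (EK : K * e' = (b - a) * ((d - c) * ((B1 + B2) * e')) + (d - c) * (B3 * e') + e') by (unfold K; ring).
  apply Rabs_bd in J1. apply Rabs_bd in J2. apply Rabs_bd. lra.
Qed.

(** Mere continuity is enough, because the cutoff is a primitive. The support [1 <= s <= 4]
    corresponds to [rho <= |Y| <= 2 rho], the annulus of the integral hypothesis. *)
Definition bump (s : R) : R := Rmax 0 ((4 - s) * (s - 1)).

(* Applied to [s = |Y|^2 / rho^2]. *)
Definition cutoff (s : R) : R := RInt bump s 4.

Lemma continuous_bump s : continuous bump s.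
Proof.
  apply (continuous_ext (fun s => (Rabs ((4 - s) * (s - 1)) + (4 - s) * (s - 1)) * (1 / 2))).
  { intros t. unfold bump, Rmax, Rabs. destruct Rle_dec, Rcase_abs; lra. }
  assert (H : continuous (fun s => (4 - s) * (s - 1)) s).
  { apply (continuous_mult (K := R_AbsRing) (fun s => 4 - s) (fun s => s - 1));
      apply (continuous_minus (V := R_NormedModule)); (apply continuous_const || apply continuous_id). }
  apply (continuous_mult (K := R_AbsRing) (fun s => Rabs ((4 - s) * (s - 1)) + (4 - s) * (s - 1)));
    [|apply continuous_const].
  apply (continuous_plus (V := R_NormedModule) (fun s => Rabs ((4 - s) * (s - 1)))); [|exact H].
  apply (continuous_comp (fun s => (4 - s) * (s - 1)) Rabs); [exact H|apply continuous_Rabs].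
Qed.

Lemma ex_RInt_bump a b : ex_RInt bump a b.
Proof. apply (ex_RInt_continuous (V := R_CompleteNormedModule)). intros; apply continuous_bump. Qed.

Lemma bump_bounds s : 0 <= bump s <= 9 / 4.
Proof.
  split; [apply Rmax_l|]. apply Rmax_lub; [lra|].
  pose proof (pow2_ge_0 (s - 5 / 2)). lra.
Qed.

Lemma bump_out s : s <= 1 \/ 4 <= s -> bump s = 0.
Proof.
  intros H. apply Rmax_left. destruct H as [H|H].
  - assert (0 <= (4 - s) * (1 - s)) by (apply Rmult_le_pos; lra). lra.
  - assert (0 <= (s - 4) * (s - 1)) by (apply Rmult_le_pos; lra). lra.
Qed.

Lemma is_derive_cutoff s : is_derive cutoff s (- bump s).
Proof.
  apply (is_derive_RInt' (V := R_CompleteNormedModule) bump cutoff s 4).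
  - apply filter_forall. intros t. apply (RInt_correct (V := R_CompleteNormedModule)), ex_RInt_bump.
  - apply continuous_bump.
Qed.

Lemma RInt_zero_on (f : R -> R) a b : a <= b -> (forall x, a < x < b -> f x = 0) -> RInt f a b = 0.
Proof.
  intros Hab H. rewrite (RInt_ext f (fun _ => 0)).
  - rewrite RInt_const. apply Rmult_0_r.
  - intros x Hx. rewrite Rmin_left, Rmax_right in Hx by lra. apply H, Hx.
Qed.

Lemma RInt_Chasles_R (f : R -> R) a b c : ex_RInt f a b -> ex_RInt f b c ->
  RInt f a b + RInt f b c = RInt f a c.
Proof. exact (RInt_Chasles (V := R_CompleteNormedModule) f a b c). Qed.

Lemma cutoff_out s : 4 <= s -> cutoff s = 0.
Proof.
  intros Hs. unfold cutoff. rewrite <- (opp_RInt_swap (V := R_CompleteNormedModule)) by apply ex_RInt_bump.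
  rewrite RInt_zero_on; [apply Ropp_0|exact Hs|]. intros x Hx. apply bump_out. lra.
Qed.

Lemma cutoff_in s : s <= 1 -> cutoff s = cutoff 1.
Proof.
  intros Hs. unfold cutoff. rewrite <- (RInt_Chasles_R bump s 1 4) by apply ex_RInt_bump.
  rewrite (RInt_zero_on bump s 1); [apply Rplus_0_l|exact Hs|]. intros x Hx. apply bump_out. lra.
Qed.

Lemma cutoff_1_pos : 0 < cutoff 1.
Proof.
  apply RInt_gt_0; [lra| |intros; apply continuous_bump].
  intros x Hx. unfold bump. assert (0 < (4 - x) * (x - 1)) by (apply Rmult_lt_0_compat; lra).
  rewrite Rmax_right; lra.
Qed.

Lemma cutoff_bounds s : 0 <= cutoff s <= cutoff 1.
Proof.
  destruct (Rle_dec 4 s) as [H|H].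
  { rewrite cutoff_out by exact H. pose proof cutoff_1_pos. lra. }
  destruct (Rle_dec s 1) as [H1|H1].
  { rewrite cutoff_in by exact H1. pose proof cutoff_1_pos. lra. }
  assert (A : forall a b, a <= b -> 0 <= RInt bump a b).
  { intros a b Hab. apply RInt_ge_0; [exact Hab|apply ex_RInt_bump|]. intros; apply bump_bounds. }
  unfold cutoff. split; [apply A; lra|].
  rewrite <- (RInt_Chasles_R bump 1 s 4) by apply ex_RInt_bump. pose proof (A 1 s). lra.
Qed.

Lemma RInt_sub_le (f : R -> R) a b c d : a <= c -> c <= d -> d <= b ->
  ex_RInt f a b -> (forall x, a < x < b -> 0 <= f x) -> RInt f c d <= RInt f a b.
Proof.
  intros H1 H2 H3 Hf Hp.
  assert (E1 : ex_RInt f a c) by (apply (ex_RInt_Chasles_1 (V := R_CompleteNormedModule) f a c b); [lra|exact Hf]).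
  assert (E2 : ex_RInt f c b) by (apply (ex_RInt_Chasles_2 (V := R_CompleteNormedModule) f a c b); [lra|exact Hf]).
  assert (E3 : ex_RInt f c d) by (apply (ex_RInt_Chasles_1 (V := R_CompleteNormedModule) f c d b); [lra|exact E2]).
  assert (E4 : ex_RInt f d b) by (apply (ex_RInt_Chasles_2 (V := R_CompleteNormedModule) f c d b); [lra|exact E2]).
  rewrite <- (RInt_Chasles_R f a c b E1 E2), <- (RInt_Chasles_R f c d b E3 E4).
  assert (0 <= RInt f a c) by (apply RInt_ge_0; [lra|exact E1|intros; apply Hp; lra]).
  assert (0 <= RInt f d b) by (apply RInt_ge_0; [lra|exact E4|intros; apply Hp; lra]). lra.
Qed.

Lemma RInt_val_RInt f a b v : Defs.RInt_val f a b v -> ex_RInt f a b /\ RInt f a b = v.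
Proof.
  intros [pr <-]. split; [apply ex_RInt_Reals_1, pr|apply RInt_Reals].
Qed.

(** The rectangle exceeds the annulus by one in [Y], the margin that integration by parts requires;
    [h] vanishes there. The strip [b < X < 0] of the annulus integral is dropped because [J] is
    nonnegative. *)
Lemma annulus_comparison J rho v (h : R -> R -> R) C b :
  0 < rho -> 0 <= C -> - (2 * rho) <= b < 0 -> half_annulus_integral J rho v -> cneg h ->
  (forall X Y, X <= 0 -> 0 <= J X Y) ->
  (forall X Y, X < 0 -> in_half_annulus rho X Y -> Rabs (h X Y) <= C * J X Y) ->
  (forall X Y, X < 0 -> ~ in_half_annulus rho X Y -> h X Y = 0) ->
  Rabs (dint h (- (2 * rho)) b (- (2 * rho) - 1) (2 * rho + 1)) <= C * v.
Proof.
  intros Hrho HC Hb [gg [Hgg Hv]] Hh HJ Hin Hout.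
  apply RInt_val_RInt in Hv. destruct Hv as [Hex Hv].
  set (ind := fun X Y => if excluded_middle_informative (in_half_annulus rho X Y) then J X Y else 0) in *.
  assert (Hind : forall X Y, X < 0 -> Rabs (h X Y) <= C * ind X Y /\ 0 <= ind X Y).
  { intros X Y HX. unfold ind. destruct excluded_middle_informative as [H|H].
    - split; [apply Hin; assumption|apply HJ; lra].
    - rewrite Hout by assumption. rewrite Rabs_R0. lra. }
  assert (Hgg' : forall X, - (2 * rho) <= X < 0 -> ex_RInt (ind X) (- (2 * rho)) (2 * rho) /\
     RInt (ind X) (- (2 * rho)) (2 * rho) = gg X).
  { intros X HX. apply RInt_val_RInt, Hgg. lra. }
  assert (Hsm : forall X, X < 0 -> RInt (fun Y => h X Y) (- (2 * rho) - 1) (2 * rho + 1) =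
      RInt (fun Y => h X Y) (- (2 * rho)) (2 * rho)).
  { intros X HX. assert (Hex' : forall u w, ex_RInt (fun Y => h X Y) u w) by (intros; apply cneg_ex_RInt; assumption).
    assert (Hz : forall Y, 2 * rho < Rabs Y -> h X Y = 0).
    { intros Y HY. apply Hout; [exact HX|]. intros [_ [_ H]]. pose proof (proj2 (normY_ge X Y)). lra. }
    rewrite <- (RInt_Chasles_R _ (- (2 * rho) - 1) (- (2 * rho)) (2 * rho + 1)) by apply Hex'.
    rewrite <- (RInt_Chasles_R _ (- (2 * rho)) (2 * rho) (2 * rho + 1)) by apply Hex'.
    rewrite (RInt_zero_on _ (- (2 * rho) - 1) (- (2 * rho))), (RInt_zero_on _ (2 * rho) (2 * rho + 1)); try lra.
    - intros Y HY. apply Hz. rewrite Rabs_pos_eq; lra.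
    - intros Y HY. apply Hz. rewrite Rabs_left1; lra. }
  assert (Hinner : forall X, - (2 * rho) <= X < 0 ->
     Rabs (RInt (fun Y => h X Y) (- (2 * rho) - 1) (2 * rho + 1)) <= C * gg X /\ 0 <= gg X).
  { intros X HX. destruct (Hgg' X HX) as [E1 E2]. rewrite Hsm by lra. rewrite <- E2. split.
    - rewrite <- RInt_scal_R by exact E1.
      assert (E3 : ex_RInt (fun Y => h X Y) (- (2 * rho)) (2 * rho)) by (apply cneg_ex_RInt; [exact Hh|lra]).
      eapply Rle_trans; [apply abs_RInt_le; [lra|exact E3]|].
      apply RInt_le; [lra|apply (ex_RInt_norm (fun Y => h X Y)); exact E3| |].
      + apply (ex_RInt_scal (V := R_NormedModule) (ind X)); exact E1.
      + intros Y _. apply Hind. lra.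
    - apply RInt_ge_0; [lra|exact E1|]. intros Y _. apply Hind. lra. }
  assert (Hexb : ex_RInt gg (- (2 * rho)) b).
  { apply (ex_RInt_Chasles_1 (V := R_CompleteNormedModule) gg _ b 0); [lra|exact Hex]. }
  assert (Hexd : ex_RInt (fun X => RInt (fun Y => h X Y) (- (2 * rho) - 1) (2 * rho + 1)) (- (2 * rho)) b).
  { apply cneg_ex_dint; [exact Hh|lra|lra|lra]. }
  apply Rle_trans with (C * RInt gg (- (2 * rho)) b).
  - unfold dint. rewrite <- RInt_scal_R by exact Hexb.
    eapply Rle_trans; [apply abs_RInt_le; [lra|exact Hexd]|].
    apply RInt_le; [lra|apply ex_RInt_norm; exact Hexd| |].
    + apply (ex_RInt_scal (V := R_NormedModule) gg); exact Hexb.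
    + intros X HX. apply Hinner. lra.
  - rewrite <- Hv. apply Rmult_le_compat_l; [exact HC|]. apply RInt_sub_le; try lra; [exact Hex|].
    intros X HX. apply Hinner. lra.
Qed.

Lemma dint_lower f a b c d a' b' c' d' m : cneg f -> a <= a' -> a' <= b' -> b' <= b -> b < 0 ->
  c <= c' -> c' <= d' -> d' <= d ->
  (forall X Y, X < 0 -> 0 <= f X Y) ->
  (forall X Y, a' <= X <= b' -> c' <= Y <= d' -> m <= f X Y) ->
  (b' - a') * ((d' - c') * m) <= dint f a b c d.
Proof.
  intros Hf H1 H2 H3 Hb H4 H5 H6 Hp Hm. unfold dint.
  assert (Hc : forall k u w, RInt (fun _ : R => k) u w = (w - u) * k).
  { intros k u w. rewrite RInt_const. reflexivity. }
  apply Rle_trans with (RInt (fun X => RInt (fun Y => f X Y) c d) a' b').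
  - rewrite <- Hc. apply RInt_le; [lra|apply ex_RInt_const| |].
    + apply cneg_ex_dint; [exact Hf|lra|lra|lra].
    + intros X HX. apply Rle_trans with (RInt (fun Y => f X Y) c' d').
      * rewrite <- Hc. apply RInt_le; [lra|apply ex_RInt_const|apply cneg_ex_RInt; [exact Hf|lra]|].
        intros Y HY. apply Hm; lra.
      * apply RInt_sub_le; try lra; [apply cneg_ex_RInt; [exact Hf|lra]|]. intros Y _. apply Hp. lra.
  - apply RInt_sub_le; try lra; [apply cneg_ex_dint; [exact Hf|lra|lra|lra]|].
    intros X HX. apply RInt_ge_0; [lra|apply cneg_ex_RInt; [exact Hf|lra]|]. intros Y _. apply Hp. lra.
Qed.

Definition chi (rho X Y : R) : R := cutoff ((X ^ 2 + Y ^ 2) / rho ^ 2).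

Lemma cneg_comp_1d (u : R -> R) f : (forall t, continuous u t) -> cneg f -> cneg (fun X Y => u (f X Y)).
Proof.
  intros Hu Hf X Y HX. apply (continuity_1d_2d_pt_comp u f); [|apply Hf, HX].
  apply continuity_pt_filterlim, Hu.
Qed.

Lemma cneg_radial rho : cneg (fun X Y => (X ^ 2 + Y ^ 2) / rho ^ 2).
Proof.
  unfold Rdiv. apply cneg_mult; [|apply cneg_const].
  apply cneg_plus; simpl; repeat apply cneg_mult; (apply cneg_X || apply cneg_Y || apply cneg_const).
Qed.

Lemma is_derive_chi_X rho X Y : 0 < rho ->
  is_derive (fun x => chi rho x Y) X (- bump ((X ^ 2 + Y ^ 2) / rho ^ 2) * (2 / rho ^ 2 * X)).
Proof.
  intros Hr.
  replace (- bump ((X ^ 2 + Y ^ 2) / rho ^ 2) * (2 / rho ^ 2 * X)) with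
    (scal (2 / rho ^ 2 * X) (- bump ((X ^ 2 + Y ^ 2) / rho ^ 2))) by apply Rmult_comm.
  apply (is_derive_comp (K := R_AbsRing) (V := R_NormedModule) cutoff (fun x => (x ^ 2 + Y ^ 2) / rho ^ 2)).
  - apply is_derive_cutoff.
  - auto_derive; [tauto|]. field. lra.
Qed.

Lemma is_derive_chi_Y rho X Y : 0 < rho ->
  is_derive (fun y => chi rho X y) Y (- bump ((X ^ 2 + Y ^ 2) / rho ^ 2) * (2 / rho ^ 2 * Y)).
Proof.
  intros Hr.
  replace (- bump ((X ^ 2 + Y ^ 2) / rho ^ 2) * (2 / rho ^ 2 * Y)) with
    (scal (2 / rho ^ 2 * Y) (- bump ((X ^ 2 + Y ^ 2) / rho ^ 2))) by apply Rmult_comm.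
  apply (is_derive_comp (K := R_AbsRing) (V := R_NormedModule) cutoff (fun y => (X ^ 2 + y ^ 2) / rho ^ 2)).
  - apply is_derive_cutoff.
  - auto_derive; [tauto|]. field. lra.
Qed.

(* The field [V = (g X - PZ, g Y + PR)] has divergence [2 g] and satisfies [V . grad G = - k G]. *)
Lemma energy_identity g k G GR GZ P PR PZ rho b : 0 < rho -> - (2 * rho) <= b -> b < 0 ->
  cneg G -> cneg GR -> cneg GZ -> cneg P -> cneg PR -> cneg PZ ->
  (forall X Y, X < 0 -> is_derive (fun x => G x Y) X (GR X Y)) ->
  (forall X Y, X < 0 -> is_derive (fun y => G X y) Y (GZ X Y)) ->
  (forall X Y, X < 0 -> is_derive (fun x => P x Y) X (PR X Y)) ->
  (forall X Y, X < 0 -> is_derive (fun y => P X y) Y (PZ X Y)) ->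
  (forall X Y, X < 0 -> k * G X Y + (g * X - PZ X Y) * GR X Y + (g * Y + PR X Y) * GZ X Y = 0) ->
  (2 * g - k) * dint (fun X Y => chi rho X Y * G X Y) (- (2 * rho)) b (- (2 * rho) - 1) (2 * rho + 1) +
  dint (fun X Y => G X Y * (- bump ((X ^ 2 + Y ^ 2) / rho ^ 2) * (2 / rho ^ 2) *
     (g * (X * X + Y * Y) + (Y * PR X Y - X * PZ X Y))))
    (- (2 * rho)) b (- (2 * rho) - 1) (2 * rho + 1) =
  RInt (fun Y => chi rho b Y * G b Y * (g * b - PZ b Y)) (- (2 * rho) - 1) (2 * rho + 1).
Proof.
  intros Hrho Hb1 Hb HG HGR HGZ HP HPR HPZ DGR DGZ DPR DPZ Heq.
  set (a := - (2 * rho)) in *. set (c := a - 1). set (d := 2 * rho + 1).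
  assert (Hcd : c <= d) by (unfold c, d, a; lra).
  assert (Hr2 : 0 < rho ^ 2) by (apply pow_lt; exact Hrho).
  set (bb := fun X Y => bump ((X ^ 2 + Y ^ 2) / rho ^ 2)).
  assert (Cb : cneg bb) by (apply (cneg_comp_1d bump); [apply continuous_bump|apply cneg_radial]).
  assert (Cchi : cneg (chi rho)).
  { apply (cneg_comp_1d cutoff); [|apply cneg_radial].
    intros t. apply (ex_derive_continuous (V := R_NormedModule)). exists (- bump t). apply is_derive_cutoff. }
  assert (CX := cneg_X). assert (CY := cneg_Y).
  set (phi := fun X Y => chi rho X Y * G X Y).
  set (phiR := fun X Y => -1 * bb X Y * (2 / rho ^ 2 * X) * G X Y + chi rho X Y * GR X Y).
  set (phiZ := fun X Y => -1 * bb X Y * (2 / rho ^ 2 * Y) * G X Y + chi rho X Y * GZ X Y).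
  assert (Cphi : cneg phi) by (unfold phi; cnegs).
  assert (CphiR : cneg phiR) by (unfold phiR; cnegs).
  assert (CphiZ : cneg phiZ) by (unfold phiZ; cnegs).
  assert (DphiR : forall X Y, X < 0 -> is_derive (fun x => phi x Y) X (phiR X Y)).
  { intros X Y HX. unfold phiR. replace (-1 * bb X Y * (2 / rho ^ 2 * X) * G X Y) with
      ((- bb X Y * (2 / rho ^ 2 * X)) * G X Y) by ring.
    apply (is_derive_mult (K := R_AbsRing) (fun x => chi rho x Y) (fun x => G x Y));
      [apply is_derive_chi_X, Hrho|apply DGR, HX|exact Rmult_comm]. }
  assert (DphiZ : forall X Y, X < 0 -> is_derive (fun y => phi X y) Y (phiZ X Y)).
  { intros X Y HX. unfold phiZ. replace (-1 * bb X Y * (2 / rho ^ 2 * Y) * G X Y) with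
      ((- bb X Y * (2 / rho ^ 2 * Y)) * G X Y) by ring.
    apply (is_derive_mult (K := R_AbsRing) (fun y => chi rho X y) (fun y => G X y));
      [apply is_derive_chi_Y, Hrho|apply DGZ, HX|exact Rmult_comm]. }
  assert (Hzero : forall X Y, 2 * rho <= Rabs X \/ 2 * rho <= Rabs Y -> phi X Y = 0).
  { intros X Y H. unfold phi, chi. rewrite cutoff_out; [ring|].
    apply Rmult_le_reg_r with (rho ^ 2); [exact Hr2|]. unfold Rdiv. rewrite Rmult_assoc, Rinv_l by lra.
    assert (H4 : forall u, 2 * rho <= Rabs u -> 4 * rho ^ 2 <= u ^ 2).
    { intros u Hu. rewrite <- (pow2_abs u). replace (4 * rho ^ 2) with ((2 * rho) ^ 2) by ring.
      apply pow_incr. lra. }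
    pose proof (pow2_ge_0 X). pose proof (pow2_ge_0 Y).
    destruct H as [H|H]; specialize (H4 _ H); lra. }
  assert (Za : forall Y, phi a Y = 0).
  { intros Y. apply Hzero. left. unfold a. rewrite Rabs_Ropp, Rabs_pos_eq; lra. }
  assert (Zc : forall X Y, Y <= c + 1 -> phi X Y = 0).
  { intros X Y HY. apply Hzero. right. unfold c, a in HY. rewrite Rabs_left1; lra. }
  assert (Zd : forall X Y, d - 1 <= Y -> phi X Y = 0).
  { intros X Y HY. apply Hzero. right. unfold d in HY. rewrite Rabs_pos_eq; lra. }
  assert (I1 := dint_bracket P PR PZ phi phiR phiZ a b c d Hb1 Hb Hcd HP HPR HPZ Cphi CphiR CphiZ DPR DPZ DphiR DphiZ Za Zc Zd).
  assert (I2 : dint (fun X Y => phi X Y + X * phiR X Y) a b c d = RInt (fun Y => b * phi b Y) c d).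
  { apply (dint_derive_X (fun X Y => X * phi X Y)); try assumption; [cnegs|cnegs| |].
    - intros X Y HX. replace (phi X Y + X * phiR X Y) with (plus (mult 1 (phi X Y)) (mult X (phiR X Y)))
        by (unfold plus, mult; simpl; ring).
      apply (is_derive_mult (K := R_AbsRing) (fun x => x) (fun x => phi x Y));
        [exact (is_derive_id (K := R_AbsRing) X)|apply DphiR, HX|exact Rmult_comm].
    - intros Y _. rewrite Za. ring. }
  assert (I3 : dint (fun X Y => phi X Y + Y * phiZ X Y) a b c d = 0).
  { apply (dint_derive_Y (fun X Y => Y * phi X Y)); try assumption; [cnegs| |].
    - intros X Y HX. replace (phi X Y + Y * phiZ X Y) with (plus (mult 1 (phi X Y)) (mult Y (phiZ X Y)))
        by (unfold plus, mult; simpl; ring).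
      apply (is_derive_mult (K := R_AbsRing) (fun y => y) (fun y => phi X y));
        [exact (is_derive_id (K := R_AbsRing) Y)|apply DphiZ, HX|exact Rmult_comm].
    - intros X. rewrite Zc, Zd by lra. lra. }
  set (hh := fun X Y => G X Y * (-1 * bb X Y * (2 / rho ^ 2) * (g * (X * X + Y * Y) + (Y * PR X Y - X * PZ X Y)))).
  assert (Chh : cneg hh) by (unfold hh; cnegs).
  rewrite (dint_ext (fun X Y => G X Y * (- bump ((X ^ 2 + Y ^ 2) / rho ^ 2) * (2 / rho ^ 2) *
     (g * (X * X + Y * Y) + (Y * PR X Y - X * PZ X Y)))) hh); try assumption.
  2:{ intros X Y _ _. unfold hh, bb. ring. }
  change (fun X Y => chi rho X Y * G X Y) with phi.
  rewrite <- dint_scal by assumption. rewrite <- dint_plus by cnegs.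
  (* The right-hand side is formally the divergence of [phi] times the field, with the mixed second
     derivatives of [P] cancelled, so it makes sense for [P] of class [C^1]. The equation has
     replaced the derivative of [G] along the field. *)
  rewrite (dint_ext (fun X Y => (2 * g - k) * phi X Y + hh X Y)
    (fun X Y => (g * (phi X Y + X * phiR X Y) + g * (phi X Y + Y * phiZ X Y)) +
                -1 * (PZ X Y * phiR X Y - PR X Y * phiZ X Y))); try assumption.
  2:{ intros X Y HX HY. assert (E := Heq X Y ltac:(lra)).
      transitivity ((2 * g) * phi X Y + hh X Y - chi rho X Y * (k * G X Y)); [unfold phi; ring|].
      replace (k * G X Y) with (- ((g * X - PZ X Y) * GR X Y + (g * Y + PR X Y) * GZ X Y)) by lra.
      unfold hh, phi, phiR, phiZ. ring. }
  rewrite !dint_plus by cnegs. rewrite !dint_scal by cnegs. rewrite I1, I2, I3.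
  assert (Ex1 : ex_RInt (fun Y => phi b Y) c d) by (apply cneg_ex_RInt; assumption).
  assert (Ex2 : ex_RInt (fun Y => phi b Y * PZ b Y) c d).
  { apply (cneg_ex_RInt (fun X Y => phi X Y * PZ X Y)); [cnegs|exact Hb]. }
  rewrite RInt_scal_R by exact Ex1.
  rewrite (RInt_ext (fun Y => chi rho b Y * G b Y * (g * b - PZ b Y)) (fun Y => g * b * phi b Y - phi b Y * PZ b Y)).
  2:{ intros Y _. unfold phi. toR. ring. }
  rewrite RInt_minus_R; [|apply (ex_RInt_scal (V := R_NormedModule) (fun Y => phi b Y)); exact Ex1|exact Ex2].
  rewrite RInt_scal_R by exact Ex1. toR. ring.
Qed.

(** * Vanishing of a profile by the maximum principle and by the energy identity *)

Lemma transport_max_le c g Q QR QZ PR PZ : c < 0 -> C1_D_with Q QR QZ ->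
  (forall Y, PZ 0 Y = 0) ->
  (forall eps, 0 < eps -> exists M, forall X Y, X <= 0 -> M < normY X Y -> Rabs (Q X Y) < eps) ->
  (forall X Y, X <= 0 -> c * Q X Y + (g * X - PZ X Y) * QR X Y + (g * Y + PR X Y) * QZ X Y = 0) ->
  forall X Y, X <= 0 -> Q X Y <= 0.
Proof.
  intros Hc HQ H0 Hinf Heq X0 Y0 HX0. apply Rnot_lt_le. intros Hpos.
  destruct (Hinf (Q X0 Y0) Hpos) as [M HM].
  set (B := Rmax (Rabs M) (Rmax (Rabs X0) (Rabs Y0)) + 1).
  assert (HB : Rabs M < B /\ Rabs X0 < B /\ Rabs Y0 < B).
  { unfold B. pose proof (Rmax_l (Rabs M) (Rmax (Rabs X0) (Rabs Y0))).
    pose proof (Rmax_r (Rabs M) (Rmax (Rabs X0) (Rabs Y0))).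
    pose proof (Rmax_l (Rabs X0) (Rabs Y0)). pose proof (Rmax_r (Rabs X0) (Rabs Y0)). lra. }
  destruct HB as [HBM [HBX HBY]]. assert (HM0 := Rabs_pos M). assert (HM1 := Rle_abs M).
  apply Rabs_bd' in HBX. apply Rabs_bd' in HBY.
  destruct (continuous_rect_max (fun X Y => Q (Rmin X 0) Y) (- B) 0 (- B) B) as [X [Y [HX [HY Hmax]]]]; try lra.
  { intros X Y _ _. apply (proj1 (continuity_2d_continuous (fun X Y => Q (Rmin X 0) Y) X Y)), cont_D_clamp, HQ. }
  assert (Hmax' : forall X' Y', - B <= X' <= 0 -> - B <= Y' <= B -> Q X' Y' <= Q X Y).
  { intros X' Y' HX' HY'. specialize (Hmax X' Y' HX' HY'). rewrite !Rmin_left in Hmax by lra. exact Hmax. }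
  assert (HQ0 : Q X0 Y0 <= Q X Y) by (apply Hmax'; lra).
  assert (HN : normY X Y <= M).
  { apply Rnot_lt_le. intros HN. specialize (HM X Y ltac:(lra) HN). apply Rabs_bd' in HM. lra. }
  destruct (normY_ge X Y) as [HNX HNY].
  assert (HXB : Rabs X < B) by lra. assert (HYB : Rabs Y < B) by lra.
  apply Rabs_bd' in HXB. apply Rabs_bd' in HYB.
  assert (E := Heq X Y ltac:(lra)).
  assert (DZ : QZ X Y = 0).
  { apply (local_max_derive0 (fun y => Q X y) Y _ (Rmin (Y + B) (B - Y))).
    - apply Rmin_glb_lt; lra.
    - apply (C1_D_derive_Z Q QR QZ); [exact HQ|lra].
    - intros y Hy. pose proof (Rmin_l (Y + B) (B - Y)). pose proof (Rmin_r (Y + B) (B - Y)).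
      apply Rabs_bd' in Hy. apply Hmax'; lra. }
  (* If the maximum lies on [X = 0], the normal derivative of [Q] may be nonzero, but the normal
     component [g X - PZ] of the field vanishes by the boundary condition. *)
  assert (DR : (g * X - PZ X Y) * QR X Y = 0).
  { destruct (Rle_lt_or_eq_dec X 0) as [HX1|HX1]; [lra| |].
    - assert (QR X Y = 0); [|rewrite H; ring].
      apply (local_max_derive0 (fun x => Q x Y) X _ (Rmin (X + B) (- X))).
      + apply Rmin_glb_lt; lra.
      + apply (C1_D_derive_X Q QR QZ); [exact HQ|lra].
      + intros y Hy. pose proof (Rmin_l (X + B) (- X)). pose proof (Rmin_r (X + B) (- X)).
        apply Rabs_bd' in Hy. apply Hmax'; lra.
    - rewrite HX1, H0. ring. }
  rewrite DZ, DR in E. assert (c * Q X Y < 0); [|lra].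
  rewrite Rmult_comm. apply Ropp_lt_cancel. rewrite Ropp_0, Ropp_mult_distr_r. apply Rmult_lt_0_compat; lra.
Qed.

Lemma C1_D_with_opp Q QR QZ : C1_D_with Q QR QZ ->
  C1_D_with (fun X Y => - Q X Y) (fun X Y => - QR X Y) (fun X Y => - QZ X Y).
Proof.
  intros [H [H1 [H2 H3]]].
  assert (Hc : forall f, cont_D f -> cont_D (fun X Y => - f X Y)).
  { intros f Hf X Y HX e He. destruct (Hf X Y HX e He) as [eta [Heta Hx]]. exists eta. split; [exact Heta|].
    intros X' Y' A B C. replace (- f X' Y' - - f X Y) with (- (f X' Y' - f X Y)) by ring.
    rewrite Rabs_Ropp. apply Hx; assumption. }
  split; [|auto]. intros X Y HX. destruct (H X Y HX) as [HR HZ]. split.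
  - intros e He. destruct (HR e He) as [d [Hd Hl]]. exists d. split; [exact Hd|].
    intros h Hh. specialize (Hl h Hh). simpl in *. unfold Rdist in *.
    replace ((- Q (X + h) Y - - Q X Y) / h - - QR X Y) with (- ((Q (X + h) Y - Q X Y) / h - QR X Y))
      by (unfold Rdiv; ring).
    rewrite Rabs_Ropp. exact Hl.
  - apply (derivable_pt_lim_opp (fun y => Q X y)). exact HZ.
Qed.

Lemma transport_max_vanish c g Q QR QZ PR PZ : c < 0 -> C1_D_with Q QR QZ ->
  (forall Y, PZ 0 Y = 0) ->
  (forall eps, 0 < eps -> exists M, forall X Y, X <= 0 -> M < normY X Y -> Rabs (Q X Y) < eps) ->
  (forall X Y, X <= 0 -> c * Q X Y + (g * X - PZ X Y) * QR X Y + (g * Y + PR X Y) * QZ X Y = 0) ->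
  forall X Y, X <= 0 -> Q X Y = 0.
Proof.
  intros Hc HQ H0 Hinf Heq X Y HX. apply Rle_antisym.
  - apply (transport_max_le c g Q QR QZ PR PZ); assumption.
  - assert (- Q X Y <= 0); [|lra].
    apply (transport_max_le c g (fun X Y => - Q X Y) (fun X Y => - QR X Y) (fun X Y => - QZ X Y) PR PZ); try assumption.
    + apply C1_D_with_opp, HQ.
    + intros eps Heps. destruct (Hinf eps Heps) as [M HM]. exists M. intros. rewrite Rabs_Ropp. auto.
    + intros X' Y' HX'. rewrite <- Ropp_0, <- (Heq X' Y' HX'). ring.
Qed.

Lemma cneg_of_cont_D f : cont_D f -> cneg f.
Proof. intros Hf X Y HX. apply cont_D_interior; assumption. Qed.

Lemma cneg_pow f n : cneg f -> cneg (fun X Y => f X Y ^ n).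
Proof.
  intros Hf. induction n as [|n IH]; simpl; [apply cneg_const|apply cneg_mult; assumption].
Qed.

Lemma even_pow_nonneg x p : Nat.Even p -> 0 <= x ^ p.
Proof. intros [k ->]. rewrite pow_mult. apply pow_le, pow2_ge_0. Qed.

Lemma even_pow_le x p q : Nat.Even p -> Nat.Even q -> (p <= q)%nat -> Rabs x <= 1 -> x ^ q <= x ^ p.
Proof.
  intros Hp [k Hk] Hpq Hx. destruct Hp as [j Hj]. subst p q.
  replace (2 * k)%nat with (2 * j + 2 * (k - j))%nat by lia.
  rewrite pow_add. rewrite <- (Rmult_1_r (x ^ (2 * j))) at 2.
  apply Rmult_le_compat_l; [apply even_pow_nonneg; exists j; reflexivity|].
  rewrite pow_mult. apply Rle_trans with (1 ^ (k - j)); [|rewrite pow1; apply Rle_refl].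
  apply pow_incr. split; [apply pow2_ge_0|]. rewrite <- (pow2_abs x). apply Rle_trans with (1 ^ 2); [|lra].
  apply pow_incr. split; [apply Rabs_pos|exact Hx].
Qed.

(** A nonzero [Q] keeps the bulk term at least [K0] for all large [rho], while the annulus term and
    the flux near the boundary are each at most [K0 / 4]. The exponent may exceed [p0], because
    [|Q| <= 1] far out makes higher even powers smaller on the annulus. *)
Lemma transport_energy_vanish c g p0 Q QR QZ P PR PZ J : 0 < g ->
  C1_D_with Q QR QZ -> C1_D_with P PR PZ -> (forall Y, PZ 0 Y = 0) ->
  (forall eps, 0 < eps -> exists M, forall X Y, X <= 0 -> M < normY X Y -> Rabs (Q X Y) < eps) ->
  (forall eps, 0 < eps -> exists M, forall X Y, X <= 0 ->
      M < normY X Y -> normY (PR X Y) (PZ X Y) <= eps * normY X Y) ->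
  (forall X Y, X <= 0 -> c * Q X Y + (g * X - PZ X Y) * QR X Y + (g * Y + PR X Y) * QZ X Y = 0) ->
  Nat.Even p0 -> (forall X Y, X <= 0 -> Q X Y ^ p0 <= J X Y) ->
  (forall eps, 0 < eps -> exists M, forall rho, M < rho ->
      exists v, half_annulus_integral J rho v /\ Rabs v < eps) ->
  forall X Y, X <= 0 -> Q X Y = 0.
Proof.
  intros Hg HQ HP H0 Hinf HPinf Heq Hp0 HJ Hd Xs Ys HXs. apply NNPP. intros HQs.
  (* the energy identity carries the factor [2 g - p c], which must not vanish *)
  assert (Hp : exists p, Nat.Even p /\ (p0 <= p)%nat /\ (1 <= p)%nat /\ 2 * g - INR p * c <> 0).
  { destruct (Req_dec (2 * g - INR (p0 + 2) * c) 0) as [E|E].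
    - exists (p0 + 4)%nat. split; [|split; [lia|split; [lia|]]].
      + destruct Hp0 as [k ->]. exists (k + 2)%nat. lia.
      + rewrite plus_INR in E |- *. simpl (INR 2) in E. simpl (INR 4). intros E2.
        assert (c = 0) by lra. subst c. lra.
    - exists (p0 + 2)%nat. split; [|split; [lia|split; [lia|exact E]]].
      destruct Hp0 as [k ->]. exists (k + 1)%nat. lia. }
  destruct Hp as [p [Hpe [Hpp [Hp1 Hpc]]]].
  assert (HcQ : cont_D Q) by apply HQ. assert (HcPZ : cont_D PZ) by apply HP.
  set (G := fun X Y => Q X Y ^ p).
  set (GR := fun X Y => INR p * Q X Y ^ pred p * QR X Y).
  set (GZ := fun X Y => INR p * Q X Y ^ pred p * QZ X Y).
  assert (NQ : cneg Q) by (apply cneg_of_cont_D, HQ).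
  assert (NQR : cneg QR) by (apply cneg_of_cont_D, HQ).
  assert (NQZ : cneg QZ) by (apply cneg_of_cont_D, HQ).
  assert (NP : cneg P) by (apply cneg_of_cont_D, HP).
  assert (NPR : cneg PR) by (apply cneg_of_cont_D, HP).
  assert (NPZ : cneg PZ) by (apply cneg_of_cont_D, HP).
  assert (NQp : cneg (fun X Y => Q X Y ^ pred p)) by (apply cneg_pow, NQ).
  assert (NG : cneg G) by (apply cneg_pow, NQ).
  assert (NGR : cneg GR) by (unfold GR; cnegs). assert (NGZ : cneg GZ) by (unfold GZ; cnegs).
  assert (NX := cneg_X). assert (NY := cneg_Y).
  assert (Hpow : forall (f : R -> R) x d, is_derive f x d -> is_derive (fun y => f y ^ p) x (INR p * f x ^ pred p * d)).
  { intros f x d Hf. replace (INR p * f x ^ pred p * d) with (INR p * d * f x ^ pred p) by ring.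
    apply is_derive_pow. exact Hf. }
  assert (HGpos : forall X Y, 0 <= G X Y) by (intros; apply even_pow_nonneg, Hpe).
  assert (HGeq : forall X Y, X < 0 -> INR p * c * G X Y + (g * X - PZ X Y) * GR X Y + (g * Y + PR X Y) * GZ X Y = 0).
  { intros X Y HX. assert (E := Heq X Y (Rlt_le _ _ HX)).
    assert (EG : G X Y = Q X Y ^ pred p * Q X Y).
    { unfold G. destruct p; [lia|]. simpl. ring. }
    rewrite EG. unfold GR, GZ.
    replace (INR p * c * (Q X Y ^ pred p * Q X Y) + (g * X - PZ X Y) * (INR p * Q X Y ^ pred p * QR X Y) +
      (g * Y + PR X Y) * (INR p * Q X Y ^ pred p * QZ X Y)) with
      (INR p * Q X Y ^ pred p * (c * Q X Y + (g * X - PZ X Y) * QR X Y + (g * Y + PR X Y) * QZ X Y)) by ring.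
    rewrite E. ring. }
  assert (Hbox : exists x1 y1 e m, 0 < e /\ 0 < m /\ x1 + e < 0 /\
    forall X Y, x1 - e <= X <= x1 + e -> y1 - e <= Y <= y1 + e -> m <= G X Y).
  { assert (Ha : 0 < Rabs (Q Xs Ys) / 2) by (pose proof (Rabs_pos_lt _ HQs); lra).
    destruct (HcQ Xs Ys HXs _ Ha) as [eta [Heta Hc]].
    exists (Xs - eta / 2), Ys, (eta / 4), ((Rabs (Q Xs Ys) / 2) ^ p).
    split; [lra|]. split; [apply pow_lt; lra|]. split; [lra|]. intros X Y HX HY.
    specialize (Hc X Y ltac:(lra) ltac:(apply Rabs_bd'; lra) ltac:(apply Rabs_bd'; lra)).
    assert (Rabs (Q Xs Ys) / 2 <= Rabs (Q X Y)).
    { pose proof (Rabs_triang_inv (Q Xs Ys) (Q X Y)) as T. rewrite Rabs_minus_sym in T. lra. }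
    unfold G. apply Rle_trans with (Rabs (Q X Y) ^ p); [apply pow_incr; lra|].
    rewrite RPow_abs, Rabs_pos_eq; [lra|apply HGpos]. }
  destruct Hbox as [x1 [y1 [e [m [He [Hm [Hx1 HGm]]]]]]].
  set (I0 := cutoff 1). assert (HI0 : 0 < I0) by apply cutoff_1_pos.
  set (kk := 2 * g - INR p * c).
  assert (Hkk : 0 < Rabs kk) by (apply Rabs_pos_lt; exact Hpc).
  set (K0 := Rabs kk * (2 * e * (2 * e * (I0 * m)))).
  assert (HK0 : 0 < K0) by (unfold K0; repeat apply Rmult_lt_0_compat; lra).
  (* On the annulus the weight in the identity is at most the product of [9 / 4] from the bump,
     [2 / rho^2] from its argument, and [(4 g + 8) rho^2] from the field, where the gradient of [P]
     is at most [2 rho]. *)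
  set (C := 9 / 2 * (4 * g + 8)). assert (HC : 0 < C) by (unfold C; lra).
  destruct (Hd (K0 / (4 * C))) as [M1 HM1]. { apply Rdiv_lt_0_compat; lra. }
  destruct (Hinf 1 Rlt_0_1) as [M2 HM2].
  destruct (HPinf 1 Rlt_0_1) as [M3 HM3].
  set (rho := 1 + Rabs M1 + Rabs M2 + Rabs M3 + Rabs x1 + Rabs y1 + 2 * e).
  pose proof (Rabs_pos M1). pose proof (Rabs_pos M2). pose proof (Rabs_pos M3).
  pose proof (Rabs_pos x1). pose proof (Rabs_pos y1).
  pose proof (Rle_abs M1). pose proof (Rle_abs M2). pose proof (Rle_abs M3).
  assert (Hr : 0 < rho) by (unfold rho; lra).
  destruct (HM1 rho ltac:(unfold rho; lra)) as [v [Hv Hve]].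
  assert (Hr2 : 0 < rho ^ 2) by (apply pow_lt; exact Hr).
  set (h := fun X Y => G X Y * (- bump ((X ^ 2 + Y ^ 2) / rho ^ 2) * (2 / rho ^ 2) *
     (g * (X * X + Y * Y) + (Y * PR X Y - X * PZ X Y)))).
  assert (Nb : cneg (fun X Y => bump ((X ^ 2 + Y ^ 2) / rho ^ 2)))
    by (apply (cneg_comp_1d bump); [apply continuous_bump|apply cneg_radial]).
  assert (Nchi : cneg (chi rho)).
  { apply (cneg_comp_1d cutoff); [|apply cneg_radial].
    intros t. apply (ex_derive_continuous (V := R_NormedModule)). exists (- bump t). apply is_derive_cutoff. }
  assert (Nh : cneg h).
  { intros X Y HX. apply (continuity_2d_pt_ext (fun X Y => G X Y * (-1 * bump ((X ^ 2 + Y ^ 2) / rho ^ 2) * (2 / rho ^ 2) *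
     (g * (X * X + Y * Y) + (Y * PR X Y - X * PZ X Y))))).
    - intros x y. unfold h. ring.
    - revert X Y HX.
      match goal with |- forall X Y, X < 0 -> continuity_2d_pt ?f X Y => change (cneg f) end. cnegs. }
  assert (Hnorm : forall X Y, normY X Y ^ 2 = X ^ 2 + Y ^ 2).
  { intros X Y. unfold normY. apply pow2_sqrt. pose proof (pow2_ge_0 X). pose proof (pow2_ge_0 Y). lra. }
  assert (Hnpos : forall X Y, 0 <= normY X Y) by (intros; apply sqrt_pos).
  assert (Hhin : forall X Y, X < 0 -> in_half_annulus rho X Y -> Rabs (h X Y) <= C * J X Y).
  { intros X Y HX [_ [Hn1 Hn2]].
    assert (HGJ : G X Y <= J X Y).
    { apply Rle_trans with (Q X Y ^ p0); [|apply HJ; lra].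
      apply even_pow_le; try assumption. apply Rlt_le, HM2; [lra|]. unfold rho in Hn1. lra. }
    assert (HPn : normY (PR X Y) (PZ X Y) <= 2 * rho).
    { assert (normY (PR X Y) (PZ X Y) <= 1 * normY X Y); [|lra]. apply HM3; [lra|]. unfold rho in Hn1. lra. }
    destruct (normY_ge X Y) as [A1 A2]. destruct (normY_ge (PR X Y) (PZ X Y)) as [A3 A4].
    assert (A5 : X * X + Y * Y <= 4 * rho ^ 2).
    { replace (X * X + Y * Y) with (normY X Y ^ 2) by (rewrite Hnorm; ring).
      replace (4 * rho ^ 2) with ((2 * rho) ^ 2) by ring. apply pow_incr. specialize (Hnpos X Y). lra. }
    assert (A6 : Rabs (Y * PR X Y) <= 4 * rho ^ 2).
    { rewrite Rabs_mult. replace (4 * rho ^ 2) with (2 * rho * (2 * rho)) by ring.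
      apply Rmult_le_compat; try apply Rabs_pos; lra. }
    assert (A7 : Rabs (X * PZ X Y) <= 4 * rho ^ 2).
    { rewrite Rabs_mult. replace (4 * rho ^ 2) with (2 * rho * (2 * rho)) by ring.
      apply Rmult_le_compat; try apply Rabs_pos; lra. }
    assert (A8 : Rabs (g * (X * X + Y * Y) + (Y * PR X Y - X * PZ X Y)) <= (4 * g + 8) * rho ^ 2).
    { assert (0 <= g * (X * X + Y * Y)) by (apply Rmult_le_pos; [lra|nra]).
      assert (g * (X * X + Y * Y) <= g * (4 * rho ^ 2)) by (apply Rmult_le_compat_l; lra).
      apply Rabs_bd in A6. apply Rabs_bd in A7. apply Rabs_bd. lra. }
    unfold h. rewrite !Rabs_mult, Rabs_Ropp.
    rewrite (Rabs_pos_eq (G X Y)) by apply HGpos.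
    rewrite (Rabs_pos_eq (bump _)) by apply bump_bounds.
    rewrite (Rabs_pos_eq (2 / rho ^ 2)) by (apply Rdiv_le_0_compat; lra).
    rewrite Rmult_comm. apply Rmult_le_compat; [|apply HGpos| |exact HGJ].
    - apply Rmult_le_pos; [|apply Rabs_pos].
      apply Rmult_le_pos; [apply bump_bounds|apply Rdiv_le_0_compat; lra].
    - apply Rle_trans with (9 / 4 * (2 / rho ^ 2) * ((4 * g + 8) * rho ^ 2)).
      + apply Rmult_le_compat; [|apply Rabs_pos| |exact A8].
        * apply Rmult_le_pos; [apply bump_bounds|apply Rdiv_le_0_compat; lra].
        * apply Rmult_le_compat_r; [apply Rdiv_le_0_compat; lra|apply bump_bounds].
      + right. unfold C. field. lra. }
  assert (Hhout : forall X Y, X < 0 -> ~ in_half_annulus rho X Y -> h X Y = 0).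
  { intros X Y HX Hn. unfold h. rewrite bump_out; [ring|].
    assert (D : normY X Y <= rho \/ 2 * rho <= normY X Y).
    { destruct (Rle_dec (normY X Y) rho) as [A|A]; [left; exact A|]. right.
      apply Rnot_lt_le. intros B. apply Hn. split; [lra|lra]. }
    rewrite <- Hnorm. specialize (Hnpos X Y). destruct D as [D|D]; [left|right].
    - apply Rmult_le_reg_r with (rho ^ 2); [exact Hr2|]. unfold Rdiv. rewrite Rmult_assoc, Rinv_l, Rmult_1_r, Rmult_1_l by lra.
      apply pow_incr. lra.
    - apply Rmult_le_reg_r with (rho ^ 2); [exact Hr2|]. unfold Rdiv. rewrite Rmult_assoc, Rinv_l, Rmult_1_r by lra.
      replace (4 * rho ^ 2) with ((2 * rho) ^ 2) by ring. apply pow_incr. lra. }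
  (* the flux through [X = b] is small for [b] near [0] because [PZ] vanishes on [X = 0] *)
  set (W := 2 * rho + 1 - (- (2 * rho) - 1)). assert (HW : 0 < W) by (unfold W; lra).
  destruct (cont_D_bounded Q (-1) (- (2 * rho) - 1) (2 * rho + 1) HcQ) as [B [HB HBb]]; try lra.
  set (B' := I0 * B ^ p + 1).
  assert (HB' : 1 <= B').
  { unfold B'. assert (0 <= I0 * B ^ p) by (apply Rmult_le_pos; [lra|apply pow_le; exact HB]). lra. }
  set (ep := K0 / (8 * W * B')).
  assert (HWB : 0 < W * B') by (apply Rmult_lt_0_compat; lra).
  assert (Hep : 0 < ep) by (unfold ep; apply Rdiv_lt_0_compat; lra).
  destruct (uniform_continuity_2d (fun X Y => PZ (Rmin X 0) Y) (-1) 0 (- (2 * rho) - 1) (2 * rho + 1))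
    with (eps := mkposreal _ Hep) as [de Hde].
  { intros x y _ _. apply cont_D_clamp, HcPZ. }
  simpl in Hde. pose proof (cond_pos de).
  assert (Hbb : exists b, x1 + e <= b < 0 /\ -1 <= b /\ - b < de /\ g * - b <= ep).
  { exists (Rmax (Rmax (x1 + e) (-1)) (Rmax (- de / 2) (- ep / g))).
    assert (Hn : - ep / g < 0).
    { unfold Rdiv. rewrite <- Ropp_mult_distr_l. apply Ropp_lt_gt_0_contravar.
      apply Rmult_lt_0_compat; [exact Hep|apply Rinv_0_lt_compat; exact Hg]. }
    set (b := Rmax (Rmax (x1 + e) (-1)) (Rmax (- de / 2) (- ep / g))).
    assert (Hb : x1 + e <= b /\ -1 <= b /\ - de / 2 <= b /\ - ep / g <= b /\ b < 0).
    { unfold b, Rmax. repeat destruct Rle_dec; lra. }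
    split; [lra|]. split; [lra|]. split; [lra|].
    replace ep with (g * - (- ep / g)) by (field; lra). apply Rmult_le_compat_l; lra. }
  destruct Hbb as [b [Hb1 [Hb2 [Hb3 Hb4]]]].
  assert (Hxr : - (2 * rho) <= x1 - e).
  { unfold rho. assert (- Rabs x1 <= x1); [|lra]. pose proof (Rle_abs (- x1)). rewrite Rabs_Ropp in *. lra. }
  assert (Hyr : - (2 * rho) - 1 <= y1 - e /\ y1 + e <= 2 * rho + 1).
  { unfold rho. pose proof (Rle_abs (- y1)). pose proof (Rle_abs y1). rewrite Rabs_Ropp in *. lra. }
  assert (Eid := energy_identity g (INR p * c) G GR GZ P PR PZ rho b Hr ltac:(lra) ltac:(lra)
    NG NGR NGZ NP NPR NPZ
    (fun X Y HX => Hpow (fun x => Q x Y) X (QR X Y) (C1_D_derive_X Q QR QZ X Y HQ HX))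
    (fun X Y HX => Hpow (fun y => Q X y) Y (QZ X Y) (C1_D_derive_Z Q QR QZ X Y HQ (Rlt_le _ _ HX)))
    (fun X Y HX => C1_D_derive_X P PR PZ X Y HP HX)
    (fun X Y HX => C1_D_derive_Z P PR PZ X Y HP (Rlt_le _ _ HX)) HGeq).
  change (fun X Y => G X Y * (- bump ((X ^ 2 + Y ^ 2) / rho ^ 2) * (2 / rho ^ 2) *
     (g * (X * X + Y * Y) + (Y * PR X Y - X * PZ X Y)))) with h in Eid.
  fold kk in Eid.
  set (E1 := dint (fun X Y => chi rho X Y * G X Y) (- (2 * rho)) b (- (2 * rho) - 1) (2 * rho + 1)) in *.
  set (E2 := dint h (- (2 * rho)) b (- (2 * rho) - 1) (2 * rho + 1)) in *.
  set (E3 := RInt (fun Y => chi rho b Y * G b Y * (g * b - PZ b Y)) (- (2 * rho) - 1) (2 * rho + 1)) in *.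
  assert (F1 : 2 * e * (2 * e * (I0 * m)) <= E1).
  { replace (2 * e * (2 * e * (I0 * m))) with ((x1 + e - (x1 - e)) * ((y1 + e - (y1 - e)) * (I0 * m))) by ring.
    apply dint_lower; try lra.
    - cnegs.
    - intros X Y _. apply Rmult_le_pos; [apply cutoff_bounds|apply HGpos].
    - intros X Y HX HY. unfold chi. rewrite cutoff_in.
      + apply Rmult_le_compat_l; [unfold I0 in HI0; lra|apply HGm; assumption].
      + apply Rmult_le_reg_r with (rho ^ 2); [exact Hr2|]. unfold Rdiv.
        rewrite Rmult_assoc, Rinv_l, Rmult_1_r, Rmult_1_l by lra.
        rewrite <- Hnorm. apply pow_incr. split; [apply Hnpos|].
        eapply Rle_trans; [apply normY_le|].
        assert (Rabs X <= Rabs x1 + e).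
        { replace X with (x1 + (X - x1)) by ring. eapply Rle_trans; [apply Rabs_triang|].
          apply Rplus_le_compat_l, Rabs_bd. lra. }
        assert (Rabs Y <= Rabs y1 + e).
        { replace Y with (y1 + (Y - y1)) by ring. eapply Rle_trans; [apply Rabs_triang|].
          apply Rplus_le_compat_l, Rabs_bd. lra. }
        unfold rho. lra. }
  assert (F2 : Rabs E2 <= K0 / 4).
  { apply Rle_trans with (C * v).
    - apply (annulus_comparison J); try assumption; try lra.
      intros X Y HX. eapply Rle_trans; [|apply HJ; exact HX]. apply even_pow_nonneg, Hp0.
    - apply Rle_trans with (C * Rabs v); [apply Rmult_le_compat_l; [lra|apply Rle_abs]|].
      apply Rle_trans with (C * (K0 / (4 * C))); [apply Rmult_le_compat_l; lra|]. right. field. lra. }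
  assert (F3 : Rabs E3 <= K0 / 4).
  { apply Rle_trans with (W * (B' * (2 * ep))).
    - unfold E3, W. apply abs_RInt_le_const; [lra| |].
      + apply (cneg_ex_RInt (fun X Y => chi rho X Y * G X Y * (g * X - PZ X Y))); [cnegs|lra].
      + intros Y HY. rewrite Rabs_mult. apply Rmult_le_compat; try apply Rabs_pos.
        * rewrite Rabs_mult, (Rabs_pos_eq (chi rho b Y)) by apply cutoff_bounds.
          rewrite (Rabs_pos_eq (G b Y)) by apply HGpos.
          apply Rle_trans with (I0 * B ^ p); [|unfold B'; lra].
          apply Rmult_le_compat; [apply cutoff_bounds|apply HGpos|apply cutoff_bounds|].
          unfold G. rewrite <- (Rabs_pos_eq (Q b Y ^ p)) by apply HGpos. rewrite <- RPow_abs.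
          apply pow_incr. split; [apply Rabs_pos|]. apply HBb; lra.
        * specialize (Hde 0 Y b Y ltac:(lra) HY ltac:(lra) HY).
          rewrite !Rmin_left, H0 in Hde by lra. rewrite Rminus_0_r, Rminus_diag, Rabs_R0 in Hde.
          rewrite Rminus_0_r in Hde.
          specialize (Hde ltac:(rewrite Rabs_left1; lra) ltac:(lra)).
          apply Rabs_bd' in Hde. assert (g * - b = - (g * b)) by ring.
          assert (0 <= g * - b) by (apply Rmult_le_pos; lra). apply Rabs_bd. lra.
    - right. unfold ep. field. split; lra. }
  assert (F4 : Rabs (kk * E1) = Rabs kk * E1).
  { rewrite Rabs_mult, (Rabs_pos_eq E1); [reflexivity|].
    eapply Rle_trans; [|exact F1]. repeat apply Rmult_le_pos; lra. }
  assert (F5 : K0 <= Rabs (kk * E1)).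
  { rewrite F4. unfold K0. apply Rmult_le_compat_l; [lra|exact F1]. }
  replace (kk * E1) with (E3 - E2) in F5 by lra.
  pose proof (Rabs_triang E3 (- E2)) as T. rewrite Rabs_Ropp in T. unfold Rminus in F5. lra.
Qed.

(** * Rescaling *)

(* [l = (T - t)^gamma] replaces the time variable, so that the expansions become power series in [l]. *)
Definition tau (gamma l : R) : R := Rpower l (1 / gamma).

(** In case (ii) the function [delta] is only monotone and may jump, so [W] need not be open in
    time. Asking for a whole neighbourhood makes differentiation in [l] legitimate. *)
Definition scaled_interior (W : R -> R -> R -> Prop) (gamma T l X Y : R) : Prop :=
  0 < l /\ exists e, 0 < e /\ forall r z t, Rabs (r - (1 + l * X)) < e -> Rabs (z - l * Y) < e ->
    Rabs (t - (T - tau gamma l)) < e -> W r z t.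

Lemma tau_pos gamma l : 0 < tau gamma l.
Proof. apply exp_pos. Qed.

Lemma tau_power gamma l : 0 < gamma -> 0 < l -> Rpower (tau gamma l) gamma = l.
Proof.
  intros Hg Hl. unfold tau. rewrite Rpower_mult. replace (1 / gamma * gamma) with 1 by (field; lra).
  apply Rpower_1, Hl.
Qed.

Lemma tau_lt gamma l m : 0 < gamma -> 0 < l < m -> tau gamma l < tau gamma m.
Proof.
  intros Hg Hl. apply Rlt_Rpower_l; [|exact Hl]. apply Rdiv_lt_0_compat; lra.
Qed.

Lemma tau_of_power gamma s : 0 < gamma -> 0 < s -> tau gamma (Rpower s gamma) = s.
Proof.
  intros Hg Hs. unfold tau. rewrite Rpower_mult. replace (gamma * (1 / gamma)) with 1 by (field; lra).
  apply Rpower_1, Hs.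
Qed.

(** At a fixed time [W] is open in space even where it is not open in space-time; the final
    statement about the gradient of [psi1] relies on this. *)
Lemma W_slice gamma T W : W_case1 T W \/ W_case2 gamma T W -> forall r z t, W r z t ->
  0 < r < 1 /\ exists e, 0 < e /\ forall x y, Rabs (x - r) < e -> Rabs (y - z) < e -> W x y t.
Proof.
  intros [[de [Hde HW]]|[T0 [de [_ [_ [_ [_ [_ HW]]]]]]]] r z t HWr; assert (H := proj1 (HW r z t) HWr).
  - split; [lra|].
    exists (Rmin (Rmin (r - (1 - de)) (1 - r)) (Rmin (z + de) (de - z))).
    split; [repeat apply Rmin_glb_lt; lra|]. intros x y Hx Hy. apply HW.
    pose proof (Rmin_l (Rmin (r - (1 - de)) (1 - r)) (Rmin (z + de) (de - z))).
    pose proof (Rmin_r (Rmin (r - (1 - de)) (1 - r)) (Rmin (z + de) (de - z))).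
    pose proof (Rmin_l (r - (1 - de)) (1 - r)). pose proof (Rmin_r (r - (1 - de)) (1 - r)).
    pose proof (Rmin_l (z + de) (de - z)). pose proof (Rmin_r (z + de) (de - z)).
    apply Rabs_bd' in Hx. apply Rabs_bd' in Hy. lra.
  - split; [lra|].
    exists (Rmin r (Rmin (Rmin (r - (1 - de t)) (1 - r)) (Rmin (z + de t) (de t - z)))).
    split; [repeat apply Rmin_glb_lt; lra|]. intros x y Hx Hy. apply HW.
    set (A := Rmin (Rmin (r - (1 - de t)) (1 - r)) (Rmin (z + de t) (de t - z))) in *.
    pose proof (Rmin_l r A). pose proof (Rmin_r r A).
    assert (A <= r - (1 - de t) /\ A <= 1 - r /\ A <= z + de t /\ A <= de t - z).
    { unfold A. pose proof (Rmin_l (Rmin (r - (1 - de t)) (1 - r)) (Rmin (z + de t) (de t - z))).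
      pose proof (Rmin_r (Rmin (r - (1 - de t)) (1 - r)) (Rmin (z + de t) (de t - z))).
      pose proof (Rmin_l (r - (1 - de t)) (1 - r)). pose proof (Rmin_r (r - (1 - de t)) (1 - r)).
      pose proof (Rmin_l (z + de t) (de t - z)). pose proof (Rmin_r (z + de t) (de t - z)). lra. }
    apply Rabs_bd' in Hx. apply Rabs_bd' in Hy. lra.
Qed.

(** In case (ii) the limsup condition gives a time [ts] with [delta ts > 8 B m], where
    [m = (T - ts)^gamma]. As [delta] decreases, this lower bound holds at all earlier admissible
    times, that is for [l >= m]; the window [[2 m, 4 m]] stays strictly before [ts] and needs only
    half of the width. Smallness of [B m] keeps [r] positive. *)
Lemma scaled_windows gamma T W : 0 < gamma -> W_case1 T W \/ W_case2 gamma T W ->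
  windows (scaled_interior W gamma T).
Proof.
  intros Hg HW M eps Heps. pose proof (Rabs_pos M) as HM0. pose proof (Rle_abs M) as HM1.
  set (B := Rabs M + 1).
  assert (HB : 1 <= B) by (unfold B; lra).
  assert (Hprod : forall l X Y, 0 < l -> - M <= X < 0 -> Rabs Y <= M -> - (l * B) < l * X < 0 /\ - (l * B) < l * Y < l * B).
  { intros l X Y Hl HX HY. apply Rabs_bd in HY. unfold B.
    split; split.
    - rewrite <- Ropp_mult_distr_r_reverse. apply Rmult_lt_compat_l; lra.
    - rewrite <- (Rmult_0_r l). apply Rmult_lt_compat_l; lra.
    - rewrite <- Ropp_mult_distr_r_reverse. apply Rmult_lt_compat_l; lra.
    - apply Rmult_lt_compat_l; lra. }
  destruct HW as [[de [Hde HW]]|[T0 [de [HT0 [Hdp [Hdm [_ [Hsup HW]]]]]]]].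
  - assert (Hpd : 0 < Rpower de gamma) by apply exp_pos.
    set (mu := Rmin (eps / 2) (Rmin (de / (4 * B)) (Rpower de gamma / 4))).
    assert (Hmu : 0 < mu /\ mu <= eps / 2 /\ mu <= de / (4 * B) /\ mu <= Rpower de gamma / 4).
    { assert (0 < de / (4 * B)) by (apply Rdiv_lt_0_compat; lra).
      unfold mu, Rmin. repeat destruct Rle_dec; lra. }
    exists mu. split; [lra|]. intros l X Y Hl HX HY. split; [lra|].
    assert (HlB : l * B <= de / 2).
    { apply Rle_trans with (2 * (de / (4 * B)) * B); [apply Rmult_le_compat_r; lra|].
      right. field. lra. }
    destruct (Hprod l X Y ltac:(lra) HX HY) as [P1 P2].
    assert (Ht : tau gamma l < de).
    { rewrite <- (tau_of_power gamma de Hg) by lra. apply tau_lt; lra. }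
    pose proof (tau_pos gamma l) as Htp.
    assert (HA : exists A, 0 < A /\ A <= de / 2 /\ A <= - (l * X) /\ A <= tau gamma l /\ A <= de - tau gamma l).
    { exists (Rmin (Rmin (de / 2) (- (l * X))) (Rmin (tau gamma l) (de - tau gamma l))).
      unfold Rmin. repeat destruct Rle_dec; lra. }
    destruct HA as [A HA]. exists A. split; [apply HA|]. intros r z t Hr Hz Ht'. apply HW.
    apply Rabs_bd' in Hr. apply Rabs_bd' in Hz. apply Rabs_bd' in Ht'. lra.
  - assert (Hpd : 0 < Rpower (T - T0) gamma) by apply exp_pos.
    set (mu := Rmin (eps / 2) (Rmin (1 / (8 * B)) (Rpower (T - T0) gamma / 4))).
    assert (Hmu : 0 < mu /\ mu <= eps / 2 /\ mu <= 1 / (8 * B) /\ mu <= Rpower (T - T0) gamma / 4).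
    { assert (0 < 1 / (8 * B)) by (apply Rdiv_lt_0_compat; lra).
      unfold mu, Rmin. repeat destruct Rle_dec; lra. }
    destruct (Hsup (8 * B) (tau gamma mu) (tau_pos _ _)) as [ts [Hts1 [Hts2 Hts3]]].
    set (m := Rpower (T - ts) gamma).
    assert (Hm0 : 0 < m) by apply exp_pos.
    assert (Hmmu : m < mu).
    { unfold m. rewrite <- (tau_power gamma mu Hg) by lra. apply Rlt_Rpower_l; lra. }
    assert (Hmt : tau gamma m = T - ts) by (apply tau_of_power; lra).
    assert (Hdts : 8 * B * m < de ts).
    { apply Rmult_lt_compat_r with (r := m) in Hts3; [|exact Hm0].
      replace (Rpower (T - ts) (- gamma) * de ts * m) with (de ts) in Hts3; [exact Hts3|].
      unfold m. rewrite Rpower_Ropp. field. apply Rgt_not_eq, exp_pos. }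
    exists (2 * m). split; [lra|]. intros l X Y Hl HX HY. split; [lra|].
    destruct (Hprod l X Y ltac:(lra) HX HY) as [P1 P2].
    assert (HlB : l * B <= 4 * (B * m)).
    { replace (4 * (B * m)) with ((4 * m) * B) by ring. apply Rmult_le_compat_r; lra. }
    assert (HBm : B * m < 1 / 8).
    { apply Rlt_le_trans with (B * (1 / (8 * B))); [apply Rmult_lt_compat_l; lra|]. right. field. lra. }
    assert (Htl : tau gamma m < tau gamma l) by (apply tau_lt; lra).
    assert (Htl0 : tau gamma l < T - T0).
    { rewrite <- (tau_of_power gamma (T - T0) Hg) by lra. apply tau_lt; lra. }
    assert (HBm0 : 0 < B * m) by (apply Rmult_lt_0_compat; lra).
    assert (HA : exists A, 0 < A /\ A <= B * m /\ A <= - (l * X) /\ A <= tau gamma l - tau gamma m /\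
      A <= T - T0 - tau gamma l).
    { exists (Rmin (Rmin (B * m) (- (l * X))) (Rmin (tau gamma l - tau gamma m) (T - T0 - tau gamma l))).
      unfold Rmin. repeat destruct Rle_dec; lra. }
    destruct HA as [A HA]. exists A. split; [apply HA|]. intros r z t Hr Hz Ht'. apply HW.
    apply Rabs_bd' in Hr. apply Rabs_bd' in Hz. apply Rabs_bd' in Ht'.
    assert (Hd : de ts <= de t) by (apply Hdm; lra). lra.
Qed.

Lemma is_derive_Rpower l c : 0 < l -> is_derive (fun m => Rpower m c) l (c * Rpower l (c - 1)).
Proof. intros Hl. apply is_derive_Reals, derivable_pt_lim_power, Hl. Qed.

Lemma continuous_tau gamma l : 0 < l -> continuous (tau gamma) l.
Proof.
  intros Hl. apply (ex_derive_continuous (V := R_NormedModule)). eexists. apply is_derive_Rpower, Hl.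
Qed.

Lemma scaled_interior_open W gamma T l X Y : scaled_interior W gamma T l X Y ->
  locally l (fun m => scaled_interior W gamma T m X Y).
Proof.
  intros [Hl [e [He HW]]].
  assert (L1 : locally l (fun m => 0 < m)).
  { exists (mkposreal l Hl). intros m Hm. change (Rabs (m - l) < l) in Hm. apply Rabs_bd' in Hm. lra. }
  assert (He2 : 0 < e / 2) by lra.
  assert (Cl : forall k : R, continuous (fun m => m * k) l).
  { intros k. apply (continuous_mult (K := R_AbsRing)); [apply continuous_id|apply continuous_const]. }
  pose proof (proj1 (filterlim_locally _ _) (Cl X) (mkposreal _ He2)) as L2.
  pose proof (proj1 (filterlim_locally _ _) (Cl Y) (mkposreal _ He2)) as L3.
  pose proof (proj1 (filterlim_locally _ _) (continuous_tau gamma l Hl) (mkposreal _ He2)) as L4.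
  generalize (filter_and _ _ L1 (filter_and _ _ L2 (filter_and _ _ L3 L4))). apply filter_imp.
  intros m [A1 [A2 [A3 A4]]]. change (Rabs (m * X - l * X) < e / 2) in A2.
  change (Rabs (m * Y - l * Y) < e / 2) in A3. change (Rabs (tau gamma m - tau gamma l) < e / 2) in A4.
  split; [exact A1|]. exists (e / 2). split; [exact He2|]. intros r z t Hr Hz Ht.
  apply Rabs_bd' in A2. apply Rabs_bd' in A3. apply Rabs_bd' in A4.
  apply Rabs_bd' in Hr. apply Rabs_bd' in Hz. apply Rabs_bd' in Ht.
  apply HW; apply Rabs_bd'; lra.
Qed.

Lemma scaled_interior_W W gamma T l X Y : scaled_interior W gamma T l X Y ->
  0 < l /\ W (1 + l * X) (l * Y) (T - tau gamma l).
Proof.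
  intros [Hl [e [He HW]]]. split; [exact Hl|]. apply HW; rewrite Rminus_diag, Rabs_R0; exact He.
Qed.

Lemma continuous_scaled W gamma T f l X Y : cont3_on W f -> scaled_interior W gamma T l X Y ->
  continuous (unc3 (fun l X Y => f (1 + l * X) (l * Y) (T - tau gamma l))) (l, (X, Y)).
Proof.
  intros Hf HV. assert (HV' := HV). destruct HV' as [Hl [e [He HW]]].
  apply filterlim_locally. intros eps.
  destruct (Hf _ _ _ (proj2 (scaled_interior_W _ _ _ _ _ _ HV)) eps (cond_pos eps)) as [eta [Heta Hc]].
  set (d := Rmin e eta). assert (Hd : 0 < d) by (apply Rmin_glb_lt; lra).
  pose proof (Rmin_l e eta). pose proof (Rmin_r e eta).
  assert (C1 : continuous (fun p : R * (R * R) => 1 + fst p * fst (snd p)) (l, (X, Y))) by cont.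
  assert (C2 : continuous (fun p : R * (R * R) => fst p * snd (snd p)) (l, (X, Y))) by cont.
  assert (C3 : continuous (fun p : R * (R * R) => T - tau gamma (fst p)) (l, (X, Y))).
  { apply (continuous_minus (V := R_NormedModule)); [apply continuous_const|].
    apply (continuous_comp fst (tau gamma)); [apply continuous_fst|apply continuous_tau; exact Hl]. }
  pose proof (proj1 (filterlim_locally _ _) C1 (mkposreal _ Hd)) as L1.
  pose proof (proj1 (filterlim_locally _ _) C2 (mkposreal _ Hd)) as L2.
  pose proof (proj1 (filterlim_locally _ _) C3 (mkposreal _ Hd)) as L3.
  generalize (filter_and _ _ L1 (filter_and _ _ L2 L3)). apply filter_imp.
  intros [l' [X' Y']] [A1 [A2 A3]].
  change (Rabs (1 + l' * X' - (1 + l * X)) < d) in A1.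
  change (Rabs (l' * Y' - l * Y) < d) in A2.
  change (Rabs (T - tau gamma l' - (T - tau gamma l)) < d) in A3.
  unfold d in *.
  change (Rabs (f (1 + l' * X') (l' * Y') (T - tau gamma l') - f (1 + l * X) (l * Y) (T - tau gamma l)) < eps).
  apply Hc; try lra. apply HW; lra.
Qed.

Lemma mvt_partial (f : R -> R) f' a b e K d : (forall x, Rabs (x - a) < d -> is_derive f x (f' x)) ->
  (forall x, Rabs (x - a) < d -> Rabs (f' x - K) <= e) -> Rabs (b - a) < d ->
  Rabs (f b - f a - K * (b - a)) <= e * Rabs (b - a).
Proof.
  intros Hf Hb Hab.
  assert (HM : forall u, Rmin a b <= u <= Rmax a b -> Rabs (u - a) < d).
  { intros u Hu. eapply Rle_lt_trans; [|exact Hab]. revert Hu. unfold Rmin, Rmax, Rabs.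
    repeat destruct Rle_dec; repeat destruct Rcase_abs; lra. }
  destruct (MVT_gen f a b f') as [xi [Hxi E]].
  - intros x Hx. apply Hf, HM. lra.
  - intros x Hx. apply derivable_continuous_pt. exists (f' x). apply is_derive_Reals, Hf, HM, Hx.
  - rewrite E. replace (f' xi * (b - a) - K * (b - a)) with ((f' xi - K) * (b - a)) by ring.
    rewrite Rabs_mult. apply Rmult_le_compat_r; [apply Rabs_pos|]. apply Hb, HM, Hxi.
Qed.

(** Partial derivatives are given on [W] only, so total differentiability comes from the mean value
    theorem in one coordinate at a time, inside a box contained in [W]. *)
Lemma chain_rule3 W f fr fz ft (r z t : R -> R) l r' z' t' e :
  0 < e ->
  (forall a b c, Rabs (a - r l) < e -> Rabs (b - z l) < e -> Rabs (c - t l) < e -> W a b c) ->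
  (forall a b c, W a b c -> is_derive (fun x => f x b c) a (fr a b c) /\
     is_derive (fun y => f a y c) b (fz a b c) /\ is_derive (fun s => f a b s) c (ft a b c)) ->
  cont3_on W fr -> cont3_on W fz -> cont3_on W ft ->
  is_derive r l r' -> is_derive z l z' -> is_derive t l t' ->
  is_derive (fun m => f (r m) (z m) (t m)) l
    (fr (r l) (z l) (t l) * r' + fz (r l) (z l) (t l) * z' + ft (r l) (z l) (t l) * t').
Proof.
  intros He HW Hd Hcr Hcz Hct Dr Dz Dt.
  set (r0 := r l) in *. set (z0 := z l) in *. set (t0 := t l) in *.
  assert (HW0 : W r0 z0 t0) by (apply HW; rewrite Rminus_diag, Rabs_R0; exact He).
  set (kr := fr r0 z0 t0). set (kz := fz r0 z0 t0). set (kt := ft r0 z0 t0).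
  apply is_derive_Reals. intros eps Heps.
  set (S := Rabs r' + Rabs z' + Rabs t' + 3 + Rabs kr + Rabs kz + Rabs kt).
  pose proof (Rabs_pos r'). pose proof (Rabs_pos z'). pose proof (Rabs_pos t').
  pose proof (Rabs_pos kr). pose proof (Rabs_pos kz). pose proof (Rabs_pos kt).
  assert (HS : 3 <= S) by (unfold S; lra).
  set (ep := Rmin 1 (eps / (2 * S))).
  assert (Hep : 0 < ep /\ ep <= 1 /\ ep <= eps / (2 * S)).
  { unfold ep. split; [apply Rmin_glb_lt; [lra|apply Rdiv_lt_0_compat; lra]|]. split; [apply Rmin_l|apply Rmin_r]. }
  destruct (Hcr _ _ _ HW0 ep (proj1 Hep)) as [e1 [He1 C1]].
  destruct (Hcz _ _ _ HW0 ep (proj1 Hep)) as [e2 [He2 C2]].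
  destruct (Hct _ _ _ HW0 ep (proj1 Hep)) as [e3 [He3 C3]].
  set (d := Rmin e (Rmin e1 (Rmin e2 e3))).
  assert (Hdd : 0 < d /\ d <= e /\ d <= e1 /\ d <= e2 /\ d <= e3).
  { unfold d, Rmin. repeat destruct Rle_dec; lra. }
  assert (Cr : continuous r l) by (apply (ex_derive_continuous (V := R_NormedModule)); eexists; exact Dr).
  assert (Cz : continuous z l) by (apply (ex_derive_continuous (V := R_NormedModule)); eexists; exact Dz).
  assert (Ct : continuous t l) by (apply (ex_derive_continuous (V := R_NormedModule)); eexists; exact Dt).
  destruct (proj1 (filterlim_locally _ _) Cr (mkposreal _ (proj1 Hdd))) as [g1 G1].
  destruct (proj1 (filterlim_locally _ _) Cz (mkposreal _ (proj1 Hdd))) as [g2 G2].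
  destruct (proj1 (filterlim_locally _ _) Ct (mkposreal _ (proj1 Hdd))) as [g3 G3].
  apply is_derive_Reals in Dr. apply is_derive_Reals in Dz. apply is_derive_Reals in Dt.
  destruct (Dr ep (proj1 Hep)) as [g4 G4]. destruct (Dz ep (proj1 Hep)) as [g5 G5].
  destruct (Dt ep (proj1 Hep)) as [g6 G6].
  pose proof (cond_pos g1). pose proof (cond_pos g2). pose proof (cond_pos g3).
  pose proof (cond_pos g4). pose proof (cond_pos g5). pose proof (cond_pos g6).
  assert (Hgg : exists g, 0 < g /\ g <= g1 /\ g <= g2 /\ g <= g3 /\ g <= g4 /\ g <= g5 /\ g <= g6).
  { exists (Rmin (Rmin g1 (Rmin g2 g3)) (Rmin g4 (Rmin g5 g6))). unfold Rmin. repeat destruct Rle_dec; lra. }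
  destruct Hgg as [g [Hg0 Hgs]].
  exists (mkposreal g Hg0). intros h Hh0 Hh. simpl in Hh.
  assert (B1 : Rabs (r (l + h) - r0) < d).
  { apply (G1 (l + h)). change (Rabs (l + h - l) < g1). replace (l + h - l) with h by ring. lra. }
  assert (B2 : Rabs (z (l + h) - z0) < d).
  { apply (G2 (l + h)). change (Rabs (l + h - l) < g2). replace (l + h - l) with h by ring. lra. }
  assert (B3 : Rabs (t (l + h) - t0) < d).
  { apply (G3 (l + h)). change (Rabs (l + h - l) < g3). replace (l + h - l) with h by ring. lra. }
  specialize (G4 h Hh0 ltac:(lra)). specialize (G5 h Hh0 ltac:(lra)). specialize (G6 h Hh0 ltac:(lra)).
  fold r0 in G4. fold z0 in G5. fold t0 in G6.
  set (r1 := r (l + h)) in *. set (z1 := z (l + h)) in *. set (t1 := t (l + h)) in *.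
  assert (Z0 : forall x, Rabs (x - x) < d) by (intros x; rewrite Rminus_diag, Rabs_R0; lra).
  assert (HWd : forall a b c, Rabs (a - r0) < d -> Rabs (b - z0) < d -> Rabs (c - t0) < d -> W a b c).
  { intros. apply HW; lra. }
  assert (M1 : Rabs (f r1 z1 t1 - f r0 z1 t1 - kr * (r1 - r0)) <= ep * Rabs (r1 - r0)).
  { apply (mvt_partial (fun x => f x z1 t1) (fun x => fr x z1 t1) r0 r1 ep kr d); try assumption.
    - intros x Hx. apply Hd, HWd; assumption.
    - intros x Hx. apply Rlt_le, C1; try lra. apply HWd; assumption. }
  assert (M2 : Rabs (f r0 z1 t1 - f r0 z0 t1 - kz * (z1 - z0)) <= ep * Rabs (z1 - z0)).
  { apply (mvt_partial (fun x => f r0 x t1) (fun x => fz r0 x t1) z0 z1 ep kz d); try assumption.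
    - intros x Hx. apply Hd, HWd; auto.
    - intros x Hx. pose proof (Z0 r0). apply Rlt_le, C2; try lra. apply HWd; auto. }
  assert (M3 : Rabs (f r0 z0 t1 - f r0 z0 t0 - kt * (t1 - t0)) <= ep * Rabs (t1 - t0)).
  { apply (mvt_partial (fun x => f r0 z0 x) (fun x => ft r0 z0 x) t0 t1 ep kt d); try assumption.
    - intros x Hx. apply Hd, HWd; auto.
    - intros x Hx. pose proof (Z0 r0). pose proof (Z0 z0). apply Rlt_le, C3; try lra. apply HWd; auto. }
  assert (Q : forall K F x x', Rabs (F - K * x) <= ep * Rabs x -> Rabs (x / h - x') < ep ->
     Rabs (F / h - K * x') <= ep * (Rabs x' + 1) + Rabs K * ep).
  { intros K F x x' HF1 HF2.
    replace (F / h - K * x') with ((F - K * x) / h + K * (x / h - x')) by (field; exact Hh0).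
    eapply Rle_trans; [apply Rabs_triang|]. apply Rplus_le_compat.
    - unfold Rdiv. rewrite Rabs_mult. apply Rle_trans with (ep * Rabs x * Rabs (/ h)).
      + apply Rmult_le_compat_r; [apply Rabs_pos|exact HF1].
      + rewrite Rmult_assoc, <- Rabs_mult. apply Rmult_le_compat_l; [lra|].
        change (x * / h) with (x / h). replace (x / h) with (x' + (x / h - x')) by ring.
        eapply Rle_trans; [apply Rabs_triang|]. lra.
    - rewrite Rabs_mult. apply Rmult_le_compat_l; [apply Rabs_pos|lra]. }
  assert (Q1 := Q _ _ _ r' M1 G4). assert (Q2 := Q _ _ _ z' M2 G5). assert (Q3 := Q _ _ _ t' M3 G6).
  change (Rabs ((f r1 z1 t1 - f r0 z0 t0) / h - (kr * r' + kz * z' + kt * t')) < eps).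
  replace ((f r1 z1 t1 - f r0 z0 t0) / h - (kr * r' + kz * z' + kt * t')) with
    (((f r1 z1 t1 - f r0 z1 t1) / h - kr * r') + ((f r0 z1 t1 - f r0 z0 t1) / h - kz * z') +
     ((f r0 z0 t1 - f r0 z0 t0) / h - kt * t')) by (field; exact Hh0).
  assert (HSe : ep * S <= eps / 2).
  { apply Rle_trans with (eps / (2 * S) * S); [apply Rmult_le_compat_r; lra|]. right. field. lra. }
  assert (ES : ep * S = (ep * (Rabs r' + 1) + Rabs kr * ep) + (ep * (Rabs z' + 1) + Rabs kz * ep) +
     (ep * (Rabs t' + 1) + Rabs kt * ep)) by (unfold S; ring).
  apply Rle_lt_trans with (ep * S); [|lra]. rewrite ES.
  eapply Rle_trans; [apply Rabs_triang|]. apply Rplus_le_compat; [|exact Q3].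
  eapply Rle_trans; [apply Rabs_triang|]. apply Rplus_le_compat; assumption.
Qed.

Definition rescale (gamma T c : R) (f : R -> R -> R -> R) (l X Y : R) : R :=
  Rpower (tau gamma l) c * f (1 + l * X) (l * Y) (T - tau gamma l).

Lemma Rpower_tau gamma l c : Rpower (tau gamma l) c = Rpower l (c / gamma).
Proof. unfold tau. rewrite Rpower_mult. f_equal. unfold Rdiv. ring. Qed.

Lemma Rpower_pred l c : 0 < l -> l * Rpower l (c - 1) = Rpower l c.
Proof.
  intros Hl. rewrite <- (Rpower_1 l Hl) at 1. rewrite <- Rpower_plus. f_equal. ring.
Qed.

Lemma rescale_derive_X gamma T c f l X Y d :
  is_derive (fun x => f x (l * Y) (T - tau gamma l)) (1 + l * X) d ->
  is_derive (fun x => rescale gamma T c f l x Y) X (l * (Rpower (tau gamma l) c * d)).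
Proof.
  intros H. replace (l * (Rpower (tau gamma l) c * d)) with (Rpower (tau gamma l) c * (l * d)) by ring.
  unfold rescale. apply is_derive_scal.
  apply (is_derive_ext (fun x => (fun x => f x (l * Y) (T - tau gamma l)) (l * x + 1))).
  - intros t. f_equal. ring.
  - apply (is_derive_comp_affine (fun x => f x (l * Y) (T - tau gamma l))). rewrite Rplus_comm. exact H.
Qed.

Lemma rescale_derive_Y gamma T c f l X Y d :
  is_derive (fun y => f (1 + l * X) y (T - tau gamma l)) (l * Y) d ->
  is_derive (fun y => rescale gamma T c f l X y) Y (l * (Rpower (tau gamma l) c * d)).
Proof.
  intros H. replace (l * (Rpower (tau gamma l) c * d)) with (Rpower (tau gamma l) c * (l * d)) by ring.
  unfold rescale. apply is_derive_scal.
  apply (is_derive_ext (fun y => (fun y => f (1 + l * X) y (T - tau gamma l)) (l * y + 0))).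
  - intros t. f_equal. ring.
  - apply (is_derive_comp_affine (fun y => f (1 + l * X) y (T - tau gamma l))). rewrite Rplus_0_r. exact H.
Qed.

Lemma rescale_continuous W gamma T c f l X Y : cont3_on W f -> scaled_interior W gamma T l X Y ->
  continuous (unc3 (rescale gamma T c f)) (l, (X, Y)).
Proof.
  intros Hf HV. apply (continuous_mult (K := R_AbsRing) (fun p : R * (R * R) => Rpower (tau gamma (fst p)) c)
    (unc3 (fun l X Y => f (1 + l * X) (l * Y) (T - tau gamma l)))).
  - apply (continuous_comp fst (fun m => Rpower (tau gamma m) c)); [apply continuous_fst|].
    apply (continuous_ext (fun m => Rpower m (c / gamma))); [intros m; symmetry; apply Rpower_tau|].
    apply (ex_derive_continuous (V := R_NormedModule)). eexists. apply is_derive_Rpower, HV.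
  - apply (continuous_scaled W); assumption.
Qed.

Lemma continuous_slice (f : R -> R -> R -> R) l X Y : continuous (unc3 f) (l, (X, Y)) ->
  continuous (fun p : R * R => f l (fst p) (snd p)) (X, Y).
Proof.
  intros H. apply (continuous_unc3 _ f (fun _ => l) fst snd (X, Y)).
  - exact H.
  - apply continuous_const.
  - apply continuous_fst.
  - apply continuous_snd.
Qed.

Lemma rescale_series W gamma T a f F l X Y : 0 < gamma -> self_similar W gamma T a f F ->
  scaled_interior W gamma T l X Y -> is_pseries (fun k => F k X Y) l (rescale gamma T (- a) f l X Y).
Proof.
  intros Hg HS HV. destruct (scaled_interior_W _ _ _ _ _ _ HV) as [Hl HW].
  destruct (HS _ _ _ HW) as [S [HS1 HS2]]. unfold rescale. rewrite HS2.
  replace (T - (T - tau gamma l)) with (tau gamma l) in * by ring.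
  rewrite <- Rmult_assoc, <- Rpower_plus. replace (- a + a) with 0 by ring.
  rewrite Rpower_O, Rmult_1_l by apply tau_pos.
  apply is_series_Reals in HS1. revert HS1. apply is_series_ext. intros k.
  assert (Hlp : Rpower (tau gamma l) (- gamma) = / l) by (rewrite Rpower_Ropp, tau_power; trivial).
  rewrite Hlp. replace ((1 + l * X - 1) * / l) with X by (field; lra).
  replace (l * Y * / l) with Y by (field; lra).
  rewrite Rmult_comm with (r1 := INR k), <- Rpower_mult, tau_power, Rpower_pow by assumption.
  reflexivity.
Qed.

Definition rescale_dl (gamma T c : R) (f fr fz ft : R -> R -> R -> R) (l X Y : R) : R :=
  c / gamma * Rpower l (c / gamma - 1) * f (1 + l * X) (l * Y) (T - tau gamma l) +
  Rpower (tau gamma l) c * (fr (1 + l * X) (l * Y) (T - tau gamma l) * X +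
    fz (1 + l * X) (l * Y) (T - tau gamma l) * Y +
    ft (1 + l * X) (l * Y) (T - tau gamma l) * - (1 / gamma * Rpower l (1 / gamma - 1))).

Lemma rescale_derive_l W gamma T c f fr fz ft l X Y :
  (forall r z t, W r z t -> is_derive (fun x => f x z t) r (fr r z t) /\
     is_derive (fun y => f r y t) z (fz r z t) /\ is_derive (fun s => f r z s) t (ft r z t)) ->
  cont3_on W fr -> cont3_on W fz -> cont3_on W ft -> scaled_interior W gamma T l X Y ->
  is_derive (fun m => rescale gamma T c f m X Y) l (rescale_dl gamma T c f fr fz ft l X Y).
Proof.
  intros Hd Hr Hz Ht [Hl [e [He HW]]]. unfold rescale, rescale_dl.
  apply (is_derive_mult (K := R_AbsRing) (fun m => Rpower (tau gamma m) c)
    (fun m => f (1 + m * X) (m * Y) (T - tau gamma m))).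
  - apply (is_derive_ext (fun m => Rpower m (c / gamma))); [intros m; symmetry; apply Rpower_tau|].
    apply is_derive_Rpower, Hl.
  - apply (chain_rule3 W f fr fz ft (fun m => 1 + m * X) (fun m => m * Y) (fun m => T - tau gamma m) l X Y _ e);
      try assumption.
    + auto_derive; [tauto|ring].
    + auto_derive; [tauto|ring].
    + replace (- (1 / gamma * Rpower l (1 / gamma - 1))) with (0 - 1 / gamma * Rpower l (1 / gamma - 1)) by ring.
      apply (is_derive_minus (V := R_NormedModule) (fun _ => T) (tau gamma)).
      * apply (is_derive_const (V := R_NormedModule)).
      * apply is_derive_Rpower, Hl.
  - apply Rmult_comm.
Qed.

(** Differentiating in [l] at fixed [(X, Y)] mixes the time derivative with dilation in space.
    Solved for the time derivative, this is the origin of the terms [c q], [g (X qx + Y qz)] and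
    [- g s] in [transport_op]. *)
Lemma rescale_dl_euler gamma T c f fr fz ft l X Y : 0 < gamma -> 0 < l ->
  gamma * (l * rescale_dl gamma T c f fr fz ft l X Y) = c * rescale gamma T c f l X Y +
    gamma * (X * (l * rescale gamma T c fr l X Y) + Y * (l * rescale gamma T c fz l X Y)) -
    tau gamma l * rescale gamma T c ft l X Y.
Proof.
  intros Hg Hl. unfold rescale_dl, rescale.
  set (F := f _ _ _). set (FR := fr _ _ _). set (FZ := fz _ _ _). set (FT := ft _ _ _).
  assert (E1 : l * Rpower l (c / gamma - 1) = Rpower (tau gamma l) c) by (rewrite Rpower_tau; apply Rpower_pred, Hl).
  assert (E2 : l * Rpower l (1 / gamma - 1) = tau gamma l) by (apply Rpower_pred, Hl).
  set (a := Rpower l (c / gamma - 1)) in *. set (b := Rpower l (1 / gamma - 1)) in *.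
  rewrite <- E1, <- E2. field. lra.
Qed.

(** The balance of scales: two space derivatives of the rescaled stream function carry the same
    power of [T - t] as the vorticity, and so does the transport velocity against the time
    derivative. *)
Lemma tau_square gamma l : 0 < gamma -> 0 < l -> Rpower (tau gamma l) (1 - 2 * gamma) * (l * l) = tau gamma l.
Proof.
  intros Hg Hl. rewrite <- (tau_power gamma l) at 2 3 by assumption. rewrite <- !Rpower_plus.
  replace (1 - 2 * gamma + (gamma + gamma)) with 1 by ring. apply Rpower_1, tau_pos.
Qed.

Lemma stream_family_rescale W gamma T psi psir psiz psirr psizz w Psi Om : 0 < gamma ->
  W_case1 T W \/ W_case2 gamma T W ->
  (forall r z t, W r z t -> is_derive (fun x => psi x z t) r (psir r z t) /\
     is_derive (fun y => psi r y t) z (psiz r z t) /\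
     is_derive (fun x => psir x z t) r (psirr r z t) /\ is_derive (fun y => psiz r y t) z (psizz r z t) /\
     - (psirr r z t + 3 / r * psir r z t + psizz r z t) = w r z t) ->
  cont3_on W psi ->
  self_similar W gamma T (-1 + 2 * gamma) psi Psi -> self_similar W gamma T (-1) w Om ->
  stream_family (scaled_interior W gamma T) (rescale gamma T (1 - 2 * gamma) psi)
    (fun l X Y => l * rescale gamma T (1 - 2 * gamma) psir l X Y)
    (fun l X Y => l * rescale gamma T (1 - 2 * gamma) psiz l X Y) (rescale gamma T 1 w) Psi Om.
Proof.
  intros Hg HW Hd Hc HP HO.
  exists (fun l X Y => l * (l * rescale gamma T (1 - 2 * gamma) psirr l X Y)),
    (fun l X Y => l * (l * rescale gamma T (1 - 2 * gamma) psizz l X Y)).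
  intros l X Y HV. destruct (scaled_interior_W _ _ _ _ _ _ HV) as [Hl HWp].
  destruct (Hd _ _ _ HWp) as [D1 [D2 [D3 [D4 E]]]].
  destruct (W_slice gamma T W HW _ _ _ HWp) as [Hr _].
  split; [|split].
  - split; [exact Hl|]. split; [lra|]. ands.
    + apply continuous_slice, (rescale_continuous W); assumption.
    + apply rescale_derive_X, D1.
    + apply is_derive_scal, rescale_derive_X, D3.
    + apply rescale_derive_Y, D2.
    + apply is_derive_scal, rescale_derive_Y, D4.
    + unfold rescale at 4. rewrite <- E, Rpower_1 by apply tau_pos.
      rewrite <- (tau_square gamma l Hg Hl) at 1. unfold rescale. field. lra.
  - replace (1 - 2 * gamma) with (- (-1 + 2 * gamma)) by ring. apply (rescale_series W); assumption.
  - replace 1 with (- (-1)) by ring. apply (rescale_series W); assumption.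
Qed.

Lemma transport_family_rescale W gamma T c ka psi psir psiz f fr fz ft Q : 0 < gamma ->
  (forall r z t, W r z t -> is_derive (fun x => f x z t) r (fr r z t) /\
     is_derive (fun y => f r y t) z (fz r z t) /\ is_derive (fun s => f r z s) t (ft r z t) /\
     ft r z t + - r * psiz r z t * fr r z t + (2 * psi r z t + r * psir r z t) * fz r z t =
       ka * f r z t * psiz r z t) ->
  cont3_on W f -> cont3_on W fr -> cont3_on W fz -> cont3_on W ft ->
  self_similar W gamma T (- c) f Q ->
  transport_family (scaled_interior W gamma T) gamma c ka (rescale gamma T (1 - 2 * gamma) psi)
    (fun l X Y => l * rescale gamma T (1 - 2 * gamma) psir l X Y)
    (fun l X Y => l * rescale gamma T (1 - 2 * gamma) psiz l X Y) (rescale gamma T c f) Q.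
Proof.
  intros Hg Hd Hf Hr Hz Ht HS.
  exists (fun l X Y => l * rescale gamma T c fr l X Y), (fun l X Y => l * rescale gamma T c fz l X Y),
    (rescale_dl gamma T c f fr fz ft).
  intros l X Y HV. destruct (scaled_interior_W _ _ _ _ _ _ HV) as [Hl HWp].
  destruct (Hd _ _ _ HWp) as [D1 [D2 [D3 E]]].
  ands.
  - apply continuous_slice, (rescale_continuous W); assumption.
  - apply rescale_derive_X, D1.
  - apply rescale_derive_Y, D2.
  - apply (rescale_derive_l W); try assumption. intros r z t H. destruct (Hd r z t H) as [? [? [? _]]]. auto.
  - unfold transport_op. rewrite rescale_dl_euler by assumption.
    rewrite <- (tau_square gamma l Hg Hl). unfold rescale.
    set (B := Rpower (tau gamma l) (1 - 2 * gamma)). set (A := Rpower (tau gamma l) c).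
    revert E. set (r := 1 + l * X). set (z := l * Y). set (t := T - tau gamma l). intros E.
    replace (ft r z t) with (ka * f r z t * psiz r z t + r * psiz r z t * fr r z t -
      (2 * psi r z t + r * psir r z t) * fz r z t) by lra. ring.
  - rewrite <- (Ropp_involutive c). apply (rescale_series W); assumption.
Qed.

(** * Induction over the profiles and conclusion *)

Lemma transport_family_next V g c ka psi psiR psiZ q Q :
  transport_family V g c ka psi psiR psiZ q Q -> (forall l X Y, V l X Y -> 0 < l /\ Q O X Y = 0) ->
  transport_family V g (c - g) ka psi psiR psiZ (fun l X Y => q l X Y / l) (fun k => Q (S k)).
Proof.
  intros [qR [qZ [ql H]]] H0.
  exists (fun l X Y => / l * qR l X Y), (fun l X Y => / l * qZ l X Y),
    (fun l X Y => ql l X Y / l - q l X Y / l ^ 2).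
  intros l X Y HV. destruct (H l X Y HV) as [Hc [D1 [D2 [D3 [E S]]]]]. destruct (H0 l X Y HV) as [Hl HQ].
  ands.
  - apply (continuous_mult (K := R_AbsRing) (fun p : R * R => q l (fst p) (snd p)) (fun _ => / l));
      [exact Hc|apply continuous_const].
  - apply (is_derive_ext (fun x => / l * q l x Y)); [intros t; apply Rmult_comm|]. apply is_derive_scal, D1.
  - apply (is_derive_ext (fun y => / l * q l X y)); [intros t; apply Rmult_comm|]. apply is_derive_scal, D2.
  - replace (ql l X Y / l - q l X Y / l ^ 2) with ((ql l X Y * l - q l X Y * 1) / l ^ 2) by (field; lra).
    apply (is_derive_div (fun m => q m X Y) (fun m => m)); [exact D3|apply (is_derive_id (K := R_AbsRing))|lra].
  - replace 0 with (/ l * 0) by ring. rewrite <- E. unfold transport_op. field. lra.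
  - replace (q l X Y / l) with ((q l X Y - Q O X Y) / l) by (rewrite HQ; field; lra).
    apply (is_pseries_tail (fun k => Q k X Y)); assumption.
Qed.

Lemma transport_profiles_vanish V g ka psi psiR psiZ w Psi Om PR PZ OR OZ : 0 < g ->
  windows V -> (forall l X Y, V l X Y -> locally l (fun m => V m X Y)) ->
  (forall l X Y, V l X Y -> 0 < l /\ X <= 0) ->
  stream_family V psi psiR psiZ w Psi Om ->
  (forall k, cont_D (Psi k)) -> (forall k, cont_D (Om k)) ->
  C1_D_with (Psi O) PR PZ -> C1_D_with (Om O) OR OZ -> (forall Y, PZ 0 Y = 0) ->
  (forall eps, 0 < eps -> exists M, forall X Y, X <= 0 ->
      M < normY X Y -> normY (PR X Y) (PZ X Y) <= eps * normY X Y) ->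
  forall k c q Q, transport_family V g c ka psi psiR psiZ q Q -> (forall k, C1_D (Q k)) ->
  (forall k eps, 0 < eps -> exists M, forall X Y, X <= 0 -> M < normY X Y -> Rabs (Q k X Y) < eps) ->
  (forall k, c - INR k * g < 0 \/ exists p J, Nat.Even p /\ (forall X Y, X <= 0 -> Q k X Y ^ p <= J X Y) /\
     forall eps, 0 < eps -> exists M, forall rho, M < rho ->
       exists v, half_annulus_integral J rho v /\ Rabs v < eps) ->
  forall X Y, X <= 0 -> Q k X Y = 0.
Proof.
  intros Hg HV HVo HVl HS HcP HcO HP HO HZ0 Hb.
  (* Each step of the induction divides [q] by [l], which shifts [Q] and lowers [c]; hence the
     first-profile case is needed for all [c], [q] and [Q]. The stream function is not shifted, so
     [Psi O] drives every stage. *)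
  assert (Base : forall c q Q, transport_family V g c ka psi psiR psiZ q Q -> (forall k, C1_D (Q k)) ->
  (forall k eps, 0 < eps -> exists M, forall X Y, X <= 0 -> M < normY X Y -> Rabs (Q k X Y) < eps) ->
  (forall k, c - INR k * g < 0 \/ exists p J, Nat.Even p /\ (forall X Y, X <= 0 -> Q k X Y ^ p <= J X Y) /\
     forall eps, 0 < eps -> exists M, forall rho, M < rho ->
       exists v, half_annulus_integral J rho v /\ Rabs v < eps) ->
  forall X Y, X <= 0 -> Q O X Y = 0).
  { intros c q Q HT HQ Hdec Halt. destruct (HQ O) as [QR [QZ HQ0]].
    assert (HcQ : forall k, cont_D (Q k)) by (intros k; destruct (HQ k) as [a [b Hab]]; apply Hab).
    assert (Heq := transport_limit V g c ka psi psiR psiZ w Psi Om q Q PR PZ OR OZ QR QZ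
      HV HVo HS HT HcP HcO HcQ HP HO HQ0).
    destruct (Halt O) as [Hneg|[p [J [Hp [HJ Hann]]]]].
    - apply (transport_max_vanish c g (Q O) QR QZ PR PZ); try assumption; [|apply Hdec].
      simpl in Hneg. lra.
    - apply (transport_energy_vanish c g p (Q O) QR QZ (Psi O) PR PZ J); try assumption. apply Hdec. }
  induction k as [|k IH]; intros c q Q HT HQ Hdec Halt.
  - apply (Base c q Q); assumption.
  - apply (IH (c - g) (fun l X Y => q l X Y / l) (fun k => Q (S k))).
    + apply transport_family_next; [exact HT|]. intros l X Y HVp. destruct (HVl l X Y HVp).
      split; [assumption|]. apply (Base c q Q); assumption.
    + intros j. apply HQ.
    + intros j. apply Hdec.
    + intros j. destruct (Halt (S j)) as [H|H]; [left|right; exact H]. rewrite S_INR in H. lra.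
Qed.

Lemma self_similar_zero W gamma T a f F r z t : self_similar W gamma T a f F -> W r z t -> r < 1 ->
  (forall k X Y, X <= 0 -> F k X Y = 0) -> f r z t = 0.
Proof.
  intros HS HW Hr H0. destruct (HS _ _ _ HW) as [S [H1 ->]].
  assert (HX : (r - 1) * Rpower (T - t) (- gamma) <= 0).
  { assert (0 < Rpower (T - t) (- gamma)) by apply exp_pos. nra. }
  apply is_series_Reals in H1. apply is_series_unique in H1.
  rewrite <- H1, (Series_ext _ (fun n => 0 * 0)); [rewrite Series_scal_l; ring|].
  intros k. rewrite H0 by exact HX. ring.
Qed.

Lemma elliptic_family_of_stream V psi psiR psiZ w Psi Om :
  stream_family V psi psiR psiZ w Psi Om -> (forall l X Y, V l X Y -> w l X Y = 0) ->
  (forall l X Y, V l X Y -> continuous (unc3 psi) (l, (X, Y))) -> elliptic_family V 0 psi Psi.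
Proof.
  intros [psiRR [psiZZ H]] H0 Hc. exists psiR, psiRR, psiZ, psiZZ. intros l X Y HV.
  destruct (H l X Y HV) as [[A1 [A2 [A3 [A4 [A5 [A6 [A7 A8]]]]]]] [S _]].
  split; [apply Hc, HV|]. split; [|exact S]. unfold slice_at. ands; try assumption.
  rewrite A8, H0 by exact HV. field. lra.
Qed.

Lemma self_similar_const W gamma T a f F r z r' z' t : self_similar W gamma T a f F ->
  W r z t -> W r' z' t -> r < 1 -> r' < 1 ->
  (forall k, exists c, forall X Y, X < 0 -> F k X Y = c) -> f r z t = f r' z' t.
Proof.
  intros HS HW HW' Hr Hr' Hc.
  destruct (HS _ _ _ HW) as [S [H1 ->]]. destruct (HS _ _ _ HW') as [S' [H1' ->]]. f_equal.
  assert (HX : forall x, x < 1 -> (x - 1) * Rpower (T - t) (- gamma) < 0).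
  { intros x Hx. assert (0 < Rpower (T - t) (- gamma)) by apply exp_pos. nra. }
  apply is_series_Reals in H1. apply is_series_Reals in H1'.
  rewrite <- (is_series_unique _ _ H1), <- (is_series_unique _ _ H1'). apply Series_ext. intros k.
  destruct (Hc k) as [c E]. rewrite !E by (apply HX; assumption). reflexivity.
Qed.

Lemma derivable_pt_lim_locally_const (f : R -> R) x e : 0 < e ->
  (forall y, Rabs (y - x) < e -> f y = f x) -> derivable_pt_lim f x 0.
Proof.
  intros He H. apply is_derive_Reals. apply (is_derive_ext_loc (fun _ => f x)).
  - exists (mkposreal e He). intros y Hy. symmetry. apply H. exact Hy.
  - apply (is_derive_const (V := R_NormedModule)).
Qed.

Lemma C1_D_boundary_const P PR PZ : C1_D_with P PR PZ -> (forall Y, PZ 0 Y = 0) -> forall Y, P 0 Y = P 0 0.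
Proof.
  intros HP H0 Y.
  destruct (MVT_gen (fun y => P 0 y) 0 Y (fun y => PZ 0 y)) as [xi [_ E]].
  - intros y _. apply (C1_D_derive_Z P PR PZ); [exact HP|lra].
  - intros y _. apply derivable_continuous_pt. exists (PZ 0 y).
    apply is_derive_Reals, (C1_D_derive_Z P PR PZ); [exact HP|lra].
  - rewrite H0 in E. lra.
Qed.

Theorem theorem2
  (gamma T : R) (Hgamma : 0 < gamma) (HT : 0 < T)
  (W : R -> R -> R -> Prop)
  (HW : W_case1 T W \/ W_case2 gamma T W)
  (u1 w1 psi1 : R -> R -> R -> R)
  (Hsol : classical_solution W u1 w1 psi1)
  (U Om Psi PsiR PsiZ : nat -> R -> R -> R)
  (HuF : self_similar W gamma T (-1 + gamma / 2) u1 U)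
  (HwF : self_similar W gamma T (-1) w1 Om)
  (HpF : self_similar W gamma T (-1 + 2 * gamma) psi1 Psi)
  (* (a) *)
  (Ha_U : forall k, C1_D (U k))
  (Ha_Om : forall k, C1_D (Om k))
  (Ha_Psi : forall k, C1_D_with (Psi k) (PsiR k) (PsiZ k))
  (* (b) *)
  (Hb_UO : forall k eps, 0 < eps -> exists M, forall X Y, X <= 0 ->
      M < normY X Y -> Rabs (U k X Y) + Rabs (Om k X Y) < eps)
  (Hb_Psi : forall k eps, 0 < eps -> exists M, forall X Y, X <= 0 ->
      M < normY X Y -> normY (PsiR k X Y) (PsiZ k X Y) <= eps * normY X Y)
  (* (c) *)
  (Hc : forall k Y, PsiZ k 0 Y = 0)
  (* (d) *)
  (Hd : exists p : nat, Nat.Even p /\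
      forall k : nat, INR k <= 1 / gamma ->
      forall eps, 0 < eps -> exists M, forall rho, M < rho ->
        exists v, half_annulus_integral
                    (fun X Y => U k X Y ^ p + Om k X Y ^ p) rho v /\
                  Rabs v < eps) :
  forall r z t, W r z t ->
    u1 r z t = 0 /\ w1 r z t = 0 /\
    derivable_pt_lim (fun x => psi1 x z t) r 0 /\
    derivable_pt_lim (fun y => psi1 r y t) z 0.
Proof.
  destruct Hsol as [u1r [u1z [u1t [w1r [w1z [w1t [p1r [p1z [p1rr [p1zz [HD [Cu [Cur [Cuz [Cut
    [Cw [Cwr [Cwz [Cwt [Cp [_ [_ [_ [_ HE]]]]]]]]]]]]]]]]]]]]]]]].
  assert (HV := scaled_windows gamma T W Hgamma HW).
  assert (HVo : forall l X Y, scaled_interior W gamma T l X Y ->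
     locally l (fun m => scaled_interior W gamma T m X Y)) by apply scaled_interior_open.
  assert (HVX : forall l X Y, scaled_interior W gamma T l X Y -> 0 < l /\ X < 0).
  { intros l X Y HVp. destruct (scaled_interior_W _ _ _ _ _ _ HVp) as [Hl HWp]. split; [exact Hl|].
    destruct (W_slice gamma T W HW _ _ _ HWp) as [Hr _]. nra. }
  assert (HVX' : forall l X Y, scaled_interior W gamma T l X Y -> 0 < l /\ X <= 0).
  { intros l X Y HVp. destruct (HVX l X Y HVp). lra. }
  assert (HS : stream_family (scaled_interior W gamma T) (rescale gamma T (1 - 2 * gamma) psi1)
    (fun l X Y => l * rescale gamma T (1 - 2 * gamma) p1r l X Y)
    (fun l X Y => l * rescale gamma T (1 - 2 * gamma) p1z l X Y) (rescale gamma T 1 w1) Psi Om).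
  { apply (stream_family_rescale W gamma T psi1 p1r p1z p1rr p1zz); try assumption.
    intros r z t H. destruct (HD r z t H) as [_ [_ [_ [_ [_ [_ [D7 [D8 [D9 D10]]]]]]]]].
    destruct (HE r z t H) as [_ [_ E3]]. ands; try (apply is_derive_Reals; assumption). exact E3. }
  assert (HcP : forall k, cont_D (Psi k)) by (intros k; apply (Ha_Psi k)).
  assert (HcO : forall k, cont_D (Om k)) by (intros k; destruct (Ha_Om k) as [a [b Hab]]; apply Hab).
  destruct (Ha_Om O) as [OR [OZ HO]].
  destruct Hd as [p [Hp Hann]].
  (* Beyond the range of the annulus hypothesis the zeroth-order coefficient is negative, both for
     [c = 1 - gamma / 2] and for [c = 1]. *)
  assert (HINR : forall k c, c <= 1 -> ~ INR k <= 1 / gamma -> c - INR k * gamma < 0).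
  { intros k c Hc1 Hk. apply Rnot_le_lt in Hk. apply Rmult_lt_compat_r with (r := gamma) in Hk; [|exact Hgamma].
    replace (1 / gamma * gamma) with 1 in Hk by (field; lra). lra. }
  assert (HU : forall k X Y, X <= 0 -> U k X Y = 0).
  { intros k. apply (transport_profiles_vanish _ gamma 2 _ _ _ _ _ _ (PsiR O) (PsiZ O) OR OZ Hgamma HV HVo HVX' HS
      HcP HcO (Ha_Psi O) HO (Hc O) (Hb_Psi O) k (1 - gamma / 2) (rescale gamma T (1 - gamma / 2) u1)).
    - apply (transport_family_rescale W gamma T (1 - gamma / 2) 2 psi1 p1r p1z u1 u1r u1z u1t); try assumption.
      + intros r z t H. destruct (HD r z t H) as [D1 [D2 [D3 _]]]. destruct (HE r z t H) as [E1 _].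
        ands; try (apply is_derive_Reals; assumption). exact E1.
      + replace (- (1 - gamma / 2)) with (-1 + gamma / 2) by ring. exact HuF.
    - exact Ha_U.
    - intros j eps Heps. destruct (Hb_UO j eps Heps) as [M HM]. exists M. intros X Y HX HN.
      specialize (HM X Y HX HN). pose proof (Rabs_pos (Om j X Y)). lra.
    - intros j. destruct (Rle_dec (INR j) (1 / gamma)) as [Hj|Hj]; [right|left; apply HINR; [lra|exact Hj]].
      exists p, (fun X Y => U j X Y ^ p + Om j X Y ^ p). split; [exact Hp|]. split; [|apply Hann, Hj].
      intros X Y _. pose proof (even_pow_nonneg (Om j X Y) p Hp). lra. }
  assert (Hu : forall r z t, W r z t -> u1 r z t = 0).
  { intros r z t H. apply (self_similar_zero W gamma T _ u1 U r z t HuF H); [|exact HU].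
    apply (W_slice gamma T W HW _ _ _ H). }
  (* With [u1 = 0] the source [2 u1 u1z] disappears, so [w1] obeys the same transport equation
     without stretching: [ka = 0], with exponent [1]. *)
  assert (HOm : forall k X Y, X <= 0 -> Om k X Y = 0).
  { intros k. apply (transport_profiles_vanish _ gamma 0 _ _ _ _ _ _ (PsiR O) (PsiZ O) OR OZ Hgamma HV HVo HVX' HS
      HcP HcO (Ha_Psi O) HO (Hc O) (Hb_Psi O) k 1 (rescale gamma T 1 w1)).
    - apply (transport_family_rescale W gamma T 1 0 psi1 p1r p1z w1 w1r w1z w1t); try assumption.
      intros r z t H. destruct (HD r z t H) as [_ [_ [_ [D4 [D5 [D6 _]]]]]]. destruct (HE r z t H) as [_ [E2 _]].
      ands; try (apply is_derive_Reals; assumption). rewrite E2, (Hu r z t H). ring.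
    - exact Ha_Om.
    - intros j eps Heps. destruct (Hb_UO j eps Heps) as [M HM]. exists M. intros X Y HX HN.
      specialize (HM X Y HX HN). pose proof (Rabs_pos (U j X Y)). lra.
    - intros j. destruct (Rle_dec (INR j) (1 / gamma)) as [Hj|Hj]; [right|left; apply HINR; [lra|exact Hj]].
      exists p, (fun X Y => U j X Y ^ p + Om j X Y ^ p). split; [exact Hp|]. split; [|apply Hann, Hj].
      intros X Y _. pose proof (even_pow_nonneg (U j X Y) p Hp). lra. }
  assert (Hw : forall r z t, W r z t -> w1 r z t = 0).
  { intros r z t H. apply (self_similar_zero W gamma T _ w1 Om r z t HwF H); [|exact HOm].
    apply (W_slice gamma T W HW _ _ _ H). }
  assert (HPc : forall k, exists c, forall X Y, X < 0 -> Psi k X Y = c).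
  { intros k. apply (elliptic_family_const k _ (rescale gamma T (1 - 2 * gamma) psi1) Psi HV).
    - apply (elliptic_family_of_stream _ _ _ _ _ _ _ HS).
      + intros l X Y HVp. destruct (scaled_interior_W _ _ _ _ _ _ HVp) as [_ HWp]. unfold rescale.
        rewrite Hw by exact HWp. ring.
      + intros l X Y HVp. apply (rescale_continuous W); assumption.
    - intros l X Y HVp. apply (HVX l X Y HVp).
    - exact HcP.
    - intros j. apply (C1_D_boundary_const (Psi j) (PsiR j) (PsiZ j)); [apply Ha_Psi|apply Hc].
    - intros j. apply (sublinear_gradient_growth (Psi j) (PsiR j) (PsiZ j)); [apply Ha_Psi|apply Hb_Psi].
    - intros j. apply (sublinear_gradient_growth (Psi j) (PsiR j) (PsiZ j)); [apply Ha_Psi|apply Hb_Psi]. }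
  intros r z t H. destruct (W_slice gamma T W HW _ _ _ H) as [Hr [e [He Hball]]].
  (* Every profile is constant for [X < 0], so at a fixed time each term of the series is constant
     in space. The sum may still depend on [t]. *)
  assert (Hloc : forall x y, Rabs (x - r) < e -> Rabs (y - z) < e -> psi1 x y t = psi1 r z t).
  { intros x y Hx Hy. assert (H' := Hball x y Hx Hy).
    apply (self_similar_const W gamma T _ psi1 Psi x y r z t HpF H' H); [|lra|exact HPc].
    apply (W_slice gamma T W HW _ _ _ H'). }
  split; [apply Hu, H|]. split; [apply Hw, H|].
  split; apply (derivable_pt_lim_locally_const _ _ e He); intros y Hy; apply Hloc; try exact Hy;
    rewrite Rminus_diag, Rabs_R0; exact He.
Qed.
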